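(* Let $\gamma\in(-1,0)$, $\nu\in(0,1)$ with $\gamma+\nu>0$, and let $\beta$ be an angular kernel satisfying the assumption in the context. Let $q>6$ be such that $q>\gamma^2/(\gamma+\nu)$ and let $f_0\in\mathcal P_q(\mathbb R^3)$ have a finite entropy. Let $(f_t)_{t\ge0}$ be the unique weak solution to the Boltzmann equation starting from $f_0$ described in the context. For each $N\ge1$ and $K\in[1,\infty)$, let $(V^i_t)_{i=1,\dots,N,\,t\ge0}$ be the Markov process with generator $\mathcal L_{N,K}$ (defined in the context) starting from an i.i.d. family $(V^i_0)_{i=1,\dots,N}$ of $f_0$-distributed random variables, and let $\mu^{N,K}_t=N^{-1}\sum_{i=1}^N\delta_{V^i_t}$ be the associated empirical measure. Then for all $T>0$ there is a constant $C_{T,q}$ (which may depend on $T,q$ and on the fixed data $f_0,\gamma,\nu,\beta$, but not on $N$ or $K$) such that $$\sup_{t\in[0,T]}\mathbb E\big[\mathcal W_2^2(\mu^{N,K}_t,f_t)\big]\le C_{T,q}\Big(N^{-(1-6/q)(2+2\gamma)/3}+K^{1-2/\nu}+N^{-1/2}\Big).$$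
   Context: **Kernel.** $\beta:(0,\pi]\to\mathbb R_+$ is measurable, there are constants $0<c_0<c_1$ with $c_0\theta^{-1-\nu}\le\beta(\theta)\le c_1\theta^{-1-\nu}$ for all $\theta\in(0,\pi/2)$, and $\beta(\theta)=0$ for $\theta\in[\pi/2,\pi]$. The collision kernel is $B(|v-v_*|,\theta)$ with $B(|v-v_*|,\theta)\sin\theta=|v-v_*|^\gamma\beta(\theta)$. Set $H(\theta)=\int_\theta^{\pi/2}\beta(x)dx$ and let $G=H^{-1}$ be its inverse, defined on $[0,\infty)$. **Particle system.** For $v,v_*\in\mathbb R^3$ and $\sigma\in\mathbb S^2$ let $v'(v,v_*,\sigma)=\frac{v+v_*}{2}+\frac{|v-v_*|}{2}\sigma$ and let $\theta$ be defined by $\cos\theta=\frac{v-v_*}{|v-v_*|}\cdot\sigma$. For $u\in\mathbb R^3$, $u\mathbf e_i=(0,\dots,u,\dots,0)\in(\mathbb R^3)^N$ with $u$ at the $i$-th place. For bounded Lipschitz $\phi:(\mathbb R^3)^N\to\mathbb R$ and $\mathbf v=(v_1,\dots,v_N)$, $$\mathcal L_{N,K}\phi(\mathbf v)=\frac1N\sum_{i\ne j}\int_{\mathbb S^2}\big[\phi(\mathbf v+(v'(v_i,v_j,\sigma)-v_i)\mathbf e_i)-\phi(\mathbf v)\big]B(|v_i-v_j|,\theta)\mathbf 1_{\{\theta\ge G(K/|v_i-v_j|^\gamma)\}}d\sigma,$$ terms with $v_i=v_j$ being zero. The total jump rate is the constant $2\pi(N-1)K$, so $\mathcal L_{N,K}$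 uniquely defines a strong Markov process. **Spaces.** $m_q(f)=\int|v|^qf(dv)$; $\mathcal P_q(\mathbb R^3)$ is the set of probability measures $f$ on $\mathbb R^3$ with $m_q(f)<\infty$. Finite entropy means that $f_0$ has a density with $\int f_0|\log f_0|dv<\infty$. $\mathcal W_2^2(g,\tilde g)=\inf_R\int|v-\tilde v|^2R(dv,d\tilde v)$ over couplings $R$ of $g,\tilde g$. **Weak solution.** For $x\ne0$ fix (measurably) $I(x)\in\mathbb R^3$ with $|I(x)|=|x|$, $I(x)\perp x$; $J(x)=\frac{x}{|x|}\wedge I(x)$; $\Gamma(x,\varphi)=(\cos\varphi)I(x)+(\sin\varphi)J(x)$; $a(v,v_*,\theta,\varphi)=-\frac{1-\cos\theta}{2}(v-v_* )+\frac{\sin\theta}{2}\Gamma(v-v_*,\varphi)$. A measurable family $(f_t)_{t\ge0}$ of probability measures on $\mathbb R^3$ is a weak solution to the Boltzmann equation if $\int vf_t(dv)=\int vf_0(dv)$, $\int|v|^2f_t(dv)=\int|v|^2f_0(dv)<\infty$ for all $t\ge0$, and for every bounded globally Lipschitz $\phi$ and $t\ge0$, $\int\phi\,df_t=\int\phi\,df_0+\int_0^t\int\int\mathcal A\phi(v,v_* )f_s(dv_* )f_s(dv)ds$, where $\mathcal A\phi(v,v_* )=|v-v_*|^\gamma\int_0^{\pi/2}\beta(\theta)d\theta\int_0^{2\pi}[\phi(v+a(v,v_*,\theta,\varphi))-\phi(v)]d\varphi$ (and $\mathcal A\phi(v,v)=0$). **Known well-posedness.** Let $p_0(\gamma,\nu,q)=\frac{q-\gamma}{q(3-\nu)/3-\gamma}\in(3/(3+\gamma),3/(3-\nu))$.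 If $f_0\in\mathcal P_q(\mathbb R^3)$ has finite entropy, with $q\ge2$, $q>\gamma^2/(\gamma+\nu)$, then for $p\in(3/(3+\gamma),p_0(\gamma,\nu,q))$ there is a unique weak solution in $L^\infty([0,\infty),\mathcal P_2(\mathbb R^3))\cap L^1_{loc}([0,\infty),L^p(\mathbb R^3))$ starting from $f_0$; this is the solution $(f_t)_{t\ge0}$ of the statement. *)

(* Defs.v *)
From HB Require Import structures.
From mathcomp Require Import all_boot all_order all_algebra.
From mathcomp Require Import all_classical all_reals all_analysis.
From mathcomp Require Import measurable_realfun.

Set Implicit Arguments.
Unset Strict Implicit.
Unset Printing Implicit Defensive.

Import Order.TTheory GRing.Theory Num.Theory.
Import numFieldNormedType.Exports.

Local Open Scope classical_set_scope.
Local Open Scope ring_scope.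

(* R^3 is the iterated product, which carries the product sigma-algebra and
   the componentwise operations; the library norm on it is the sup norm, so
   the Euclidean norm [norm3] is defined separately. *)
Notation vec3 R := ((R * R) * R)%type.

Definition vec3_mk (R : realType) (x y z : R) : vec3 R := ((x, y), z).

Definition scale3 (R : realType) (a : R) (v : vec3 R) : vec3 R :=
  vec3_mk (a * v.1.1) (a * v.1.2) (a * v.2).

Definition dot3 (R : realType) (v w : vec3 R) : R :=
  v.1.1 * w.1.1 + v.1.2 * w.1.2 + v.2 * w.2.

Definition norm3 (R : realType) (v : vec3 R) : R := Num.sqrt (dot3 v v).

Definition cross3 (R : realType) (v w : vec3 R) : vec3 R :=
  vec3_mk (v.1.2 * w.2 - v.2 * w.1.2)
          (v.2 * w.1.1 - v.1.1 * w.2)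
          (v.1.1 * w.1.2 - v.1.2 * w.1.1).

(* The library declares [lebesgue_measure] on [measurableTypeR R], which is R
   with its Borel sigma-algebra; [vec3 R] has the same measurable sets. *)
Definition leb3 (R : realType) : {measure set (measurableTypeR R *
    measurableTypeR R * measurableTypeR R)%type -> \bar R} :=
  (@lebesgue_measure R \x @lebesgue_measure R \x @lebesgue_measure R)%E.

Definition leb2 (R : realType) : {measure set (measurableTypeR R *
    measurableTypeR R)%type -> \bar R} :=
  (@lebesgue_measure R \x @lebesgue_measure R)%E.

Definition dist3 (R : realType) (v w : vec3 R) : R := norm3 (v - w).

Definition distN (R : realType) (N : nat) (x y : N.-tuple (vec3 R)) : R :=
  Num.sqrt (\sum_(i < N) dist3 (tnth x i) (tnth y i) ^+ 2).

Definition bounded_lipschitz (R : realType) (T : Type) (dist : T -> T -> R)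
    (phi : T -> R) : Prop :=
  (exists M : R, forall x, `|phi x| <= M) /\
  (exists L : R, forall x y, `|phi x - phi y| <= L * dist x y).

(* Integration over the unit sphere against the (unnormalized) surface
   measure, in spherical coordinates: dsigma = sin a da db. *)
Definition sphere_point (R : realType) (a b : R) : vec3 R :=
  vec3_mk (sin a * cos b) (sin a * sin b) (cos a).

Definition sphere_integral (R : realType) (g : vec3 R -> R) : R :=
  \int[leb2 R]_(x in (`[0, pi]%classic `*` `[0, 2 * pi]%classic : set (R * R)))
    (g (sphere_point x.1 x.2) * sin x.1).

Definition angular_kernel (R : realType) (nu : R) (beta : R -> R) : Prop :=
  [/\ measurable_fun `]0, pi] beta,
      (forall x, 0 < x <= pi -> 0 <= beta x),
      (exists c0 c1 : R, 0 < c0 < c1 /\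
         forall x, 0 < x < pi / 2 ->
           c0 * x `^ (- 1 - nu) <= beta x <= c1 * x `^ (- 1 - nu)) &
      (forall x, pi / 2 <= x <= pi -> beta x = 0)].

Definition angularH (R : realType) (beta : R -> R) (x : R) : R :=
  \int[lebesgue_measure]_(y in `[x, pi / 2]) beta y.

(* The inverse of [angularH beta], a decreasing bijection from ]0, pi/2] onto
   [0, +oo[ when [beta] is an angular kernel. *)
Definition angularG (R : realType) (beta : R -> R) (z : R) : R :=
  get [set x : R | 0 < x <= pi / 2 /\ angularH beta x = z].

(* B is determined by B(r, x) sin x = r^gamma beta(x), except at x = 0 and
   x = pi. *)
Definition collisionB (R : realType) (gamma : R) (beta : R -> R) (r x : R) : R :=
  r `^ gamma * beta x / sin x.

Definition post_collision (R : realType) (v w s : vec3 R) : vec3 R :=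
  scale3 2^-1 (v + w) + scale3 (norm3 (v - w) / 2) s.

Definition deviation_angle (R : realType) (v w s : vec3 R) : R :=
  acos (dot3 (v - w) s / norm3 (v - w)).

Definition add_at (R : realType) (N : nat) (x : N.-tuple (vec3 R)) (i : 'I_N)
    (u : vec3 R) : N.-tuple (vec3 R) :=
  [tuple (if k == i then tnth x k + u else tnth x k) | k < N].

Definition particle_generator (R : realType) (gamma : R) (beta : R -> R)
    (N : nat) (K : R) (phi : N.-tuple (vec3 R) -> R)
    (x : N.-tuple (vec3 R)) : R :=
  N%:R^-1 * \sum_(i < N) \sum_(j < N | i != j)
    let vi := tnth x i in let vj := tnth x j in
    let r := norm3 (vi - vj) in
    if vi == vj then 0 else
    sphere_integral (fun s =>
      let theta := deviation_angle vi vj s in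
      (phi (add_at x i (post_collision vi vj s - vi)) - phi x)
      * collisionB gamma beta r theta
      * (angularG beta (K / r `^ gamma) <= theta)%R%:R).

Definition past_events (R : realType) (d d' : measure_display)
    (Omega : measurableType d) (E : measurableType d')
    (X : R -> Omega -> E) (s : R) : set (set Omega) :=
  <<s [set A | exists r B, [/\ 0 <= r <= s, measurable B & A = X r @^-1` B]] >>.

Definition markov_semigroup (R : realType) (d : measure_display)
    (E : measurableType d) (kappa : R -> R.-pker E ~> E) : Prop :=
  (forall x B, measurable B -> kappa 0 x B = \d_x B) /\
  (forall s t x B, 0 <= s -> 0 <= t -> measurable B ->
     kappa (s + t) x B = (\int[kappa s x]_y kappa t y B)%E).

(* On the class D of test functions, the infinitesimal generator (the
   derivative at 0 of the semigroup, in the uniform norm) is L. *)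
Definition has_generator_on (R : realType) (d : measure_display)
    (E : measurableType d) (kappa : R -> R.-pker E ~> E)
    (D : set (E -> R)) (L : (E -> R) -> E -> R) : Prop :=
  forall phi, D phi -> forall eps : R, 0 < eps ->
    \forall h \near 0^'+, forall x,
      `| (\int[kappa h x]_y phi y - phi x) / h - L phi x | <= eps.

Definition markov_process (R : realType) (d d' : measure_display)
    (Omega : measurableType d) (E : measurableType d')
    (P : probability Omega R) (kappa : R -> R.-pker E ~> E)
    (X : R -> Omega -> E) : Prop :=
  forall s t A B, 0 <= s -> 0 <= t -> past_events X s A -> measurable B ->
    P (A `&` X (s + t) @^-1` B) = (\int[P]_(w in A) kappa t (X s w) B)%E.

Definition cadlag (R : realType) (x : R -> vec3 R) : Prop :=
  forall t, 0 <= t ->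
    x s @[s --> t^'+] --> x t /\
    (0 < t -> exists l : vec3 R, x s @[s --> t^'-] --> l).

Definition particle_process (R : realType) (gamma : R) (beta : R -> R)
    (N : nat) (K : R) (d : measure_display) (Omega : measurableType d)
    (P : probability Omega R) (X : R -> Omega -> N.-tuple (vec3 R)) : Prop :=
  (forall w i, cadlag (fun t => tnth (X t w) i)) /\
  (exists kappa : R -> R.-pker (N.-tuple (vec3 R)) ~> (N.-tuple (vec3 R)),
    [/\ markov_semigroup kappa,
        has_generator_on kappa (bounded_lipschitz (@distN R N))
          (@particle_generator R gamma beta N K) &
        markov_process P kappa X]).

Definition iid (R : realType) (d d' : measure_display)
    (Omega : measurableType d) (E : measurableType d')
    (P : probability Omega R) (f0 : probability E R)
    (N : nat) (Y : 'I_N -> Omega -> E) : Prop :=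
  (forall i B, measurable B -> P (Y i @^-1` B) = f0 B) /\
  (forall (J : {set 'I_N}) (B : 'I_N -> set E),
     (forall i, measurable (B i)) ->
     P (\bigcap_(i in [set` J]) (Y i @^-1` B i))
     = (\prod_(i in J) P (Y i @^-1` B i))%E).

Definition moment (R : realType) (q : R) (f : probability (vec3 R) R) : \bar R :=
  (\int[f]_v (norm3 v `^ q)%:E)%E.

Definition mean3 (R : realType) (f : probability (vec3 R) R) : vec3 R :=
  vec3_mk (\int[f]_v v.1.1) (\int[f]_v v.1.2) (\int[f]_v v.2).

Definition density_of (R : realType) (f : probability (vec3 R) R)
    (g : vec3 R -> R) : Prop :=
  [/\ measurable_fun setT g, (forall v, 0 <= g v) &
      forall A, measurable A -> f A = (\int[leb3 R]_(v in A) (g v)%:E)%E].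

(* [ln 0 = 0] in the library, so that 0 |log 0| = 0 as required. *)
Definition finite_entropy (R : realType) (f : probability (vec3 R) R) : Prop :=
  exists2 g, density_of f g &
    (\int[leb3 R]_v (g v * `|ln (g v)|)%:E < +oo)%E.

(* The L^p norm of the density of f, +oo (= inf of the empty set) when f has no
   density. *)
Definition density_Lnorm (R : realType) (p : R) (f : probability (vec3 R) R) :
    \bar R :=
  ereal_inf [set 'N[leb3 R]_(p%:E)[EFin \o g]%E | g in density_of f].

Definition coupling (R : realType) (d : measure_display) (E : measurableType d)
    (mu nu : set E -> \bar R) (rho : probability (E * E)%type R) : Prop :=
  forall A, measurable A -> rho (A `*` setT) = mu A /\ rho (setT `*` A) = nu A.

Definition W2sq (R : realType) (mu nu : set (vec3 R) -> \bar R) : \bar R :=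
  ereal_inf [set (\int[rho]_z (norm3 (z.1 - z.2) ^+ 2)%:E)%E
            | rho in coupling mu nu].

Definition empirical_measure (R : realType) (N : nat) (x : N.-tuple (vec3 R)) :
    set (vec3 R) -> \bar R :=
  fun A => ((N%:R^-1)%:E * \sum_(i < N) \d_(tnth x i) A)%E.

Definition frame_choice (R : realType) (I : vec3 R -> vec3 R) : Prop :=
  measurable_fun [set x : vec3 R | x != 0] I /\
  (forall x, x != 0 -> norm3 (I x) = norm3 x /\ dot3 (I x) x = 0).

Definition Gamma3 (R : realType) (I : vec3 R -> vec3 R) (x : vec3 R) (ph : R) :
    vec3 R :=
  scale3 (cos ph) (I x) + scale3 (sin ph) (cross3 (scale3 (norm3 x)^-1 x) (I x)).

Definition jump (R : realType) (I : vec3 R -> vec3 R) (v w : vec3 R)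
    (theta ph : R) : vec3 R :=
  - scale3 ((1 - cos theta) / 2) (v - w)
  + scale3 (sin theta / 2) (Gamma3 I (v - w) ph).

Definition boltzmannA (R : realType) (gamma : R) (beta : R -> R)
    (I : vec3 R -> vec3 R) (phi : vec3 R -> R) (v w : vec3 R) : R :=
  if v == w then 0 else
  norm3 (v - w) `^ gamma *
  \int[lebesgue_measure]_(theta in `]0, pi / 2])
    (beta theta * \int[lebesgue_measure]_(ph in `[0, 2 * pi])
       (phi (v + jump I v w theta ph) - phi v)).

Definition weak_solution (R : realType) (gamma : R) (beta : R -> R)
    (I : vec3 R -> vec3 R) (f : R -> probability (vec3 R) R) : Prop :=
  [/\ (forall A, measurable A ->
         measurable_fun (`[0, +oo[%classic : set R) (fun t => f t A)),
      (moment 2%R (f 0%R) < +oo)%E,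
      (forall t, 0 <= t -> mean3 (f t) = mean3 (f 0)),
      (forall t, 0 <= t -> moment 2 (f t) = moment 2 (f 0)) &
      forall phi, bounded_lipschitz (@dist3 R) phi -> forall t, 0 <= t ->
        \int[f t]_v phi v = \int[f 0]_v phi v +
          \int[lebesgue_measure]_(s in `[0, t])
            \int[f s]_v \int[f s]_w boltzmannA gamma beta I phi v w].

(* f belongs to L^oo([0, +oo[, P_2) and to L^1_loc([0, +oo[, L^p). *)
Definition uniqueness_class (R : realType) (p : R)
    (f : R -> probability (vec3 R) R) : Prop :=
  (exists M : R, forall t, 0 <= t -> (moment 2%R (f t) <= M%:E)%E) /\
  (forall T : R, 0 < T ->
     (\int[lebesgue_measure]_(t in `[0%R, T]) density_Lnorm p (f t) < +oo)%E).

Definition p0 (R : realType) (gamma nu q : R) : R :=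
  (q - gamma) / (q * (3 - nu) / 3 - gamma).

(* Main.v *)
(* The particle system and N independent copies of f_t are compared by Kantorovich duality for the truncated costs
  sum_i min(|v_i - w_i|^2, M): U(t) is the supremum of E[phi(V_t)] + int psi d(f_t)^N over the bounded Lipschitz pairs with
  phi(v) + psi(w) <= cost(v, w). For such a pair the sum of the two generators is bounded by a coupling of collisions:
  v_j is paired with a point drawn from the piece of f_t allotted to w_j by a transport of f_t onto the empirical
  measure of w, the deviation angles are G(z / |v - v_*|^gamma) for a common z, and the azimuths are measured in parallel
  frames. The singular weights |w_i - y|^gamma, cut off at distance N^(-1/3), have bounded integrals against f_t by the L^p
  bound, and their sums over the particles are large only with exponentially small probability. Hence U satisfies a
  discrete Gronwall inequality. The allotment costs N^(-1/2), by a dyadic greedy transport using moments of order 6,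
  and the neglected grazing collisions cost K^(1-2/nu). *)
Require Import Defs.
From HB Require Import structures.
From mathcomp Require Import all_boot all_order all_algebra.
From mathcomp Require Import all_classical all_reals all_analysis.
From mathcomp Require Import measurable_realfun ring lra.

Set Implicit Arguments.
Unset Strict Implicit.
Unset Printing Implicit Defensive.

Import Order.TTheory GRing.Theory Num.Theory.
Import numFieldNormedType.Exports.

Local Open Scope classical_set_scope.
Local Open Scope ring_scope.

Local Notation mfun := (measurable_fun setT) (only parsing).

Local Notation leb := lebesgue_measure (only parsing).
Local Notation mcomp := measurableT_comp (only parsing).
Local Notation mEFinP := measurable_EFinP (only parsing).
Local Notation mcst := measurable_cst (only parsing).
Local Notation mfst := measurable_fst (only parsing).
Local Notation mfunB := measurable_funB (only parsing).
Local Notation mfunD := measurable_funD (only parsing).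
Local Notation mfunM := measurable_funM (only parsing).
Local Notation mfunX := measurable_funX (only parsing).
Local Notation mfun_pair := measurable_fun_pair (only parsing).
Local Notation msnd := measurable_snd (only parsing).
Local Notation mtnth := measurable_tnth (only parsing).
Local Notation integ P f := (P.-integrable setT (EFin \o f)) (only parsing).
Tactic Notation "via" uconstr(mid) := refine (@le_trans _ _ mid _ _ _ _).
Tactic Notation "upto" uconstr(h) := refine (@le_trans _ _ _ _ _ h _).

(** A pathwise coupling would require optimal plans chosen measurably along the trajectories, and a
    construction of the coupled process. With duality only the laws of the two systems occur, and
    the dynamics enters through one inequality between generators at a fixed pair (v, w). It passes
    to U because a bound phi + psi <= A cost + b1 + b2 can be integrated after a double c-transform.
    The price is that test functions are bounded and Lipschitz, whence the truncation at M. Its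
    error is M^-2 times a sixth moment of the particles, for which only a bound exponential in K is
    available; this is harmless because M tends to infinity while N and K stay fixed. Before that,
    the level Lam at which the collisions of the nonlinear process are cut off tends to infinity. No
    density is available for the particles. The estimate is therefore arranged so that the singular
    weight always belongs to the relative velocity w_i - y, both of whose points come from f_t. The
    cutoff distance N^(-1/3) leaves an error N^(-(2+gamma)/3), which is below the first term of the
    statement. *)

Lemma eq_ler (R : realType) (x y : R) : x = y -> x <= y.
Proof. by move->. Qed.

Lemma pi2_ge0 (R : realType) : 0 <= 2 * pi :> R.
by rewrite mulr_ge0 ?pi_ge0. Qed.

(** * Bounded measurable functions *)

Section BoundedMeasurable.
Context d (T : measurableType d) (R : realType).
Implicit Types f g : T -> R.
Definition bmeas f := mfun f /\ exists M, forall x, `|f x| <= M.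

Lemma bmeas_cst c : bmeas (fun=> c).
by split; [exact: mcst | exists `|c|]. Qed.

Lemma bmeasD f g : bmeas f -> bmeas g -> bmeas (fun x => f x + g x).
move=> [mf [M fM]] [mg [K gK]]; split; first exact: mfunD.
by exists (M + K) => x; upto (ler_normD _ _); apply: lerD.
Qed.

Lemma bmeasM f g : bmeas f -> bmeas g -> bmeas (fun x => f x * g x).
move=> [mf [M fM]] [mg [K gK]]; split; first exact: mfunM.
by exists (M * K) => x; rewrite normrM; apply: ler_pM.
Qed.

Lemma bmeasZ a f : bmeas f -> bmeas (fun x => a * f x).
by move=> bf; apply: bmeasM => //; exact: bmeas_cst. Qed.

Lemma bmeasN f : bmeas f -> bmeas (fun x => - f x).
by move=> [mf [M fM]]; split; [exact: mcomp | exists M => x; rewrite normrN].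
Qed.

Lemma bmeasB f g : bmeas f -> bmeas g -> bmeas (fun x => f x - g x).
by move=> bf bg; apply: bmeasD => //; exact: bmeasN. Qed.

Lemma bmeas_sum (J : finType) (P : pred J) (F : J -> T -> R) :
 (forall i, P i -> bmeas (F i)) -> bmeas (fun x => \sum_(i | P i) F i x).
move=> bF; pose G i := if P i then F i else (fun=> 0).
have bG i : bmeas (G i) by rewrite /G; case: ifPn => [/bF//|_]; exact: bmeas_cst.
have -> : (fun x => \sum_(i | P i) F i x) = (fun x => \sum_i G i x).
 by apply/funext => x; rewrite big_mkcond; apply: eq_bigr => i _; rewrite /G; case: ifP.
split; first by apply: measurable_sum => i; exact: (bG i).1.
have /choice[M GM] i : exists M, forall x, `|G i x| <= M by exact: (bG i).2.
by exists (\sum_i M i) => x; upto (ler_norm_sum _ _ _); apply: ler_sum.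
Qed.

Lemma bmeas_indic (A : set T) : measurable A -> bmeas (\1_A).
move=> mA; split; first exact: measurable_indic.
by exists 1 => x; rewrite indicE; case: (_ \in _); rewrite ?normr1 ?normr0.
Qed.

Lemma bmeas_bound f a b : mfun f -> (forall x, a <= f x <= b) -> bmeas f.
move=> mf fab; split=> //; exists (`|a| + `|b|) => x; have /andP[af fb] := fab x.
have := ler_norm (- a); have := ler_norm b; have := normr_ge0 a; have := normr_ge0 b.
by rewrite normrN ler_norml => *; apply/andP; split; lra.
Qed.

Lemma bmeas_min f (b : R) : mfun f -> (forall x, 0 <= f x) -> 0 <= b -> bmeas (fun x => Num.min (f x) b).
move=> mf f0 b0; apply: (@bmeas_bound _ 0 b).
 by apply: measurable_minr => //; exact: mcst.
by move=> x; rewrite le_min f0 b0 ge_min lexx orbT.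
Qed.

End BoundedMeasurable.

Lemma bmeas_comp d1 d2 (T1 : measurableType d1) (T2 : measurableType d2) (R : realType) (f : T2 -> R) (S : T1 -> T2) :
 bmeas f -> mfun S -> bmeas (fun x => f (S x)).
move=> [mf [M fM]] mS; split; first exact: (mcomp mf mS).
by exists M => x.
Qed.

(* The finite positive functionals that satisfy the bounded convergence
  theorem: integration of bounded functions against finite measures, but
  also iterated integrals, without a measure on the product having to be built. *)
Definition bfun d (T : measurableType d) (R : realType) (I : (T -> R) -> R) : Prop :=
 [/\ forall f g, bmeas f -> bmeas g -> I (fun x => f x + g x) = I f + I g,
   forall a f, bmeas f -> I (fun x => a * f x) = a * I f, forall f, bmeas f -> (forall x, 0 <= f x) -> 0 <= I f &
   forall (F : nat -> T -> R) (f : T -> R) (M : R), (forall n, mfun (F n)) ->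
    (forall n x, `|F n x| <= M) -> (forall x, F n x @[n --> \oo] --> f x) -> I (F n) @[n --> \oo] --> I f].

Import HBNNSimple.

(** * Functional monotone class theorem *)

Section MonotoneClass.
Context d (T : measurableType d) (R : realType).

Lemma bmeas_lim (F : nat -> T -> R) (f : T -> R) (M : R) : (forall n, mfun (F n)) ->
 (forall n x, `|F n x| <= M) -> (forall x, F n x @[n --> \oo] --> f x) -> bmeas f.
move=> mF FM Ff; split; first by apply: (measurable_fun_cvg mF) => x _; exact: Ff.
exists M => x; have := Ff x => /cvg_norm nF.
by apply: (limr_le_near_ nF) || (rewrite -(cvg_lim _ nF)//; apply: limr_le; [apply/cvg_ex; eexists; exact: nF | exact: nearW]).
Qed.

(** Both parts are sigma-additivity of the Dirac measure at [x]: the partial sums increase to the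
    measure of the union, which is at most 1. *)
Lemma indic_bigcup_cvg (F : nat -> set T) : (forall n, measurable (F n)) -> trivIset setT F ->
 (forall x, (fun n => \sum_(i < n) \1_(F i) x) @ \oo --> (\1_(\bigcup_n F n) x : R)) /\
 forall n x, `|\sum_(i < n) \1_(F i) x| <= 1 :> R.
move=> mF tF; have mU : measurable (\bigcup_n F n) by exact: bigcup_measurable.
split=> [x|n x].
 have := @measure_semi_sigma_additive _ _ _ (\d_x : {measure set T -> \bar R}) F mF tF mU.
 rewrite /= /dirac => /fine_cvgP[_]; apply: cvg_trans; apply: near_eq_cvg; near=> n. by rewrite /= big_mkord sumEFin.
rewrite ger0_norm; last by apply: sumr_ge0 => i _; rewrite indicE.
rewrite -lee_fin -sumEFin -(big_mkord xpredT (fun i => (\1_(F i) x)%:E)).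
via (\sum_(0 <= i <oo) \d_x (F i))%E; first by apply: nneseries_lim_ge.
by rewrite -(@measure_semi_bigcup _ _ _ (\d_x : {measure set T -> \bar R}) F mF tF mU) /= /dirac lee_fin indicE; case: (_ \in _).
Unshelve. all: by end_near. Qed.

(** Dynkin's theorem gives the indicators of all measurable sets, sums give simple functions,
    increasing simple approximations give bounded nonnegative functions, and adding a constant
    removes the sign condition. *)
Lemma bmeas_class (G : set (set T)) (H : (T -> R) -> Prop) : @measurable _ T = <<s G >> -> setI_closed G ->
 H (fun=> 1) -> (forall A, G A -> H (\1_A)) ->
 (forall f g, bmeas f -> bmeas g -> H f -> H g -> H (fun x => f x + g x)) ->
 (forall a f, bmeas f -> H f -> H (fun x => a * f x)) ->
 (forall (F : nat -> T -> R) (f : T -> R) (M : R), (forall n, mfun (F n)) ->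
    (forall n x, `|F n x| <= M) -> (forall x, F n x @[n --> \oo] --> f x) -> (forall n, H (F n)) -> H f) ->
 forall f, bmeas f -> H f.
move=> GE GI H1 HG HD HZ HL.
have Hsum n (F : 'I_n -> T -> R) : (forall i, bmeas (F i)) -> (forall i, H (F i)) -> H (fun x => \sum_(i < n) F i x).
 elim: n F => [F _ _|n IH F bF HF].
  have := HZ 0 _ (bmeas_cst _ 1) H1; congr H; apply/funext => x. by rewrite mul0r big_ord0.
 have -> : (fun x => \sum_(i < n.+1) F i x) = fun x => \sum_(i < n) F (widen_ord (leqnSn n) i) x + F ord_max x.
  by apply/funext => x; rewrite big_ord_recr.
 by apply: HD => //; [exact: bmeas_sum | exact: IH].
have Hind A : measurable A -> H (\1_A).
 move=> mA; move: (mA); rewrite {1}GE => sA; move: A sA mA.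
 suff Q : forall A, <<s G >> A -> H (\1_A) by move=> A sA _; exact: Q.
 apply: (dynkin_induction GE GI) => //; first by rewrite indicT.
 - move=> S mS HS; have -> : \1_(~` S) = fun x => 1 + (-1) * \1_S x :> R.
   by apply/funext => x; rewrite !indicE in_setC; case: (x \in S); rewrite /= ?mulr1 ?mulr0 ?addr0 ?subrr.
  by apply: HD; [exact: bmeas_cst | exact/bmeasZ/bmeas_indic | | apply: HZ => //; exact: bmeas_indic].
 - move=> F mF tF HF; have [cF FB] := indic_bigcup_cvg mF tF.
  apply: (HL _ _ 1 _ FB cF) => n; first by apply: measurable_sum => i; exact: measurable_indic.
  by apply: Hsum => i; [exact: bmeas_indic | exact: HF].
have Hpos (f : T -> R) (M : R) : mfun f -> (forall x, 0 <= f x <= M) -> H f.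
 move=> mf f0. have mEf : mfun (EFin \o f) by exact/mEFinP.
 pose F n (x : T) : R := nnsfun_approx measurableT mEf n x. have cF x : F n x @[n --> \oo] --> f x.
  have /fine_cvgP[_ /=] := @cvg_nnsfun_approx _ _ _ _ measurableT _ mEf (fun x _ => ltac:(by rewrite lee_fin; have /andP[] := f0 x)) x Logic.I.
  by [].
 have FM n x : `|F n x| <= M.
  rewrite ger0_norm; last exact: fun_ge0; have /andP[_] := f0 x; apply: le_trans.
  have nd : nondecreasing_seq (F ^~ x).
   by move=> a b ab; have := nd_nnsfun_approx measurableT mEf ab => /lefP/(_ x).
  by have := nondecreasing_cvgn_le nd (cvgP _ (cF x)) n; rewrite (cvg_lim _ (cF x)).
 apply: (HL F f M) => // n; have HF : H (fun x => nnsfun_approx measurableT mEf n x); last exact: HF.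
 apply: (@eq_ind_r _ _ H _ _ (funext (fimfunEord (nnsfun_approx measurableT mEf n)))).
 have mFi (y : R) : bmeas (\1_(F n @^-1` [set y]) : T -> R).
  by apply: bmeas_indic; rewrite -[X in measurable X]setTI; apply: measurable_funP.
 set s : seq R := finmap.enum_fset _.
 apply: (Hsum (size s) (fun i x => s`_i * \1_(F n @^-1` [set s`_i]) x)) => i; first exact: bmeasZ.
 by apply: HZ => //; apply: Hind; rewrite -[X in measurable X]setTI; apply: measurable_funP.
move=> f [mf [M fM]].
have -> : f = fun x => (f x + M) + (- M) * 1 by apply/funext => x; rewrite mulr1 addrK.
apply: HD.
- by apply: bmeasD; [split=> //; exists M | exact: bmeas_cst].
- exact/bmeasZ/bmeas_cst.
- apply: (Hpos _ (M + M)) => [|x]; first by apply: mfunD => //; exact: mcst.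
 by have := fM x; rewrite ler_norml => /andP[a b]; rewrite -lerBlDr sub0r a lerD2r b.
- by apply: HZ => //; exact: bmeas_cst.
Qed.

End MonotoneClass.

(** * Calculus of bounded functionals *)

Section BoundedFunctional.
Context d (T : measurableType d) (R : realType) (I : (T -> R) -> R).
Hypothesis bI : bfun I.
Implicit Types f g : T -> R.

Lemma bfunD f g : bmeas f -> bmeas g -> I (fun x => f x + g x) = I f + I g.
by case: bI => + _ _ _; apply. Qed.

Lemma bfunZ a f : bmeas f -> I (fun x => a * f x) = a * I f.
by case: bI => _ + _ _; apply. Qed.

Lemma bfun_ge0 f : bmeas f -> (forall x, 0 <= f x) -> 0 <= I f.
by case: bI => _ _ + _; apply. Qed.

Lemma bfun_cvg (F : nat -> T -> R) f (M : R) : (forall n, mfun (F n)) ->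
 (forall n x, `|F n x| <= M) -> (forall x, F n x @[n --> \oo] --> f x) -> I (F n) @[n --> \oo] --> I f.
by case: bI => _ _ _; apply. Qed.

Lemma bfunN f : bmeas f -> I (fun x => - f x) = - I f.
move=> bf; rewrite (_ : (fun x => - f x) = fun x => (-1) * f x) ?bfunZ ?mulN1r//.
by apply/funext => x; rewrite mulN1r.
Qed.

Lemma bfunB f g : bmeas f -> bmeas g -> I (fun x => f x - g x) = I f - I g.
by move=> bf bg; rewrite bfunD ?bfunN//; exact: bmeasN. Qed.

Lemma bfun_le f g : bmeas f -> bmeas g -> (forall x, f x <= g x) -> I f <= I g.
move=> bf bg fg; rewrite -subr_ge0 -bfunB//; apply: bfun_ge0; first exact: bmeasB.
by move=> x; rewrite subr_ge0.
Qed.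

Lemma bfun_cst c : I (fun=> c) = c * I (fun=> 1).
by rewrite -bfunZ ?mulr1//; exact: bmeas_cst. Qed.

Lemma bfun_mass_ge0 : 0 <= I (fun=> 1).
by apply: bfun_ge0 => //; exact: bmeas_cst. Qed.

Lemma bfun_norm_le f M : bmeas f -> (forall x, `|f x| <= M) -> `|I f| <= M * I (fun=> 1).
move=> bf fM; rewrite ler_norml -mulNr -!bfun_cst; apply/andP; split;
 by apply: bfun_le => //; [exact: bmeas_cst|move=> x; have := fM x; rewrite ler_norml => /andP[]].
Qed.

Lemma bfun_norm f : bmeas f -> `|I f| <= I (fun x => `|f x|).
move=> bf; have baf : bmeas (fun x => `|f x|).
 by case: bf => mf [M fM]; split; [exact: mcomp|exists M => x; rewrite normr_id].
rewrite ler_norml -bfunN//; apply/andP; split; apply: bfun_le => //.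
- exact: bmeasN.
- by move=> x; rewrite lerNl -normrN ler_norm.
- by move=> x; rewrite ler_norm.
Qed.

Lemma bfun_sum (J : finType) (P : pred J) (F : J -> T -> R) : (forall i, P i -> bmeas (F i)) ->
 I (fun x => \sum_(i | P i) F i x) = \sum_(i | P i) I (F i).
move=> bF.
suff H (s : seq J) : I (fun x => \sum_(i <- s | P i) F i x) = \sum_(i <- s | P i) I (F i) /\
  bmeas (fun x => \sum_(i <- s | P i) F i x) by rewrite (H (index_enum J)).1.
elim: s => [|i s [IH1 IH2]].
 have -> : (fun x => \sum_(i <- [::] | P i) F i x) = fun=> 0.
  by apply/funext => x; rewrite big_nil.
 by rewrite bfun_cst mul0r big_nil; split=> //; exact: bmeas_cst.
have [Pi|nPi] := boolP (P i); last first.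
 rewrite big_cons (negbTE nPi) (_ : (fun x => _) = fun x => \sum_(i <- s | P i) F i x)//.
 by apply/funext => x; rewrite big_cons (negbTE nPi).
rewrite big_cons Pi (_ : (fun x => _) = fun x => F i x + \sum_(i <- s | P i) F i x); last first.
 by apply/funext => x; rewrite big_cons Pi.
by rewrite bfunD// ?IH1; [split=> //; apply: bmeasD => //; exact: bF | exact: bF].
Qed.

Lemma bfun_comp d' (T' : measurableType d') (S : T -> T') : mfun S -> bfun (fun f : T' -> R => I (fun x => f (S x))).
move=> mS; split.
- by move=> f g bf bg; rewrite bfunD//; apply: bmeas_comp.
- by move=> a f bf; rewrite bfunZ//; apply: bmeas_comp.
- by move=> f bf f0; apply: bfun_ge0 => //; apply: bmeas_comp.
- move=> F f M mF FM Ff; apply: (bfun_cvg (M := M)) => // n. exact: mcomp.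
Qed.

Lemma bfun_weight (w : T -> R) : bmeas w -> (forall x, 0 <= w x) -> bfun (fun f : T -> R => I (fun x => w x * f x)).
move=> bw w0; split.
- move=> f g bf bg; rewrite -bfunD; [|exact: bmeasM..]. by congr I; apply/funext => x; rewrite mulrDr.
- move=> a f bf; rewrite -bfunZ; [|exact: bmeasM]. by congr I; apply/funext => x; rewrite mulrCA.
- by move=> f bf f0; apply: bfun_ge0; [exact: bmeasM | move=> x; rewrite mulr_ge0].
- move=> F f M mF FM Ff; case: bw => mw [K wK]; apply: (bfun_cvg (M := K * M)).
 + by move=> n; exact: mfunM.
 + by move=> n x; rewrite normrM; apply: ler_pM.
 + by move=> x; apply: cvgM => //; exact: cvg_cst.
Qed.

End BoundedFunctional.

Lemma bfun_unique d (T : measurableType d) (R : realType) (I J : (T -> R) -> R) (G : set (set T)) :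
 @measurable _ T = <<s G >> -> setI_closed G -> bfun I -> bfun J ->
 I (fun=> 1) = J (fun=> 1) -> (forall A, G A -> I (\1_A) = J (\1_A)) -> forall f, bmeas f -> I f = J f.
move=> GE GI bI bJ E1 EG; apply: (bmeas_class (H := fun f => I f = J f) GE GI) => //.
- by move=> f g bf bg If Ig; rewrite (bfunD bI)// (bfunD bJ)// If Ig.
- by move=> a f bf If; rewrite (bfunZ bI)// (bfunZ bJ)// If.
- move=> F f M mF FM Ff EF. have := bfun_cvg bI mF FM Ff; have := bfun_cvg bJ mF FM Ff. under eq_fun do rewrite -EF.
 by move=> a b; apply: (cvg_unique _ b a).
Qed.

(** * Iterated functionals and Fubini's theorem *)

Section Products.
Context d1 d2 (T1 : measurableType d1) (T2 : measurableType d2) (R : realType).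
Let rect : set (set (T1 * T2)) := [set A `*` B | A in measurable & B in measurable].
Let rectI : setI_closed rect.
move=> _ _ [A mA [B mB <-]] [A' mA' [B' mB' <-]].
exists (A `&` A'); first exact: measurableI.
exists (B `&` B'); first exact: measurableI.
by rewrite setXI.
Qed.

Lemma indicX (A : set T1) (B : set T2) x y : \1_(A `*` B) (x, y) = \1_A x * \1_B y :> R.
rewrite !indicE in_setX/=.
by case: (x \in A); case: (y \in B); rewrite /= ?mulr0 ?mulr1 ?mul0r.
Qed.

Lemma bmeas_pair1 (f : T1 * T2 -> R) x : bmeas f -> bmeas (fun y => f (x, y)).
by move=> bf; apply: (bmeas_comp bf); exact: measurable_pair1. Qed.

(** The functions [f] whose partial integral is bounded and measurable form a monotone class, and on
    a rectangle the partial integral factors as [\1_A x * J x (\1_B)]. The mass bound [C] keeps the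
    limits bounded. *)
Lemma bfun_param_family (J : T1 -> (T2 -> R) -> R) (C : R) : (forall x, bfun (J x)) ->
 (forall x, J x (fun=> 1) <= C) -> (forall B, measurable B -> mfun (fun x => J x (\1_B))) ->
 forall f, bmeas f -> bmeas (fun x => J x (fun y => f (x, y))).
move=> bJ JC mJ.
have m1 : mfun (fun x => J x (fun=> 1)).
 by have := mJ _ measurableT; rewrite indicT.
apply: (bmeas_class (H := fun f => bmeas (fun x => J x (fun y => f (x, y))))
 (measurable_prod_measurableType _ _) rectI).
- split=> //; exists C => x; rewrite ger0_norm//; exact: bfun_mass_ge0.
- move=> _ [A mA [B mB <-]]. rewrite (_ : (fun x => _) = fun x => \1_A x * J x (\1_B)); last first.
  apply/funext => x; rewrite -(bfunZ (bJ x)); last exact: bmeas_indic.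
  by congr (J x); apply/funext => y; rewrite indicX.
 apply: bmeasM; first exact: bmeas_indic. split; first exact: mJ. exists C => x; apply: le_trans (JC x).
 rewrite -[leRHS]mul1r; apply: (bfun_norm_le (bJ x)); first exact: bmeas_indic.
 by move=> y; rewrite indicE; case: (_ \in _); rewrite ?normr1 ?normr0.
- move=> f g bf bg Hf Hg. rewrite (_ : (fun x => _) = fun x => J x (fun y => f (x, y)) + J x (fun y => g (x, y))).
  exact: bmeasD.
 by apply/funext => x; rewrite (bfunD (bJ x))//; exact: bmeas_pair1.
- move=> a f bf Hf. rewrite (_ : (fun x => _) = fun x => a * J x (fun y => f (x, y))); first exact: bmeasZ.
 by apply/funext => x; rewrite (bfunZ (bJ x))//; exact: bmeas_pair1.
- move=> F f M mF FM Ff HF. have cvJ x : J x (fun y => F n (x, y)) @[n --> \oo] --> J x (fun y => f (x, y)).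
  apply: (bfun_cvg (bJ x) (M := M)) => // n. exact: (mcomp (mF n) (measurable_pair1 x)).
 apply: (bmeas_lim (F := fun n x => J x (fun y => F n (x, y))) (M := `|M| * C)).
 + by move=> n; exact: (HF n).1.
 + move=> n x; via (`|M| * J x (fun=> 1)).
   apply: (bfun_norm_le (bJ x)).
    by split; [exact: (mcomp (mF n) (measurable_pair1 x)) | exists M].
   by move=> y; upto (FM n _); exact: ler_norm.
  by apply: ler_wpM2l.
 + exact: cvJ.
Qed.

Lemma bfun_param (J : (T2 -> R) -> R) : bfun J -> forall f, bmeas f -> bmeas (fun x : T1 => J (fun y => f (x, y))).
move=> bJ; by apply: (@bfun_param_family (fun=> J) (J (fun=> 1))) => // B mB.
Qed.

Lemma bfun_mix (I : (T1 -> R) -> R) (J : T1 -> (T2 -> R) -> R) (C : R) : bfun I ->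
 (forall x, bfun (J x)) -> (forall x, J x (fun=> 1) <= C) ->
 (forall B, measurable B -> mfun (fun x => J x (\1_B))) -> bfun (fun f : T2 -> R => I (fun x => J x f)).
move=> bI bJ JC mJ.
have bJf f : bmeas f -> bmeas (fun x => J x f).
 by move=> bf; apply: (bfun_param_family bJ JC mJ (f := fun z => f z.2)); apply: bmeas_comp bf _.
split.
- move=> f g bf bg; rewrite -(bfunD bI); [|exact: bJf..]. by congr I; apply/funext => x; rewrite (bfunD (bJ x)).
- move=> a f bf; rewrite -(bfunZ bI); [|exact: bJf]. by congr I; apply/funext => x; rewrite (bfunZ (bJ x)).
- move=> f bf f0; apply: (bfun_ge0 bI); first exact: bJf. by move=> x; apply: (bfun_ge0 (bJ x)).
- move=> F f M mF FM Ff. have bF n : bmeas (F n) by split=> //; exists M. apply: (bfun_cvg bI (M := `|M| * C)).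
 + by move=> n; apply: (bJf _ _).1.
 + move=> n x; via (`|M| * J x (fun=> 1)).
   by apply: (bfun_norm_le (bJ x)) => // y; upto (FM n _); exact: ler_norm.
  by apply: ler_wpM2l.
 + by move=> x; apply: (bfun_cvg (bJ x) (M := M)).
Qed.

Lemma bfun_eq_rect (I J : (T1 * T2 -> R) -> R) : bfun I -> bfun J ->
 (forall A B, measurable A -> measurable B -> I (\1_(A `*` B)) = J (\1_(A `*` B))) -> forall f, bmeas f -> I f = J f.
move=> bI bJ E; apply: (bfun_unique (measurable_prod_measurableType _ _) rectI bI bJ).
 have := E _ _ (measurableT : measurable [set: T1]) (measurableT : measurable [set: T2]). by rewrite setXTT indicT.
by move=> _ [A mA [B mB <-]]; exact: E.
Qed.

End Products.

Lemma bfun_prod d1 d2 (T1 : measurableType d1) (T2 : measurableType d2) (R : realType) (I : (T1 -> R) -> R) (J : (T2 -> R) -> R) :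
 bfun I -> bfun J -> bfun (fun f : T1 * T2 -> R => I (fun x => J (fun y => f (x, y)))).
move=> bI bJ; have bJx x := bfun_comp bJ (@measurable_pair1 _ _ T1 T2 x).
apply: (bfun_mix (J := fun x f => J (fun y => f (x, y))) (C := J (fun=> 1)) bI bJx) => // B mB.
by have [] := bfun_param bJ (bmeas_indic R mB).
Qed.

Lemma bmeas_swap d1 d2 (T1 : measurableType d1) (T2 : measurableType d2) (R : realType)
 (f : T1 * T2 -> R) : bmeas f -> bmeas (fun z : T2 * T1 => f (z.2, z.1)).
by move=> bf; apply: (bmeas_comp bf); exact: mfun_pair. Qed.

(** Both orders of integration are bounded functionals of [f] that agree on rectangles, where each
    of them factors into the same product. *)
Lemma bfun_fubini d1 d2 (T1 : measurableType d1) (T2 : measurableType d2) (R : realType)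
 (I : (T1 -> R) -> R) (J : (T2 -> R) -> R) (f : T1 * T2 -> R) : bfun I -> bfun J -> bmeas f ->
 I (fun x => J (fun y => f (x, y))) = J (fun y => I (fun x => f (x, y))).
move=> bI bJ; move: f.
apply: (bfun_eq_rect (bfun_prod bI bJ)).
 apply: (bfun_comp (bfun_prod bJ bI) (S := fun z : T2 * T1 => (z.2, z.1))). exact: mfun_pair.
move=> A B mA mB.
rewrite (_ : (fun x => J _) = fun x => J (\1_B) * \1_A x); last first.
 apply/funext => x; rewrite mulrC -(bfunZ bJ); last exact: bmeas_indic.
 by congr J; apply/funext => y; rewrite indicX.
rewrite (bfunZ bI); last exact: bmeas_indic.
have -> : (fun y => I (fun x => \1_(A `*` B) (x, y))) = fun y => I (\1_A) * \1_B y.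
 apply/funext => y; rewrite mulrC -(bfunZ bI); last exact: bmeas_indic.
 by congr I; apply/funext => x; rewrite indicX mulrC.
by rewrite (bfunZ bJ) 1?mulrC//; exact: bmeas_indic.
Qed.

(** * Integrals as bounded functionals *)

Section Integration.
Context d (T : measurableType d) (R : realType).

(** The weight [w] will be the angular kernel away from its singularity, the sine of the surface
    element, or 1. A multiple of it dominates in the limit property. *)
Lemma bfun_Rintegral (mu : {measure set T -> \bar R}) (D : set T) (w : T -> R) :
 measurable D -> mu.-integrable D (EFin \o w) -> (forall x, D x -> 0 <= w x) ->
 bfun (fun f : T -> R => \int[mu]_(x in D) (f x * w x)).
move=> mD iw w0.
have /integrableP[/mEFinP mw _] := iw.
have ifw f : bmeas f -> mu.-integrable D (EFin \o (fun x => f x * w x)).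
 move=> [mf [M fM]]. apply: (@le_integrable _ _ _ _ _ _ _ (EFin \o (fun x => `|M| * w x))) => //.
 - by apply/mEFinP; apply: mfunM => //; exact: measurable_funTS.
 - move=> x Dx /=; rewrite lee_fin !normrM normr_id; apply: ler_wpM2r => //. by upto (fM x); exact: ler_norm.
 - by rewrite (_ : EFin \o _ = fun x => (`|M|)%:E * (w x)%:E)%E//; exact: integrableZl.
split.
- move=> f g bf bg; rewrite -RintegralD; [|by []|exact: ifw..]. by apply: eq_Rintegral => x _; rewrite mulrDl.
- move=> a f bf; rewrite -RintegralZl; [|by []|exact: ifw]. by apply: eq_Rintegral => x _; rewrite mulrA.
- by move=> f bf f0; apply: Rintegral_ge0 => x Dx; rewrite mulr_ge0//; exact: w0.
- move=> F f M mF FM Ff. have bF n : bmeas (F n) by split=> //; exists M. have bf := bmeas_lim mF FM Ff.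
 have iM : mu.-integrable D (fun x => (`|M|)%:E * (w x)%:E)%E by exact: integrableZl.
 have [||||//|_ _ cv] := @dominated_convergence _ _ _ mu D mD (fun n => EFin \o (fun x => F n x * w x))
  (EFin \o (fun x => f x * w x)) (fun x => (`|M|)%:E * (w x)%:E)%E.
 + by move=> n; have /integrableP[] := ifw _ (bF n).
 + by have /integrableP[] := ifw _ bf.
 + apply: aeW => x Dx; apply: cvg_EFin; first exact: nearW. by apply: cvgM; [exact: Ff | exact: cvg_cst].
 + exact: iM.
 + apply: aeW => x n Dx /=; rewrite lee_fin normrM (ger0_norm (w0 _ Dx)). apply: ler_wpM2r; first exact: w0.
  by upto (FM n x); exact: ler_norm.
 rewrite /Rintegral; apply: fine_cvg; rewrite fineK//. by apply: integrable_fin_num => //; exact: ifw.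
Qed.

Lemma bfun_prob (P : probability T R) : bfun (fun f : T -> R => \int[P]_x f x).
have -> : (fun f : T -> R => \int[P]_x f x) = (fun f => \int[P]_x (f x * 1)).
 by apply/funext => f; apply: eq_Rintegral => x _; rewrite mulr1.
apply: bfun_Rintegral => //.
apply/integrableP; split; first exact: mcst.
rewrite (eq_integral (cst 1%E)); last by move=> x _ /=; rewrite normr1.
by rewrite integral_cst// mul1e; apply: (le_lt_trans (probability_le1 P measurableT)); rewrite ltry.
Qed.

Lemma prob_cst (P : probability T R) (c : R) : \int[P]_x c = c.
have := Rintegral_cst P (@measurableT _ T) c => /= ->.
have -> : P setT = 1%E by exact: probability_setT.
by rewrite mulr1.
Qed.

Lemma prob_indic (P : probability T R) (A : set T) : measurable A -> \int[P]_x \1_A x = fine (P A).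
by move=> mA; rewrite /Rintegral integral_indic// setIT. Qed.

Lemma bmeas_integrable (P : probability T R) (f : T -> R) : bmeas f -> integ P f.
move=> [mf [M fM]]; apply: measurable_bounded_integrable => //.
 by apply: (le_lt_trans (probability_le1 P measurableT)); rewrite ltry.
exists `|M|; split; first exact: num_real.
by move=> x Mx y _ /=; upto (fM y); upto (ler_norm M); exact: ltW.
Qed.

Lemma bmeas_integralE (P : probability T R) (f : T -> R) : bmeas f -> (\int[P]_x (f x)%:E)%E = (\int[P]_x f x)%:E.
by move=> bf; rewrite /Rintegral fineK//; apply: integrable_fin_num => //; exact: bmeas_integrable.
Qed.

End Integration.

(** * Euclidean geometry of three-dimensional space *)

Section Vec3.
Context {R : realType}.
Implicit Types u v w x y z : vec3 R.

Lemma vec3_eq x y : x.1.1 = y.1.1 -> x.1.2 = y.1.2 -> x.2 = y.2 -> x = y.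
by case: x => [[? ?] ?]; case: y => [[? ?] ?] /= -> -> ->. Qed.

Lemma dot3C x y : dot3 x y = dot3 y x.
by rewrite /dot3; ring. Qed.

Lemma dot3DL x y z : dot3 (x + y) z = dot3 x z + dot3 y z.
by rewrite /dot3 /=; ring. Qed.

Lemma dot3DR x y z : dot3 x (y + z) = dot3 x y + dot3 x z.
by rewrite /dot3 /=; ring. Qed.

Lemma dot3NL x y : dot3 (- x) y = - dot3 x y.
by rewrite /dot3 /=; ring. Qed.

Lemma dot3NR x y : dot3 x (- y) = - dot3 x y.
by rewrite /dot3 /=; ring. Qed.

Lemma dot3ZL a x y : dot3 (scale3 a x) y = a * dot3 x y.
by rewrite /dot3 /scale3 /=; ring. Qed.

Lemma dot3ZR a x y : dot3 x (scale3 a y) = a * dot3 x y.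
by rewrite /dot3 /scale3 /=; ring. Qed.

Definition dot3E := (dot3DL, dot3DR, dot3NL, dot3NR, dot3ZL, dot3ZR).

Lemma dot3_ge0 x : 0 <= dot3 x x.
by rewrite /dot3 !addr_ge0// -expr2 sqr_ge0. Qed.

Lemma norm3_ge0 x : 0 <= norm3 x. Proof. exact: sqrtr_ge0. Qed.

Lemma norm3_sqr x : norm3 x ^+ 2 = dot3 x x.
by rewrite sqr_sqrtr// dot3_ge0. Qed.

Lemma dot3_cross x y : dot3 (cross3 x y) (cross3 x y) = dot3 x x * dot3 y y - dot3 x y ^+ 2.
by rewrite /dot3 /cross3 /=; ring. Qed.

Lemma dot3_sqr_le x y : dot3 x y ^+ 2 <= dot3 x x * dot3 y y.
by rewrite -subr_ge0 -dot3_cross dot3_ge0. Qed.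

Lemma dot3_le x y : `|dot3 x y| <= norm3 x * norm3 y.
rewrite -ler_sqr ?nnegrE ?mulr_ge0 ?norm3_ge0//.
by rewrite real_normK ?num_real// exprMn !norm3_sqr dot3_sqr_le.
Qed.

Lemma norm3_le x (a : R) : 0 <= a -> dot3 x x <= a ^+ 2 -> norm3 x <= a.
by move=> a0; rewrite -norm3_sqr ler_sqr// nnegrE ?norm3_ge0. Qed.

Lemma norm3D x y : norm3 (x + y) <= norm3 x + norm3 y.
apply: norm3_le; first by rewrite addr_ge0 ?norm3_ge0.
rewrite !dot3E (dot3C y x) sqrrD !norm3_sqr mulr2n.
have := le_trans (ler_norm _) (dot3_le x y); lra.
Qed.

Lemma norm3N x : norm3 (- x) = norm3 x.
by rewrite /norm3 !dot3E opprK. Qed.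

Lemma norm3Z a x : norm3 (scale3 a x) = `|a| * norm3 x.
by rewrite /norm3 !dot3E mulrA -expr2 sqrtrM ?sqr_ge0// sqrtr_sqr. Qed.

Lemma norm30 : norm3 (0 : vec3 R) = 0.
by rewrite /norm3 /dot3 /= !mul0r !addr0 sqrtr0. Qed.

Lemma norm3_eq0 x : (norm3 x == 0) = (x == 0).
apply/eqP/eqP => [n0|->]; last exact: norm30.
have := norm3_sqr x; rewrite n0 expr0n /dot3 /= => /esym/eqP.
rewrite -!expr2 !paddr_eq0 ?addr_ge0 ?sqr_ge0// !sqrf_eq0 => /andP[/andP[/eqP a /eqP b] /eqP c].
exact: vec3_eq.
Qed.

Lemma norm3_gt0 x : (0 < norm3 x) = (x != 0).
by rewrite lt0r norm3_eq0 norm3_ge0 andbT. Qed.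

Lemma dist3C x y : dist3 x y = dist3 y x.
by rewrite /dist3 -norm3N opprB. Qed.

Lemma dist3xx x : dist3 x x = 0.
by rewrite /dist3 subrr norm30. Qed.

Lemma dist3_ge0 x y : 0 <= dist3 x y. Proof. exact: norm3_ge0. Qed.

Lemma dist3_tri y x z : dist3 x z <= dist3 x y + dist3 y z.
by rewrite /dist3; apply: le_trans (norm3D _ _); rewrite addrA subrK.
Qed.

Lemma norm3_dist x y : `|norm3 x - norm3 y| <= dist3 x y.
have H (a b : vec3 R) : norm3 a - norm3 b <= dist3 a b.
 by rewrite lerBlDr /dist3; apply: le_trans (norm3D _ _); rewrite subrK.
by rewrite ler_norml H andbT lerNl opprB dist3C H.
Qed.

Lemma norm3_sub2 x y : norm3 (x - y) ^+ 2 <= 2 * norm3 x ^+ 2 + 2 * norm3 y ^+ 2.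
have := norm3D x (- y); rewrite norm3N => h.
have := norm3_ge0 (x - y); have := sqr_ge0 (norm3 x - norm3 y); nra.
Qed.

Lemma dist3_sqr_le x y z : dist3 x z ^+ 2 <= 2 * dist3 x y ^+ 2 + 2 * dist3 y z ^+ 2.
have := dist3_tri y x z; have := dist3_ge0 x z.
have := sqr_ge0 (dist3 x y - dist3 y z); nra.
Qed.

Lemma norm3_le_sum x : norm3 x <= `|x.1.1| + `|x.1.2| + `|x.2|.
apply: norm3_le; first by rewrite !addr_ge0.
rewrite /dot3 -!expr2 -(real_normK (num_real x.1.1)) -(real_normK (num_real x.1.2)) -(real_normK (num_real x.2)).
have := normr_ge0 x.1.1; have := normr_ge0 x.1.2; have := normr_ge0 x.2; nra.
Qed.

Lemma norm3_coord x : [/\ `|x.1.1| <= norm3 x, `|x.1.2| <= norm3 x & `|x.2| <= norm3 x].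
have H (a : R) : a ^+ 2 <= dot3 x x -> `|a| <= norm3 x.
 by move=> h; rewrite -sqrtr_sqr; exact: ler_wsqrtr.
by split; apply: H; rewrite /dot3; have := sqr_ge0 x.1.1; have := sqr_ge0 x.1.2; have := sqr_ge0 x.2; nra.
Qed.

End Vec3.

Section MeasurableVec3.
Context d (T : measurableType d) (R : realType).
Implicit Types f g : T -> vec3 R.

Lemma mvec3_coord f : mfun f -> [/\ mfun (fun t => (f t).1.1), mfun (fun t => (f t).1.2) &
   mfun (fun t => (f t).2)].
move=> mf; have m1 := mcomp mfst mf.
by split; [exact: (mcomp mfst m1) | exact: (mcomp msnd m1)
 | exact: (mcomp msnd mf)].
Qed.

Lemma mvec3_mk (a b c : T -> R) : mfun a -> mfun b -> mfun c -> mfun (fun t => vec3_mk (a t) (b t) (c t)).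
by move=> ma mb mc; apply: mfun_pair => //; exact: mfun_pair. Qed.

Lemma mvec3D f g : mfun f -> mfun g -> mfun (fun t => f t + g t).
move=> /mvec3_coord[f1 f2 f3] /mvec3_coord[g1 g2 g3].
by apply: (@mvec3_mk (fun t => (f t).1.1 + (g t).1.1)
 (fun t => (f t).1.2 + (g t).1.2) (fun t => (f t).2 + (g t).2)); exact: mfunD.
Qed.

Lemma mscale3 (a : T -> R) f : mfun a -> mfun f -> mfun (fun t => scale3 (a t) (f t)).
by move=> ma /mvec3_coord[f1 f2 f3]; apply: mvec3_mk; exact: mfunM.
Qed.

Lemma mvec3N f : mfun f -> mfun (fun t => - f t).
move=> /mvec3_coord[f1 f2 f3].
by apply: (@mvec3_mk (fun t => - (f t).1.1) (fun t => - (f t).1.2) (fun t => - (f t).2));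
 exact: mcomp.
Qed.

Lemma mvec3B f g : mfun f -> mfun g -> mfun (fun t => f t - g t).
by move=> mf mg; apply: mvec3D => //; exact: mvec3N. Qed.

Lemma mdot3 f g : mfun f -> mfun g -> mfun (fun t => dot3 (f t) (g t)).
move=> /mvec3_coord[f1 f2 f3] /mvec3_coord[g1 g2 g3].
by apply: mfunD; [apply: mfunD|]; exact: mfunM.
Qed.

Lemma mcross3 f g : mfun f -> mfun g -> mfun (fun t => cross3 (f t) (g t)).
move=> /mvec3_coord[f1 f2 f3] /mvec3_coord[g1 g2 g3].
by apply: mvec3_mk; apply: mfunB; exact: mfunM.
Qed.

Lemma msqrtr : mfun (@Num.sqrt R).
by apply: continuous_measurable_fun; exact: sqrt_continuous. Qed.

Lemma mnorm3 f : mfun f -> mfun (fun t => norm3 (f t)).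
by move=> mf; apply: (mcomp msqrtr); exact: mdot3.
Qed.

End MeasurableVec3.

(** * Configurations, truncated costs and c-transforms *)

Section Lipschitz.
Context (R : realType) (N : nat).
Notation E := (N.-tuple (vec3 R)).
Implicit Types (v w : E) (phi psi : E -> R).
Definition upd w (i : 'I_N) (x : vec3 R) : E := [tuple (if k == i then x else tnth w k) | k < N].

Lemma tnth_upd w i x k : tnth (upd w i x) k = if k == i then x else tnth w k.
by rewrite tnth_mktuple. Qed.

Lemma upd_upd w i x y : upd (upd w i x) i y = upd w i y.
by apply: eq_from_tnth => k; rewrite !tnth_upd; case: eqP. Qed.

Lemma upd_updC w i j x y : i != j -> upd (upd w i x) j y = upd (upd w j y) i x.
move=> ij; apply: eq_from_tnth => k; rewrite !tnth_upd.
by case: (eqVneq k j) => [->|//]; rewrite eq_sym (negbTE ij).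
Qed.

Lemma upd_tnth w i : upd w i (tnth w i) = w.
by apply: eq_from_tnth => k; rewrite tnth_upd; case: eqP => [->|]. Qed.

Lemma mupd d (T : measurableType d) (f : T -> E) i (g : T -> vec3 R) :
 mfun f -> mfun g -> mfun (fun t => upd (f t) i (g t)).
move=> mf mg; apply/measurable_fun_tnthP => k.
rewrite (_ : _ \o _ = fun t => if k == i then g t else tnth (f t) k).
 case: eqP => // _. exact: (mcomp (mtnth k) mf).
by apply/funext => t /=; rewrite tnth_upd.
Qed.

(** Equivalent to the Euclidean [distN] of the generator's domain, but it splits over coordinates:
    changing one coordinate changes it by the distance of the two values. *)
Definition dist1 v w : R := \sum_(i < N) dist3 (tnth v i) (tnth w i).

Lemma dist1_ge0 v w : 0 <= dist1 v w.
by apply: sumr_ge0 => i _; exact: dist3_ge0. Qed.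

Lemma dist1C v w : dist1 v w = dist1 w v.
by apply: eq_bigr => i _; rewrite dist3C. Qed.

Lemma dist1_upd w i x y : dist1 (upd w i x) (upd w i y) = dist3 x y.
rewrite /dist1 (bigD1 i)//= !tnth_upd eqxx big1 ?addr0// => k ki.
by rewrite !tnth_upd (negbTE ki) dist3xx.
Qed.

Definition lipN (L : R) phi := forall v w, `|phi v - phi w| <= L * dist1 v w.

Lemma dist3_distN v w i : dist3 (tnth v i) (tnth w i) <= distN v w.
rewrite -[leLHS]ger0_norm ?dist3_ge0// -sqrtr_sqr; apply: ler_wsqrtr.
by rewrite (bigD1 i)//= lerDl; apply: sumr_ge0 => k _; exact: sqr_ge0.
Qed.

Lemma dist1_distN v w : dist1 v w <= N%:R * distN v w.
via (\sum_(i < N) distN v w); first by apply: ler_sum => i _; exact: dist3_distN.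
by rewrite sumr_const card_ord -[X in X <= _]mulr_natl.
Qed.

Lemma distN_dist1 v w : distN v w <= dist1 v w.
rewrite -[leRHS]ger0_norm ?dist1_ge0// -sqrtr_sqr; apply: ler_wsqrtr.
rewrite /dist1.
suff H (s : seq 'I_N) : \sum_(i <- s) dist3 (tnth v i) (tnth w i) ^+ 2 <=
  (\sum_(i <- s) dist3 (tnth v i) (tnth w i)) ^+ 2 by exact: H.
elim: s => [|i s IH]; first by rewrite !big_nil expr0n.
rewrite !big_cons sqrrD; have := dist3_ge0 (tnth v i) (tnth w i).
have : 0 <= \sum_(j <- s) dist3 (tnth v j) (tnth w j) by apply: sumr_ge0 => j _; exact: dist3_ge0.
by move=> a b; have := mulr_ge0 a b; rewrite mulr2n; lra.
Qed.

Lemma lipN_bounded_lip L phi B : 0 <= L -> lipN L phi -> (forall v, `|phi v| <= B) ->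
 bounded_lipschitz (@distN R N) phi.
move=> L0 lp pB; split; first by exists B.
exists (L * N%:R) => v w; upto (lp v w).
by rewrite -mulrA; apply: ler_wpM2l => //; exact: dist1_distN.
Qed.

Lemma lipN_measurable L phi : lipN L phi -> mfun phi.
move=> lp; have D (x e : R) : 0 < e -> exists r : rat, `|x - ratr r| <= e.
 move=> e0; have xe : x - e < x + e by lra.
 by have [r] := rat_in_itvoo xe; rewrite in_itv/= => /andP[h1 h2]; exists r; rewrite ler_norml; lra.
pose pt (k : N.-tuple (rat * rat * rat)) : E :=
 [tuple vec3_mk (ratr (tnth k i).1.1) (ratr (tnth k i).1.2) (ratr (tnth k i).2) | i < N].
pose q n : E := odflt [tuple 0 | i < N] (omap pt (unpickle n)).
(* [phi] is the McShane extension of its restriction to the rational points. *)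
pose F n w := phi (q n) + `|L| * dist1 w (q n).
have HL w w' : `|phi w - phi w'| <= `|L| * dist1 w w'.
 by upto (lp _ _); apply: ler_wpM2r; [exact: dist1_ge0|exact: ler_norm].
have F_ge n w : phi w <= F n w by have := HL w (q n); rewrite ler_norml /F => /andP[_]; lra.
have lb w : has_lbound (range (F ^~ w)) by exists (phi w) => _ [n _ <-].
have -> : phi = fun w => infs (F ^~ w) 0%N.
 apply/funext => w; apply/eqP; rewrite eq_le; apply/andP; split.
  by apply: lb_le_inf => [|_ [n _ <-]//]; exists (F 0%N w), 0%N.
 (* Each of the 3 N coordinates is approximated within [d]. The error 3 N |L| d is paid once by
    [phi] and once by the distance term, whence the 6. *)
 apply/ler_addgt0Pr => e e0; pose d := e / (6 * N%:R * `|L| + 1).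
 have d1 : 0 < 6 * N%:R * `|L| + 1 by rewrite ltr_wpDl// !mulr_ge0. have d0 : 0 < d by rewrite divr_gt0.
 have [g gP] := choice (fun x => D x d d0).
 pose k := [tuple (g (tnth w i).1.1, g (tnth w i).1.2, g (tnth w i).2) | i < N].
 have dk : dist1 w (pt k) <= N%:R * (3 * d).
  rewrite [leRHS]mulr_natl -[X in _ *+ X](card_ord N) -sumr_const; apply: ler_sum => i _; rewrite !tnth_mktuple.
  upto (norm3_le_sum _) => /=; have := gP (tnth w i).1.1; have := gP (tnth w i).1.2; have := gP (tnth w i).2; lra.
 via (F (pickle k) w).
  by apply: ge_inf; [exists (phi w) => _ [n _ <-]|exists (pickle k)].
 have := HL w (pt k); rewrite /F /q pickleK /= ler_norml => /andP[h _].
 have : `|L| * dist1 w (pt k) <= `|L| * (N%:R * (3 * d)) by exact: ler_wpM2l.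
 have : 2 * (`|L| * (N%:R * (3 * d))) <= e.
  have -> : 2 * (`|L| * (N%:R * (3 * d))) = 6 * N%:R * `|L| * d by ring.
  by have : (6 * N%:R * `|L| + 1) * d = e; [rewrite /d mulrC divfK ?gt_eqF|lra].
 lra.
apply: measurable_fun_infs => [w _|n]; first exact: lb.
apply: mfunD => //; apply: mfunM => //; apply: measurable_sum => i.
by apply: mnorm3; apply: mvec3B => //; exact: mtnth.
Qed.

Definition costM (M : R) (x y : vec3 R) : R := Num.min (dist3 x y ^+ 2) M.

Lemma costM_ge0 M x y : 0 <= M -> 0 <= costM M x y.
by move=> M0; rewrite le_min sqr_ge0. Qed.

Lemma costM_le M x y : costM M x y <= M.
by rewrite ge_min lexx orbT. Qed.

Lemma costMC M x y : costM M x y = costM M y x.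
by rewrite /costM dist3C. Qed.

(** On distances below sqrt M the square has slope at most 2 sqrt M, and beyond them the cost is
    constant. *)
Lemma costM_lip M x y z : 0 <= M -> `|costM M x y - costM M x z| <= 2 * Num.sqrt M * dist3 y z.
move=> M0; have := sqr_sqrtr M0; have := sqrtr_ge0 M.
have H a b : `|dist3 x a - dist3 x b| <= dist3 a b.
 have := dist3_tri b x a; have := dist3_tri a x b; rewrite (dist3C b a) => *.
 by rewrite ler_norml; apply/andP; split; lra.
move: (Num.sqrt M) => s s0 sM; rewrite /costM -sM.
suff K a b c : 0 <= a -> 0 <= b -> a - b <= c -> 0 <= c -> Num.min (a ^+ 2) (s ^+ 2) - Num.min (b ^+ 2) (s ^+ 2) <= 2 * s * c.
 have /andP[h1 h2] : - dist3 y z <= dist3 x y - dist3 x z <= dist3 y z by rewrite -ler_norml.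
 rewrite ler_norml; apply/andP; split.
  rewrite lerNl opprB; apply: K; rewrite ?dist3_ge0//; lra.
 by apply: K; rewrite ?dist3_ge0.
move=> a0 b0 abc c0; have sc := mulr_ge0 s0 c0.
have m1 : Num.min (a ^+ 2) (s ^+ 2) <= a ^+ 2 by rewrite ge_min lexx.
have m2 : Num.min (a ^+ 2) (s ^+ 2) <= s ^+ 2 by rewrite ge_min lexx orbT.
rewrite /(Num.min (b ^+ 2)); case: ltP => bs; last lra.
have bs' : b < s by rewrite -ltr_sqr ?nnegrE.
by have [as_|sa] := leP a s; nra.
Qed.

Definition costN (M : R) v w : R := \sum_(i < N) costM M (tnth v i) (tnth w i).

Lemma costN_ge0 M v w : 0 <= M -> 0 <= costN M v w.
by move=> M0; apply: sumr_ge0 => i _; exact: costM_ge0. Qed.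

Lemma costN_le M v w : costN M v w <= N%:R * M.
via (\sum_(i < N) M); first by apply: ler_sum => i _; exact: costM_le.
by rewrite sumr_const card_ord -[X in X <= _]mulr_natl.
Qed.

Lemma costNC M v w : costN M v w = costN M w v.
by apply: eq_bigr => i _; rewrite costMC. Qed.

Lemma costNxx M v : 0 <= M -> costN M v v = 0.
by move=> M0; apply: big1 => i _; rewrite /costM dist3xx expr0n min_l. Qed.

Lemma costN_upd M v w i x y :
 costN M (upd v i x) (upd w i y) = costN M v w - costM M (tnth v i) (tnth w i) + costM M x y.
rewrite /costN (bigD1 i)//= (bigD1 i (P := predT))//= !tnth_upd eqxx.
rewrite (eq_bigr (fun k => costM M (tnth v k) (tnth w k))) => [|k ki]; last first.
 by rewrite !tnth_upd (negbTE ki).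
by rewrite [RHS]addrC addrAC subrr add0r.
Qed.

Lemma costN_lip M v w w' : 0 <= M -> `|costN M v w - costN M v w'| <= 2 * Num.sqrt M * dist1 w w'.
move=> M0; rewrite -sumrB mulr_sumr; upto (ler_norm_sum _ _ _).
by apply: ler_sum => i _; exact: costM_lip.
Qed.

(* The c-transform: whatever [f], the result is as Lipschitz as the cost. *)
Definition ctrans M (f : E -> R) (w : E) : R := inf [set costN M v w - f v | v in setT].

Section CTransform.
Variables (M B : R) (f : E -> R).
Hypotheses (M0 : 0 <= M) (fB : forall v, f v <= B).
Let lb w : lbound [set costN M v w - f v | v in setT] (- B).
by move=> _ [v _ <-]; have := costN_ge0 v w M0; have := fB v; lra. Qed.

Lemma ctrans_le v w : ctrans M f w <= costN M v w - f v.
by apply: ge_inf; [exists (- B); exact: lb | exists v]. Qed.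

Lemma ctrans_ge w a : (forall v, a <= costN M v w - f v) -> a <= ctrans M f w.
move=> h; apply: lb_le_inf; last by move=> _ [v _ <-].
by exists (costN M w w - f w); exists w.
Qed.

Lemma ctrans_lip : lipN (2 * Num.sqrt M) (ctrans M f).
have H w w' : ctrans M f w - ctrans M f w' <= 2 * Num.sqrt M * dist1 w w'.
 rewrite lerBlDr -lerBlDl; apply: ctrans_ge => v.
 have := ctrans_le v w; have := costN_lip v w w' M0; rewrite ler_norml => /andP[]; lra.
by move=> w w'; rewrite ler_norml lerNl opprB dist1C H dist1C H.
Qed.

End CTransform.

(** Two c-transforms and a shift bring any bounded measurable pair lying below the cost to one with
    these bounds (see [dual_step]). So the supremum over such pairs is the Kantorovich value, while
    all of them are test functions with uniform constants. *)
Definition admissible M phi psi := [/\ lipN (2 * Num.sqrt M) phi, lipN (2 * Num.sqrt M) psi,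
   forall v, `|phi v| <= N%:R * M, forall w, `|psi w| <= N%:R * M & forall v w, phi v + psi w <= costN M v w].

Lemma admissible_bmeas M phi psi : admissible M phi psi -> bmeas phi /\ bmeas psi.
move=> [lp ls pB sB _]; split; split; [exact: lipN_measurable lp|by exists (N%:R * M)|exact: lipN_measurable ls|by exists (N%:R * M)].
Qed.

Lemma admissible0 M : 0 <= M -> admissible M (fun=> 0) (fun=> 0).
move=> M0; have B0 : 0 <= N%:R * M by rewrite mulr_ge0.
split; rewrite ?normr0//; try by move=> v w; rewrite subrr normr0 mulr_ge0 ?dist1_ge0// mulr_ge0// sqrtr_ge0.
by move=> v w; rewrite addr0 costN_ge0.
Qed.

(** The c-transform [g] of [f = (phi - b1) / A] is at least [(psi - b2) / A], and the c-transform
    [h] of [g] is at least [f]. Shifted by [S = sup f], the pair [h], [g] is admissible; the two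
    shifts cancel because [F] and [G] have mass 1. *)
Lemma dual_step (F G : (E -> R) -> R) (M A U : R) (phi psi b1 b2 : E -> R) :
 0 <= M -> 0 < A -> bfun F -> bfun G -> F (fun=> 1) = 1 -> G (fun=> 1) = 1 ->
 (forall phi psi, admissible M phi psi -> F phi + G psi <= U) -> bmeas phi -> bmeas psi -> bmeas b1 -> bmeas b2 ->
 (forall v w, phi v + psi w <= A * costN M v w + (b1 v + b2 w)) -> F phi + G psi <= A * U + (F b1 + G b2).
move=> M0 A0 bF bG F1 G1 HU bphi bpsi bb1 bb2 H.
pose f v := A^-1 * (phi v - b1 v).
have bf : bmeas f by apply: bmeasZ; exact: bmeasB.
have [_ [K fK]] := bf.
have fK' v : f v <= K by apply: le_trans (fK v); exact: ler_norm.
pose S := sup [set f v | v in setT].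
have fS v : f v <= S.
 by apply: ub_le_sup; [exists K => _ [u _ <-] | exists v].
pose g := ctrans M f.
have gl v w : g w <= costN M v w - f v by exact: ctrans_le fK' _ _.
have gS w : - S <= g w by apply: ctrans_ge => v; have := costN_ge0 v w M0; have := fS v; lra.
have gu w : g w <= N%:R * M - S.
 rewrite lerBrDr -lerBrDl; apply: ge_sup; first by exists (f w); exists w.
 by move=> _ [v _ <-]; have := gl v w; have := costN_le M v w; lra.
have gS' w : g w <= N%:R * M - S by [].
pose h := ctrans M g.
have hl v w : h v <= costN M v w - g w by rewrite costNC; exact: ctrans_le gS' _ _.
have fh v : f v <= h v by apply: ctrans_ge => w; rewrite costNC; have := gl v w; lra.
have hu v : h v <= N%:R * M + S by have := hl v v; have := gS v; have := costN_le M v v; lra.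
have hS v : S - N%:R * M <= h v by apply: ctrans_ge => w; have := costN_ge0 w v M0; have := gu w; lra.
have ad : admissible M (fun v => h v - S) (fun w => g w + S).
 split.
 - by move=> v w; rewrite opprB addrA subrK; exact: ctrans_lip gS' _ _.
 - by move=> v w; rewrite opprD addrACA subrr addr0; exact: ctrans_lip fK' _ _.
 - by move=> v; rewrite ler_norml; have := hS v; have := hu v; move=> *; apply/andP; split; lra.
 - move=> w; rewrite ler_norml; have := gS w; have := gu w => *; apply/andP; split; last lra.
  have NM : 0 <= N%:R * M by rewrite mulr_ge0. lra.
 - by move=> v w; have := hl v w; lra.
have := HU _ _ ad; have [bh bg] := admissible_bmeas ad.
have bh' : bmeas h.
 rewrite (_ : h = fun v => (h v - S) + S); last by apply/funext => v; rewrite subrK.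
 by apply: bmeasD => //; exact: bmeas_cst.
have bg' : bmeas g.
 rewrite (_ : g = fun v => (g v + S) - S); last by apply/funext => v; rewrite addrK.
 by apply: bmeasB => //; exact: bmeas_cst.
rewrite (bfunB bF)//; last exact: bmeas_cst.
rewrite (bfunD bG)//; last exact: bmeas_cst.
rewrite (bfun_cst bF S) (bfun_cst bG S) F1 G1 => HU'.
have P1 : F phi <= A * F h + F b1.
 rewrite -(bfunZ bF)// -(bfunD bF)//; last exact: bmeasZ.
 apply: (bfun_le bF) => //; first by apply: bmeasD => //; exact: bmeasZ.
 by move=> v; rewrite -lerBlDr -ler_pdivrMl//; exact: fh.
have P2 : G psi <= A * G g + G b2.
 rewrite -(bfunZ bG)// -(bfunD bG)//; last exact: bmeasZ.
 apply: (bfun_le bG) => //; first by apply: bmeasD => //; exact: bmeasZ.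
 move=> w; rewrite -lerBlDr -ler_pdivrMl//; apply: ctrans_ge => v.
 rewrite /f ler_pdivrMl// mulrBr mulrA divff ?gt_eqF// mul1r; have := H v w; lra.
have : A * (F h + G g) <= A * U by rewrite ler_pM2l//; lra.
by rewrite mulrDr; lra.
Qed.

End Lipschitz.

Lemma mcosf (R : realType) d (T : measurableType d) (f : T -> R) : mfun f -> mfun (fun t : T => cos (f t)).
by move=> mf; apply: mcomp => //; apply: continuous_measurable_fun; exact: continuous_cos.
Qed.

Lemma msinf (R : realType) d (T : measurableType d) (f : T -> R) : mfun f -> mfun (fun t : T => sin (f t)).
by move=> mf; apply: mcomp => //; apply: continuous_measurable_fun; exact: continuous_sin.
Qed.

Ltac routine := by repeat first
 [ done | apply: mulr_ge0 | apply: addr_ge0 | apply: ltW; done | apply: exprn_ge0 | exact: norm3_ge0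
 | exact: sqr_ge0 | exact: powR_ge0 | exact: expR_ge0 | exact: pi_ge0 | rewrite invr_ge0 | exact: normr_ge0
 | apply: sumr_ge0 => ? _ | exact: bmeas_cst | apply: bmeasD | apply: bmeasB | apply: bmeasN | apply: bmeasZ
 | apply: bmeasM | apply: bmeas_sum => ? _ | exact: bmeas_indic
 | match goal with H : bmeas ?p |- bmeas (fun x => ?p (@?g x)) => apply: (bmeas_comp H) end
 | exact: mfst | exact: msnd | exact: measurable_id | exact: mtnth
 | exact: mcst | apply: mfunD | apply: mfunB | apply: mfunX
 | apply: mfunM | apply: mnorm3 | apply: mvec3D | apply: mvec3B
 | apply: mvec3N | apply: mscale3 | apply: mcosf | apply: msinf
 | apply: mupd | apply: measurable_minr | apply: measurable_maxr | apply: mfun_pair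
 | apply: bmeas_min
 | match goal with H : mfun ?p |- mfun (fun x => ?p (@?g x)) => apply: (mcomp H) | |- mfun (fun x => fst (@?g x)) => apply: (mcomp mfst) | |- mfun (fun x => snd (@?g x)) => apply: (mcomp msnd) | |- mfun (fun x => tnth (@?g x) ?i) => apply: (mcomp (mtnth i)) end ].

(** * Product laws as iterated integrals *)

Section ProductFunctional.
Context (R : realType) (N : nat).
Notation E := (N.-tuple (vec3 R)).
Notation prob := (probability (vec3 R) R).
Implicit Types (psi : E -> R) (f : prob) (g : 'I_N -> prob) (s : seq 'I_N).
Definition resamp f (i : 'I_N) psi (w : E) : R := \int[f]_x psi (upd w i x).

Lemma bmeas_upd psi w i : bmeas psi -> bmeas (fun x => psi (upd w i x)).
by move=> bp; routine. Qed.

Lemma resamp_bmeas f i psi : bmeas psi -> bmeas (resamp f i psi).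
move=> bp; apply: (bfun_param (bfun_prob f) (f := fun z : E * vec3 R => psi (upd z.1 i z.2))).
by apply: (bmeas_comp bp); exact: mupd.
Qed.

Lemma resampC f f' i j psi : i != j -> bmeas psi -> resamp f i (resamp f' j psi) = resamp f' j (resamp f i psi).
move=> ij bp; apply/funext => w; rewrite /resamp.
have := @bfun_fubini _ _ _ _ R _ _ (fun z : vec3 R * vec3 R => psi (upd (upd w i z.1) j z.2))
 (bfun_prob f) (bfun_prob f').
rewrite /= => ->.
 by apply: eq_Rintegral => y _; apply: eq_Rintegral => x _; rewrite upd_updC.
by apply: (bmeas_comp bp); do 2 apply: mupd => //.
Qed.

Lemma resampK f f' i psi : resamp f i (resamp f' i psi) = resamp f' i psi.
apply/funext => w; rewrite /resamp.
rewrite -[RHS](prob_cst f); apply: eq_Rintegral => x _.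
by apply: eq_Rintegral => y _; rewrite upd_upd.
Qed.

Definition resamps g s psi : E -> R := foldr (fun i h => resamp (g i) i h) psi s.

Lemma resamps_bmeas g s psi : bmeas psi -> bmeas (resamps g s psi).
by move=> bp; elim: s => //= i s IH; exact: resamp_bmeas. Qed.

Lemma resamps_comm g s f i psi : i \notin s -> bmeas psi ->
 resamps g s (resamp f i psi) = resamp f i (resamps g s psi).
move=> + bp; elim: s => //= j s IH; rewrite inE negb_or => /andP[ij /IH ->].
by rewrite resampC 1?eq_sym//; exact: resamps_bmeas.
Qed.

Lemma eq_resamps g g' s psi : {in s, g =1 g'} -> resamps g s psi = resamps g' s psi.
elim: s => //= i s IH H; rewrite (H i) ?inE ?eqxx// IH// => j js.
by apply: H; rewrite inE js orbT.
Qed.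

Definition subst g (i : 'I_N) f : 'I_N -> prob := fun k => if k == i then f else g k.

(** Once coordinate [i] is integrated out, integrating it again changes nothing. So a resampling of
    [i] placed innermost overrides the law of that coordinate. *)
Lemma resamps_subst g s f i psi : uniq s -> i \in s -> bmeas psi ->
 resamps (subst g i f) s psi = resamps g s (resamp f i psi).
move=> + + bp; elim: s => //= j s IH /andP[js us]; rewrite inE => /predU1P[ij|si].
 rewrite -{j}ij in js *; rewrite resamps_comm// resampK {1}/subst eqxx; congr resamp.
 by apply: eq_resamps => k ks; rewrite /subst; case: eqP js ks => // -> /negbTE ->.
rewrite IH//; congr resamp; rewrite /subst.
by case: eqP js => // ->; rewrite si.
Qed.

Lemma resamps_bfun g s w : bfun (fun psi => resamps g s psi w).
elim: s w => [w|i s IH w] /=; first by [].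
apply: (bfun_mix (C := 1) (bfun_prob (g i)) (J := fun x psi => resamps g s psi (upd w i x))).
- by move=> x; exact: IH.
- move=> x; have -> : forall s', resamps g s' (fun=> 1) = fun=> 1; last by [].
 by elim=> //= j s' ->; apply/funext => z; rewrite /resamp prob_cst.
- by move=> B mB; have [] := bmeas_upd w i (resamps_bmeas g s (bmeas_indic R mB)).
Qed.

Lemma resamps_cst g s c : resamps g s (fun=> c) = fun=> c.
by elim: s => //= i s ->; apply/funext => w; rewrite /resamp prob_cst. Qed.

Lemma resamps_prod g s (h : 'I_N -> vec3 R -> R) w : uniq s -> (forall i, bmeas (h i)) ->
 resamps g s (fun w => \prod_i h i (tnth w i)) w = \prod_i (if i \in s then \int[g i]_x h i x else h i (tnth w i)).
move=> + bh; elim: s w => //= i s IH w /andP[si us].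
rewrite /resamp.
have -> : (fun x => resamps g s (fun w => \prod_i h i (tnth w i)) (upd w i x)) =
  (fun x => (\prod_(k | k != i) (if k \in s then \int[g k]_x h k x else h k (tnth w k))) * h i x).
 apply/funext => x; rewrite IH// (bigD1 i)//= (negbTE si) tnth_upd eqxx mulrC; congr (_ * _).
 by apply: eq_bigr => k ki; rewrite tnth_upd (negbTE ki).
rewrite (bfunZ (bfun_prob (g i)))// [RHS](bigD1 i)//= inE eqxx mulrC; congr (_ * _).
by apply: eq_bigr => k ki; rewrite inE (negbTE ki).
Qed.

(* Integration against the product of the [g i], as an iterated integral;
  the base point is irrelevant since every coordinate is integrated. *)
Definition prodf g psi : R := resamps g (enum 'I_N) psi [tuple 0 | i < N].

Lemma prodf_subst g f i psi : bmeas psi -> prodf (subst g i f) psi = prodf g (resamp f i psi).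
by move=> bp; rewrite /prodf resamps_subst ?enum_uniq ?mem_enum. Qed.

Lemma prodf_bfun g : bfun (prodf g).
exact: resamps_bfun. Qed.

Lemma prodf1 g : prodf g (fun=> 1) = 1.
by rewrite /prodf resamps_cst. Qed.

Lemma prodf_cst g c : prodf g (fun=> c) = c.
by rewrite /prodf resamps_cst. Qed.

Lemma prodf_prod g (h : 'I_N -> vec3 R -> R) : (forall i, bmeas (h i)) ->
 prodf g (fun w => \prod_i h i (tnth w i)) = \prod_i \int[g i]_x h i x.
move=> bh; rewrite /prodf resamps_prod ?enum_uniq//.
by apply: eq_bigr => i _; rewrite mem_enum.
Qed.

Lemma bmeas_tnth (h : vec3 R -> R) i : bmeas h -> bmeas (fun w : E => h (tnth w i)).
by move=> bh; routine. Qed.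

Lemma tuple_boxes : @measurable _ E =
 <<s [set [set w : E | forall i, B i (tnth w i)] | B in [set B : 'I_N -> set (vec3 R) | forall i, measurable (B i)]] >>.
apply/seteqP; split.
 apply: smallest_sub; first exact: smallest_sigma_algebra. move=> A; rewrite -bigcup_seq => -[i /= _ [B mB <-]].
 apply: sub_sigma_algebra; exists (fun k => if k == i then B else setT).
  by move=> k /=; case: ifP.
 apply/seteqP; split => w /=.
  by move=> /(_ i); rewrite eqxx.
 by move=> [_ Bw] k; case: eqP => [->|].
apply: smallest_sub; first exact: sigma_algebra_measurable.
move=> _ [B mB <-].
rewrite (_ : [set w | _] = ~` \bigcup_(i in [set: 'I_N]) ~` ((fun w : E => tnth w i) @^-1` B i)); last first.
 rewrite setC_bigcup; apply/seteqP; split => w /= H i; first by rewrite setCK => _; exact: H.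
 by have := H i Logic.I; rewrite setCK.
apply: measurableC; apply: countable_bigcupT_measurable; first exact: countableP.
move=> i; apply: measurableC; rewrite -[X in measurable X]setTI.
exact: mtnth.
Qed.

Lemma prodf_unique (F : (E -> R) -> R) g : bfun F -> F (fun=> 1) = 1 ->
 (forall B : 'I_N -> set (vec3 R), (forall i, measurable (B i)) ->
   F (\1_[set w : E | forall i, B i (tnth w i)]) = \prod_i fine (g i (B i))) ->
 forall psi, bmeas psi -> F psi = prodf g psi.
move=> bF F1 FB; apply: (bfun_unique tuple_boxes _ bF (prodf_bfun g)).
- move=> _ _ [B mB <-] [B' mB' <-]; exists (fun i => B i `&` B' i).
  by move=> i; routine.
 apply/seteqP; split => w /= H; first by split=> i; have [] := H i. by move=> i; split; [exact: H.1|exact: H.2].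
- by rewrite prodf1.
move=> _ [B mB <-]; rewrite FB//.
rewrite (_ : \1_ _ = fun w : E => \prod_i \1_(B i) (tnth w i)).
 rewrite (prodf_prod g (h := fun i => \1_(B i))); last by move=> i; routine.
 by apply: eq_bigr => i _; rewrite prob_indic.
apply/funext => w; rewrite indicE.
have [/asboolP H|] := boolP `[< forall i, B i (tnth w i) >].
 by rewrite mem_set// big1// => i _; rewrite indicE mem_set.
move=> /asboolPn H; rewrite memNset//; move/existsNP: H => [i Bi].
by rewrite (bigD1 i)//= indicE memNset// mul0r.
Qed.

Lemma prodf_iid d (Omega : measurableType d) (P : probability Omega R) (f0 : prob)
 (V : Omega -> E) : mfun V -> iid P f0 (fun i w => tnth (V w) i) ->
 forall psi, bmeas psi -> \int[P]_w psi (V w) = prodf (fun=> f0) psi.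
move=> mV [law ind]; apply: prodf_unique.
- exact: (bfun_comp (bfun_prob P) mV).
- by rewrite prob_cst.
move=> B mB.
have mi i : measurable ((fun w => tnth (V w) i) @^-1` B i).
 rewrite -[X in measurable X]setTI. by apply: (mcomp (mtnth i) mV).
have := ind [set: 'I_N]%SET B mB.
rewrite (_ : \bigcap_(i in _) _ = V @^-1` [set w | forall i, B i (tnth w i)]); last first.
 by apply/seteqP; split => w /= H i; [apply: H => /=; rewrite inE|move=> _; exact: H].
move=> PE.
have -> : (fun w => \1_[set w : E | forall i, B i (tnth w i)] (V w)) =
  \1_(V @^-1` [set w | forall i, B i (tnth w i)]) :> (Omega -> R) by [].
rewrite prob_indic; last first.
 rewrite -[X in measurable X]setTI; apply: mV => //. by rewrite tuple_boxes; apply: sub_sigma_algebra; exists B.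
rewrite PE (eq_bigr (fun i => (fine (f0 (B i)))%:E)); last first.
 by move=> i _; rewrite fineK ?law//; exact: fin_num_measure.
by rewrite prodEFin/=; apply: eq_bigl => i; rewrite inE.
Qed.

End ProductFunctional.

(** * Integrals over compact intervals *)

Section Intervals.
Context {R : realType}.
Implicit Types (a b c : R) (f F : R -> R).
Definition iint a b f : R := \int[leb]_(x in `[a, b]) f x.

Lemma lebesgue_itvcc a b : leb (`[a, b]%classic : set R) = (Num.max 0 (b - a))%:E.
rewrite lebesgue_measure_itv/= lte_fin; case: ltP => h; last by rewrite max_l// subr_le0.
by rewrite -EFinB max_r// subr_ge0 ltW.
Qed.

Lemma integrable_itv_cst a b c : (@lebesgue_measure R).-integrable `[a, b] (EFin \o (fun=> c)).
apply/integrableP; split; first routine.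
rewrite (eq_integral (cst (`|c|%:E)%E)); last by [].
by rewrite integral_cst//= lebesgue_itvcc -EFinM ltry.
Qed.

Lemma bfun_itv (a b : R) (w : R -> R) :
 (@lebesgue_measure R).-integrable `[a, b] (EFin \o w) -> (forall x, a <= x <= b -> 0 <= w x) ->
 bfun (fun f : R -> R => iint a b (fun x => f x * w x)).
move=> iw w0; apply: (@bfun_Rintegral _ (measurableTypeR R) R (@lebesgue_measure R) `[a, b]%classic w) => //.
Qed.

Lemma iint_bfun a b : bfun (iint a b).
have -> : iint a b = fun f => iint a b (fun x => f x * 1).
 by apply/funext => f; apply: eq_Rintegral => x _; rewrite mulr1.
by apply: bfun_itv => //; exact: integrable_itv_cst.
Qed.

Lemma iint_cst a b c : a <= b -> iint a b (fun=> c) = (b - a) * c.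
move=> ab; rewrite /iint /Rintegral.
have -> : (\int[leb]_(x in `[a, b]) c%:E = c%:E * leb (`[a, b]%classic : set R))%E.
 exact: (@integral_cst _ (measurableTypeR R)).
by rewrite lebesgue_itvcc -EFinM/= max_r ?subr_ge0// mulrC.
Qed.

Lemma iint_ray a b c : iint a b (\1_(`[c, +oo[%classic)) = Num.max 0 (b - Num.max a c).
rewrite /iint /Rintegral.
have -> : (\int[leb]_(x in `[a, b]) (\1_(`[c, +oo[%classic) x)%:E =
  leb (`[c, +oo[%classic `&` `[a, b]%classic : set R))%E.
 by apply: (@integral_indic _ (measurableTypeR R)) => //; routine.
have -> : `[c, +oo[%classic `&` `[a, b]%classic = `[Num.max a c, b]%classic :> set R.
 apply/seteqP; split => x /=; rewrite !in_itv/= ?andbT ge_max.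
  lra.
 lra.
by rewrite lebesgue_itvcc.
Qed.

Lemma eq_iint a b f g : (forall x, a <= x <= b -> f x = g x) -> iint a b f = iint a b g.
by move=> fg; apply: eq_Rintegral => x; rewrite inE/= in_itv/= => /fg. Qed.

Lemma bfun_eq_ray (I J : (R -> R) -> R) : bfun I -> bfun J -> I (fun=> 1) = J (fun=> 1) ->
 (forall c, I (\1_(`[c, +oo[%classic)) = J (\1_(`[c, +oo[%classic))) -> forall f, bmeas f -> I f = J f.
move=> bI bJ E1 E; have H := @bfun_unique _ (measurableTypeR R) R I J ((@RGenCInfty.G R)).
refine (H _ _ bI bJ E1 _).
- exact: RGenCInfty.measurableE.
- move=> _ _ [x ->] [y ->]; exists (Num.max x y).
 by apply/seteqP; split => z /=; rewrite !in_itv/= !andbT ge_max => /andP.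
- by move=> _ [x ->].
Qed.

Lemma iint_FTC F f a b : a <= b -> (forall x, a <= x <= b -> is_derive x 1 F (f x)) ->
 {within `[a, b], continuous f} -> iint a b f = F b - F a.
rewrite le_eqVlt => /predU1P[<- _ _|ab dF cf].
 by rewrite subrr /iint set_itv1 Rintegral_set1.
have cF x : a <= x <= b -> {for x, continuous F}.
 move=> xab; apply: differentiable_continuous; rewrite -derivable1_diffP. by have [] := dF _ xab.
rewrite /iint /Rintegral (@continuous_FTC2 _ f F)//.
- split.
 + by move=> x; rewrite in_itv/= => /andP[ax xb]; have [|+ _] := dF x; rewrite ?(ltW ax) ?(ltW xb).
 + by apply: cvg_at_right_filter; apply: cF; rewrite lexx ltW.
 + by apply: cvg_at_left_filter; apply: cF; rewrite lexx ltW.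
- by move=> x; rewrite in_itv/= => /andP[ax xb]; have [|_ <-] := dF x; rewrite ?derive1E ?(ltW ax) ?(ltW xb).
Qed.

Lemma iint_powR (s t e : R) : 0 < s -> s <= t -> e + 1 != 0 ->
 iint s t (fun x => x `^ e) = (t `^ (e + 1) - s `^ (e + 1)) / (e + 1).
move=> s0 st e1.
have dF x : s <= x <= t -> is_derive x 1 (fun x => (e + 1)^-1 * x `^ (e + 1)) (x `^ e).
 move=> /andP[sx _]; have x0 := lt_le_trans s0 sx. have -> : x `^ e = (e + 1)^-1 *: ((e + 1) * x `^ (e + 1 - 1)).
  by rewrite addrK /GRing.scale/= mulrA mulVf// mul1r.
 have := is_derive1_powR (e + 1) x0 => dP. exact: (@is_deriveZ _ _ _ _ (e + 1)^-1 _ _ _ dP).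
rewrite (iint_FTC st dF); first by lra.
apply: continuous_in_subspaceT => x; rewrite inE/= in_itv/= => /andP[sx _].
apply: differentiable_continuous; rewrite -derivable1_diffP.
by have [] := is_derive1_powR e (lt_le_trans s0 sx).
Qed.

Lemma iint_powR_integrable (s t e : R) : 0 < s ->
 (@lebesgue_measure R).-integrable `[s, t] (EFin \o (fun x => x `^ e)).
move=> s0; apply: continuous_compact_integrable; first exact: segment_compact.
apply: continuous_in_subspaceT => x; rewrite inE/= in_itv/= => /andP[sx _].
apply: differentiable_continuous; rewrite -derivable1_diffP.
by have [] := is_derive1_powR e (lt_le_trans s0 sx).
Qed.

(** Two integrations: y - sin y has derivative 1 - cos y >= 0, and y^2/2 + cos y has derivative y -
    sin y. *)
Lemma one_minus_cos_le (x : R) : 1 - cos x <= x ^+ 2 / 2.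
wlog x0 : x / 0 <= x.
 move=> H; case: (leP 0 x) => [|/ltW x0]; first exact: H.
 by have := H (- x); rewrite cosN sqrrN; apply; rewrite oppr_ge0.
have dh (y : R) : is_derive y 1 (fun y : R => y ^+ 2 / 2 + cos y) (y - sin y).
 apply: is_derive_eq; rewrite /GRing.scale/= ?mulr1 ?mulr0 ?mul0r ?add0r ?addr0. lra.
have dg (y : R) : is_derive y 1 (fun y : R => y - sin y) (1 - cos y) by apply: is_derive_eq.
have mono (f f' : R -> R) (b : R) : 0 <= b -> (forall y : R, is_derive y 1 f (f' y)) ->
  (forall y, 0 <= y -> 0 <= f' y) -> f 0 <= f b.
 move=> b0 df f'0; apply: (@ger0_derive1_le_cc _ f 0 b) => //; rewrite ?in_itv/= ?lexx ?b0//.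
 - by move=> y; rewrite in_itv/= => /andP[y0 _]; rewrite derive1E; have [_ ->] := df y; exact/f'0/ltW.
 - apply: continuous_subspaceT => y; apply: differentiable_continuous. by rewrite -derivable1_diffP; have [] := df y.
have s_le (y : R) : 0 <= y -> 0 <= y - sin y.
 move=> y0; have := mono _ _ y y0 dg (fun z _ => _). by rewrite sin0 subrr; apply => z; routine.
have := mono _ _ x x0 dh s_le.
rewrite expr0n mul0r add0r cos0; lra.
Qed.

End Intervals.

Section PowerMonotone.
Context {R : realType}.
Implicit Types x y e : R.

Lemma powR_le_neg x y e : 0 < x -> x <= y -> e <= 0 -> y `^ e <= x `^ e.
move=> x0 xy e0; rewrite -[e]opprK powRN [leRHS]powRN lef_pV2 ?posrE ?powR_gt0 ?(lt_le_trans x0 xy)//.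
by apply: ge0_ler_powR; rewrite ?oppr_ge0// nnegrE ltW// (lt_le_trans x0 xy).
Qed.

Lemma powR_le_pos x y e : 0 <= x -> x <= y -> 0 <= e -> x `^ e <= y `^ e.
by move=> x0 xy e0; apply: ge0_ler_powR; rewrite ?nnegrE// (le_trans x0). Qed.

Lemma powRK x e : 0 <= x -> e != 0 -> (x `^ e) `^ (e^-1) = x.
by move=> x0 e0; rewrite -powRrM divff// powRr1. Qed.

End PowerMonotone.

Lemma iint_add (R : realType) (a b c : R) (f : R -> R) : a <= b -> b <= c ->
 (@lebesgue_measure R).-integrable `[a, c] (EFin \o f) -> iint a c f = iint a b f + iint b c f.
move=> ab bc fi; rewrite /iint.
have := @Rintegral_itvB R f (BLeft a) (BRight c) b fi.
rewrite !bnd_simp => /(_ ab bc).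
rewrite -(@Rintegral_itv_obnd_cbnd R b (BRight c) f); last first.
 by apply: integrableS fi => //; apply: subset_itvr; rewrite bnd_simp.
by move=> <-; rewrite addrC subrK.
Qed.

Lemma iint_lray (R : realType) (a b c : R) : iint a b (\1_(`]-oo, c]%classic)) = Num.max 0 (Num.min b c - a).
rewrite /iint /Rintegral.
have -> : (\int[leb]_(x in `[a, b]) (\1_(`]-oo, c]%classic) x)%:E =
  leb (`]-oo, c]%classic `&` `[a, b]%classic : set R))%E.
 by apply: (@integral_indic _ (measurableTypeR R)) => //; routine.
have -> : `]-oo, c]%classic `&` `[a, b]%classic = `[a, Num.min b c]%classic :> set R.
 apply/seteqP; split => x /=; rewrite !in_itv/= le_min.
  lra.
 lra.
by rewrite lebesgue_itvcc.
Qed.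

(** [angular_kernel] with its constants exposed, since every later constant is explicit in nu, c0
    and c1. *)
Definition kernel_bounds (R : realType) (nu c0 c1 : R) (beta : R -> R) : Prop :=
 [/\ 0 < nu < 1, 0 < c0 /\ 0 < c1, measurable_fun `]0, pi] beta /\ (forall x, 0 < x <= pi -> 0 <= beta x),
   forall x, 0 < x < pi / 2 -> c0 * x `^ (- 1 - nu) <= beta x <= c1 * x `^ (- 1 - nu) &
   forall x, pi / 2 <= x <= pi -> beta x = 0].

Lemma angular_kernel_bounds (R : realType) (nu : R) beta : 0 < nu < 1 -> angular_kernel nu beta ->
 exists c0 c1, kernel_bounds nu c0 c1 beta.
move=> hnu [mb b0 [c0 [c1 [/andP[c00 c01] bb]]] bz].
by exists c0, c1; split => //; split => //; exact: lt_trans c01.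
Qed.

(** * The angular kernel and the inverse of its tail integral *)

Section Kernel.
Context (R : realType) (nu c0 c1 : R) (beta : R -> R).
Hypothesis Hk : kernel_bounds nu c0 c1 beta.
Implicit Types (s t z a b K : R) (F : R -> R).
Notation H := (angularH beta).
Notation G := (angularG beta).
Let pi2_gt0 : 0 < pi / 2 :> R.
by rewrite divr_gt0// pi_gt0. Qed.

Let pi2_le : pi / 2 <= pi :> R.
by rewrite ler_pdivrMr// ler_peMr ?pi_ge0// ler1n. Qed.

Let nu0 : 0 < nu. Proof. by case: Hk => /andP[]. Qed.
Let nu1 : nu < 1. Proof. by case: Hk => /andP[]. Qed.
Let c00 : 0 < c0. Proof. by case: Hk => _ []. Qed.
Let c10 : 0 < c1. Proof. by case: Hk => _ []. Qed.

Lemma beta_ge0 x : 0 < x <= pi / 2 -> 0 <= beta x.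
by case: Hk => _ _ [_ b0] _ _ /andP[x0 xp]; apply: b0; rewrite x0 (le_trans xp).
Qed.

Lemma beta_le x : 0 < x <= pi / 2 -> beta x <= c1 * x `^ (- 1 - nu).
case: Hk => _ _ _ bb bz /andP[x0]; rewrite le_eqVlt => /predU1P[xE|xp].
 by rewrite bz ?xE ?lexx ?pi2_le// mulr_ge0 ?powR_ge0// ltW.
by have := bb x; rewrite x0 xp => /(_ isT)/andP[].
Qed.

Lemma beta_ge x : 0 < x < pi / 2 -> c0 * x `^ (- 1 - nu) <= beta x.
by case: Hk => _ _ _ bb _ /bb/andP[]. Qed.

Lemma mbeta s t : 0 < s -> t <= pi / 2 -> measurable_fun `[s, t] beta.
move=> s0 tp; case: Hk => _ _ [mb _] _ _.
apply: (measurable_funS _ _ mb) => // x /=; rewrite !in_itv/= => /andP[sx xt].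
lra.
Qed.

Lemma beta_integrable s t : 0 < s -> t <= pi / 2 -> (@lebesgue_measure R).-integrable `[s, t] (EFin \o beta).
move=> s0 tp.
apply: (@le_integrable _ (measurableTypeR R) _ _ _ _ _ (EFin \o (fun x => c1 * x `^ (- 1 - nu)))) => //.
- by apply/mEFinP; exact: mbeta.
- move=> x; rewrite /= in_itv/= => /andP[sx xt]; have x0 := lt_le_trans s0 sx. have xp := le_trans xt tp.
 rewrite lee_fin !ger0_norm ?beta_le ?beta_ge0 ?x0//. routine.
- rewrite (_ : EFin \o _ = (fun x => c1%:E * (EFin \o (fun x : R => (x `^ (-1 - nu))%R)) x)%E)//.
 by apply: integrableZl => //; exact: iint_powR_integrable.
Qed.

Lemma kint_bfun s t : 0 < s -> t <= pi / 2 -> bfun (fun F => iint s t (fun x => F x * beta x)).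
move=> s0 tp; apply: bfun_itv; first exact: beta_integrable.
move=> x /andP[sx xt]; apply: beta_ge0.
lra.
Qed.

Lemma kint_integrable s t F : 0 < s -> t <= pi / 2 -> bmeas F ->
 (@lebesgue_measure R).-integrable `[s, t] (EFin \o (fun x => F x * beta x)).
move=> s0 tp [mF [M FM]].
apply: (@le_integrable _ (measurableTypeR R) _ _ _ _ _ (EFin \o (fun x => `|M| * beta x))) => //.
- apply/mEFinP; apply: mfunM; last exact: mbeta. exact: measurable_funTS.
- move=> x _; rewrite /= lee_fin !normrM normr_id; apply: ler_wpM2r => //. by upto (FM x); exact: ler_norm.
- rewrite (_ : EFin \o _ = (fun x => `|M|%:E * (EFin \o beta) x)%E)//.
 by apply: integrableZl => //; exact: beta_integrable.
Qed.

Lemma kint_add s t u F : 0 < s -> s <= t -> t <= u -> u <= pi / 2 -> bmeas F ->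
 iint s u (fun x => F x * beta x) = iint s t (fun x => F x * beta x) + iint t u (fun x => F x * beta x).
by move=> s0 st tu up bF; apply: iint_add => //; exact: kint_integrable. Qed.

Lemma angularHB s t : 0 < s -> s <= t -> t <= pi / 2 -> H s = iint s t beta + H t.
by move=> s0 st tp; apply: iint_add => //; exact: beta_integrable. Qed.

Lemma iint_beta_ge s t : 0 < s -> s <= t -> t <= pi / 2 -> c0 * t `^ (- 1 - nu) * (t - s) <= iint s t beta.
move=> s0 st tp.
have bI := beta_integrable s0 tp.
have cI := @integrable_itv_cst R s t (c0 * t `^ (- 1 - nu)).
rewrite mulrC -(iint_cst _ st) /iint.
(* The right endpoint is removed: at [t = pi / 2] the kernel vanishes and the lower bound fails. *)
rewrite -(@Rintegral_itv_bndo_bndc R (BLeft s) t beta); last first.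
 by apply: integrableS bI => //; apply: subset_itvl; rewrite bnd_simp.
rewrite -(@Rintegral_itv_bndo_bndc R (BLeft s) t (fun=> _)); last first.
 by apply: integrableS cI => //; apply: subset_itvl; rewrite bnd_simp.
apply: (@le_Rintegral _ (measurableTypeR R)) => //.
- by apply: integrableS cI => //; apply: subset_itvl; rewrite bnd_simp.
- by apply: integrableS bI => //; apply: subset_itvl; rewrite bnd_simp.
move=> x; rewrite /= in_itv/= => /andP[sx xt]; have x0 := lt_le_trans s0 sx.
apply: le_trans (beta_ge _); last by lra.
apply: ler_wpM2l; first exact: ltW.
by apply: powR_le_neg => //; [exact: ltW | have := nu0; lra].
Qed.

Lemma kint_pow_le s t F (C : R) (m : nat) : 0 < s -> s <= t -> t <= pi / 2 -> 0 <= C -> bmeas F ->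
 (forall x, s <= x <= t -> F x <= C * x ^+ m) ->
 iint s t (fun x => F x * beta x) <= C * (c1 * ((t `^ (m%:R - nu) - s `^ (m%:R - nu)) / (m%:R - nu))).
move=> s0 st tp C0 bF FC.
have m0 : m%:R - nu != 0.
 apply/eqP => /eqP; rewrite subr_eq0 => /eqP mn; have := nu0; have := nu1; rewrite -mn.
 by rewrite ltrn1 ltr0n; case: m {FC mn}.
have pI := iint_powR_integrable t (m%:R - 1 - nu) s0.
have CI : (@lebesgue_measure R).-integrable `[s, t] (EFin \o (fun x => (C * c1) * x `^ (m%:R - 1 - nu))).
 rewrite (_ : EFin \o _ = (fun x => (C * c1)%:E * (EFin \o (fun x : R => (x `^ (m%:R - 1 - nu))%R)) x)%E)//.
 by apply: integrableZl.
via (iint s t (fun x => (C * c1) * x `^ (m%:R - 1 - nu))).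
 apply: (@le_Rintegral _ (measurableTypeR R)) => //; first exact: kint_integrable.
 move=> x; rewrite /= in_itv/= => /andP[sx xt]; have x0 := lt_le_trans s0 sx.
 have xp : 0 < x <= pi / 2 by rewrite x0 (le_trans xt). via (C * x ^+ m * beta x).
  by apply: ler_wpM2r; [exact: beta_ge0 | apply: FC; rewrite sx].
 rewrite -!mulrA; apply: ler_wpM2l => //. have -> : m%:R - 1 - nu = m%:R + (-1 - nu) :> R by ring.
 rewrite powRD; last by rewrite (gt_eqF x0) implybT.
 rewrite powR_mulrn ?(ltW x0)// mulrCA; apply: ler_wpM2l; first routine. exact: beta_le.
rewrite /iint RintegralZl// -/(iint s t _) iint_powR//; last by lra.
have -> : m%:R - 1 - nu + 1 = m%:R - nu by ring.
lra.
Qed.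

Lemma iint_beta_le s t : 0 < s -> s <= t -> t <= pi / 2 -> iint s t beta <= c1 / nu * s `^ (- nu).
move=> s0 st tp.
have -> : iint s t beta = iint s t (fun x => 1 * beta x) by apply: eq_Rintegral => x _; rewrite mul1r.
have := @kint_pow_le s t (fun=> 1) 1 0 s0 st tp ler01 (bmeas_cst _ 1).
have H0 : forall x, s <= x <= t -> 1 <= 1 * x ^+ 0 by move=> x _; rewrite expr0 mulr1.
move/(_ H0)/le_trans; apply; rewrite mul1r sub0r invrN mulrN -mulNr opprB -mulrA ler_pM2l//.
rewrite mulrC ler_pM2l ?invr_gt0//; have := powR_ge0 t (- nu); lra.
Qed.

Lemma angularH_le s : 0 < s -> s <= pi / 2 -> H s <= c1 / nu * s `^ (- nu).
by move=> s0 sp; exact: iint_beta_le. Qed.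

Lemma angularH_pi2 : H (pi / 2) = 0.
by rewrite /angularH set_itv1 Rintegral_set1. Qed.

Lemma angularH_lt s t : 0 < s -> s < t -> t <= pi / 2 -> H t < H s.
move=> s0 st tp; rewrite (angularHB s0 (ltW st) tp) ltrDr.
apply: lt_le_trans (iint_beta_ge s0 (ltW st) tp).
by rewrite mulr_gt0 ?subr_gt0// mulr_gt0// powR_gt0// (lt_trans s0).
Qed.

Lemma angularH_le_anti s t : 0 < s -> s <= t -> t <= pi / 2 -> H t <= H s.
by move=> s0; rewrite le_eqVlt => /predU1P[->//|st] tp; rewrite ltW// angularH_lt. Qed.

Lemma angularH_surj z : 0 <= z -> exists x, 0 < x <= pi / 2 /\ H x = z.
move=> z0.
have [s /andP[s0 sp] zs] : exists2 s, 0 < s <= pi / 2 & z <= H s.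
 (* The interval [s, 2s] alone contributes at least e s^(-nu), which reaches z as soon as s <= (e /
    (z + 1))^(1/nu). The other bound on s keeps 2s below pi/2. *)
 pose e := c0 * 2 `^ (- 1 - nu). have e0 : 0 < e by rewrite mulr_gt0// powR_gt0.
 pose s := Num.min (pi / 2 / 2) ((e / (z + 1)) `^ nu^-1). have z1 : 0 < z + 1 by lra.
 have s0 : 0 < s by rewrite lt_min divr_gt0//= powR_gt0// divr_gt0. have s2p : 2 * s <= pi / 2.
  have : s <= pi / 2 / 2 by rewrite ge_min lexx. lra.
 exists s; first by lra. have -> : H s = iint s (2 * s) beta + H (2 * s) by apply: angularHB => //; lra.
 via (iint s (2 * s) beta); last first.
  by rewrite lerDl -angularH_pi2; apply: angularH_le_anti => //; lra.
 apply: le_trans (iint_beta_ge s0 _ s2p); last lra.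
 have -> : c0 * (2 * s) `^ (-1 - nu) * (2 * s - s) = e * s `^ (- nu).
  rewrite powRM// ?(ltW s0)// /e; have -> : s `^ (- nu) = s * s `^ (-1 - nu).
   by rewrite -{2}[s]powRr1 ?(ltW s0)// -powRD ?(gt_eqF s0) ?implybT//; congr (_ `^ _); ring.
  ring.
 have sn : s `^ nu <= e / (z + 1).
  have -> : e / (z + 1) = ((e / (z + 1)) `^ nu^-1) `^ nu.
   by rewrite -powRrM mulVf ?gt_eqF// powRr1// divr_ge0// ltW.
  by apply: powR_le_pos; [exact: ltW | rewrite ge_min lexx orbT | exact: ltW].
 rewrite powRN ler_pdivlMr ?powR_gt0//. via (z * (e / (z + 1))); first exact: ler_wpM2l.
 by rewrite mulrA ler_pdivrMr// mulrC ler_pM2l//; lra.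
have cH : {within `[s, pi / 2], continuous H}.
 have bI := beta_integrable s0 (lexx _). have cP := parameterized_integral_continuous sp bI.
 have : {within `[s, pi / 2], continuous (fun x => H s - iint s x beta)}.
  move=> x; apply: cvgB; first exact: cvg_cst. exact: cP.
 apply: subspace_eq_continuous => x; rewrite inE/= in_itv/= => /andP[sx xp].
 by rewrite /from_subspace (angularHB s0 sx xp) addrAC subrr add0r.
have [|c] := @IVT R H s (pi / 2) z sp cH.
 by rewrite angularH_pi2 ge_min z0 orbT le_max zs.
rewrite in_itv/= => /andP[sc cp] Hc; exists c; split=> //.
by rewrite (lt_le_trans s0 sc).
Qed.

Lemma angularGP z : 0 <= z -> 0 < G z <= pi / 2 /\ H (G z) = z.
move=> /angularH_surj[x xP].
by have := @getPex _ [set x | 0 < x <= pi / 2 /\ H x = z] (ex_intro _ x xP).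
Qed.

Lemma angularG_gt0 z : 0 <= z -> 0 < G z. Proof. by move=> /angularGP[/andP[]]. Qed.
Lemma angularG_le z : 0 <= z -> G z <= pi / 2. Proof. by move=> /angularGP[/andP[]]. Qed.

Lemma angularH_ge0 x : 0 < x <= pi / 2 -> 0 <= H x.
by move=> /andP[x0 xp]; rewrite -angularH_pi2; exact: angularH_le_anti. Qed.

Lemma le_angularG z c : 0 <= z -> 0 < c <= pi / 2 -> (c <= G z) = (z <= H c).
move=> z0 /andP[cgt0 cp]; have [/andP[g0 gp] Hg] := angularGP z0.
apply/idP/idP => [cg|]; first by rewrite -Hg; exact: angularH_le_anti.
by apply: contraTT; rewrite -!ltNge => gc; rewrite -[X in _ < X]Hg; exact: angularH_lt.
Qed.

Lemma angularG_anti y z : 0 <= y -> y <= z -> G z <= G y.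
move=> y0 yz; have z0 := le_trans y0 yz; have [gz Hz] := angularGP z0.
by rewrite le_angularG// Hz.
Qed.

Lemma angularG_pow_le z : 0 < z -> G z <= (c1 / nu / z) `^ nu^-1.
move=> z0; have [/andP[g0 gp] Hg] := angularGP (ltW z0).
have := angularH_le g0 gp; rewrite Hg powRN ler_pdivlMr ?powR_gt0// => zg.
have -> : G z = (G z `^ nu) `^ nu^-1 by rewrite powRK ?(ltW g0)// gt_eqF.
apply: powR_le_pos; [exact: powR_ge0 | | routine].
by rewrite ler_pdivlMr// mulrC.
Qed.

(** Extended to negative [z] by its value at 0, so that it is measurable on the whole line. *)
Definition angle z := G (Num.max z 0).

Lemma angle_ge0 z : 0 <= angle z.
by apply/ltW/angularG_gt0; rewrite le_max lexx orbT. Qed.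

Lemma angle_le z : angle z <= pi / 2.
by apply: angularG_le; rewrite le_max lexx orbT. Qed.

Lemma angleE z : 0 <= z -> angle z = G z.
by move=> z0; rewrite /angle max_l. Qed.

Lemma angle_anti y z : 0 <= y -> y <= z -> angle z <= angle y.
by move=> y0 yz; rewrite !angleE// ?(le_trans y0)//; exact: angularG_anti. Qed.

Lemma le_angle z c : 0 < c <= pi / 2 -> (c <= angle z) = (z <= H c).
by move=> cp; rewrite le_angularG// ?le_max ?lexx ?orbT// ge_max (angularH_ge0 cp) andbT.
Qed.

Lemma mangle : mfun angle.
apply: (@measurability _ _ R R setT angle (@RGenCInfty.G R) (@RGenCInfty.measurableE R)).
move=> _ [_ [c ->] <-]; rewrite setTI.
have [c00'|cgt] := leP c 0.
 rewrite (_ : _ @^-1` _ = setT)//; apply/seteqP; split => x //= _.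
 by rewrite in_itv/= andbT (le_trans c00')// angle_ge0.
have [cp|pc] := leP c (pi / 2).
 rewrite (_ : _ @^-1` _ = `]-oo, H c]%classic) ?measurable_itv//.
 by apply/seteqP; split => x /=; rewrite !in_itv/= andbT le_angle// cgt.
rewrite (_ : _ @^-1` _ = set0)//; apply/seteqP; split => x //=.
by rewrite in_itv/= andbT => /(lt_le_trans pc); rewrite ltNge angle_le.
Qed.

(** Substitution z = a H(x): the map z -> angle(z / a) pushes Lebesgue measure on [0, K] to a
    beta(x) dx on [G(K/a), pi/2]. The two functionals are compared on half-lines [c, +oo[; for 0 < c
    <= pi/2 both give min(K, a H(c)). *)
Lemma iint_angle a K F : 0 < a -> 0 <= K -> bmeas F ->
 iint 0 K (fun z => F (angle (z / a))) = a * iint (G (K / a)) (pi / 2) (fun x => F x * beta x).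
move=> a0 K0; have Ka : 0 <= K / a by routine.
have [/andP[g0 gp] Hg] := angularGP Ka.
have ma : mfun (fun z : R => angle (z / a)).
 apply: (mcomp mangle); routine.
move: F; apply: bfun_eq_ray.
- exact: (bfun_comp (iint_bfun 0 K) ma).
- have bk := kint_bfun g0 (lexx (pi / 2)); split.
 + by move=> f g bf bg; rewrite (bfunD bk)// mulrDr.
 + by move=> b f bf; rewrite (bfunZ bk)// mulrCA.
 + by move=> f bf f0; rewrite mulr_ge0 ?(ltW a0)//; exact: (bfun_ge0 bk).
 + by move=> F f M mF FM Ff; apply: cvgM; [exact: cvg_cst | exact: (bfun_cvg bk mF FM Ff)].
- rewrite iint_cst// subr0 mulr1. have -> : iint (G (K / a)) (pi / 2) (fun x => 1 * beta x) = H (G (K / a)).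
  by apply: eq_Rintegral => x _; rewrite mul1r.
 by rewrite Hg mulrCA divff ?gt_eqF// mulr1.
move=> c; set g := G (K / a) in g0 gp Hg *.
have R1 : a * iint g (pi / 2) (fun x => \1_(`[c, +oo[%classic) x * beta x) =
  if c <= pi / 2 then a * H (Num.max g c) else 0.
 have mI (i : interval R) x : (x \in ([set` i] : set R)) = (x \in i) by rewrite mem_setE.
 case: ifPn => [cp|]; last rewrite -ltNge => pc.
  congr (_ * _); rewrite /iint /angularH.
  rewrite [RHS]Rintegral_mkcond [LHS]Rintegral_mkcond; apply: eq_Rintegral => x _.
  rewrite /patch !mI !in_itv/= ge_max indicE mI in_itv/= andbT.
  by case: (leP g x); case: (leP c x) => //=; case: (leP x (pi / 2)); rewrite ?mul1r ?mul0r.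
 apply/eqP; rewrite mulf_eq0; apply/orP; right; apply/eqP.
 rewrite -[RHS](mulr0 (pi / 2 - g)) -(iint_cst _ gp); apply: eq_iint => x /andP[_ xp]; rewrite indicE mI in_itv/= andbT.
 by rewrite leNgt (le_lt_trans xp pc) mul0r.
rewrite R1.
have [cle0|c0'] := leP c 0.
 rewrite (_ : iint 0 K _ = iint 0 K (fun=> 1)); last first.
  apply: eq_iint => z _; rewrite indicE mem_set//= in_itv/= andbT. by rewrite (le_trans cle0)// angle_ge0.
 rewrite iint_cst// subr0 mulr1 (le_trans cle0 (ltW pi2_gt0)) max_l; last by lra.
 by rewrite Hg mulrCA divff ?gt_eqF// mulr1.
case: ifPn => [cp|]; last rewrite -ltNge => pc; last first.
 rewrite -[RHS](mulr0 (K - 0)) -(iint_cst _ K0).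
 apply: eq_iint => z _; rewrite indicE memNset//= in_itv/= andbT => /(lt_le_trans pc). by rewrite ltNge angle_le.
have ccp : 0 < c <= pi / 2 by lra.
have Hc0 := angularH_ge0 ccp.
have -> : iint 0 K (fun z => \1_(`[c, +oo[%classic) (angle (z / a))) = Num.min K (a * H c).
 rewrite (_ : iint 0 K _ = iint 0 K (\1_(`]-oo, a * H c]%classic))); last first.
  apply: eq_iint => z _; congr (_%:R); rewrite !mem_setE !in_itv/= andbT le_angle//. by rewrite ler_pdivrMr// mulrC.
 by rewrite iint_lray subr0 max_r// le_min K0 mulr_ge0// ltW.
have [cg|gc] := leP c g.
 rewrite Hg mulrCA divff ?gt_eqF// mulr1 min_l// mulrC -ler_pdivrMr// -Hg. exact: angularH_le_anti.
rewrite min_r// mulrC -ler_pdivlMr// -Hg; apply: angularH_le_anti => //; exact: ltW.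
Qed.

Definition theta_cst : R := c1 * ((pi / 2) `^ (1 - nu) / (1 - nu)).

Lemma theta_cst_gt0 : 0 < theta_cst.
by rewrite mulr_gt0// divr_gt0 ?powR_gt0 ?subr_gt0. Qed.

Lemma kint_theta_le s t F (C : R) : 0 < s -> s <= t -> t <= pi / 2 -> 0 <= C -> bmeas F ->
 (forall x, s <= x <= t -> F x <= C * x) -> iint s t (fun x => F x * beta x) <= C * (c1 / (1 - nu) * t `^ (1 - nu)).
move=> s0 st tp C0 bF FC.
upto (@kint_pow_le s t F C 1 s0 st tp C0 bF _).
 by [].
apply: ler_wpM2l => //; rewrite -mulrA; apply: ler_wpM2l; first exact: ltW.
rewrite mulrC; apply: ler_wpM2l; first by rewrite invr_ge0 subr_ge0 ltW.
by have := powR_ge0 s (1 - nu); lra.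
Qed.

Lemma kint_theta_cst s F (C : R) : 0 < s -> s <= pi / 2 -> 0 <= C -> bmeas F ->
 (forall x, s <= x <= pi / 2 -> F x <= C * x) -> iint s (pi / 2) (fun x => F x * beta x) <= C * theta_cst.
move=> s0 sp C0 bF FC; apply: le_trans (kint_theta_le s0 sp (lexx _) C0 bF FC) _.
by rewrite /theta_cst -mulrA [_^-1 * _]mulrC.
Qed.

Lemma kint_theta2_le s t F (C : R) : 0 < s -> s <= t -> t <= pi / 2 -> 0 <= C -> bmeas F ->
 (forall x, s <= x <= t -> F x <= C * x ^+ 2) -> iint s t (fun x => F x * beta x) <= C * (c1 * t `^ (2 - nu)).
move=> s0 st tp C0 bF FC.
upto (@kint_pow_le s t F C 2 s0 st tp C0 bF FC).
apply: ler_wpM2l => //; apply: ler_wpM2l; first exact: ltW.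
have n2 : 1 <= 2 - nu by have := nu1; lra.
rewrite ler_pdivrMr; last lra.
via (t `^ (2 - nu)); first by have := powR_ge0 s (2 - nu); lra.
by rewrite ler_peMr// powR_ge0.
Qed.

Lemma bmeas_1cos (d : measure_display) (T : measurableType d) (f : T -> R) :
 mfun f -> bmeas (fun t : T => 1 - cos (f t)).
move=> mf; apply: bmeasB; first routine.
split; last by exists 1 => t; rewrite cos_max.
apply: mcomp => //; apply: continuous_measurable_fun; exact: continuous_cos.
Qed.

Lemma mangle_div a : mfun (fun z : R => angle (z / a)).
by apply: (mcomp mangle); routine. Qed.

Lemma one_cos_theta (x : R) : 0 <= x <= pi / 2 -> 1 - cos x <= x.
move=> /andP[x0 xp]; apply: le_trans (one_minus_cos_le x) _.
have p4 : (pi : R) <= 4 by have /andP[_] := @pihalf_02 R; lra.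
nra.
Qed.

(* The total momentum lost by the angular jumps [angle (z / a)], [z <= K]. *)
Definition loss K a : R := iint 0 K (fun z => 1 - cos (angle (z / a))).

(** The price of reading the angles of two particles with rates [a] and [b] from the same [z]. *)
Definition spread K a b : R := iint 0 K (fun z => 1 - cos (angle (z / a) - angle (z / b))).

Lemma lossE K a : 0 <= K -> 0 < a -> loss K a = a * iint (G (K / a)) (pi / 2) (fun x => (1 - cos x) * beta x).
by move=> K0 a0; rewrite /loss (iint_angle a0 K0 (bmeas_1cos (@measurable_id _ R setT))). Qed.

Lemma loss_ge0 K a : 0 <= loss K a.
apply: (bfun_ge0 (iint_bfun 0 K)); first exact: bmeas_1cos (mangle_div a).
by [].
Qed.

Lemma loss_le K a : 0 <= K -> 0 < a -> loss K a <= theta_cst * a.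
move=> K0 a0; rewrite lossE// mulrC ler_pM2r// -[leRHS]mul1r.
have Ka : 0 <= K / a by routine.
have [/andP[g0 gp] _] := angularGP Ka.
apply: kint_theta_cst => //; first exact: bmeas_1cos.
move=> x /andP[gx xp]; rewrite mul1r; apply: one_cos_theta.
lra.
Qed.

(** Below: for each z the angle increases with the rate. Above: the rate [b] also produces the
    angles in [G(K/b), G(K/a)], whose contribution to the difference is negative and is dropped. *)
Lemma loss_mono K a b : 0 <= K -> 0 < b -> b <= a -> 0 <= loss K a - loss K b <= theta_cst * (a - b).
move=> K0 b0 ba; have a0 := lt_le_trans b0 ba.
have [/andP[ga0 gap] _] := angularGP (divr_ge0 K0 (ltW a0)).
have [/andP[gb0 gbp] _] := angularGP (divr_ge0 K0 (ltW b0)).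
have gab : G (K / b) <= G (K / a).
 apply: angularG_anti; first routine. by apply: ler_wpM2l => //; rewrite lef_pV2.
have bc := bmeas_1cos (@measurable_id _ R setT).
have J0 s t : 0 < s -> t <= pi / 2 -> 0 <= iint s t (fun x => (1 - cos x) * beta x).
 by move=> s0 tp; apply: (bfun_ge0 (kint_bfun s0 tp)) => // x; routine.
apply/andP; split.
 rewrite subr_ge0 !lossE//. have : loss K b <= loss K a; last by rewrite !lossE.
 have le_cos (x y : R) : 0 <= x -> x <= y -> y <= pi -> 1 - cos x <= 1 - cos y.
  move=> x0 xy yp; rewrite lerB// leNgt ltr_cos ?in_itv/= ?x0 ?yp ?(le_trans xy) ?(le_trans x0)//. lra.
 have E1 e : loss K e = iint 0 K (fun z => 1 - cos (angle (Num.max z 0 / e))).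
  by apply: eq_iint => z /andP[z0 _]; rewrite max_l.
 have me e : mfun (fun z : R => angle (Num.max z 0 / e)).
  apply: (mcomp (mangle_div e)). routine.
 rewrite !E1; apply: (bfun_le (iint_bfun 0 K)); try exact: bmeas_1cos (me _).
 move=> z; apply: le_cos; first exact: angle_ge0.
  have m0 : 0 <= Num.max z 0 by rewrite le_max lexx orbT. apply: angle_anti; first routine.
  by apply: ler_wpM2l => //; rewrite lef_pV2.
 by apply: le_trans (angle_le _) _; exact: pi2_le.
rewrite !lossE//.
rewrite (kint_add gb0 gab gap (lexx _) bc) mulrDr.
have := J0 _ _ gb0 gap; set J1 := iint (G (K / b)) _ _ => J10.
have : iint (G (K / a)) (pi / 2) (fun x => (1 - cos x) * beta x) <= 1 * theta_cst.
 apply: kint_theta_cst => // x /andP[gx xp]; rewrite mul1r; apply: one_cos_theta. lra.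
nra.
Qed.

Definition spread_cst : R := 2^-1 * (c1 * (pi / 2) `^ (2 - nu)).
Definition ratio_cst : R := c1 / (c0 * nu).

Lemma spread_cst_gt0 : 0 < spread_cst.
by rewrite mulr_gt0 ?invr_gt0// mulr_gt0// powR_gt0. Qed.

Lemma ratio_cst_gt0 : 0 < ratio_cst.
by rewrite divr_gt0// mulr_gt0. Qed.

Lemma spreadC K a b : spread K a b = spread K b a.
by apply: eq_iint => z _; rewrite -cosN opprB. Qed.

Lemma mangle_sub a b : mfun (fun z : R => angle (z / a) - angle (z / b)).
by apply: mfunB; exact: mangle_div. Qed.

Lemma spread_ge0 K a b : 0 <= spread K a b.
apply: (bfun_ge0 (iint_bfun 0 K)); first exact: bmeas_1cos (mangle_sub a b).
by [].
Qed.

Lemma spread_le K a b r : 0 <= K -> 0 < a -> 0 <= r ->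
 (forall z, 0 <= z <= K -> 0 <= angle (z / a) - angle (z / b) <= r * angle (z / a)) ->
 spread K a b <= r ^+ 2 * spread_cst * a.
move=> K0 a0 r0 H.
have [/andP[g0 gp] _] := angularGP (divr_ge0 K0 (ltW a0)).
pose F (x : R) := Num.min (r ^+ 2 / 2 * x ^+ 2) (r ^+ 2 / 2 * (pi / 2) ^+ 2).
have r2 : 0 <= r ^+ 2 / 2 by routine.
have bF : bmeas F.
 apply: bmeas_min; [|by move=> x; rewrite mulr_ge0// sqr_ge0|by rewrite mulr_ge0// sqr_ge0]. routine.
have bFa : bmeas (fun z => F (angle (z / a))) by apply: (bmeas_comp bF); exact: mangle_div.
(* Clamping [z] to [0, K] leaves the integrals unchanged and lets the hypothesis, known only on
   [0, K], be used as a pointwise bound on the line. *)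
have E1 : spread K a b = iint 0 K (fun z => 1 - cos (angle (Num.min (Num.max z 0) K / a) - angle (Num.min (Num.max z 0) K / b))).
 by apply: eq_iint => z /andP[z0 zK]; rewrite max_l// min_l.
have E2 : iint 0 K (fun z => F (angle (z / a))) = iint 0 K (fun z => F (angle (Num.min (Num.max z 0) K / a))).
 by apply: eq_iint => z /andP[z0 zK]; rewrite max_l// min_l.
have mm : mfun (fun z : R => Num.min (Num.max z 0) K).
 by apply: measurable_minr; [apply: measurable_maxr|].
have : spread K a b <= iint 0 K (fun z => F (angle (z / a))).
 rewrite E1 E2; apply: (bfun_le (iint_bfun 0 K)).
 - exact: bmeas_1cos (mcomp (mangle_sub a b) mm).
 - exact: bmeas_comp bFa mm.
 move=> z; set y := Num.min _ K; have yK : 0 <= y <= K.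
  by rewrite le_min K0 le_max lexx orbT ge_min lexx orbT.
 have /andP[h1 h2] := H _ yK; have /andP[a1 a2] : 0 <= angle (y / a) <= pi / 2.
  by rewrite angle_ge0 angle_le.
 upto (one_minus_cos_le _); rewrite /F le_min; apply/andP.
 have h3 : (angle (y / a) - angle (y / b)) ^+ 2 <= r ^+ 2 * angle (y / a) ^+ 2.
  by rewrite -exprMn ler_sqr// ?nnegrE// mulr_ge0.
 have h4 : r ^+ 2 * angle (y / a) ^+ 2 <= r ^+ 2 * (pi / 2) ^+ 2.
  by apply: ler_wpM2l; [routine| rewrite ler_sqr ?nnegrE// ltW].
 split; lra.
move/le_trans; apply; rewrite (iint_angle a0 K0 bF) mulrC; apply: ler_wpM2r; first exact: ltW.
have -> : r ^+ 2 * spread_cst = r ^+ 2 / 2 * (c1 * (pi / 2) `^ (2 - nu)) by rewrite /spread_cst mulrA.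
by apply: kint_theta2_le => // x _; rewrite ge_min lexx.
Qed.

Lemma angle_sub_ge0 a b z : 0 < b -> b <= a -> 0 <= z -> 0 <= angle (z / a) - angle (z / b).
move=> b0 ba z0; rewrite subr_ge0; apply: angle_anti; first by rewrite divr_ge0// (le_trans (ltW b0)).
by apply: ler_wpM2l => //; rewrite lef_pV2// posrE// (lt_le_trans b0).
Qed.

Lemma spread_le1 K a b : 0 <= K -> 0 < b -> b <= a -> spread K a b <= spread_cst * a.
move=> K0 b0 ba; have a0 := lt_le_trans b0 ba.
have := @spread_le K a b 1 K0 a0 ler01; rewrite expr1n mul1r; apply.
move=> z /andP[z0 _]; rewrite angle_sub_ge0//= mul1r; have := angle_ge0 (z / b); lra.
Qed.

(** With x and y the angles at rates a and b, H(y) - H(x) = (a/b - 1) H(x). The left side is at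
    least c0 x^(-1-nu) (x - y) and H(x) <= (c1/nu) x^(-nu), so x - y is at most [ratio_cst] (a/b -
    1) x. *)
Lemma spread_le2 K a b : 0 <= K -> 0 < b -> b <= a -> spread K a b <= (ratio_cst * (a / b - 1)) ^+ 2 * spread_cst * a.
move=> K0 b0 ba; have a0 := lt_le_trans b0 ba.
have ab1 : 0 <= a / b - 1 by rewrite subr_ge0 ler_pdivlMr// mul1r.
apply: spread_le => //; first routine.
move=> z /andP[z0 _]; rewrite angle_sub_ge0//=.
have za : 0 <= z / a by routine.
have zb : 0 <= z / b by routine.
have := angle_sub_ge0 b0 ba z0; rewrite !angleE//.
have [/andP[x0 xp] Hx] := angularGP za; have [/andP[y0 yp] Hy] := angularGP zb.
move: (G (z / a)) (G (z / b)) x0 xp Hx y0 yp Hy => x y x0 xp Hx y0 yp Hy; rewrite subr_ge0 => yx.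
have h1 := iint_beta_ge y0 yx xp; have h2 := angularHB y0 yx xp.
have h3 := angularH_le x0 xp.
have h4 : c0 * x `^ (-1 - nu) * (x - y) <= (a / b - 1) * (c1 / nu * x `^ (- nu)).
 via ((a / b - 1) * (z / a)); last by apply: ler_wpM2l => //; rewrite -Hx.
 have -> : (a / b - 1) * (z / a) = z / b - z / a by field; rewrite !gt_eqF. by rewrite -Hx -Hy; lra.
have xe : x `^ (- nu) = x * x `^ (-1 - nu).
 by rewrite -{2}[x]powRr1 ?(ltW x0)// -powRD ?(gt_eqF x0) ?implybT//; congr (_ `^ _); ring.
have P0 : 0 < c0 * x `^ (-1 - nu) by rewrite mulr_gt0// powR_gt0.
rewrite -(ler_pM2l P0); apply: (le_trans h4); rewrite xe /ratio_cst; apply: eq_ler.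
by field; rewrite !gt_eqF.
Qed.

Definition tail_cst : R := 2^-1 * (c1 * (c1 / nu) `^ (2 / nu - 1)).

Lemma tail_cst_gt0 : 0 < tail_cst.
by rewrite mulr_gt0 ?invr_gt0// mulr_gt0// powR_gt0// divr_gt0. Qed.

Lemma iint_1cos_add K L a : 0 <= K -> K <= L -> loss L a = loss K a + iint K L (fun z => 1 - cos (angle (z / a))).
move=> K0 KL; apply: iint_add => //.
have [mf [M fM]] := bmeas_1cos (mangle_div a).
apply: (@le_integrable _ (measurableTypeR R) _ _ _ _ _ (EFin \o (fun=> `|M|))) => //.
- by apply/mEFinP; exact: measurable_funTS.
- by move=> x _; rewrite /= lee_fin normr_id; upto (fM x); exact: ler_norm.
- exact: integrable_itv_cst.
Qed.

Lemma tail_ge0 K L a : 0 <= iint K L (fun z => 1 - cos (angle (z / a))).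
apply: (bfun_ge0 (iint_bfun K L)); first exact: bmeas_1cos (mangle_div a).
by [].
Qed.

Lemma tail_le_loss K L a : 0 <= K -> K <= L -> 0 < a -> iint K L (fun z => 1 - cos (angle (z / a))) <= theta_cst * a.
move=> K0 KL a0; have := loss_le (le_trans K0 KL) a0.
by rewrite (iint_1cos_add a K0 KL); have := loss_ge0 K a; lra.
Qed.

(** For z >= K the angles are below G(K/a), of order at most (a/K)^(1/nu), and the integral of
    theta^2 beta up to there is of order G(K/a)^(2-nu). This is the origin of K^(1-2/nu). *)
Lemma tail_le K L a : 0 < K -> K <= L -> 0 < a ->
 iint K L (fun z => 1 - cos (angle (z / a))) <= tail_cst * a * (a / K) `^ (2 / nu - 1).
move=> K0 KL a0; have L0 := lt_le_trans K0 KL.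
have [/andP[gK gKp] _] := angularGP (divr_ge0 (ltW K0) (ltW a0)).
have [/andP[gL gLp] _] := angularGP (divr_ge0 (ltW L0) (ltW a0)).
have gLK : G (L / a) <= G (K / a).
 by apply: angularG_anti; [routine| rewrite ler_pM2r// invr_gt0].
have bc := bmeas_1cos (@measurable_id _ R setT).
have -> : iint K L (fun z => 1 - cos (angle (z / a))) =
  a * iint (G (L / a)) (G (K / a)) (fun x => (1 - cos x) * beta x).
 have := iint_1cos_add a (ltW K0) KL; rewrite !lossE ?(ltW K0) ?(ltW L0)//.
 by rewrite (kint_add gL gLK gKp (lexx _) bc) mulrDr; lra.
via (a * (2^-1 * (c1 * G (K / a) `^ (2 - nu)))).
 apply: ler_wpM2l; first exact: ltW. apply: kint_theta2_le => // x _. by rewrite mulrC; exact: one_minus_cos_le.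
have h := angularG_pow_le (divr_gt0 K0 a0).
have h2 : G (K / a) `^ (2 - nu) <= (c1 / nu) `^ (2 / nu - 1) * (a / K) `^ (2 / nu - 1).
 via (((c1 / nu / (K / a)) `^ nu^-1) `^ (2 - nu)).
  by apply: powR_le_pos => //; [exact: ltW | have := nu1; lra].
 rewrite -powRrM invf_div (_ : nu^-1 * (2 - nu) = 2 / nu - 1); last by field; rewrite gt_eqF.
 by rewrite powRM// divr_ge0// ltW.
have c12 : 0 <= a * 2^-1 * c1 by routine.
have := ler_wpM2l c12 h2; rewrite /tail_cst; lra.
Qed.

Lemma angle_rate_le L a : 0 < L -> 0 < a -> G (L / a) `^ (1 - nu) <=
 (c1 / nu) `^ (nu^-1 - 1) * (a / L) `^ (nu^-1 - 1).
move=> L0 a0; have h := angularG_pow_le (divr_gt0 L0 a0).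
via (((c1 / nu / (L / a)) `^ nu^-1) `^ (1 - nu)).
 apply: powR_le_pos => //; last by rewrite subr_ge0 ltW. by apply/ltW/angularG_gt0; routine.
rewrite -powRrM invf_div (_ : nu^-1 * (1 - nu) = nu^-1 - 1); last by field; rewrite gt_eqF.
by rewrite powRM// divr_ge0// ltW.
Qed.

End Kernel.

Lemma itv_integrable (R : realType) (a b : R) (f : R -> R) : bmeas f ->
 (@lebesgue_measure R).-integrable `[a, b] (EFin \o f).
move=> [mf [M fM]].
apply: (@le_integrable _ (measurableTypeR R) _ _ _ _ _ (EFin \o (fun=> `|M|))) => //.
- by apply/mEFinP; exact: measurable_funTS.
- by move=> x _; rewrite /= lee_fin normr_id; upto (fM x); exact: ler_norm.
- exact: integrable_itv_cst.
Qed.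

(** * Translations and periodic integrals *)

Section Shift.
Context {R : realType}.
Implicit Types (a b s : R) (f : R -> R).

Lemma iint_shift a b s f : bmeas f -> iint a b (fun x => f (x + s)) = iint (a + s) (b + s) f.
have ms : mfun (fun x : R => x + s) by routine.
move: f; apply: (bfun_eq_ray (bfun_comp (iint_bfun a b) ms) (iint_bfun _ _)).
 have [ab|ba] := leP a b; first by rewrite !iint_cst ?lerD2r//; ring.
 have z c d : d < c -> iint c d (fun=> 1 : R) = 0.
  by move=> dc; rewrite /iint set_itv_ge ?Rintegral_set0// bnd_simp -ltNge.
 by rewrite !z ?ltrD2r.
move=> c; rewrite (_ : (fun x => _) = \1_(`[c - s, +oo[%classic)); last first.
 by apply/funext => x; congr (_%:R); rewrite !mem_setE !in_itv/= !andbT lerBlDr.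
rewrite !iint_ray.
have -> : Num.max (a + s) c = Num.max a (c - s) + s by rewrite addr_maxl subrK.
by rewrite opprD addrACA subrr addr0.
Qed.

Lemma iint_periodic s f : bmeas f -> (forall x, f (x + 2 * pi) = f x) -> 0 <= s <= 2 * pi ->
 iint 0 (2 * pi) (fun x => f (x + s)) = iint 0 (2 * pi) f.
move=> bf pf /andP[s0 sp]; rewrite iint_shift// add0r.
rewrite (@iint_add _ s (2 * pi) (2 * pi + s)) ?lerDl//; last exact: itv_integrable.
rewrite [RHS](@iint_add _ 0 s)//; last exact: itv_integrable.
rewrite addrC; congr (_ + _).
have := @iint_shift 0 s (2 * pi) f bf; rewrite add0r addrC => <-.
by apply: eq_iint => x _; rewrite pf.
Qed.

Lemma cos_2pi (x : R) : cos (x + 2 * pi) = cos x.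
by rewrite mulr_natl cosD2pi. Qed.

Lemma sin_2pi (x : R) : sin (x + 2 * pi) = sin x.
by rewrite mulr_natl sinD2pi. Qed.

Lemma iint_cos : iint 0 (2 * pi) (@cos R) = 0.
rewrite (iint_FTC (F := sin)) ?mulr_ge0 ?pi_ge0//.
- by rewrite -[2 * pi]add0r sin_2pi subrr.
- by apply: continuous_subspaceT; exact: continuous_cos.
Qed.

Lemma iint_sin : iint 0 (2 * pi) (@sin R) = 0.
have p0 : 0 <= 2 * pi :> R by rewrite mulr_ge0 ?pi_ge0.
have dF (x : R) : 0 <= x <= 2 * pi -> is_derive x 1 (fun x : R => - cos x) (sin x).
 by move=> _; apply: is_derive_eq; rewrite opprK.
rewrite (iint_FTC p0 dF).
 by rewrite -[2 * pi]add0r cos_2pi subrr.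
by apply: continuous_subspaceT; exact: continuous_sin.
Qed.

Lemma exists_angle (c s : R) : c ^+ 2 + s ^+ 2 = 1 -> exists2 al, 0 <= al <= 2 * pi & cos al = c /\ sin al = s.
move=> cs; have c1 : -1 <= c <= 1.
 nra.
have sE : sin (acos c) = `|s|.
 by rewrite sin_acos// -sqrtr_sqr; congr Num.sqrt; lra.
have pi0 := pi_ge0 R; have a0 := acos_ge0 c1; have ap := acos_lepi c1.
have [s0|s0] := leP 0 s.
 by exists (acos c); [lra | rewrite acosK ?in_itv//= sE ger0_norm].
exists (2 * pi - acos c); first lra.
rewrite -[X in cos X]opprK -[X in sin X]opprK cosN sinN opprB.
rewrite -cos_2pi -sin_2pi subrK acosK ?in_itv//= sE ltr0_norm//.
lra.
Qed.

End Shift.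

(** * One collision: jumps, frames and the gain of a pair of jumps *)

Section Jump.
Context (R : realType) (I : vec3 R -> vec3 R).
Hypothesis HI : frame_choice I.
Implicit Types (v w X Y e : vec3 R) (phi psi : vec3 R -> R) (th ph : R).
(** Extended by 0 at the origin: the jump at zero relative velocity is then 0, and measurability
    holds on the whole space. *)
Definition frame0 X : vec3 R := if X == 0 then 0 else I X.

Definition jmp X th ph : vec3 R :=
 - scale3 ((1 - cos th) / 2) X + scale3 (sin th / 2) (Gamma3 frame0 X ph).

(* The same jump in the frame built on a unit vector [e] orthogonal to [X]. *)
Definition jmpe e X th ph : vec3 R :=
 - scale3 ((1 - cos th) / 2) X + scale3 (sin th / 2) (scale3 (cos ph * norm3 X) e + scale3 (sin ph) (cross3 X e)).

Lemma jmpE v w th ph : v != w -> jmp (v - w) th ph = jump I v w th ph.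
by move=> vw; rewrite /jmp /jump /Gamma3 /frame0 subr_eq0 (negbTE vw). Qed.

Lemma mframe0 : mfun frame0.
case: HI => mI _; have mz : measurable [set x : vec3 R | x != 0].
 rewrite (_ : [set x | _] = setT `&` (@norm3 R) @^-1` `]0, +oo[%classic).
  routine.
 by rewrite setTI; apply/seteqP; split => x /=; rewrite in_itv/= andbT norm3_gt0.
move=> _ B mB; rewrite setTI.
rewrite (_ : _ @^-1` B = ([set x | x != 0] `&` I @^-1` B) `|` (if 0 \in B then ~` [set x | x != 0] else set0)).
 apply: measurableU; first exact: mI. by case: ifP => // _; exact: measurableC.
apply/seteqP; split => [x /=|x].
 rewrite /frame0; case: eqP => [->|x0] Bx; last by left. by right; rewrite mem_set//= eqxx.
case=> [[/= x0 Bx]|]; first by rewrite /frame0 (negbTE x0).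
by case: ifP => // /set_mem B0 /= /negP; rewrite negbK /frame0 => /eqP ->; rewrite eqxx.
Qed.

Lemma mjmp d (T : measurableType d) (X : T -> vec3 R) (th ph : T -> R) : mfun X -> mfun th -> mfun ph ->
 mfun (fun t => jmp (X t) (th t) (ph t)).
move=> mX mt mp; have mF := mcomp mframe0 mX.
have mc := mcosf mt; have ms := msinf mt.
apply: mvec3D.
 apply: mvec3N; apply: mscale3 => //. by apply: mfunM => //; apply: mfunB.
apply: mscale3; first routine.
apply: mvec3D; apply: mscale3 => //; [exact: mcosf|exact: msinf|].
apply: mcross3 => //; apply: mscale3 => //.
rewrite (_ : (fun t => (norm3 (X t))^-1) = fun t => norm3 (X t) `^ (-1)).
 by apply: (mcomp (@measurable_powR R (-1))); routine.
by apply/funext => t; rewrite powR_inv1// norm3_ge0.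
Qed.

Definition circ phi v X th : R := iint 0 (2 * pi) (fun ph => phi (v + jmp X th ph) - phi v).

Lemma cross_cross u e : cross3 u (cross3 u e) = scale3 (dot3 u e) u - scale3 (dot3 u u) e.
by apply: vec3_eq; rewrite /cross3 /dot3 /=; ring. Qed.

Lemma cross_cross_dot d u e : cross3 d (cross3 u e) = scale3 (dot3 d e) u - scale3 (dot3 d u) e.
by apply: vec3_eq; rewrite /cross3 /dot3 /=; ring. Qed.

Lemma cross3_lin a b u X Y : cross3 u (scale3 a X + scale3 b Y) = scale3 a (cross3 u X) + scale3 b (cross3 u Y).
by apply: vec3_eq; rewrite /cross3 /scale3 /=; ring. Qed.

Lemma dot3_orthonormal a b X Y : dot3 X X = 1 -> dot3 Y Y = 1 -> dot3 Y X = 0 ->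
 dot3 (scale3 a X + scale3 b Y) (scale3 a X + scale3 b Y) = a ^+ 2 + b ^+ 2.
by move=> XX YY YX; rewrite !dot3E (dot3C X Y) YX XX YY; ring. Qed.

Lemma ortho_decomp u f e : dot3 u u = 1 -> dot3 f u = 0 -> dot3 f f = 1 -> dot3 e u = 0 ->
 e = scale3 (dot3 e f) f + scale3 (dot3 e (cross3 u f)) (cross3 u f).
move=> uu fu ff eu; set J := cross3 u f.
have JJ : dot3 J J = 1 by rewrite dot3_cross uu ff (dot3C u f) fu expr0n subr0 mulr1.
have Jf : dot3 J f = 0 by rewrite /J /dot3 /cross3 /=; ring.
have Ju : dot3 J u = 0 by rewrite /J /dot3 /cross3 /=; ring.
set g := _ + _; apply/eqP; rewrite -subr_eq0 -norm3_eq0 -sqrf_eq0 norm3_sqr.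
set h := e - g.
have hf : dot3 h f = 0 by rewrite /h /g !dot3E ff Jf; ring.
have hu : dot3 h u = 0 by rewrite /h /g !dot3E eu fu Ju; ring.
have hJ : dot3 h J = 0 by rewrite /h /g !dot3E (dot3C f J) Jf JJ; ring.
have := dot3_cross h J; rewrite JJ hJ mulr1 expr0n subr0 => <-.
rewrite /J cross_cross_dot hf hu; apply/eqP.
by rewrite /dot3 /scale3 /=; ring.
Qed.

Lemma bmeas_jmpe e v X th phi : bmeas phi -> bmeas (fun ph => phi (v + jmpe e X th ph) - phi v).
move=> bp; apply: bmeasB; last routine. apply: (bmeas_comp bp). do 2?[apply: mvec3D; first routine].
by apply: mscale3; [routine|apply: mvec3D; apply: mscale3; routine].
Qed.

(** In the orthonormal frame given by [I X / |X|], the unit vector [e] has some angle [al]. The two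
    parametrisations of the circle of jumps differ by the phase [al], which the average over a
    period does not see. *)
Lemma circE e phi v X th : bmeas phi -> dot3 e e = 1 -> dot3 e X = 0 ->
 circ phi v X th = iint 0 (2 * pi) (fun ph => phi (v + jmpe e X th ph) - phi v).
move=> bp ee eX; have [->|X0] := eqVneq X 0.
 apply: eq_iint => ph _; congr (phi (v + _) - _); apply: vec3_eq;
  by rewrite /jmp /jmpe /Gamma3 /frame0 eqxx norm30 /cross3 /scale3 /=; ring.
have n0 : 0 < norm3 X by rewrite norm3_gt0.
pose u := scale3 (norm3 X)^-1 X; pose f := scale3 (norm3 X)^-1 (I X).
have [nI IX] := HI.2 X X0.
have Xn := norm3_sqr X; have n00 : norm3 X != 0 by lra.
have uu : dot3 u u = 1 by rewrite /u !dot3E -Xn expr2; field.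
have ff : dot3 f f = 1 by rewrite /f !dot3E -norm3_sqr nI expr2; field.
have fu : dot3 f u = 0 by rewrite /f /u !dot3E IX; ring.
have eu : dot3 e u = 0 by rewrite /u !dot3E eX; ring.
have dec := ortho_decomp uu fu ff eu.
have JJ : dot3 (cross3 u f) (cross3 u f) = 1.
 by rewrite dot3_cross uu ff (dot3C u f) fu expr0n subr0 mulr1.
have Jf : dot3 (cross3 u f) f = 0 by rewrite /dot3 /cross3 /=; ring.
have [al alP [ca sa]] : exists2 al, 0 <= al <= 2 * pi & cos al = dot3 e f /\ sin al = dot3 e (cross3 u f).
 apply: exists_angle; rewrite -[RHS]ee.
 have -> : dot3 e e = dot3 (scale3 (dot3 e f) f + scale3 (dot3 e (cross3 u f)) (cross3 u f))
   (scale3 (dot3 e f) f + scale3 (dot3 e (cross3 u f)) (cross3 u f)) by rewrite -dec.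
 by rewrite (dot3_orthonormal _ _ ff JJ Jf).
have XE : X = scale3 (norm3 X) u by apply: vec3_eq; rewrite /u /scale3 /=; field.
have IE : I X = scale3 (norm3 X) f by apply: vec3_eq; rewrite /f /scale3 /=; field.
have ue : cross3 u e = scale3 (dot3 e f) (cross3 u f) - scale3 (dot3 e (cross3 u f)) f.
 have -> : cross3 u e = scale3 (dot3 e f) (cross3 u f) + scale3 (dot3 e (cross3 u f)) (cross3 u (cross3 u f)).
  by rewrite -cross3_lin -dec.
 rewrite cross_cross (dot3C u f) fu uu; apply: vec3_eq; rewrite /scale3 /=; ring.
have je ph : jmpe e X th ph = jmp X th (ph + al).
 congr (_ + scale3 _ _); rewrite /Gamma3 /frame0 (negbTE X0) -/u IE.
 have -> : cross3 X e = scale3 (norm3 X) (cross3 u e).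
  by rewrite {1}XE; apply: vec3_eq; rewrite /cross3 /scale3 /=; ring.
 rewrite ue cosD sinD ca sa -/u. have -> : scale3 (cos ph * norm3 X) e = scale3 (cos ph * norm3 X)
  (scale3 (dot3 e f) f + scale3 (dot3 e (cross3 u f)) (cross3 u f)) by rewrite -dec.
 move: (dot3 e f) (dot3 e _) => a b. by apply: vec3_eq; rewrite /cross3 /scale3 /=; ring.
rewrite /circ -(@iint_periodic _ al)//.
- by apply: eq_iint => ph _; rewrite je.
- apply: bmeasB; last routine. apply: (bmeas_comp bp); apply: mvec3D; first routine.
 by apply: mjmp => //.
- by move=> ph; rewrite /jmp /Gamma3 cos_2pi sin_2pi.
Qed.

Lemma exists_unit_ortho1 X : exists2 e, dot3 e e = 1 & dot3 e X = 0.
have H Y : dot3 Y X = 0 -> Y != 0 -> exists2 e, dot3 e e = 1 & dot3 e X = 0.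
 move=> YX Y0; exists (scale3 (norm3 Y)^-1 Y); rewrite !dot3E ?YX ?mulr0//.
 by rewrite -norm3_sqr expr2; field; rewrite gt_eqF// norm3_gt0.
have [X1|X1] := eqVneq X.1.1 0.
 exists (vec3_mk 1 0 0); rewrite /dot3 /=; first ring. lra.
apply: (H (vec3_mk (- X.1.2) X.1.1 0)); first by rewrite /dot3 /=; ring.
by apply: contra_neq X1 => /(congr1 (fun y : vec3 R => y.1.2)).
Qed.

(** The normalised cross product, or for parallel vectors any unit vector orthogonal to the nonzero
    one. Measuring both azimuths from this common [e] is what makes the two frames parallel. *)
Lemma exists_unit_ortho X Y : exists e, [/\ dot3 e e = 1, dot3 e X = 0 & dot3 e Y = 0].
have [Z0|Z0] := eqVneq (cross3 X Y) 0; last first.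
 exists (scale3 (norm3 (cross3 X Y))^-1 (cross3 X Y)); rewrite !dot3E; split.
 - by rewrite -norm3_sqr expr2; field; rewrite gt_eqF// norm3_gt0.
 - by rewrite (_ : dot3 (cross3 X Y) X = 0) ?mulr0//; rewrite /dot3 /cross3 /=; ring.
 - by rewrite (_ : dot3 (cross3 X Y) Y = 0) ?mulr0//; rewrite /dot3 /cross3 /=; ring.
have [->|X0] := eqVneq X 0.
 have [e ee eY] := exists_unit_ortho1 Y; exists e; split=> //. by rewrite /dot3 /=; ring.
have [e ee eX] := exists_unit_ortho1 X; exists e; split=> //.
have := congr1 (cross3 X) Z0; rewrite cross_cross => h.
have : dot3 e (scale3 (dot3 X Y) X - scale3 (dot3 X X) Y) = 0.
 by rewrite h /dot3 /cross3 /=; ring.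
rewrite !dot3E eX mulr0 add0r => /eqP; rewrite oppr_eq0 mulf_eq0 => /orP[|/eqP//].
by rewrite -norm3_sqr sqrf_eq0 norm3_eq0 (negbTE X0).
Qed.

(* The average over [ph] of |D + a - a'|^2 - |D|^2, for the jumps a, a' of the
  relative velocities X, Y of deviation angles th, th', is at most this. *)
Definition pair_gain D X Y (th th' : R) : R :=
 - (2^-1 * dot3 (D + D - (X - Y)) (scale3 (1 - cos th) X - scale3 (1 - cos th') Y))
 + 2^-1 * (1 - cos (th - th')) * dot3 X Y.

(** The terms linear in cos ph and sin ph will integrate to 0. What separates the two sides is 2 b
    b' cos(ph)^2 (|X| |Y| - X.Y), nonnegative by Cauchy-Schwarz and the sign of
    [sin th * sin th']. *)
Lemma jmpe_pair e D X Y th th' : dot3 e e = 1 -> dot3 e X = 0 -> dot3 e Y = 0 -> 0 <= sin th * sin th' ->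
 exists A B : R, forall ph, norm3 (D + jmpe e X th ph - jmpe e Y th' ph) ^+ 2 - norm3 D ^+ 2 <=
  pair_gain D X Y th th' + A * cos ph + B * sin ph.
move=> ee eX eY ss.
pose a := (1 - cos th) / 2; pose b := sin th / 2; pose a' := (1 - cos th') / 2; pose b' := sin th' / 2.
exists (2 * (b * norm3 X - b' * norm3 Y) * dot3 D e).
exists (2 * (b * dot3 D (cross3 X e) - b' * dot3 D (cross3 Y e))
    + 2 * (a * b' * dot3 X (cross3 Y e) + a' * b * dot3 Y (cross3 X e))).
move=> ph; rewrite !norm3_sqr /jmpe -/a -/b -/a' -/b'.
set U := cross3 X e; set W := cross3 Y e.
have Xe : dot3 X e = 0 by rewrite dot3C.
have Ye : dot3 Y e = 0 by rewrite dot3C.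
have UU : dot3 U U = dot3 X X by rewrite /U dot3_cross ee Xe expr0n subr0 mulr1.
have WW : dot3 W W = dot3 Y Y by rewrite /W dot3_cross ee Ye expr0n subr0 mulr1.
have UW : dot3 U W = dot3 X Y.
 have -> : dot3 U W = dot3 X Y * dot3 e e - dot3 X e * dot3 e Y by rewrite /U /W /dot3 /cross3 /=; ring. nra.
have Ue : dot3 U e = 0 by rewrite /U /dot3 /cross3 /=; ring.
have We : dot3 W e = 0 by rewrite /W /dot3 /cross3 /=; ring.
have eU : dot3 e U = 0 by rewrite dot3C.
have eW : dot3 e W = 0 by rewrite dot3C.
have XU : dot3 X U = 0 by rewrite /U /dot3 /cross3 /=; ring.
have YW : dot3 Y W = 0 by rewrite /W /dot3 /cross3 /=; ring.
have cs := cos2Dsin2 ph; have cs1 := cos2Dsin2 th; have cs2 := cos2Dsin2 th'.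
have XY := le_trans (ler_norm _) (dot3_le X Y).
have nX := norm3_sqr X; have nY := norm3_sqr Y.
have P : 0 <= 2 * (b * b') * cos ph ^+ 2 * (norm3 X * norm3 Y - dot3 X Y).
 apply: mulr_ge0; last by lra. apply: mulr_ge0; last exact: sqr_ge0. by rewrite /b /b'; lra.
rewrite /pair_gain cosB !dot3E (dot3C Y X) (dot3C U X) (dot3C W Y) (dot3C W X) (dot3C U Y) (dot3C W U)
 (dot3C X D) (dot3C Y D) (dot3C e D) (dot3C U D) (dot3C W D) XU YW Ue We eU eW Xe Ye eX eY ee UU WW UW.
move: (norm3 X) (norm3 Y) (dot3 X X) (dot3 Y Y) (dot3 X Y) (dot3 D X) (dot3 D Y) (dot3 D e) (dot3 D U) (dot3 D W)
 (dot3 X W) (dot3 Y U) (dot3 D D) nX nY P XY => nX nY XX YY XY DX DY De DU DW XW YU DD enX enY P _.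
rewrite -subr_ge0; apply: le_trans P _; apply: eq_ler.
rewrite /a /b /a' /b' -enX -enY.
move: (cos ph) (sin ph) (cos th) (sin th) (cos th') (sin th') cs cs1 cs2 => cp sp ct st cu su s1 s2 s3.
have e1 : cp ^+ 2 + sp ^+ 2 - 1 = 0 by rewrite s1 subrr.
have e2 : ct ^+ 2 + st ^+ 2 - 1 = 0 by rewrite s2 subrr.
have e3 : cu ^+ 2 + su ^+ 2 - 1 = 0 by rewrite s3 subrr.
(* [err] is the combination of the three relations cos^2 + sin^2 = 1 by which the two sides differ;
   adding it leaves a polynomial identity. *)
pose err := - ((st / 2) ^+ 2 * nX ^+ 2 + (su / 2) ^+ 2 * nY ^+ 2 - 2 * (st / 2) * (su / 2) * XY) * (cp ^+ 2 + sp ^+ 2 - 1)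
 - nX ^+ 2 / 4 * (ct ^+ 2 + st ^+ 2 - 1) - nY ^+ 2 / 4 * (cu ^+ 2 + su ^+ 2 - 1).
have err0 : err = 0 by rewrite /err e1 e2 e3; ring.
have H (x y : R) : x + err = y -> x = y by move=> <-; rewrite err0 addr0.
by apply: H; rewrite /err; field.
Qed.

End Jump.

(** * Scalar inequalities behind the energy balance *)

Section ScalarBounds.
Context (R : realType).
Implicit Types (r s d a b t th sg rho x y : R).

Lemma sqr_ratio_le x r s d : 0 <= x -> 0 <= r -> s <= 2 * r -> x * r <= d -> x ^+ 2 * (r * s) <= 2 * d ^+ 2.
move=> x0 r0 sr xr; via (2 * (x * r) ^+ 2).
 by have := ler_wpM2l (mulr_ge0 (sqr_ge0 x) r0) sr; lra.
by rewrite ler_pM2l// ler_pXn2r// nnegrE ?mulr_ge0//; apply: le_trans xr; routine.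
Qed.

Lemma sqr_le4 s d : 0 <= s -> s <= 2 * d -> s * s <= 4 * d ^+ 2.
move=> s0 sd; rewrite (_ : 4 * d ^+ 2 = (2 * d) * (2 * d)); last by ring.
nra.
Qed.

Lemma loss_split_le r s d a b th x y : 0 < r -> 0 <= d -> s - r <= d -> 0 <= th -> 0 <= b ->
 r * a <= s * b -> y <= th * b -> x - y <= th * (a - b) -> y * d + (x - y) * r <= 2 * th * b * d.
move=> r0 d0 sr t0 b0 m hy hxy.
have h1 := ler_wpM2r d0 hy; have h2 := ler_wpM2r (ltW r0) hxy.
have h3 := ler_wpM2l (mulr_ge0 t0 b0) sr.
nra.
Qed.

Lemma loss_small_le th g e d x y : 0 <= th -> 0 <= g -> 0 <= e -> 0 <= d ->
 x <= th * (2 * e * g) \/ x <= th * (2 * d * g) -> y <= th * (e * g) -> x + y <= th * (3 * (g * e) + 2 * (g * d)).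
move=> t0 g0 e0 d0; have h1 := mulr_ge0 t0 (mulr_ge0 g0 e0); have h2 := mulr_ge0 t0 (mulr_ge0 g0 d0).
lra.
Qed.

(** Here r, s, d are |X|, |Y|, |X - Y| and a, b the rates of X and Y. If s <= 2r the rates are
    comparable and the mismatch is of second order in a/b - 1. Otherwise s <= 2d and the first-order
    bound is already quadratic in d. *)
Lemma spread_split_le r s d a b t sg rho : 0 < r -> 0 < s -> 0 < a -> 0 < b -> - d <= r - s ->
 0 <= sg -> b <= a -> r * a <= s * b -> (s <= 2 * r -> a <= 2 * b) ->
 t <= sg * a -> t <= (rho * (a / b - 1)) ^+ 2 * sg * a -> t * (r * s) <= 4 * sg * (1 + rho ^+ 2) * b * d ^+ 2.
move=> r0 s0 a0 b0 rs1 sg0 ba m mr le1 le2.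
have B0 : 0 <= sg * b * d ^+ 2 by rewrite mulr_ge0 ?sqr_ge0// mulr_ge0// ltW.
have C0 : 0 <= sg * b * d ^+ 2 * rho ^+ 2 by nra.
have rs0 : 0 <= r * s by routine.
have D0 : 0 <= rho ^+ 2 * sg by rewrite mulr_ge0 ?sqr_ge0// ltW.
have [s2|s2] := leP s (2 * r).
 have x0 : 0 <= a / b - 1 by rewrite subr_ge0 ler_pdivlMr// mul1r. have xr : (a / b - 1) * r <= d.
  rewrite mulrBl mul1r mulrAC -(mulrC r) lerBlDr ler_pdivrMr//; have := ler_wpM2r (ltW b0) rs1. by clear -m; lra.
 have q := sqr_ratio_le x0 (ltW r0) s2 xr. have h := ler_wpM2r rs0 le2; apply: (le_trans h).
 have h2 : (rho ^+ 2 * sg) * a * ((a / b - 1) ^+ 2 * (r * s)) <= (rho ^+ 2 * sg) * (2 * b) * (2 * d ^+ 2).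
  apply: ler_pM => //; first routine.
   routine.
  by rewrite ler_wpM2l// mr.
 move: (a / b - 1) h2 => x; rewrite exprMn; clear -B0 C0; lra.
have s4 : s * s <= 4 * d ^+ 2 by apply: sqr_le4; [exact: ltW|clear -rs1 s2; lra].
upto (ler_wpM2r rs0 le1).
have h1 := ler_wpM2l (mulr_ge0 sg0 (ltW s0)) m.
have h2 := ler_wpM2l (mulr_ge0 sg0 (ltW b0)) s4; clear -h1 h2 B0 C0; lra.
Qed.

Lemma spread_split_ge r s d a b t sg rho : 0 < r -> 0 < s -> 0 < a -> 0 < b -> r - s <= d ->
 0 <= sg -> s <= r -> s * b <= r * a -> a <= b -> t <= sg * b -> t <= (rho * (b / a - 1)) ^+ 2 * sg * b ->
 t * (r * s) <= 4 * sg * (1 + rho ^+ 2) * b * d ^+ 2.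
move=> r0 s0 a0 b0 rs1 sg0 sr m ab le1 le2.
have B0 : 0 <= sg * b * d ^+ 2 by rewrite mulr_ge0 ?sqr_ge0// mulr_ge0// ltW.
have C0 : 0 <= sg * b * d ^+ 2 * rho ^+ 2 by nra.
have rs0 : 0 <= r * s by nra.
have D0 : 0 <= rho ^+ 2 * sg by nra.
have [s2|s2] := leP r (2 * s).
 have x0 : 0 <= b / a - 1 by rewrite subr_ge0 ler_pdivlMr// mul1r. have xr : (b / a - 1) * s <= d.
  rewrite mulrBl mul1r mulrAC -(mulrC s) lerBlDr ler_pdivrMr//; have := ler_wpM2r (ltW a0) rs1. by clear -m; lra.
 have q := sqr_ratio_le x0 (ltW s0) s2 xr. have h := ler_wpM2r rs0 le2; apply: (le_trans h).
 have h2 : (rho ^+ 2 * sg) * b * ((b / a - 1) ^+ 2 * (s * r)) <= (rho ^+ 2 * sg) * b * (2 * d ^+ 2).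
  by apply: ler_wpM2l => //; routine.
 move: (b / a - 1) h2 => x; rewrite exprMn; clear -B0 C0; lra.
have s4 : r * r <= 4 * d ^+ 2 by apply: sqr_le4; [exact: ltW|clear -rs1 s2; lra].
upto (ler_wpM2r rs0 le1).
have h1 : sg * b * (r * s) <= sg * b * (r * r).
 by rewrite ler_wpM2l ?(mulr_ge0 sg0 (ltW b0))// ler_wpM2l// ltW.
have h2 := ler_wpM2l (mulr_ge0 sg0 (ltW b0)) s4; clear -h1 h2 B0 C0; lra.
Qed.

Lemma spread_small_le r s d a b t sg rho g eps : 0 < r -> 0 < s -> 0 < a -> 0 < b -> 0 <= d ->
 0 <= sg -> 0 < g -> 0 <= eps -> s < eps -> r <= eps + d -> r * a <= (eps + d) * g -> s * b <= eps * g ->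
 t <= sg * (a + b) -> t * (r * s) <= 4 * sg * (1 + rho ^+ 2) * g * (eps ^+ 2 + 2 * d ^+ 2).
move=> r0 s0 a0 b0 d0 sg0 g0 e0 se rE hX hY h1.
upto (ler_wpM2r (mulr_ge0 (ltW r0) (ltW s0)) h1).
have h2 : (r * a) * s <= (eps + d) * g * eps by apply: ler_pM => //; [rewrite mulr_ge0 ?ltW|exact: ltW|exact: ltW].
have h3 : (s * b) * r <= eps * g * (eps + d) by apply: ler_pM => //; [rewrite mulr_ge0 ?ltW|exact: ltW].
have h4 : sg * (a + b) * (r * s) <= sg * (2 * g * (eps * (eps + d))).
 nra.
apply: (le_trans h4).
have h5 : eps * (eps + d) <= 2 * (eps ^+ 2 + 2 * d ^+ 2).
 nra.
have h6 := ler_wpM2l (mulr_ge0 sg0 (ltW g0)) h5.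
have h70 : 0 <= sg * g * (eps ^+ 2 + 2 * d ^+ 2).
 routine.
have h7 := mulr_ge0 h70 (sqr_ge0 rho).
clear -h6 h70 h7; lra.
Qed.

(** T1, T2 and Q (T3 + s^2/2) are the loss, spread and tail terms of a pair whose relative velocity
    has norm s below the cutoff e. Young's inequality splits the cross products. *)
Lemma energy_dissip_small th SB ta g e Kt q Q n u m d s T1 T2 T3 :
 0 <= th -> 0 <= SB -> 0 <= ta -> 0 <= g -> 0 <= e -> 0 <= Kt -> 0 <= q -> 0 <= Q -> 0 <= n -> 0 <= u -> 0 <= d ->
 T1 <= 2^-1 * (u * m) -> m <= th * (3 * (g * e) + 2 * (g * d)) ->
 u * d <= q -> u ^+ 2 <= 2 * q -> d ^+ 2 <= 2 * q -> n ^+ 2 <= q ->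
 T2 <= SB * g * (e ^+ 2 + 2 * d ^+ 2) -> T3 <= n * s -> Q * s <= th * (e * g) -> Q * s ^+ 2 <= ta * Kt ->
 T1 + 2^-1 * T2 + Q * (T3 + 2^-1 * s ^+ 2) <= (3 * th + 2 * SB + ta) * (g * q + e ^+ 2 * g + Kt).
move=> t0 S0 a0 g0 e0 K0 q0 Q0 n0 u0 d0 h1 hm ud u2 d2 n2 h2 h3 Qs Qs2.
have e1 : 2^-1 * (u * m) <= th * g * (2^-1 * (5 * q) + e ^+ 2).
 have a : u * m <= u * (th * (3 * (g * e) + 2 * (g * d))) by exact: ler_wpM2l.
 have b : 3 * (u * e) + 2 * (u * d) <= 5 * q + 2 * e ^+ 2.
  have := sqr_ge0 (u - e); have := sqr_ge0 e; rewrite sqrrB; clear -ud u2; lra.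
 have := ler_wpM2l (mulr_ge0 t0 g0) b; clear -a; lra.
have e2 : 2^-1 * T2 <= SB * g * (2^-1 * e ^+ 2 + 2 * q).
 have b := ler_wpM2l (mulr_ge0 S0 g0) d2; clear -b h2; lra.
have e3 : Q * (T3 + 2^-1 * s ^+ 2) <= th * g * (2^-1 * e ^+ 2 + 2^-1 * q) + ta * Kt.
 have a := ler_wpM2l Q0 h3; have b := ler_wpM2r n0 Qs. have c : e * n <= 2^-1 * e ^+ 2 + 2^-1 * q.
  have := sqr_ge0 (e - n); rewrite sqrrB; clear -n2; lra.
 have f := ler_wpM2l (mulr_ge0 t0 g0) c; have := mulr_ge0 Q0 (sqr_ge0 s); clear -a b f Qs2; lra.
have p1 := mulr_ge0 (mulr_ge0 t0 g0) q0; have p2 := mulr_ge0 (mulr_ge0 t0 g0) (sqr_ge0 e).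
have p3 := mulr_ge0 (mulr_ge0 S0 g0) q0; have p4 := mulr_ge0 (mulr_ge0 S0 g0) (sqr_ge0 e).
have p5 := mulr_ge0 a0 (mulr_ge0 g0 q0); have p6 := mulr_ge0 a0 (mulr_ge0 g0 (sqr_ge0 e)).
have p7 := mulr_ge0 t0 K0; have p8 := mulr_ge0 S0 K0.
clear -h1 e1 e2 e3 p1 p2 p3 p4 p5 p6 p7 p8; lra.
Qed.

Lemma energy_dissip_large th SB ta b z Kt q Q n u m d s T1 T2 T3 :
 0 <= th -> 0 <= SB -> 0 <= ta -> 0 <= b -> 0 <= z -> 0 <= Kt -> 0 <= q -> 0 <= Q -> 0 <= u -> 0 <= d ->
 T1 <= 2^-1 * (u * m) -> m <= 2 * th * b * d -> u * d <= q -> d ^+ 2 <= 2 * q -> n ^+ 2 <= q ->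
 T2 <= SB * b * d ^+ 2 -> T3 <= n * s -> Q <= th * b -> Q * s ^+ 2 <= ta * Kt ->
 T1 + 2^-1 * T2 + Q * (T3 + 2^-1 * s ^+ 2) <= (3 * th + 2 * SB + ta) * (b * q + z + Kt).
move=> t0 S0 a0 b0 z0 K0 q0 Q0 u0 d0 h1 hm ud d2 n2 h2 h3 Qb Qs2.
have e1 : 2^-1 * (u * m) <= th * b * q.
 nra.
have e2 : 2^-1 * T2 <= SB * b * q.
 have c := ler_wpM2l (mulr_ge0 S0 b0) d2; clear -c h2; lra.
have e3 : Q * (T3 + 2^-1 * s ^+ 2) <= 2^-1 * (th * b * q) + ta * Kt.
 have a := ler_wpM2l Q0 h3. have c : n * s + 2^-1 * s ^+ 2 <= 2^-1 * q + s ^+ 2.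
  have := sqr_ge0 (n - s); rewrite sqrrB; clear -n2; lra.
 have f := ler_wpM2l Q0 c; have := ler_wpM2r q0 Qb; clear -a f Qs2; lra.
have p1 := mulr_ge0 (mulr_ge0 t0 b0) q0; have p2 := mulr_ge0 t0 z0.
have p3 := mulr_ge0 (mulr_ge0 S0 b0) q0; have p4 := mulr_ge0 S0 z0.
have p5 := mulr_ge0 a0 (mulr_ge0 b0 q0); have p6 := mulr_ge0 a0 z0.
have p7 := mulr_ge0 t0 K0; have p8 := mulr_ge0 S0 K0.
clear -h1 e1 e2 e3 p1 p2 p3 p4 p5 p6 p7 p8; lra.
Qed.

End ScalarBounds.

Local Opaque loss spread iint theta_cst spread_cst ratio_cst tail_cst.

(** * Energy balance of a coupled pair of collisions *)

Section Collision.
Context (R : realType) (I : vec3 R -> vec3 R) (gamma nu c0 c1 : R) (beta : R -> R).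
Hypotheses (HI : frame_choice I) (Hk : kernel_bounds nu c0 c1 beta) (Hg : -1 < gamma < 0) (Hgn : 0 < gamma + nu).
Implicit Types (v w X Y D e : vec3 R) (phi psi : vec3 R -> R) (th K L M k z eps : R).
Notation angle := (angle beta).

Lemma bmeas_circ d (T : measurableType d) (phi : T * vec3 R -> R) (v X : T -> vec3 R) (th : T -> R) :
 bmeas phi -> mfun v -> mfun X -> mfun th -> bmeas (fun t => circ I (fun x => phi (t, x)) (v t) (X t) (th t)).
move=> bp mv mX mt.
apply: (bfun_param (iint_bfun 0 (2 * pi)) (f := fun z : T * R =>
 phi (z.1, v z.1 + jmp I (X z.1) (th z.1) z.2) - phi (z.1, v z.1))).
have m1 : mfun (fun z : T * R => v z.1) by exact: mcomp.
apply: bmeasB; apply: (bmeas_comp bp); apply: mfun_pair => //.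
apply: mvec3D => //; apply: (mjmp HI) => //; exact: mcomp.
Qed.

Lemma bmeas_circ1 psi v X : bmeas psi -> bmeas (circ I psi v X).
by move=> bp; exact: (bmeas_circ (phi := fun z : R * vec3 R => psi z.2) (bmeas_comp bp msnd)). Qed.

(** Both jumps use the same unit vector and the same azimuth. Where |v - w|^2 < M the cost grows by
    at most the growth of the square; elsewhere it is already maximal. The cos and sin terms of
    [jmpe_pair] integrate to 0. *)
Lemma circ_pair phi psi M k v w X Y th th' : bmeas phi -> bmeas psi ->
 (forall x y, phi x + psi y <= costM M x y + k) -> 0 <= sin th * sin th' -> circ I phi v X th + circ I psi w Y th' <=
 2 * pi * (costM M v w + k - phi v - psi w) +
 2 * pi * (if dist3 v w ^+ 2 < M then pair_gain (v - w) X Y th th' else 0).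
move=> bp bs H ss; have [e [ee eX eY]] := exists_unit_ortho X Y.
rewrite (circE HI _ _ bp ee eX) (circE HI _ _ bs ee eY).
have [A [B AB]] := jmpe_pair (v - w) ee eX eY ss.
have b2 := iint_bfun 0 (2 * pi : R); have p0 : 0 <= 2 * pi :> R by rewrite mulr_ge0 ?pi_ge0.
rewrite -(bfunD b2); [|exact: bmeas_jmpe..].
set gap := costM M v w + k - phi v - psi w.
have bc : bmeas (@cos R).
 by split; [routine|exists 1 => x; exact: cos_max].
have bsn : bmeas (@sin R).
 by split; [routine|exists 1 => x; exact: sin_max].
set T := if _ then _ else _.
pose A' := if dist3 v w ^+ 2 < M then A else 0; pose B' := if dist3 v w ^+ 2 < M then B else 0.
have bR : bmeas (fun ph : R => (gap + T) + (A' * cos ph + B' * sin ph)).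
 routine.
have : iint 0 (2 * pi) (fun ph : R => (gap + T) + (A' * cos ph + B' * sin ph)) = 2 * pi * gap + 2 * pi * T.
 rewrite (bfunD b2); [|exact: bmeas_cst|routine]. rewrite (bfunD b2 (bmeasZ A' bc) (bmeasZ B' bsn)).
 rewrite (bfunZ b2 A' bc) (bfunZ b2 B' bsn) iint_cos iint_sin iint_cst// subr0; ring.
move=> <-; apply: (bfun_le b2) => //; first by apply: bmeasD; exact: bmeas_jmpe.
move=> ph; have := H (v + jmpe e X th ph) (w + jmpe e Y th' ph).
have -> : costM M (v + jmpe e X th ph) (w + jmpe e Y th' ph) =
  Num.min (norm3 (v - w + jmpe e X th ph - jmpe e Y th' ph) ^+ 2) M.
 by rewrite /costM /dist3 opprD addrACA addrA.
have := AB ph; rewrite /gap /T /A' /B' /costM /dist3; case: ifPn => [lt|].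
 set Q := norm3 (_ + _ - _) ^+ 2 => h1; rewrite [Num.min (norm3 (v - w) ^+ 2) M]min_l ?(ltW lt)//.
 have : Num.min Q M <= Q by rewrite ge_min lexx. lra.
rewrite -leNgt => le _; rewrite [Num.min (norm3 (v - w) ^+ 2) M]min_r//.
set Q := norm3 (_ + _ - _) ^+ 2; have : Num.min Q M <= M by rewrite ge_min lexx orbT.
lra.
Qed.

(** The angle is parametrised by [z] in [0, K], so that two particles with different collision rates
    can share [z]. *)
Definition coll K phi v X : R := iint 0 K (fun z => circ I phi v X (angle (z / norm3 X `^ gamma))).

Lemma mrate d (T : measurableType d) (X : T -> vec3 R) (f : T -> R) : mfun X -> mfun f ->
 mfun (fun t => angle (f t / norm3 (X t) `^ gamma)).
move=> mX mf; apply: (mcomp (mangle Hk)); apply: mfunM => //.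
rewrite (_ : (fun t => _) = fun t => norm3 (X t) `^ (- gamma)).
 by apply: (mcomp (@measurable_powR R (- gamma))); routine.
by apply/funext => t; rewrite powRN.
Qed.

Lemma bmeas_coll d (T : measurableType d) K (phi : T * vec3 R -> R) (v X : T -> vec3 R) :
 bmeas phi -> mfun v -> mfun X -> bmeas (fun t => coll K (fun x => phi (t, x)) (v t) (X t)).
move=> bp mv mX.
apply: (bfun_param (iint_bfun 0 K) (f := fun z : T * R =>
 circ I (fun x => phi (z.1, x)) (v z.1) (X z.1) (angle (z.2 / norm3 (X z.1) `^ gamma)))).
apply: (bmeas_circ (phi := fun z : (T * R) * vec3 R => phi (z.1.1, z.2))).
- apply: (bmeas_comp bp); apply: mfun_pair => //. routine.
- exact: mcomp.
- exact: mcomp.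
- by apply: mrate => //; routine.
Qed.

Lemma bmeas_circ_angle phi v X : bmeas phi -> bmeas (fun z : R => circ I phi v X (angle (z / norm3 X `^ gamma))).
move=> bp; apply: (bmeas_circ (phi := fun z : R * vec3 R => phi z.2)) => //.
- exact: (bmeas_comp bp).
- exact: (mangle_div Hk).
Qed.

Lemma circ0 phi v X : circ I phi v X 0 = 0.
rewrite /circ -[RHS](mulr0 (2 * pi - 0)) -iint_cst ?mulr_ge0 ?pi_ge0//.
apply: eq_iint => ph _; rewrite (_ : v + _ = v) ?subrr//.
by apply: vec3_eq; rewrite /jmp cos0 sin0 /scale3 /=; ring.
Qed.

Lemma sin_angle_ge0 z : 0 <= sin (angle z).
apply: sin_ge0_pi; rewrite (angle_ge0 Hk) (le_trans (angle_le Hk z))//.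
by rewrite ler_pdivrMr// ler_peMr ?pi_ge0// ler1n.
Qed.

(** The integral of [pair_gain] over the common [z]: both particles jump for z <= K, which gives the
    first two terms, and only the second one for K < z <= L, which gives the last. *)
Definition TT K L D X Y : R := let a := norm3 X `^ gamma in let b := norm3 Y `^ gamma in
 - (2^-1 * dot3 (D + D - (X - Y)) (scale3 (loss beta K a) X - scale3 (loss beta K b) Y))
 + 2^-1 * spread beta K a b * dot3 X Y
 + iint K L (fun z => 1 - cos (angle (z / b))) * (dot3 D Y + 2^-1 * dot3 Y Y).

Lemma bmeas_loss c : bmeas (fun z : R => 1 - cos (angle (z / c))).
by apply: bmeas_1cos; exact: (mangle_div Hk). Qed.

Lemma bmeas_spread a b : bmeas (fun z : R => 1 - cos (angle (z / a) - angle (z / b))).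
by apply: bmeas_1cos; exact: (mangle_sub Hk). Qed.

Lemma bmeas_angle_comb k0 k1 k2 k3 a b : bmeas (fun z : R => k0 + (k1 * (1 - cos (angle (z / a))) +
 (k2 * (1 - cos (angle (z / b))) + k3 * (1 - cos (angle (z / a) - angle (z / b)))))).
by do ![apply: bmeasD]; [exact: bmeas_cst|apply: bmeasZ; exact: bmeas_loss..|
 apply: bmeasZ; exact: bmeas_spread].
Qed.

Lemma iint_angle_comb K k0 k1 k2 k3 a b : 0 <= K -> iint 0 K (fun z => k0 + (k1 * (1 - cos (angle (z / a))) +
  (k2 * (1 - cos (angle (z / b))) + k3 * (1 - cos (angle (z / a) - angle (z / b)))))) =
 K * k0 + (k1 * loss beta K a + (k2 * loss beta K b + k3 * spread beta K a b)).
move=> K0; have bK := iint_bfun 0 K.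
have B1 := bmeasZ k1 (bmeas_loss a); have B2 := bmeasZ k2 (bmeas_loss b).
have B3 := bmeasZ k3 (bmeas_spread a b).
rewrite (bfunD bK (bmeas_cst _ k0) (bmeasD B1 (bmeasD B2 B3))) (bfunD bK B1 (bmeasD B2 B3)) (bfunD bK B2 B3).
rewrite (bfunZ bK k1 (bmeas_loss a)) (bfunZ bK k2 (bmeas_loss b)).
by rewrite (bfunZ bK k3 (bmeas_spread a b)) iint_cst// subr0.
Qed.

Lemma iint_angle_tail K L k0 k1 b : K <= L -> iint K L (fun z => k0 + k1 * (1 - cos (angle (z / b)))) =
 (L - K) * k0 + k1 * iint K L (fun z => 1 - cos (angle (z / b))).
move=> KL; have bK := iint_bfun K L; have B1 := bmeasZ k1 (bmeas_loss b).
by rewrite (bfunD bK (bmeas_cst _ k0) B1) (bfunZ bK k1 (bmeas_loss b)) iint_cst.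
Qed.

Lemma coll_pair phi psi M k v w X Y K L : bmeas phi -> bmeas psi -> 0 <= K -> K <= L ->
 (forall x y, phi x + psi y <= costM M x y + k) -> coll K phi v X + coll L psi w Y <=
 2 * pi * L * (costM M v w + k - phi v - psi w) + 2 * pi * (if dist3 v w ^+ 2 < M then TT K L (v - w) X Y else 0).
move=> bp bs K0 KL H.
have := fun th th' => @circ_pair phi psi M k v w X Y th th' bp bs H.
move: (costM M v w + k - phi v - psi w) => gap CP.
have bcp := bmeas_circ_angle v X bp; have bcs := bmeas_circ_angle w Y bs.
rewrite /coll /TT; move: CP bcp bcs.
set a := norm3 X `^ gamma; set b := norm3 Y `^ gamma.
move: a b => a b CP bcp bcs.
rewrite [iint 0 L _](@iint_add _ 0 K L)//; last exact: itv_integrable.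
have bK := iint_bfun 0 K; have bL := iint_bfun K L.
have sn z z' : 0 <= sin (angle z) * sin (angle z') by rewrite mulr_ge0// sin_angle_ge0.
rewrite addrA -(bfunD bK)//.
have CP1 z := CP _ _ (sn (z / a) (z / b)).
(* Beyond [K] the first particle stays put; it is treated as a jump of angle 0. *)
have CP2 z : circ I psi w Y (angle (z / b)) <= 2 * pi * gap +
  2 * pi * (if dist3 v w ^+ 2 < M then pair_gain (v - w) X Y 0 (angle (z / b)) else 0).
 by have := CP 0 (angle (z / b)); rewrite sin0 mul0r circ0 add0r; exact.
clear CP; case: ifP CP1 CP2 => _ CP1 CP2.
 pose k1 := - pi * dot3 (v - w + (v - w) - (X - Y)) X. pose k2 := pi * dot3 (v - w + (v - w) - (X - Y)) Y.
 pose k3 := pi * dot3 X Y. pose k4 := 2 * pi * (dot3 (v - w) Y + 2^-1 * dot3 Y Y).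
 have P1 := bfun_le bK (bmeasD bcp bcs) (bmeas_angle_comb (2 * pi * gap) k1 k2 k3 a b).
 have P2 := bfun_le bL bcs (bmeasD (bmeas_cst _ (2 * pi * gap)) (bmeasZ k4 (bmeas_loss b))).
 upto (lerD (P1 _) (P2 _)) => [z|z|].
 - upto (CP1 z); rewrite lerD2l /pair_gain dot3DR dot3NR !dot3ZR /k1 /k2 /k3. by apply: eq_ler; field.
 - upto (CP2 z); rewrite lerD2l /pair_gain sub0r cosN cos0 /k4.
  have -> : scale3 (1 - 1) X - scale3 (1 - cos (angle (z / b))) Y = scale3 (- (1 - cos (angle (z / b)))) Y.
   by apply: vec3_eq; rewrite /scale3 /=; ring.
  have -> : v - w + (v - w) - (X - Y) = (v - w) + (v - w) - X + Y by rewrite opprB addrCA addrC.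
  move: (cos _) => cc. by apply: eq_ler; rewrite !dot3E; field.
 rewrite iint_angle_comb// iint_angle_tail// /k1 /k2 /k3 /k4 dot3DR dot3NR !dot3ZR. by apply: eq_ler; field.
have P1 := bfun_le bK (bmeasD bcp bcs) (bmeas_cst _ (2 * pi * gap)).
have P2 := bfun_le bL bcs (bmeas_cst _ (2 * pi * gap)).
upto (lerD (P1 _) (P2 _)) => [z|z|].
- by upto (CP1 z); rewrite mulr0 addr0.
- by upto (CP2 z); rewrite mulr0 addr0.
by rewrite !iint_cst//; apply: eq_ler; ring.
Qed.

Definition lsing eps x : R := Num.max x eps `^ gamma.

Let g0 : gamma < 0. Proof. by case/andP: Hg. Qed.
Let g1 : 0 < 1 + gamma. Proof. by case/andP: Hg; lra. Qed.

Lemma powg_anti (x y : R) : 0 < x -> x <= y -> y `^ gamma <= x `^ gamma.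
by move=> x0 xy; apply: powR_le_neg => //; exact: ltW. Qed.

Lemma powgM (x : R) : 0 < x -> x * x `^ gamma = x `^ (1 + gamma).
by move=> x0; rewrite powRD ?(gt_eqF x0) ?implybT// powRr1// ltW. Qed.

(** The exponent 1 + gamma is positive: momentum times rate is increasing in the relative speed,
    although the rate is singular. *)
Lemma powgM_mono (x y : R) : 0 < x -> x <= y -> x * x `^ gamma <= y * y `^ gamma.
move=> x0 xy; rewrite !powgM// ?(lt_le_trans x0)//.
by apply: powR_le_pos => //; exact: ltW.
Qed.

Lemma lsing_gt0 eps x : 0 < eps -> 0 < lsing eps x.
by move=> e0; rewrite powR_gt0// lt_max e0 orbT. Qed.

Lemma lsing_le eps x : 0 < eps -> lsing eps x <= eps `^ gamma.
by move=> e0; apply: powg_anti => //; rewrite le_max lexx orbT. Qed.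

Let th0 : 0 < theta_cst nu c1. Proof. exact: (theta_cst_gt0 Hk). Qed.
Let sp0 : 0 < spread_cst nu c1. Proof. exact: (spread_cst_gt0 Hk). Qed.
Let ra0 : 0 < ratio_cst nu c0 c1. Proof. exact: (ratio_cst_gt0 Hk). Qed.
Let ta0 : 0 < tail_cst nu c1. Proof. exact: (tail_cst_gt0 Hk). Qed.

Local Notation P K X := (loss beta K (norm3 X `^ gamma)).
Local Notation S K X Y := (spread beta K (norm3 X `^ gamma) (norm3 Y `^ gamma)).

Lemma norm_scale_lossB K X Y c : 0 <= K -> P K X * norm3 X + P K Y * norm3 Y <= c ->
 norm3 (scale3 (P K X) X - scale3 (P K Y) Y) <= c.
move=> K0; have := loss_ge0 Hk K (norm3 X `^ gamma); have := loss_ge0 Hk K (norm3 Y `^ gamma).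
move: (P K X) (P K Y) => x y y0 x0 h; upto (norm3D _ _).
by rewrite norm3N !norm3Z (ger0_norm x0) (ger0_norm y0).
Qed.

Lemma norm_scale_splitB X Y (x y : R) : 0 <= y -> y <= x ->
 norm3 (scale3 x X - scale3 y Y) <= y * norm3 (X - Y) + (x - y) * norm3 X.
move=> y0 yx.
have -> : scale3 x X - scale3 y Y = scale3 y (X - Y) + scale3 (x - y) X.
 by apply: vec3_eq; rewrite /scale3 /=; ring.
upto (norm3D _ _); rewrite !norm3Z (ger0_norm y0) (@ger0_norm _ (x - y))//.
lra.
Qed.

(** The smaller of the two losses multiplies X - Y, and the difference of the losses multiplies the
    shorter vector. [loss_mono] bounds that difference by the difference of the rates, which is
    tamed by [powgM_mono]. *)
Lemma norm_lossB K X Y : 0 <= K -> Y != 0 ->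
 norm3 (scale3 (P K X) X - scale3 (P K Y) Y) <= 2 * theta_cst nu c1 * norm3 Y `^ gamma * norm3 (X - Y).
move=> K0 Y0; have s0 : 0 < norm3 Y by rewrite norm3_gt0.
have b0 := powR_gt0 gamma s0.
have PY := loss_le Hk K0 b0; have PY0 := loss_ge0 Hk K (norm3 Y `^ gamma).
have d0 := norm3_ge0 (X - Y).
have [X0|X0] := eqVneq X 0.
 have e1 : norm3 (X - Y) = norm3 Y by rewrite X0 sub0r norm3N.
 have e2 (x : R) : x * norm3 X = 0 by rewrite X0 norm30 mulr0.
 apply: (norm_scale_lossB (X := X) (Y := Y) K0); rewrite e1.
 move: PY; move: (P K X) (P K Y) => x y PY; rewrite e2 add0r. upto (ler_wpM2r (ltW s0) PY).
 have h := mulr_ge0 (mulr_ge0 (ltW th0) (ltW b0)) (ltW s0). by rewrite -(mulrA 2) -(mulrA 2) ler_peMl ?ler1n.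
have r0 : 0 < norm3 X by rewrite norm3_gt0.
have a0 := powR_gt0 gamma r0.
have PX := loss_le Hk K0 a0; have PX0 := loss_ge0 Hk K (norm3 X `^ gamma).
have rs := norm3_dist X Y; rewrite /dist3 ler_norml in rs; case/andP: rs => rs1 rs2.
have [rs|sr] := leP (norm3 X) (norm3 Y).
 have ba := powg_anti r0 rs; have m := powgM_mono r0 rs. have /andP[l1 l2] := loss_mono Hk K0 b0 ba.
 move: PY PY0 l1 l2; move: (P K X) (P K Y) => x y PY PY0 l1 l2.
 upto (@norm_scale_splitB X Y x y PY0 _); first by rewrite -subr_ge0.
 have sd : norm3 Y - norm3 X <= norm3 (X - Y) by rewrite -opprB lerNl.
 exact: (loss_split_le r0 d0 sd (ltW th0) (ltW b0) m PY l2).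
have ab := powg_anti s0 (ltW sr); have m := powgM_mono s0 (ltW sr).
have /andP[l1 l2] := loss_mono Hk K0 a0 ab.
move: PX PX0 l1 l2; move: (P K X) (P K Y) => x y PX PX0 l1 l2.
rewrite -norm3N opprB.
upto (@norm_scale_splitB Y X y x PX0 _); first by rewrite -subr_ge0.
rewrite -(norm3N (Y - X)) opprB.
via (2 * theta_cst nu c1 * norm3 X `^ gamma * norm3 (X - Y)).
 exact: (loss_split_le s0 d0 rs2 (ltW th0) (ltW a0) m PX l2).
exact: (ler_wpM2r d0 (ler_wpM2l (mulr_ge0 (ler0n R 2) (ltW th0)) ab)).
Qed.

(** Below [eps] the constant |Y|^gamma of [norm_lossB] is too large. Bounding each loss separately
    brings it down to eps^gamma, for an additive term of order eps^(1+gamma). *)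
Lemma norm_lossB_small K X Y eps : 0 <= K -> norm3 Y < eps -> norm3 (scale3 (P K X) X - scale3 (P K Y) Y) <=
 theta_cst nu c1 * (3 * (eps `^ gamma * eps) + 2 * (eps `^ gamma * norm3 (X - Y))).
move=> K0 se; have e0 := le_lt_trans (norm3_ge0 Y) se.
have d0 := norm3_ge0 (X - Y); have ge0 : 0 < eps `^ gamma by rewrite powR_gt0.
have B Z r : norm3 Z <= r -> 0 < r -> P K Z * norm3 Z <= theta_cst nu c1 * (r * r `^ gamma).
 move=> Zr r0; have [->|Z0] := eqVneq Z 0.
  by rewrite norm30 mulr0 mulr_ge0 ?(ltW th0)// mulr_ge0 ?powR_ge0// ltW.
 have z0 : 0 < norm3 Z by rewrite norm3_gt0. have a0 : 0 < norm3 Z `^ gamma by rewrite powR_gt0.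
 upto (ler_wpM2r (ltW z0) (loss_le Hk K0 a0)); rewrite -mulrA ler_pM2l// mulrC. exact: powgM_mono.
apply: (norm_scale_lossB (X := X) (Y := Y) K0); have hY := B Y eps (ltW se) e0.
have rs := norm3_dist X Y; rewrite /dist3 ler_norml in rs; case/andP: rs => rs1 rs2.
move: (B X) hY; move: (P K X) (P K Y) => x y {}B hY.
have [r2|r2] := leP (norm3 X) (2 * eps).
 have e2 : 0 < 2 * eps by lra. have h : (2 * eps) `^ gamma <= eps `^ gamma.
  by apply: (powg_anti e0); rewrite ler_peMl ?(ltW e0)// ler1n.
 apply: (loss_small_le (ltW th0) (ltW ge0) (ltW e0) d0 _ hY); left. by upto (B _ r2 e2); rewrite ler_pM2l// ler_pM2l.
have re : eps <= norm3 X by lra.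
have z0 : 0 < norm3 X by lra.
have h : norm3 X `^ gamma <= eps `^ gamma by exact: (powg_anti e0).
apply: (loss_small_le (ltW th0) (ltW ge0) (ltW e0) d0 _ hY); right.
upto (B _ (lexx _) z0); rewrite ler_pM2l//.
nra.
Qed.

Definition spread_bound : R := 4 * spread_cst nu c1 * (1 + ratio_cst nu c0 c1 ^+ 2).

Lemma spread_bound_ge0 : 0 <= spread_bound.
by apply: mulr_ge0; [apply: mulr_ge0 => //; exact: ltW|apply: addr_ge0 => //; exact: sqr_ge0]. Qed.

Lemma dot_le_norm X Y : dot3 X Y <= norm3 X * norm3 Y.
exact: le_trans (ler_norm _) (dot3_le X Y). Qed.

Lemma spread_dot K X Y : 0 <= K -> Y != 0 ->
 S K X Y * dot3 X Y <= spread_bound * norm3 Y `^ gamma * norm3 (X - Y) ^+ 2.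
move=> K0 Y0; have s0 : 0 < norm3 Y by rewrite norm3_gt0.
have b0 := powR_gt0 gamma s0.
have d0 := norm3_ge0 (X - Y).
have [->|X0] := eqVneq X 0.
 rewrite (_ : dot3 0 Y = 0) ?mulr0; last by rewrite /dot3 /=; ring.
 by rewrite mulr_ge0 ?sqr_ge0// mulr_ge0 ?(ltW b0)// spread_bound_ge0.
have r0 : 0 < norm3 X by rewrite norm3_gt0.
have a0 := powR_gt0 gamma r0.
have S0 := spread_ge0 Hk K (norm3 X `^ gamma) (norm3 Y `^ gamma).
upto (ler_wpM2l S0 (dot_le_norm X Y)).
have rs := norm3_dist X Y; rewrite /dist3 ler_norml in rs; case/andP: rs => rs1 rs2.
(* Since x times x^gamma is increasing, halving the argument at most doubles the power. *)
have half : (norm3 Y / 2) `^ gamma <= 2 * norm3 Y `^ gamma.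
 have x2 : 0 < norm3 Y / 2 by rewrite divr_gt0. have h : norm3 Y / 2 <= norm3 Y by lra.
 by have := @powgM_mono _ _ x2 h; rewrite -mulrA ler_pM2l//; lra.
have mr : norm3 Y <= 2 * norm3 X -> norm3 X `^ gamma <= 2 * norm3 Y `^ gamma.
 move=> h; apply: le_trans half; apply: powg_anti; first by rewrite divr_gt0. lra.
have m1 := @powg_anti _ (norm3 Y) r0; have m2 := @powg_anti _ (norm3 X) s0.
have m3 := @powgM_mono _ (norm3 Y) r0; have m4 := @powgM_mono _ (norm3 X) s0.
have le1 := @spread_le1 _ _ _ _ _ Hk K _ _ K0 b0; have le2 := @spread_le2 _ _ _ _ _ Hk K _ _ K0 b0.
have le1' := @spread_le1 _ _ _ _ _ Hk K _ _ K0 a0; have le2' := @spread_le2 _ _ _ _ _ Hk K _ _ K0 a0.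
move: {le1 le2 le1' le2'} (le1 (norm3 X `^ gamma)) (le2 (norm3 X `^ gamma)) (le1' (norm3 Y `^ gamma)) (le2' (norm3 Y `^ gamma)).
rewrite (spreadC beta K (norm3 Y `^ gamma)) /spread_bound.
move: (S K X Y) {S0} => t le1 le2 le1' le2'.
have [rs|sr] := leP (norm3 X) (norm3 Y).
 have ba := m1 rs. exact: (spread_split_le r0 s0 a0 b0 rs1 (ltW sp0) ba (m3 rs) mr (le1 ba) (le2 ba)).
have ab := m2 (ltW sr).
exact: (spread_split_ge r0 s0 a0 b0 rs2 (ltW sp0) (ltW sr) (m4 (ltW sr)) ab (le1' ab) (le2' ab)).
Qed.

Lemma spread_dot_small K X Y eps : 0 <= K -> norm3 Y < eps ->
 S K X Y * dot3 X Y <= spread_bound * eps `^ gamma * (eps ^+ 2 + 2 * norm3 (X - Y) ^+ 2).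
move=> K0 se; have e0 := le_lt_trans (norm3_ge0 Y) se.
have d0 := norm3_ge0 (X - Y); have ge0 : 0 < eps `^ gamma by rewrite powR_gt0.
have z0 : 0 <= spread_bound * eps `^ gamma * (eps ^+ 2 + 2 * norm3 (X - Y) ^+ 2).
 rewrite mulr_ge0//; first by rewrite mulr_ge0 ?spread_bound_ge0// ltW. routine.
have [X0|X0] := eqVneq X 0.
 have -> : dot3 X Y = 0 by rewrite X0 /dot3 /=; ring. by move: (S K X Y) => t; rewrite mulr0.
have [Y0|Y0] := eqVneq Y 0.
 have -> : dot3 X Y = 0 by rewrite Y0 /dot3 /=; ring. by move: (S K X Y) => t; rewrite mulr0.
have r0 : 0 < norm3 X by rewrite norm3_gt0.
have s0 : 0 < norm3 Y by rewrite norm3_gt0.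
have a0 := powR_gt0 gamma r0.
have b0 := powR_gt0 gamma s0.
have S0 := spread_ge0 Hk K (norm3 X `^ gamma) (norm3 Y `^ gamma).
upto (ler_wpM2l S0 (dot_le_norm X Y)).
have rs := norm3_dist X Y; rewrite /dist3 ler_norml in rs; case/andP: rs => rs1 rs2.
have h1 : S K X Y <= spread_cst nu c1 * (norm3 X `^ gamma + norm3 Y `^ gamma).
 have [ab|ba] := leP (norm3 X `^ gamma) (norm3 Y `^ gamma).
  rewrite spreadC; upto (spread_le1 Hk K0 a0 ab); rewrite ler_pM2l// lerDr; exact: ltW.
 upto (spread_le1 Hk K0 b0 (ltW ba)); rewrite ler_pM2l// lerDl; exact: ltW.
move: S0 h1; move: (S K X Y) => t S0 h1.
have hY : norm3 Y * norm3 Y `^ gamma <= eps * eps `^ gamma by apply: powgM_mono => //; exact: ltW.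
have hX : norm3 X * norm3 X `^ gamma <= (eps + norm3 (X - Y)) * eps `^ gamma.
 have [le|lt] := leP (norm3 X) eps.
  upto (powgM_mono r0 le); rewrite ler_pM2r//; lra.
 apply: ler_pM; [exact: ltW|exact: powR_ge0|lra|]. by apply: powg_anti => //; exact: ltW.
have rE : norm3 X <= eps + norm3 (X - Y) by rewrite -lerBlDl (le_trans _ rs2)// lerB// ltW.
rewrite /spread_bound; exact: (spread_small_le (ratio_cst nu c0 c1) r0 s0 a0 b0 d0 (ltW sp0) ge0 (ltW e0) se rE hX hY h1).
Qed.

Lemma norm3_parallelogram (D E : vec3 R) : let q := norm3 D ^+ 2 + norm3 E ^+ 2 in
 [/\ norm3 (D + E) * norm3 (D - E) <= q, norm3 (D + E) ^+ 2 <= 2 * q & norm3 (D - E) ^+ 2 <= 2 * q].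
have h : norm3 (D + E) ^+ 2 + norm3 (D - E) ^+ 2 = 2 * (norm3 D ^+ 2 + norm3 E ^+ 2).
 by rewrite !norm3_sqr /dot3 /=; ring.
move=> q; rewrite /q; have := sqr_ge0 (norm3 (D + E)); have := sqr_ge0 (norm3 (D - E)).
have := sqr_ge0 (norm3 (D + E) - norm3 (D - E)).
move: h; move: (norm3 (D + E)) (norm3 (D - E)) (norm3 D ^+ 2 + norm3 E ^+ 2) => x y z h; rewrite sqrrB => h1 h2 h3.
by split; lra.
Qed.

(** [tail_le] leaves the power 2 + 2 gamma/nu of |Y|. It is nonnegative because gamma + nu > 0 and
    at most 2 because gamma < 0, so the power is at most 1 + |Y|^2. *)
Lemma tail_moment_le K L Y : 1 <= K -> K <= L -> Y != 0 ->
 iint K L (fun z => 1 - cos (angle (z / norm3 Y `^ gamma))) * norm3 Y ^+ 2 <=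
 tail_cst nu c1 * (K `^ (1 - 2 / nu) * (1 + norm3 Y ^+ 2)).
move=> K1 KL Y0; have K0 : 0 < K by lra.
have s0 : 0 < norm3 Y by rewrite norm3_gt0.
have b0 := powR_gt0 gamma s0.
have nu0 : 0 < nu by case: Hk => /andP[].
upto (ler_wpM2r (sqr_ge0 _) (tail_le Hk K0 KL b0)).
set e := 2 / nu - 1.
have -> : tail_cst nu c1 * norm3 Y `^ gamma * (norm3 Y `^ gamma / K) `^ e * norm3 Y ^+ 2 =
  tail_cst nu c1 * (K `^ (1 - 2 / nu) * ((norm3 Y `^ gamma) `^ (2 / nu) * norm3 Y ^+ 2)).
 have -> : norm3 Y `^ gamma / K = norm3 Y `^ gamma * K `^ (- 1) by rewrite powR_inv1 ?ltW.
 rewrite powRM ?powR_ge0// -[(K `^ _) `^ _]powRrM mulN1r opprB.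
 rewrite (_ : 2 / nu = 1 + e); last by rewrite /e addrC subrK.
 rewrite [_ `^ (1 + e)]powRD ?(gt_eqF b0) ?implybT// powRr1 ?(ltW b0)//. lra.
rewrite ler_pM2l// ler_wpM2l ?powR_ge0// -powRrM.
have [s1|s1] := leP (norm3 Y) 1.
 apply: (@le_trans _ _ 1); last by nra. rewrite -(powR_mulrn 2 (ltW s0)) -powRD ?(gt_eqF s0) ?implybT//.
 have pos : 0 <= gamma * (2 / nu) + 2%:R.
  rewrite (_ : _ + _ = (gamma + nu) * (2 / nu)); last by field; rewrite gt_eqF.
  by rewrite mulr_ge0 ?(ltW Hgn)// divr_ge0 ?ltW.
 have := @ge0_ler_powR R _ pos (norm3 Y) 1; rewrite !nnegrE (ltW s0) ler01 powR1. lra.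
via (1 * norm3 Y ^+ 2); last by lra.
rewrite ler_wpM2r ?sqr_ge0//.
rewrite -[leRHS](powRr0 (norm3 Y)); apply: ler_powR; first exact: ltW.
by apply: mulr_le0_ge0; routine.
Qed.

Definition pair_cst : R := 3 * theta_cst nu c1 + 2 * spread_bound + tail_cst nu c1.

(** D separates the two particles and E their collision partners. Then 2D - (X - Y) = D + E while X
    - Y = D - E, and |D + E| |D - E| <= |D|^2 + |E|^2: this is why the quadratic cost closes. The
    two regimes are |Y| below and above [eps]. *)
Lemma TT_le K L D (E X Y : vec3 R) eps : 0 < eps -> 1 <= K -> K <= L -> X - Y = D - E ->
 TT K L D X Y <= pair_cst * (lsing eps (norm3 Y) * (norm3 D ^+ 2 + norm3 E ^+ 2) +
  eps `^ (2 + gamma) + K `^ (1 - 2 / nu) * (1 + norm3 Y ^+ 2)).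
move=> e0 K1 KL XY; have K0 : 0 < K by lra.
rewrite /TT XY (_ : D + D - (D - E) = D + E); last by rewrite opprB addrA addrAC addrK.
set W := scale3 _ _ - _; set Q := iint _ _ _; set q := _ + _ ^+ 2.
have [hq1 hq2 hq3] := norm3_parallelogram D E.
have t1 : - (2^-1 * dot3 (D + E) W) <= 2^-1 * (norm3 (D + E) * norm3 W).
 by rewrite -mulrN ler_pM2l ?invr_gt0// (le_trans (ler_norm _))// normrN dot3_le.
have t3 : dot3 D Y <= norm3 D * norm3 Y by exact: dot_le_norm.
have Q0 : 0 <= Q by exact: (tail_ge0 Hk).
have eg : eps `^ (2 + gamma) = eps ^+ 2 * eps `^ gamma.
 by rewrite powRD ?(gt_eqF e0) ?implybT// powR_mulrn// ltW.
have ge0 : 0 < eps `^ gamma by rewrite powR_gt0.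
have Kt0 : 0 <= K `^ (1 - 2 / nu) * (1 + norm3 Y ^+ 2).
 routine.
have q0 : 0 <= q by routine.
have nq : norm3 D ^+ 2 <= q by rewrite lerDl sqr_ge0.
have Qs2 : Q * norm3 Y ^+ 2 <= tail_cst nu c1 * (K `^ (1 - 2 / nu) * (1 + norm3 Y ^+ 2)).
 have [/eqP Y0|Y0] := boolP (Y == 0); last exact: tail_moment_le.
 have -> : Q * norm3 Y ^+ 2 = 0 by move: (Q) => Q'; rewrite Y0 norm30 expr0n mulr0.
 by apply: mulr_ge0 => //; exact: ltW.
have [se|es] := ltP (norm3 Y) eps.
 have -> : lsing eps (norm3 Y) = eps `^ gamma by rewrite /lsing max_r// ltW.
 have n1 := norm_lossB_small X (ltW K0) se; have n2 := spread_dot_small X (ltW K0) se.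
 have Qs : Q * norm3 Y <= theta_cst nu c1 * (eps * eps `^ gamma).
  have [/eqP Y0|Y0] := boolP (Y == 0).
   have -> : Q * norm3 Y = 0 by move: (Q) => Q'; rewrite Y0 norm30 mulr0. apply: mulr_ge0; first exact: ltW.
   routine.
  have s0 : 0 < norm3 Y by rewrite norm3_gt0. have b0 := powR_gt0 gamma s0.
  upto (ler_wpM2r (ltW s0) (tail_le_loss Hk (ltW K0) KL b0)).
  rewrite -(mulrA (theta_cst nu c1)) ler_pM2l// mulrC; exact: powgM_mono s0 (ltW se).
 rewrite eg -!norm3_sqr -(mulrA 2^-1); rewrite XY in n1 n2.
 exact: (energy_dissip_small (ltW th0) spread_bound_ge0 (ltW ta0) (ltW ge0) (ltW e0) Kt0 q0 Q0
  (norm3_ge0 D) (norm3_ge0 _) (norm3_ge0 _) t1 n1 hq1 hq2 hq3 nq n2 t3 Qs Qs2).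
have Y0 : Y != 0 by rewrite -norm3_gt0 (lt_le_trans e0).
have s0 : 0 < norm3 Y by rewrite norm3_gt0.
have b0 := powR_gt0 gamma s0.
have -> : lsing eps (norm3 Y) = norm3 Y `^ gamma by rewrite /lsing max_l.
have n1 := norm_lossB X (ltW K0) Y0; have n2 := spread_dot X (ltW K0) Y0.
rewrite -!norm3_sqr -(mulrA 2^-1); rewrite XY in n1 n2.
exact: (energy_dissip_large (ltW th0) spread_bound_ge0 (ltW ta0) (ltW b0) (powR_ge0 _ _) Kt0 q0 Q0
  (norm3_ge0 _) (norm3_ge0 _) t1 n1 hq1 hq3 nq n2 t3 (tail_le_loss Hk (ltW K0) KL b0) Qs2).
Qed.

Lemma pair_cst_ge0 : 0 <= pair_cst.
have h1 : 0 <= 3 * theta_cst nu c1 by apply: mulr_ge0 => //; exact: ltW.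
have h2 : 0 <= 2 * spread_bound by apply: mulr_ge0 => //; exact: spread_bound_ge0.
by rewrite /pair_cst; apply: addr_ge0; [routine|exact: ltW].
Qed.

Lemma coll_pair_le phi psi M k v w X Y K L (E : vec3 R) eps : bmeas phi -> bmeas psi -> 0 < eps -> 0 <= M ->
 1 <= K -> K <= L -> X - Y = v - w - E -> (forall x y, phi x + psi y <= costM M x y + k) ->
 coll K phi v X + coll L psi w Y <= 2 * pi * L * (costM M v w + k - phi v - psi w) +
 2 * pi * pair_cst * (lsing eps (norm3 Y) * (costM M v w + norm3 E ^+ 2) +
  eps `^ (2 + gamma) + K `^ (1 - 2 / nu) * (1 + norm3 Y ^+ 2)).
move=> bp bs e0 M0 K1 KL XY H; have K0 : 0 <= K by lra.
have := @coll_pair phi psi M k v w X Y K L bp bs K0 KL H; move/le_trans; apply.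
rewrite lerD2l -(mulrA (2 * pi)).
have p0 : 0 <= 2 * pi :> R by rewrite mulr_ge0 ?pi_ge0.
apply: (ler_wpM2l p0); case: ifPn => [lt|_].
 upto (TT_le e0 K1 KL XY); rewrite /costM min_l ?(ltW lt)//.
apply: (mulr_ge0 pair_cst_ge0); apply: addr_ge0; first apply: addr_ge0.
- apply: mulr_ge0; first routine. by apply: addr_ge0; [exact: costM_ge0|routine].
- exact: powR_ge0.
- routine.
Qed.

End Collision.
Local Transparent loss spread iint theta_cst spread_cst ratio_cst tail_cst.

Lemma leb2_rect (R : realType) (A B : set R) : measurable A -> measurable B ->
 leb2 R (A `*` B) = (leb A * leb B)%E.
move=> mA mB; exact: (@product_measure1E _ _ (measurableTypeR R) (measurableTypeR R) R
 (@lebesgue_measure R) (@lebesgue_measure R) A B mA mB).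
Qed.

Lemma lebesgue_itv_fin (R : realType) (a b : R) (A : set R) : measurable A ->
 leb (A `&` `[a, b]%classic) \is a fin_num.
move=> mA; rewrite ge0_fin_numE ?measure_ge0//.
apply: (@le_lt_trans _ _ (leb (`[a, b]%classic : set R))).
 have mI : measurable (`[a, b]%classic : set R) by [].
 apply: (@le_measure _ (measurableTypeR R)) (@subIsetr _ _ _); rewrite inE//. exact: measurableI.
by rewrite lebesgue_itvcc ltry.
Qed.

Lemma iint_indic (R : realType) (a b : R) (A : set R) : measurable A ->
 iint a b (\1_A) = fine (leb (A `&` `[a, b]%classic)).
by move=> mA; rewrite /iint /Rintegral (@integral_indic _ (measurableTypeR R)).
Qed.

Lemma leb2_iint (R : realType) (a b c d : R) (h : R * R -> R) : a <= b -> c <= d -> bmeas h ->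
 \int[leb2 R]_(x in (`[a, b]%classic `*` `[c, d]%classic : set (R * R))) h x =
 iint a b (fun x => iint c d (fun y => h (x, y))).
move=> ab cd; set D := (_ `*` _).
have mD : measurable (D : set (measurableTypeR R * measurableTypeR R)).
 by apply: measurableX; routine.
have fD : (leb2 R D < +oo)%E.
 rewrite leb2_rect; try exact: measurable_itv. by rewrite !lebesgue_itvcc -EFinM ltry.
have bI : bfun (fun h : R * R -> R => \int[leb2 R]_(x in D) h x).
 have -> : (fun h : R * R -> R => \int[leb2 R]_(x in D) h x) = (fun h => \int[leb2 R]_(x in D) (h x * 1)).
  by apply/funext => f; apply: eq_Rintegral => x _; rewrite mulr1.
 refine (@bfun_Rintegral _ (measurableTypeR R * measurableTypeR R)%type R (leb2 R) D (fun=> 1) mD _ (fun _ _ => ler01)).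
 apply: measurable_bounded_integrable => //.
 by exists 1; split; [exact: num_real|move=> x x1 y _; rewrite normr1 ltW].
have bJ := bfun_prod (iint_bfun a b) (iint_bfun c d).
move: h; apply: (bfun_eq_rect bI bJ) => A B mA mB.
have -> : (fun x : R => iint c d (fun y => \1_(A `*` B) (x, y))) = fun x => iint c d (\1_B) * \1_A x.
 apply/funext => x; rewrite mulrC -(bfunZ (iint_bfun c d) _ (bmeas_indic _ mB)).
 by apply: eq_iint => y _; exact: indicX.
rewrite (bfunZ (iint_bfun a b) _ (bmeas_indic _ mA)) !iint_indic// mulrC -fineM; try exact: lebesgue_itv_fin.
rewrite -leb2_rect; try by apply: measurableI => //; routine.
rewrite setXI /Rintegral (@integral_indic _ (measurableTypeR R * measurableTypeR R)%type)//.
exact: (@measurableX _ _ (measurableTypeR R) (measurableTypeR R)).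
Qed.

(** * Rotation invariance of the surface measure *)

Section Sphere.
Context {R : realType}.
Implicit Types (g : vec3 R -> R) (h : R -> R) (a b c s : R).
Definition sphI g : R := iint 0 pi (fun a => iint 0 (2 * pi) (fun b => g (sphere_point a b)) * sin a).

Lemma msphere_point d (T : measurableType d) (a b : T -> R) : mfun a -> mfun b ->
 mfun (fun t => sphere_point (a t) (b t)).
move=> ma mb; apply: mvec3_mk.
- routine.
- routine.
- exact: mcosf.
Qed.

Lemma sphI_bfun : bfun sphI.
have bI := @bfun_itv R 0 pi sin _ _.
have bP : bfun (fun h : R * R -> R => iint 0 pi (fun a => iint 0 (2 * pi) (fun b => h (a, b)) * sin a)).
 apply: (bfun_prod (bI _ _) (iint_bfun 0 (2 * pi))).
  by apply: itv_integrable; split; [routine|exists 1 => x; exact: sin_max].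
 by move=> x x0; exact: sin_ge0_pi.
have mS : mfun (fun z : R * R => sphere_point z.1 z.2) by exact: msphere_point.
exact: (bfun_comp bP mS).
Qed.

Lemma sphere_integralE g : bmeas g -> sphere_integral g = sphI g.
move=> bg; rewrite /sphere_integral.
rewrite (@leb2_iint R 0 pi 0 (2 * pi) (fun x => g (sphere_point x.1 x.2) * sin x.1)) ?pi_ge0 ?mulr_ge0 ?pi_ge0//.
 apply: eq_iint => a _; rewrite [RHS]mulrC. have ba : bmeas (fun b : R => g (sphere_point a b)).
  by apply: (bmeas_comp bg); exact: msphere_point.
 rewrite -(bfunZ (iint_bfun 0 (2 * pi)) _ ba). by apply: eq_iint => b _; rewrite mulrC.
apply: bmeasM; first by apply: (bmeas_comp bg); exact: msphere_point.
by split; [routine|exists 1 => x; exact: sin_max].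
Qed.

Definition rotY s (x : vec3 R) : vec3 R := vec3_mk (x.1.1 * cos s + x.2 * sin s) x.1.2 (x.2 * cos s - x.1.1 * sin s).

Definition smoothb h h' :=
 [/\ forall x : R, is_derive x 1 h (h' x), continuous h', exists M, forall x, `|h x| <= M &
   exists M, forall x, `|h' x| <= M].

Lemma smoothb_cont h h' : smoothb h h' -> continuous h.
move=> [dh _ _ _] x; apply: differentiable_continuous; rewrite -derivable1_diffP.
by [].
Qed.

Lemma smoothb_bmeas h h' : smoothb h h' -> bmeas h /\ bmeas h'.
move=> sh; have ch := smoothb_cont sh; case: sh => _ ch' bh bh'.
by split; split=> //; exact: continuous_measurable_fun.
Qed.

Lemma contD (f g : R -> R) : continuous f -> continuous g -> continuous (fun x => f x + g x).
by move=> cf cg x; apply: cvgD; [exact: cf|exact: cg]. Qed.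

Lemma contM (f g : R -> R) : continuous f -> continuous g -> continuous (fun x => f x * g x).
by move=> cf cg x; apply: cvgM; [exact: cf|exact: cg]. Qed.

Lemma contN (f : R -> R) : continuous f -> continuous (fun x => - f x).
by move=> cf x; apply: cvgN; exact: cf. Qed.

Lemma contF (f g : R -> R) : continuous f -> continuous g -> continuous (fun x => f (g x)).
by move=> cf cg x; apply: continuous_comp; [exact: cg|exact: cf]. Qed.

Lemma derivM3 (p q r p' q' r' h1 h2 h3 h1' h2' h3' k k' : R -> R) (x : R) :
 is_derive x 1 p (p' x) -> is_derive x 1 q (q' x) -> is_derive x 1 r (r' x) -> is_derive x 1 k (k' x) ->
 smoothb h1 h1' -> smoothb h2 h2' -> smoothb h3 h3' ->
 is_derive x 1 (fun x => k x * (h1 (p x) * (h2 (q x) * h3 (r x)))) (k' x * (h1 (p x) * (h2 (q x) * h3 (r x))) +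
   k x * (h1' (p x) * p' x * (h2 (q x) * h3 (r x)) + h1 (p x) * (h2' (q x) * q' x * h3 (r x) + h2 (q x) * (h3' (r x) * r' x)))).
move=> dp dq dr dk [d1 _ _ _] [d2 _ _ _] [d3 _ _ _].
have D1 : is_derive x 1 (fun x => h1 (p x)) (h1' (p x) * p' x) by exact: is_derive1_comp.
have D2 : is_derive x 1 (fun x => h2 (q x)) (h2' (q x) * q' x) by exact: is_derive1_comp.
have D3 : is_derive x 1 (fun x => h3 (r x)) (h3' (r x) * r' x) by exact: is_derive1_comp.
apply: is_derive_eq; rewrite /GRing.scale/=; ring.
Qed.

Lemma contM3 (p q r p' q' r' h1 h2 h3 h1' h2' h3' k k' : R -> R) :
 continuous p -> continuous q -> continuous r -> continuous p' -> continuous q' -> continuous r' ->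
 continuous k -> continuous k' -> smoothb h1 h1' -> smoothb h2 h2' -> smoothb h3 h3' ->
 continuous (fun x => k' x * (h1 (p x) * (h2 (q x) * h3 (r x))) +
   k x * (h1' (p x) * p' x * (h2 (q x) * h3 (r x)) + h1 (p x) * (h2' (q x) * q' x * h3 (r x) + h2 (q x) * (h3' (r x) * r' x)))).
move=> cp cq cr cp' cq' cr' ck ck' s1 s2 s3.
have c1 := contF (smoothb_cont s1) cp; have c2 := contF (smoothb_cont s2) cq.
have c3 := contF (smoothb_cont s3) cr.
case: s1 s2 s3 => _ d1 _ _ [_ d2 _ _] [_ d3 _ _].
have c1' := contF d1 cp; have c2' := contF d2 cq; have c3' := contF d3 cr.
have c23 := contM c2 c3.
apply: (contD (contM ck' (contM c1 c23))); apply: (contM ck).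
apply: (contD (contM (contM c1' cp') c23)); apply: (contM c1).
exact: (contD (contM (contM c2' cq') c3) (contM c2 (contM c3' cr'))).
Qed.

Lemma bmeasM3 d (T : measurableType d) (p q r p' q' r' k k' : T -> R) (h1 h2 h3 h1' h2' h3' : R -> R) :
 bmeas p -> bmeas q -> bmeas r -> bmeas p' -> bmeas q' -> bmeas r' -> bmeas k -> bmeas k' ->
 smoothb h1 h1' -> smoothb h2 h2' -> smoothb h3 h3' ->
 bmeas (fun x => k' x * (h1 (p x) * (h2 (q x) * h3 (r x))) +
   k x * (h1' (p x) * p' x * (h2 (q x) * h3 (r x)) + h1 (p x) * (h2' (q x) * q' x * h3 (r x) + h2 (q x) * (h3' (r x) * r' x)))).
move=> [mp _] [mq _] [mr _] bp' bq' br' bk bk' /smoothb_bmeas[d1 d1'] /smoothb_bmeas[d2 d2'] /smoothb_bmeas[d3 d3'].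
have c1 := bmeas_comp d1 mp; have c2 := bmeas_comp d2 mq; have c3 := bmeas_comp d3 mr.
have c1' := bmeas_comp d1' mp; have c2' := bmeas_comp d2' mq; have c3' := bmeas_comp d3' mr.
have c23 := bmeasM c2 c3.
apply: (bmeasD (bmeasM bk' (bmeasM c1 c23))); apply: (bmeasM bk).
apply: (bmeasD (bmeasM (bmeasM c1' bp') c23)); apply: (bmeasM c1).
exact: (bmeasD (bmeasM (bmeasM c2' bq') c3) (bmeasM c2 (bmeasM c3' br'))).
Qed.

Lemma bmeas_sinf d (T : measurableType d) (f : T -> R) : mfun f -> bmeas (fun t : T => sin (f t)).
by move=> mf; split; [routine|exists 1 => t; exact: sin_max]. Qed.

Lemma bmeas_cosf d (T : measurableType d) (f : T -> R) : mfun f -> bmeas (fun t : T => cos (f t)).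
by move=> mf; split; [routine|exists 1 => t; exact: cos_max]. Qed.

Section Flow.
Variables h1 h2 h3 h1' h2' h3' : R -> R.
Hypotheses (s1 : smoothb h1 h1') (s2 : smoothb h2 h2') (s3 : smoothb h3 h3').
Let P a b s : R := sin a * cos b * cos s + cos a * sin s.
Let Y a b : R := sin a * sin b.
Let Q a b s : R := cos a * cos s - sin a * cos b * sin s.
Let u a b s : R := h1 (P a b s) * (h2 (Y a b) * h3 (Q a b s)).
Let D a b s (p y q : R) : R := h1' (P a b s) * p * (h2 (Y a b) * h3 (Q a b s)) +
 h1 (P a b s) * (h2' (Y a b) * y * h3 (Q a b s) + h2 (Y a b) * (h3' (Q a b s) * q)).
Let Da a b s : R := cos a * cos b * u a b s +
 sin a * cos b * D a b s (cos a * cos b * cos s - sin a * sin s) (cos a * sin b) (- sin a * cos s - cos a * cos b * sin s).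
Let Db a b s : R := cos a * cos b * u a b s +
 cos a * sin b * D a b s (- (sin a * sin b * cos s)) (sin a * cos b) (sin a * sin b * sin s).
Let Ds a b s : R := sin a * D a b s (Q a b s) 0 (- P a b s).

(** The rotation field is divergence free for sin a da db: in spherical coordinates the s-derivative
    of the integrand is a total a-derivative minus a total b-derivative. *)
Lemma flow_DE a b s : Ds a b s = Da a b s - Db a b s.
rewrite /Ds /Da /Db /D /P /Q.
have ea : sin a ^+ 2 = 1 - cos a ^+ 2 by rewrite -(cos2Dsin2 a) addrC addKr.
have eb : sin b ^+ 2 = 1 - cos b ^+ 2 by rewrite -(cos2Dsin2 b) addrC addKr.
move: (h1 _) (h1' _) (h2 _) (h2' _) (h3 _) (h3' _) (u _ _ _) => x x' y y' z z' w.
move: (sin a) (cos a) (sin b) (cos b) (sin s) (cos s) ea eb => sa ca sb cb ss cs ea eb.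
ring: ea eb.
Qed.

Let c1 := smoothb_cont s1.
Let c2 := smoothb_cont s2.
Let c3 := smoothb_cont s3.
Let c1' : continuous h1'. Proof. by case: s1. Qed.
Let c2' : continuous h2'. Proof. by case: s2. Qed.
Let c3' : continuous h3'. Proof. by case: s3. Qed.

Lemma flow_dDs a b s : is_derive s 1 (fun s => sin a * u a b s) (Ds a b s).
apply: is_derive_eq.
 apply: (@derivM3 (fun s => P a b s) (fun=> Y a b) (fun s => Q a b s) (fun s => Q a b s) (fun=> 0) (fun s => - P a b s) h1 h2 h3 h1' h2' h3' (fun=> sin a) (fun=> 0)) => //.
 - by rewrite /P; apply: is_derive_eq; rewrite /Q /GRing.scale/=; ring.
 - by rewrite /Q; apply: is_derive_eq; rewrite /P /GRing.scale/=; ring.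
by rewrite /Ds /D; ring.
Qed.

Lemma flow_dDa a b s : is_derive a 1 (fun a => sin a * cos b * u a b s) (Da a b s).
apply: is_derive_eq.
 apply: (@derivM3 (fun a => P a b s) (fun a => Y a b) (fun a => Q a b s)
  (fun a => cos a * cos b * cos s - sin a * sin s) (fun a => cos a * sin b) (fun a => - sin a * cos s - cos a * cos b * sin s)
   h1 h2 h3 h1' h2' h3' (fun a => sin a * cos b) (fun a => cos a * cos b)) => //;
  by rewrite ?/P ?/Q ?/Y; apply: is_derive_eq; rewrite /GRing.scale/=; ring.
by [].
Qed.

Lemma flow_dDb a b s : is_derive b 1 (fun b => cos a * sin b * u a b s) (Db a b s).
apply: is_derive_eq.
 apply: (@derivM3 (fun b => P a b s) (fun b => Y a b) (fun b => Q a b s)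
  (fun b => - (sin a * sin b * cos s)) (fun b => sin a * cos b) (fun b => sin a * sin b * sin s)
   h1 h2 h3 h1' h2' h3' (fun b => cos a * sin b) (fun b => cos a * cos b)) => //;
  by rewrite ?/P ?/Q ?/Y; apply: is_derive_eq; rewrite /GRing.scale/=; ring.
by [].
Qed.

Ltac trig_cont := lazymatch goal with
 | |- continuous (fun x => @?f x + @?g x) => apply: (@contD f g); trig_cont
 | |- continuous (fun x => @?f x * @?g x) => apply: (@contM f g); trig_cont
 | |- continuous (fun x => - @?f x) => apply: (@contN f); trig_cont
 | |- continuous (fun x => sin x) => exact: continuous_sin
 | |- continuous (fun x => cos x) => exact: continuous_cos
 | |- continuous _ => exact: cst_continuous end.

Lemma flow_cDs a b : continuous (fun s => Ds a b s).
have := @contM3 (fun s => P a b s) (fun=> Y a b) (fun s => Q a b s) (fun s => Q a b s) (fun=> 0) (fun s => - P a b s)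
 h1 h2 h3 h1' h2' h3' (fun=> sin a) (fun=> 0) _ _ _ _ _ _ _ _ s1 s2 s3.
move=> H; have -> : (fun s => Ds a b s) = (fun s => 0 * u a b s + Ds a b s).
 by apply/funext => x; rewrite mul0r add0r.
by apply: H; rewrite ?/P ?/Q ?/Y /=; trig_cont.
Qed.

Lemma flow_cDa b s : continuous (fun a => Da a b s).
have := @contM3 (fun a => P a b s) (fun a => Y a b) (fun a => Q a b s)
  (fun a => cos a * cos b * cos s - sin a * sin s) (fun a => cos a * sin b) (fun a => - sin a * cos s - cos a * cos b * sin s)
   h1 h2 h3 h1' h2' h3' (fun a => sin a * cos b) (fun a => cos a * cos b) _ _ _ _ _ _ _ _ s1 s2 s3.
by apply; rewrite ?/P ?/Q ?/Y /=; trig_cont.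
Qed.

Lemma flow_cDb a s : continuous (fun b => Db a b s).
have := @contM3 (fun b => P a b s) (fun b => Y a b) (fun b => Q a b s)
  (fun b => - (sin a * sin b * cos s)) (fun b => sin a * cos b) (fun b => sin a * sin b * sin s)
   h1 h2 h3 h1' h2' h3' (fun b => cos a * sin b) (fun b => cos a * cos b) _ _ _ _ _ _ _ _ s1 s2 s3.
by apply; rewrite ?/P ?/Q ?/Y /=; trig_cont.
Qed.

Section FlowMeasurable.
Context d (T : measurableType d) (a b s : T -> R).
Hypotheses (ma : mfun a) (mb : mfun b) (ms : mfun s).
Let bsa := bmeas_sinf ma. Let bca := bmeas_cosf ma.
Let bsb := bmeas_sinf mb. Let bcb := bmeas_cosf mb.
Let bss := bmeas_sinf ms. Let bcs := bmeas_cosf ms.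

Lemma flow_bP : bmeas (fun t => P (a t) (b t) (s t)).
exact: (bmeasD (bmeasM (bmeasM bsa bcb) bcs) (bmeasM bca bss)). Qed.

Lemma flow_bY : bmeas (fun t => Y (a t) (b t)).
exact: (bmeasM bsa bsb). Qed.

Lemma flow_bQ : bmeas (fun t => Q (a t) (b t) (s t)).
exact: (bmeasB (bmeasM bca bcs) (bmeasM (bmeasM bsa bcb) bss)). Qed.

Lemma flow_bDa : bmeas (fun t => Da (a t) (b t) (s t)).
exact: (bmeasM3 flow_bP flow_bY flow_bQ (bmeasB (bmeasM (bmeasM bca bcb) bcs) (bmeasM bsa bss)) (bmeasM bca bsb)
 (bmeasB (bmeasM (bmeasN bsa) bcs) (bmeasM (bmeasM bca bcb) bss)) (bmeasM bsa bcb) (bmeasM bca bcb) s1 s2 s3).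
Qed.

Lemma flow_bDb : bmeas (fun t => Db (a t) (b t) (s t)).
exact: (bmeasM3 flow_bP flow_bY flow_bQ (bmeasN (bmeasM (bmeasM bsa bsb) bcs)) (bmeasM bsa bcb)
 (bmeasM (bmeasM bsa bsb) bss) (bmeasM bca bsb) (bmeasM bca bcb) s1 s2 s3).
Qed.

End FlowMeasurable.

(** Both total derivatives integrate to 0: sin a cos b u vanishes at a = 0 and a = pi, and cos a sin
    b u vanishes at b = 0 and b = 2 pi. *)
Lemma flow_invariant t : 0 <= t ->
 sphI (fun x => h1 (rotY t x).1.1 * (h2 (rotY t x).1.2 * h3 (rotY t x).2)) = sphI (fun x => h1 x.1.1 * (h2 x.1.2 * h3 x.2)).
move=> t0; have pi0 : 0 <= pi :> R by exact: pi_ge0.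
have pi20 : 0 <= 2 * pi :> R by lra.
have ba0 := iint_bfun 0 (pi : R); have bb0 := iint_bfun 0 (2 * pi : R); have bs0 := iint_bfun 0 t.
have Ia b s : iint 0 pi (fun a => Da a b s) = 0.
 rewrite (iint_FTC pi0 (fun a _ => flow_dDa a b s)) ?sinpi ?sin0 ?mul0r ?subrr//.
 by apply: continuous_subspaceT; exact: flow_cDa.
have Ib a s : iint 0 (2 * pi) (fun b => Db a b s) = 0.
 rewrite (iint_FTC pi20 (fun b _ => flow_dDb a b s)) ?mulr_natl ?sin2pi ?sin0 ?mulr0 ?mul0r ?subrr//.
 by apply: continuous_subspaceT; exact: flow_cDb.
have Is a b : iint 0 t (fun s => Ds a b s) = sin a * u a b t - sin a * u a b 0.
 rewrite (iint_FTC t0 (fun s _ => flow_dDs a b s))//. by apply: continuous_subspaceT; exact: flow_cDs.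
have mf (a : R) : bmeas (fun z : R * R => Db a z.1 z.2) by exact: flow_bDb.
have mDa : bmeas (fun z : R * (R * R) => Da z.1 z.2.1 z.2.2).
 by apply: flow_bDa => //; exact: mcomp.
have mDb : bmeas (fun z : R * (R * R) => Db z.1 z.2.1 z.2.2).
 by apply: flow_bDb => //; exact: mcomp.
have mu s : bmeas (fun z : R * R => u z.1 z.2 s).
 have d1 := smoothb_bmeas s1; have d2 := smoothb_bmeas s2; have d3 := smoothb_bmeas s3.
 have mP := @flow_bP _ (R * R)%type fst snd (fun=> s) mfst msnd (mcst _).
 have mY := @flow_bY _ (R * R)%type fst snd mfst msnd.
 have mQ := @flow_bQ _ (R * R)%type fst snd (fun=> s) mfst msnd (mcst _).
 exact: (bmeasM (bmeas_comp d1.1 mP.1) (bmeasM (bmeas_comp d2.1 mY.1) (bmeas_comp d3.1 mQ.1))).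
have E s : sphI (fun x => h1 (rotY s x).1.1 * (h2 (rotY s x).1.2 * h3 (rotY s x).2)) =
  iint 0 pi (fun a => iint 0 (2 * pi) (fun b => sin a * u a b s)).
 by apply: eq_iint => a _; rewrite mulrC -(bfunZ bb0 (sin a) (bmeas_pair1 a (mu s))).
have -> : sphI (fun x => h1 x.1.1 * (h2 x.1.2 * h3 x.2)) =
  sphI (fun x => h1 (rotY 0 x).1.1 * (h2 (rotY 0 x).1.2 * h3 (rotY 0 x).2)).
 by congr sphI; apply/funext => x; rewrite /rotY cos0 sin0 /= !mulr1 !mulr0 addr0 subr0.
have bAB := bfun_prod ba0 bb0; have bBS := bfun_prod bb0 bs0.
have mus s : bmeas (fun z : R * R => sin z.1 * u z.1 z.2 s).
 by apply: bmeasM => //; apply: bmeas_sinf.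
apply/eqP; rewrite -subr_eq0 !E -(bfunB bAB (mus t) (mus 0)) /=.
have -> : (fun a => iint 0 (2 * pi) (fun b => sin a * u a b t - sin a * u a b 0)) =
  (fun a => iint 0 (2 * pi) (fun b => iint 0 t (fun s => Da a b s)) - 0).
 apply/funext => a.
 have -> : (fun b => sin a * u a b t - sin a * u a b 0) = (fun b => iint 0 t (fun s => Da a b s - Db a b s)).
  by apply/funext => b; rewrite -Is; apply: eq_iint => s _; exact: flow_DE.
 rewrite (bfunB bBS (bmeas_pair1 a mDa) (bmeas_pair1 a mDb)) /=; congr (_ - _).
 rewrite (bfun_fubini bb0 bs0 (mf a)) /=.
 have -> : (fun y : R => iint 0 (2 * pi) (fun x => Db a x y)) = (fun=> 0) by apply/funext => s; rewrite Ib.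
 by rewrite iint_cst// mulr0.
have -> : (fun a => iint 0 (2 * pi) (fun b => iint 0 t (fun s => Da a b s)) - 0) =
  (fun a => iint 0 (2 * pi) (fun b => iint 0 t (fun s => Da a b s))) by apply/funext => a; rewrite subr0.
rewrite (bfun_fubini ba0 bBS mDa) /=.
have -> : (fun x : R => iint 0 t (fun y => iint 0 pi (fun x0 => Da x0 x y))) = (fun=> 0).
 apply/funext => b; have -> : (fun y => iint 0 pi (fun x0 => Da x0 b y)) = (fun=> 0) by apply/funext => s; rewrite Ia.
 by rewrite iint_cst// mulr0.
by rewrite iint_cst// mulr0.
Qed.

End Flow.

(* A smooth approximation of the indicator of [c, +oo[. *)
Definition soft c (n : nat) (x : R) : R := expR (- expR (- (n%:R ^+ 2 * (x - c) + n%:R))).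

Lemma soft_smooth c n : exists h', smoothb (soft c n) h'.
pose e x : R := expR (- (n%:R ^+ 2 * (x - c) + n%:R)).
have de (x : R) : is_derive x 1 e (- n%:R ^+ 2 * e x).
 have dl : is_derive x 1 (fun x : R => - (n%:R ^+ 2 * (x - c) + n%:R)) (- n%:R ^+ 2).
  by apply: is_derive_eq; rewrite /GRing.scale/=; ring.
 have := @is_derive1_comp R expR (fun x : R => - (n%:R ^+ 2 * (x - c) + n%:R)) x _ _ (is_derive_expR _) dl.
 by rewrite mulrC.
have ce : continuous e.
 move=> x; apply: differentiable_continuous; rewrite -derivable1_diffP; by [].
exists (fun x => expR (- e x) * (n%:R ^+ 2 * e x)); split.
- move=> x; have dl : is_derive x 1 (fun x : R => - e x) (n%:R ^+ 2 * e x).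
  by apply: is_derive_eq; rewrite mulNr opprK.
 exact: (@is_derive1_comp R expR (fun x : R => - e x) x _ _ (is_derive_expR _) dl).
- apply: contM; last by apply: contM => //; exact: cst_continuous.
 by apply: (contF (@continuous_expR R)); exact: contN.
- exists 1 => x; rewrite ger0_norm ?expR_ge0// -[leRHS]expR0 ler_expR oppr_le0; routine.
- exists (n%:R ^+ 2) => x; rewrite ger0_norm; last first.
  routine.
 rewrite mulrCA -[leRHS]mulr1 ler_wpM2l ?sqr_ge0// expRN mulrC ler_pdivrMr ?expR_gt0// mul1r.
 by apply: le_trans (expR_ge1Dx _); rewrite lerDr.
Qed.

Lemma expRN_le (x : R) : 0 <= x -> expR (- x) <= (1 + x)^-1.
by move=> x0; rewrite expRN lef_pV2 ?posrE ?expR_gt0 ?ltr_wpDr ?expR_ge1Dx//. Qed.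

(** The summand n in the exponent forces the limit 1 at x = c itself; for x < c it is beaten by the
    factor n^2. *)
Lemma soft_cvg c x : soft c n x @[n --> \oo] --> (\1_(`[c, +oo[%classic) x : R).
have H0 : (n.+1%:R^-1 : R) @[n --> \oo] --> 0 by exact: cvg_harmonic.
have nb n : 0 <= soft c n x <= 1.
 by rewrite expR_ge0/= -[leRHS]expR0 ler_expR oppr_le0 expR_ge0.
rewrite indicE mem_setE in_itv/= andbT; case: leP => [cx|xc] /=.
 apply: (@squeeze_cvgr _ _ _ _ (fun n => 1 - n.+1%:R^-1) (fun=> 1)).
 - near=> n; have /andP[_ ->] := nb n; rewrite andbT. apply: le_trans (expR_ge1Dx _); rewrite lerD2l lerN2.
  have y : n%:R <= n%:R ^+ 2 * (x - c) + n%:R :> R by nra. via (expR (- n%:R)); first by rewrite ler_expR lerN2.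
  by rewrite (le_trans (expRN_le _))// -natr1 addrC.
 - by rewrite -[X in _ --> X]subr0; apply: cvgB => //; exact: cvg_cst.
 - exact: cvg_cst.
apply: (@squeeze_cvgr _ _ _ _ (fun=> 0) (fun n => n.+1%:R^-1)) => //; last exact: cvg_cst.
near=> n; have /andP[-> _] /= := nb n.
have nd : 2 <= n%:R * (c - x).
 rewrite -ler_pdivrMr ?subr_gt0//; near: n; exact: nbhs_infty_ger.
have n0 : 0 <= n%:R :> R by [].
have y : n%:R ^+ 2 * (x - c) + n%:R <= - n%:R.
 have := ler_wpM2l n0 nd; rewrite expr2; move: (n%:R) => m; lra.
rewrite /soft; set E := expR (- (_ + _)); have E1 : n%:R <= E.
 via (expR n%:R); first by apply: le_trans (expR_ge1Dx _); rewrite lerDr. by rewrite ler_expR lerNr.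
via (expR (- n%:R)); first by rewrite ler_expR lerN2.
by rewrite (le_trans (expRN_le _))// -natr1 addrC.
Unshelve. all: by end_near. Qed.

Lemma msoft c n : mfun (soft c n).
by have [h' /smoothb_bmeas[[]]] := soft_smooth c n. Qed.

Lemma soft_le c n x : `|soft c n x| <= 1.
by rewrite ger0_norm ?expR_ge0// -[leRHS]expR0 ler_expR oppr_le0 expR_ge0. Qed.

Lemma bfun_eq_rays (I J : (R -> R) -> R) : bfun I -> bfun J ->
 (forall c, I (\1_(`[c, +oo[%classic)) = J (\1_(`[c, +oo[%classic))) -> forall f, bmeas f -> I f = J f.
move=> bI bJ E; apply: (bfun_eq_ray bI bJ) => //.
have C (x : R) : \1_(`[- n%:R, +oo[%classic) x @[n --> \oo] --> (1 : R).
 apply: cvg_near_cst; near=> n; rewrite indicE mem_setE in_itv/= andbT. suff -> : - n%:R <= x by [].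
 rewrite lerNl; near: n; exact: nbhs_infty_ger.
have M n : mfun (\1_(`[- n%:R, +oo[%classic) : R -> R).
 routine.
have L n (x : R) : `|\1_(`[- n%:R, +oo[%classic) x : R| <= 1.
 by rewrite indicE; case: (_ \in _); rewrite ?normr1 ?normr0.
have h1 := bfun_cvg bI M L C; have h2 := bfun_cvg bJ M L C.
have e : (fun n : nat => I (\1_(`[- n%:R, +oo[%classic))) = (fun n => J (\1_(`[- n%:R, +oo[%classic))).
 by apply/funext => n; rewrite E.
by rewrite e in h1; exact: (cvg_unique _ h1 h2).
Unshelve. all: by end_near. Qed.

Lemma bfun_eq_soft (I J : (R -> R) -> R) : bfun I -> bfun J ->
 (forall c n, I (soft c n) = J (soft c n)) -> forall f, bmeas f -> I f = J f.
move=> bI bJ E; apply: bfun_eq_rays => // c.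
have h1 := bfun_cvg bI (msoft c) (@soft_le c) (@soft_cvg c).
have h2 := bfun_cvg bJ (msoft c) (@soft_le c) (@soft_cvg c).
have e : (fun n : nat => I (soft c n)) = (fun n => J (soft c n)) by apply/funext => n; exact: E.
by rewrite e in h1; exact: (cvg_unique _ h1 h2).
Qed.

Lemma bfun_weight_comp d d' (T : measurableType d) (T' : measurableType d') (I : (T -> R) -> R) (f : T -> T') (w : T -> R) :
 bfun I -> mfun f -> bmeas w -> (forall x, 0 <= w x) -> bfun (fun h : T' -> R => I (fun t => w t * h (f t))).
by move=> bI mf bw w0; exact: (bfun_comp (bfun_weight bI bw w0) mf). Qed.

Definition determining d (T : measurableType d) (X : Type) (f : X -> T -> R) := forall I J : (T -> R) -> R,
 bfun I -> bfun J -> (forall x, I (f x) = J (f x)) -> forall h : T -> R, bmeas h -> I h = J h.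

(** Freezing one factor as a weight leaves a functional of the other variable, to which the property
    of that variable applies. Nonnegativity of [f2] keeps the weighted functional positive. *)
Lemma determining_prod d1 d2 (T1 : measurableType d1) (T2 : measurableType d2) (X1 X2 : Type)
 (f1 : X1 -> T1 -> R) (f2 : X2 -> T2 -> R) : (forall x, bmeas (f2 x)) -> (forall x y, 0 <= f2 x y) ->
 determining f1 -> determining f2 -> determining (fun (k : X1 * X2) (z : T1 * T2) => f1 k.1 z.1 * f2 k.2 z.2).
move=> b2 p2 D1 D2 I J bI bJ E.
have E1 x2 (g : T1 -> R) : bmeas g -> I (fun z => f2 x2 z.2 * g z.1) = J (fun z => f2 x2 z.2 * g z.1).
 have bw : bmeas (fun z : T1 * T2 => f2 x2 z.2) by apply: bmeas_comp (b2 x2) _.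
 have w0 (z : T1 * T2) : 0 <= f2 x2 z.2 by [].
 move: g; apply: (D1 _ _ (bfun_weight_comp bI mfst bw w0) (bfun_weight_comp bJ mfst bw w0)) => x1.
 have -> : (fun t : T1 * T2 => f2 x2 t.2 * f1 x1 t.1) = fun t => f1 x1 t.1 * f2 x2 t.2 by apply/funext => t; rewrite mulrC.
 exact: (E (x1, x2)).
apply: (bfun_eq_rect bI bJ) => A B mA mB.
have bw : bmeas (fun z : T1 * T2 => \1_A z.1 : R) by apply: bmeas_comp (bmeas_indic _ mA) _.
have w0 (z : T1 * T2) : 0 <= \1_A z.1 :> R by rewrite indicE.
have -> : \1_(A `*` B) = (fun z => \1_A z.1 * \1_B z.2) :> (T1 * T2 -> R) by apply/funext => -[x y]; exact: indicX.
apply: (D2 _ _ (bfun_weight_comp bI msnd bw w0) (bfun_weight_comp bJ msnd bw w0)) (bmeas_indic R mB) => x2.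
have -> : (fun t : T1 * T2 => \1_A t.1 * f2 x2 t.2) = fun t => f2 x2 t.2 * \1_A t.1 by apply/funext => t; rewrite mulrC.
exact/E1/bmeas_indic.
Qed.

Lemma bfun3_eq_soft (I J : (vec3 R -> R) -> R) : bfun I -> bfun J -> (forall c1 c2 c3 n1 n2 n3,
  I (fun x => soft c1 n1 x.1.1 * (soft c2 n2 x.1.2 * soft c3 n3 x.2)) =
  J (fun x => soft c1 n1 x.1.1 * (soft c2 n2 x.1.2 * soft c3 n3 x.2))) -> forall f, bmeas f -> I f = J f.
move=> bI bJ E; pose s (k : R * nat) := soft k.1 k.2.
have sD : determining s by move=> I' J' bI' bJ' H; apply: bfun_eq_soft => // c n; exact: (H (c, n)).
have bs k : bmeas (s k) by split; [exact: msoft|exists 1; exact: soft_le].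
have s0 k x : 0 <= s k x by exact: expR_ge0.
apply: (determining_prod bs s0 (determining_prod bs s0 sD sD) sD bI bJ) => -[[[a1 n1] [a2 n2]] [a3 n3]] /=.
have -> : (fun z : vec3 R => s (a1, n1) z.1.1 * s (a2, n2) z.1.2 * s (a3, n3) z.2) =
 fun z => soft a1 n1 z.1.1 * (soft a2 n2 z.1.2 * soft a3 n3 z.2) by apply/funext => z; rewrite mulrA.
exact: E.
Qed.

Lemma mrotY s : mfun (rotY s).
have [m1 m2 m3] := mvec3_coord (@measurable_id _ (vec3 R) setT).
apply: mvec3_mk => //.
- by apply: mfunD; apply: mfunM => //; routine.
- by apply: mfunB; apply: mfunM => //; routine.
Qed.

Lemma sphI_rotY g s : bmeas g -> 0 <= s -> sphI (fun x => g (rotY s x)) = sphI g.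
move=> bg s0; move: g bg; apply: (bfun3_eq_soft (bfun_comp sphI_bfun (mrotY s)) sphI_bfun).
move=> c1 c2 c3 n1 n2 n3.
have [h1' S1] := soft_smooth c1 n1; have [h2' S2] := soft_smooth c2 n2; have [h3' S3] := soft_smooth c3 n3.
exact: (flow_invariant S1 S2 S3 s0).
Qed.

Definition rotZ s (x : vec3 R) : vec3 R :=
 vec3_mk (x.1.1 * cos s - x.1.2 * sin s) (x.1.1 * sin s + x.1.2 * cos s) x.2.

Lemma mrotZ s : mfun (rotZ s).
have [m1 m2 m3] := mvec3_coord (@measurable_id _ (vec3 R) setT).
apply: mvec3_mk => //.
- by apply: mfunB; apply: mfunM => //; routine.
- by apply: mfunD; apply: mfunM => //; routine.
Qed.

Lemma sphI_rotZ g s : bmeas g -> 0 <= s <= 2 * pi -> sphI (fun x => g (rotZ s x)) = sphI g.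
move=> bg hs; apply: eq_iint => a _; congr (_ * _).
have bb : bmeas (fun b : R => g (sphere_point a b)).
 by apply: (bmeas_comp bg); exact: msphere_point.
rewrite -[RHS](iint_periodic bb _ hs); last by move=> b; rewrite /sphere_point cos_2pi sin_2pi.
apply: eq_iint => b _; congr g; rewrite /rotZ /sphere_point /= cosD sinD.
by apply: vec3_eq => /=; ring.
Qed.

End Sphere.

Lemma sphere_axis (R : realType) (k : vec3 R) : dot3 k k = 1 ->
 exists a b, [/\ 0 <= a <= 2 * pi, 0 <= b <= 2 * pi & sphere_point a b = k].
case: k => -[x y] z; rewrite /dot3/= => kk.
pose r := Num.sqrt (x ^+ 2 + y ^+ 2).
have r2 : r ^+ 2 = x ^+ 2 + y ^+ 2 by rewrite sqr_sqrtr ?addr_ge0 ?sqr_ge0.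
have zr : z ^+ 2 + r ^+ 2 = 1 by lra.
have [a ha [ca sa]] := exists_angle zr.
have [r0|r0] := eqVneq r 0.
 exists a, 0; rewrite lexx mulr_ge0 ?pi_ge0//; split => //. have := r2; rewrite r0 expr0n/= => /esym/eqP.
 rewrite paddr_eq0 ?sqr_ge0// !sqrf_eq0 => /andP[/eqP-> /eqP->]. by rewrite /sphere_point ca sa r0 !mul0r.
have xyr : (x / r) ^+ 2 + (y / r) ^+ 2 = 1 by rewrite !expr_div_n -mulrDl -r2 divff// expf_neq0.
have [b hb [cb sb]] := exists_angle xyr.
exists a, b; split => //; rewrite /sphere_point ca sa cb sb.
by rewrite ![r * _]mulrC !divfK.
Qed.

(** [rotY] and [rotZ] carry the pole to [k], so spherical coordinates about the pole become
    coordinates about [k]. *)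
Lemma sphI_frame (R : realType) (g : vec3 R -> R) (k : vec3 R) : bmeas g -> dot3 k k = 1 ->
 exists e, [/\ dot3 e e = 1, dot3 e k = 0 & sphI g = iint 0 pi (fun th => iint 0 (2 * pi) (fun ph =>
   g (scale3 (cos th) k + scale3 (sin th) (scale3 (cos ph) e + scale3 (sin ph) (cross3 k e)))) * sin th)].
move=> bg /sphere_axis[a [b [ha hb <-]]].
have /andP[a0 _] := ha.
have ea : sin a ^+ 2 = 1 - cos a ^+ 2 by rewrite -(cos2Dsin2 a) addrC addKr.
have eb : sin b ^+ 2 = 1 - cos b ^+ 2 by rewrite -(cos2Dsin2 b) addrC addKr.
exists (vec3_mk (cos a * cos b) (cos a * sin b) (- sin a)); split.
- by rewrite /dot3 /=; move: ea eb; move: (cos a) (sin a) (cos b) (sin b) => ca sa cb sb ea eb; ring: ea eb.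
- by rewrite /dot3 /=; move: ea eb; move: (cos a) (sin a) (cos b) (sin b) => ca sa cb sb ea eb; ring: ea eb.
rewrite -(sphI_rotZ bg hb) -(sphI_rotY (bmeas_comp bg (mrotZ b)) a0).
apply: eq_iint => th _; congr (_ * _); apply: eq_iint => ph _; congr g.
rewrite /rotZ /rotY /sphere_point; apply: vec3_eq => /=;
 move: ea eb; move: (cos a) (sin a) (cos b) (sin b) (cos th) (sin th) (cos ph) (sin ph) => ca sa cb sb ct st cp sp ea eb; ring: ea eb.
Qed.

(** * The particle generator in the variable z *)

Section SphereCollision.
Context (R : realType) (I : vec3 R -> vec3 R) (gamma nu c0 c1 : R) (beta : R -> R).
Hypotheses (HI : frame_choice I) (Hk : kernel_bounds nu c0 c1 beta).
Implicit Types (v w X k : vec3 R) (psi : vec3 R -> R) (G K th x : R).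
(** Makes the arccosine monotone, hence measurable, on the whole line; it is the identity on scalar
    products of unit vectors. *)
Definition clip (c : R) : R := Num.max (-1) (Num.min 1 c).

Lemma clip_bound c : -1 <= clip c <= 1.
by rewrite le_max lexx /= ge_max (le_trans (lerN10 R) ler01) ge_min lexx. Qed.

Lemma clip_id c : -1 <= c <= 1 -> clip c = c.
by move=> /andP[h1 h2]; rewrite /clip min_r// max_r. Qed.

Lemma macos_clip : mfun (fun c : R => acos (clip c)).
apply: nonincreasing_measurable => // s t st.
have := clip_bound s; have := clip_bound t.
have : clip s <= clip t.
 rewrite /clip ge_max !le_max lexx /=; apply/orP; right. by rewrite le_min !ge_min lexx st /= orbT.
move: (clip s) (clip t) => x y xy hy hx.
have := @ltr_cos R (acos x) (acos y).
rewrite !in_itv/= !acos_ge0// !acos_lepi// !acosK ?in_itv// => /(_ isT isT) h.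
lra.
Qed.

(** The angular factor of [collisionB] with the cutoff and the vanishing of beta beyond pi/2 built
    in. It is bounded, since sin x >= sin G on its support. *)
Definition angular_weight G x : R := if x \in `[G, pi / 2]%classic then beta x / sin x else 0.

Lemma bmeas_angular_weight G : 0 < G <= pi / 2 -> bmeas (angular_weight G).
move=> /andP[G0 Gp].
have sG : 0 < sin G.
 by apply: sin_gt0_pi; rewrite G0 (le_lt_trans Gp)// ltr_pdivrMr// ltr_pMr ?pi_gt0// ltr1n.
have sin_mono x : G <= x <= pi / 2 -> sin G <= sin x.
 move=> /andP[Gx xp]; have := @ltr_sin R x G; rewrite !in_itv/= xp (le_trans Gx xp). lra.
split.
 have mI : measurable (`[G, pi / 2]%classic : set R) by [].
 have -> : angular_weight G = (fun x => beta x / sin x) \_ `[G, pi / 2].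
  by [].
 apply/(measurable_restrictT _ mI). apply: (eq_measurable_fun (fun x => beta x * sin x `^ (- 1))).
  by move=> x; rewrite inE/= in_itv/= => hx; rewrite powR_inv1// (le_trans (ltW sG))// sin_mono.
 apply: mfunM; first exact: (mbeta Hk).
 apply: measurable_funTS; apply: (mcomp (@measurable_powR R (- 1))); routine.
have b0 : 0 <= c1 * G `^ (- 1 - nu) / sin G.
 by rewrite divr_ge0 ?(ltW sG)// mulr_ge0 ?powR_ge0//; case: Hk => _ [_ /ltW].
exists (c1 * G `^ (- 1 - nu) / sin G) => x; rewrite /angular_weight; case: ifPn => [|_]; last by rewrite normr0.
rewrite inE/= in_itv/= => hx; have sGx := sin_mono _ hx; have s0 := lt_le_trans sG sGx.
have /andP[Gx xp] := hx; have x0 := lt_le_trans G0 Gx.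
have bx : 0 <= beta x by apply: (beta_ge0 Hk); rewrite x0.
rewrite ger0_norm ?divr_ge0 ?(ltW s0)//; apply: ler_pM => //; first routine.
 upto (beta_le Hk _); first by lra. rewrite ler_wpM2l//; first by case: Hk => _ [_ /ltW].
 apply: powR_le_neg => //; case: Hk => /andP[nu0 _]; lra.
by rewrite lef_pV2 ?posrE.
Qed.

Lemma collisionB_weight v w s K : v != w -> 0 < K -> dot3 s s = 1 ->
 let a := norm3 (v - w) `^ gamma in let th := deviation_angle v w s in
 collisionB gamma beta (norm3 (v - w)) th * (angularG beta (K / a) <= th)%R%:R =
 a * angular_weight (angularG beta (K / a)) (acos (clip (dot3 (scale3 (norm3 (v - w))^-1 (v - w)) s))).
move=> vw K0 ss a th.
have X0 : 0 < norm3 (v - w) by rewrite norm3_gt0 subr_eq0.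
have a0 : 0 < a by rewrite powR_gt0.
have [/andP[G0 Gp] _] := angularGP Hk (divr_ge0 (ltW K0) (ltW a0)).
have cb : -1 <= dot3 (scale3 (norm3 (v - w))^-1 (v - w)) s <= 1.
 rewrite -ler_norml (le_trans (dot3_le _ _))// norm3Z gtr0_norm ?invr_gt0// mulVf ?gt_eqF// mul1r.
 by rewrite /norm3 ss sqrtr1.
have thE : th = acos (clip (dot3 (scale3 (norm3 (v - w))^-1 (v - w)) s)).
 by rewrite clip_id// /th /deviation_angle dot3ZL mulrC.
have : 0 <= th <= pi by rewrite thE clip_id// acos_ge0// acos_lepi.
rewrite -thE /angular_weight /collisionB mem_setE in_itv/= -/a => /andP[th0 thp].
case: leP => [Gth|] /=; last by rewrite mulr0n !mulr0.
rewrite mulr1 -mulrA; case: leP => // pth.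
by case: Hk => _ _ _ _ -> //; rewrite ?mul0r// (ltW pth).
Qed.

Lemma iint_angular_weight G F : 0 < G <= pi / 2 ->
 iint 0 pi (fun x => F x * angular_weight G x * sin x) = iint G (pi / 2) (fun x => F x * beta x).
move=> /andP[G0 Gp]; have mI a b : measurable (`[a, b]%classic : set R) by [].
have pp : pi / 2 <= pi :> R by lra.
have -> : iint G (pi / 2) (fun x => F x * beta x) =
  \int[leb]_(x in `[0, pi] `&` `[G, pi / 2]) (F x * beta x).
 congr (\int[_]_(x in _) _); apply/seteqP; split => x /=; rewrite !in_itv/=.
  lra.
 lra.
rewrite /iint /Rintegral integral_mkcondr; congr fine.
apply: eq_integral => x _; rewrite patchE /angular_weight.
case: ifPn => [|_]; last by rewrite mulr0 mul0r.
rewrite inE/= in_itv/= => /andP[h1 h2]; congr (_%:E); rewrite -!mulrA; congr (_ * _).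
rewrite mulVf ?mulr1// gt_eqF// sin_gt0_pi// (lt_le_trans G0)//=.
lra.
Qed.

(** In spherical coordinates about v - w the sine of the surface element cancels the one in
    [collisionB]; the substitution [iint_angle] then turns the deviation angle into [z] in
    [0, K]. *)
Lemma sphere_integral_coll psi v w K : bmeas psi -> v != w -> 0 < K ->
 sphere_integral (fun s => let th := deviation_angle v w s in
  (psi (post_collision v w s) - psi v) * collisionB gamma beta (norm3 (v - w)) th *
  (angularG beta (K / norm3 (v - w) `^ gamma) <= th)%R%:R) = coll I gamma beta K psi v (v - w).
move=> bp vw K0.
have X0 : 0 < norm3 (v - w) by rewrite norm3_gt0 subr_eq0.
set a := norm3 (v - w) `^ gamma; have a0 : 0 < a by rewrite powR_gt0.
have [/andP[G0 Gp] _] := angularGP Hk (divr_ge0 (ltW K0) (ltW a0)).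
have Gpp : 0 < angularG beta (K / a) <= pi / 2 by lra.
set G := angularG beta (K / a) in G0 Gp Gpp *.
set k := scale3 (norm3 (v - w))^-1 (v - w).
have kk : dot3 k k = 1.
 by rewrite /k dot3ZL dot3ZR -norm3_sqr; field; rewrite gt_eqF.
have kX : scale3 (norm3 (v - w)) k = v - w.
 by apply: vec3_eq; rewrite /k /scale3 /= mulrA mulfV ?mul1r// gt_eqF.
pose g s := a * ((psi (post_collision v w s) - psi v) * angular_weight G (acos (clip (dot3 k s)))).
have mpc : mfun (fun s => post_collision v w s).
 by apply: mvec3D; [exact: mcst|apply: mscale3 => //; exact: mcst].
have bg : bmeas g.
 apply: bmeasZ; apply: bmeasM; first by apply: bmeasB; [exact: (bmeas_comp bp)|exact: bmeas_cst].
 apply: (bmeas_comp (bmeas_angular_weight Gpp)). apply: (mcomp macos_clip).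
 by apply: mdot3 => //; exact: mcst.
transitivity (sphere_integral g).
 apply: eq_Rintegral => x _; congr (_ * _); rewrite /g -mulrA collisionB_weight//.
  by rewrite mulrCA.
 case: x => x y; have e1 := cos2Dsin2 x; have e2 := cos2Dsin2 y; rewrite /dot3 /sphere_point /=. nra.
have [e [ee ek ->]] : exists e, [/\ dot3 e e = 1, dot3 e k = 0 & sphere_integral g =
  iint 0 pi (fun th => iint 0 (2 * pi) (fun ph =>
   g (scale3 (cos th) k + scale3 (sin th) (scale3 (cos ph) e + scale3 (sin ph) (cross3 k e)))) * sin th)].
 by rewrite sphere_integralE//; exact: sphI_frame.
have eX : dot3 e (v - w) = 0 by rewrite -kX dot3ZR ek mulr0.
rewrite /coll -/a (iint_angle Hk a0 (ltW K0)); last first.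
 exact: (bmeas_circ1 HI).
rewrite -(iint_angular_weight _ Gpp) -/G.
have bc := bmeas_circ1 HI v (v - w) bp.
have bw := bmeas_angular_weight Gpp.
have bsn := bmeas_sinf (@measurable_id _ R setT).
rewrite -(bfunZ (iint_bfun 0 pi) a (bmeasM (bmeasM bc bw) bsn)).
apply: eq_iint => th th0; rewrite mulrA; congr (_ * _).
have bj := bmeas_jmpe e v (v - w) th bp.
rewrite (circE HI _ _ bp ee eX) [iint _ _ _ * angular_weight _ _]mulrC mulrA -(bfunZ (iint_bfun 0 (2 * pi)) _ bj).
apply: eq_iint => ph _; rewrite /g.
set s := (scale3 (cos th) k + _); have -> : dot3 k s = cos th.
 have ke : dot3 k e = 0 by rewrite dot3C. have kf : dot3 k (cross3 k e) = 0 by rewrite /dot3 /cross3 /=; ring.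
 rewrite /s; move: kk ke kf {s}; move: (cross3 k e) => f; move: (k) => k' kk' ke' kf'.
 by rewrite !dot3E kk' ke' kf' !mulr0 !addr0 mulr1 mulr0 addr0.
rewrite clip_id ?cos_geN1 ?cos_le1// cosK ?in_itv//.
have -> : post_collision v w s = v + jmpe e (v - w) th ph.
 have e1 : post_collision v w s = scale3 2^-1 (v + w) + scale3 2^-1 (scale3 (norm3 (v - w)) s).
  by rewrite /post_collision; apply: vec3_eq; rewrite /scale3 /=; ring.
 have e2 : scale3 (norm3 (v - w)) s = scale3 (cos th) (v - w) +
   scale3 (sin th) (scale3 (cos ph * norm3 (v - w)) e + scale3 (sin ph) (cross3 (v - w) e)).
  rewrite /s -[in cross3 (v - w)]kX -[in X in _ = scale3 _ X + _]kX.
  by apply: vec3_eq; rewrite /scale3 /cross3 /=; ring.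
 rewrite e1 e2 /jmpe; move: (norm3 (v - w)) => n; by apply: vec3_eq; rewrite /scale3 /=; field.
by rewrite -mulrA; congr (_ * _); rewrite mulrC.
Qed.

Lemma coll0 psi v K : 0 <= K -> coll I gamma beta K psi v 0 = 0.
move=> K0; rewrite /coll -[RHS](mulr0 (K - 0)) -iint_cst//.
apply: eq_iint => z _; rewrite /circ -[RHS](mulr0 (2 * pi - 0)) -iint_cst ?mulr_ge0 ?pi_ge0//.
apply: eq_iint => ph _; rewrite (_ : v + _ = v) ?subrr//.
by rewrite /jmp /Gamma3 /frame0 eqxx; apply: vec3_eq; rewrite /scale3 /cross3 /=; ring.
Qed.

Lemma particle_generatorE N (phi : N.-tuple (vec3 R) -> R) (x : N.-tuple (vec3 R)) K : bmeas phi -> 0 < K ->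
 particle_generator gamma beta K phi x = N%:R^-1 * \sum_(i < N) \sum_(j < N | i != j)
  coll I gamma beta K (fun y => phi (upd x i y)) (tnth x i) (tnth x i - tnth x j).
move=> bp K0; congr (_ * _); apply: eq_bigr => i _; apply: eq_bigr => j _.
rewrite /=; have [->|vij] := eqVneq (tnth x i) (tnth x j); first by rewrite subrr coll0// ltW.
rewrite -(sphere_integral_coll (bmeas_upd x i bp) vij K0); congr sphere_integral; apply/funext => s.
rewrite upd_tnth; congr ((phi _ - _) * _ * _); apply: eq_from_tnth => k.
by rewrite tnth_mktuple tnth_upd; case: eqP => // ->; rewrite addrC subrK.
Qed.

End SphereCollision.

(** * The full collision operator and its cutoff *)

Section BoltzmannCutoff.
Context (R : realType) (I : vec3 R -> vec3 R) (gamma nu c0 c1 : R) (beta : R -> R).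
Hypotheses (HI : frame_choice I) (Hk : kernel_bounds nu c0 c1 beta).
Implicit Types (v w X e : vec3 R) (phi : vec3 R -> R) (th s B C L : R).
Let nu0 : 0 < nu. Proof. by case: Hk => /andP[]. Qed.
Let nu1 : 0 < 1 - nu. Proof. by case: Hk => /andP[_]; rewrite subr_gt0. Qed.
Let c10 : 0 < c1. Proof. by case: Hk => _ [_]. Qed.
Let pi20 : 0 < pi / 2 :> R. Proof. by rewrite divr_gt0 ?pi_gt0. Qed.

Lemma norm3_jmpe e X th ph : dot3 e e = 1 -> dot3 e X = 0 -> 0 <= th -> norm3 (jmpe e X th ph) <= norm3 X * th.
move=> ee eX th0; rewrite -ler_sqr ?nnegrE ?mulr_ge0 ?norm3_ge0//.
have -> : norm3 (jmpe e X th ph) ^+ 2 = norm3 X ^+ 2 * ((1 - cos th) / 2).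
 have XX := norm3_sqr X; have eC : dot3 (cross3 X e) (cross3 X e) = norm3 X ^+ 2.
  by rewrite dot3_cross ee (dot3C X e) eX XX; ring.
 have f1 : dot3 X (cross3 X e) = 0 by rewrite /dot3 /cross3 /=; ring.
 have f2 : dot3 e (cross3 X e) = 0 by rewrite /dot3 /cross3 /=; ring.
 have f1' : dot3 (cross3 X e) X = 0 by rewrite dot3C. have f2' : dot3 (cross3 X e) e = 0 by rewrite dot3C.
 have Xe : dot3 X e = 0 by rewrite dot3C.
 have et : sin th ^+ 2 = 1 - cos th ^+ 2 by rewrite -(cos2Dsin2 th) addrC addKr.
 have ep : sin ph ^+ 2 = 1 - cos ph ^+ 2 by rewrite -(cos2Dsin2 ph) addrC addKr.
 rewrite norm3_sqr /jmpe !dot3E -XX; move: f1 f2 f1' f2' eC; move: (cross3 X e) => f f1 f2 f1' f2' eC.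
 rewrite ?f1 ?f2 ?f1' ?f2' ?Xe ?eX ?ee ?eC.
 by move: (norm3 X) (cos th) (sin th) (cos ph) (sin ph) et ep => n ct st cp sp et ep; field: et ep.
rewrite exprMn ler_wpM2l ?sqr_ge0//; have := one_minus_cos_le th; have := sqr_ge0 th; lra.
Qed.

Lemma mbeta0 s : s <= pi -> measurable_fun `]0, s] beta.
case: Hk => _ _ [mb _] _ _ sp; apply: measurable_funS mb; first routine.
by apply: subset_itvl; rewrite bnd_simp.
Qed.

Lemma theta_beta_le s : 0 < s <= pi / 2 ->
 (\int[leb]_(x in `]0%R, s]) (x * beta x)%:E <= (c1 / (1 - nu) * s `^ (1 - nu))%:E)%E.
move=> /andP[s0 sp].
have pp : pi / 2 <= pi :> R by lra.
(* Exhaustion of ]0, s] by intervals away from the singularity, for monotone convergence. *)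
pose F n : set R := `[s / n.+1%:R, s]%classic.
have Fs n x : F n x -> 0 < x <= s.
 by rewrite /F/= in_itv/= => /andP[h1 h2]; rewrite h2 (lt_le_trans _ h1)// divr_gt0.
have UF : \bigcup_n F n = `]0, s]%classic.
 apply/seteqP; split => [x [n _ /Fs]|x]; rewrite /= in_itv//=.
 move=> /andP[x0 xs]; have [n ns] : exists n, s / x <= n.+1%:R :> R.
  exists (Num.bound (s / x)); upto (ltW (archi_boundP _)); last by lra. routine.
 by exists n => //; rewrite /F/= in_itv/= xs andbT ler_pdivrMr// mulrC -ler_pdivrMr.
have mF n : measurable_fun (F n) (fun x => (x * beta x)%:E).
 apply/mEFinP; apply: mfunM => //. by apply: (mbeta Hk) => //; rewrite divr_gt0.
have F0 n x : F n x -> (0 <= (x * beta x)%:E)%E.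
 move=> /Fs/andP[x0 xs]; rewrite lee_fin mulr_ge0 ?(ltW x0)//. by apply: (beta_ge0 Hk); rewrite x0 (le_trans xs).
have nF : nondecreasing_seq F.
 move=> m n mn; rewrite subsetEset => x; rewrite /F/= !in_itv/= => /andP[h1 ->]; rewrite andbT.
 by apply: le_trans h1; rewrite ler_wpM2l ?(ltW s0)// lef_pV2 ?posrE// ler_nat.
have mS n : measurable (F n) by exact: measurable_itv.
have cv := @ge0_nondecreasing_set_cvg_integral _ (measurableTypeR R) R F (fun x => (x * beta x)%:E)
 (@lebesgue_measure R) nF mS mF F0.
rewrite UF in cv; rewrite -(cvg_lim _ cv)//.
apply: lime_le; first exact: cvgP cv.
near=> n.
have sn0 : 0 < s / n.+1%:R by rewrite divr_gt0.
have sn : s / n.+1%:R <= s by rewrite ler_pdivrMr// ler_peMr ?(ltW s0)// ler1n.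
pose h (x : R) := Num.min (Num.max x 0) s.
have hE x : s / n.+1%:R <= x <= s -> h x = x.
 by move=> /andP[h1 h2]; rewrite /h max_l ?min_l// (le_trans (ltW sn0)).
have bh : bmeas h.
 apply: (@bmeas_bound _ _ _ _ 0 s) => [|x]; last by rewrite le_min le_max lexx orbT (ltW s0) ge_min lexx orbT.
 by apply: measurable_minr; routine.
have A : iint (s / n.+1%:R) s (fun x => h x * beta x) <= c1 / (1 - nu) * s `^ (1 - nu).
 by have := kint_theta_le Hk sn0 sn sp ler01 bh; rewrite mul1r; apply => x hx; rewrite hE// mul1r.
have -> : (\int[leb]_(x in F n) (x * beta x)%:E)%E = (iint (s / n.+1%:R) s (fun x => h x * beta x))%:E; last by [].
rewrite /iint /Rintegral fineK; last by apply: integrable_fin_num => //; exact: (kint_integrable Hk).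
by apply: eq_integral => x; rewrite inE /F /= in_itv/= => hx; rewrite hE.
Unshelve. all: by end_near. Qed.

Lemma kernel_integrable s F C : 0 < s <= pi / 2 -> 0 <= C -> bmeas F ->
 (forall x, 0 < x <= pi / 2 -> `|F x| <= C * x) ->
 (@lebesgue_measure R).-integrable `]0, s] (EFin \o (fun x => beta x * F x)) /\
 (\int[leb]_(x in `]0%R, s]) `|(beta x * F x)%:E| <= (C * (c1 / (1 - nu) * s `^ (1 - nu)))%:E)%E.
move=> s0 C0 bF FC; have pp : pi / 2 <= pi :> R by lra.
have mS : measurable (`]0, s]%classic : set R) by [].
have /andP[s00 sp] := s0.
have mb : measurable_fun `]0, s] beta by apply: mbeta0; exact: le_trans pp.
have mG : measurable_fun `]0, s] (EFin \o (fun x => beta x * F x)).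
 by apply/mEFinP; apply: mfunM => //; apply: measurable_funTS; case: bF.
have mX : measurable_fun `]0, s] (fun x => (x * beta x)%:E).
 by apply/mEFinP; routine.
have b0 x : 0 < x <= s -> 0 <= beta x.
 by move=> /andP[h1 h2]; apply: (beta_ge0 Hk); rewrite h1 (le_trans h2).
have le : (\int[leb]_(x in `]0%R, s]) `|(beta x * F x)%:E| <= (C * (c1 / (1 - nu) * s `^ (1 - nu)))%:E)%E.
 via (\int[leb]_(x in `]0%R, s]) (C%:E * (x * beta x)%:E))%E.
  apply: (@ge0_le_integral _ (measurableTypeR R)) => //.
  - exact: mcomp.
  - by have := mX => /mEFinP h; apply/mEFinP; routine.
  - move=> x; rewrite /= in_itv/= => hx; rewrite -EFinM lee_fin normrM (ger0_norm (b0 _ hx)).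
   rewrite mulrA [leLHS]mulrC ler_wpM2r ?b0//; apply: FC; case/andP: hx => -> /=. lra.
 rewrite (@ge0_integralZl_EFin _ (measurableTypeR R))//.
 - by rewrite EFinM; apply: lee_wpmul2l; rewrite ?lee_fin//; exact: theta_beta_le.
 - by move=> x; rewrite /= in_itv/= => hx; rewrite lee_fin mulr_ge0 ?b0//; case/andP: hx => /ltW.
split=> //; apply/integrableP; split => //; exact: (le_lt_trans le (ltry _)).
Qed.

Lemma kernel_cut s F C : 0 < s <= pi / 2 -> 0 <= C -> bmeas F -> (forall x, 0 < x <= pi / 2 -> `|F x| <= C * x) ->
 `|\int[leb]_(x in `]0, pi / 2]) (beta x * F x) - iint s (pi / 2) (fun x => F x * beta x)| <=
 C * (c1 / (1 - nu) * s `^ (1 - nu)).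
move=> s0 C0 bF FC; have /andP[s00 sp] := s0.
have p2 : 0 < (pi / 2 : R) <= (pi / 2 : R) by lra.
have [ip _] := kernel_integrable p2 C0 bF FC.
have [is_ ls] := kernel_integrable s0 C0 bF FC.
have := @Rintegral_itvB R (fun x => beta x * F x) (BRight 0) (BRight (pi / 2)) s ip.
rewrite !bnd_simp => /(_ (ltW s00) sp) E.
have -> : iint s (pi / 2) (fun x => F x * beta x) = \int[leb]_(x in `]s, pi / 2]) (beta x * F x).
 rewrite Rintegral_itv_obnd_cbnd; first by apply: eq_Rintegral => x _; rewrite mulrC.
 by apply: integrableS ip => //; apply: subset_itvr; rewrite bnd_simp ltW.
rewrite -E opprB addrCA subrr addr0.
upto (@le_normr_Rintegral _ (measurableTypeR R) _ _ _ _ _ is_) => //.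
rewrite -lee_fin; apply: le_trans ls; rewrite /Rintegral fineK//.
by apply: integrable_fin_num => //; exact: (integrable_norm is_).
Qed.

Lemma kernel_bound F C : 0 <= C -> bmeas F -> (forall x, 0 < x <= pi / 2 -> `|F x| <= C * x) ->
 `|\int[leb]_(x in `]0, pi / 2]) (beta x * F x)| <= C * theta_cst nu c1.
move=> C0 bF FC; have p2 : 0 < (pi / 2 : R) <= (pi / 2 : R) by rewrite pi20 lexx.
have := kernel_cut p2 C0 bF FC.
rewrite /iint set_itv1 Rintegral_set1 subr0 /theta_cst; move/le_trans; apply.
lra.
Qed.

Definition rate_cst : R := 2 * pi * (c1 / (1 - nu)) * (c1 / nu) `^ (nu^-1 - 1).

Lemma rate_cst_ge0 : 0 <= rate_cst.
have p2 := pi2_ge0 R.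
exact: (mulr_ge0 (mulr_ge0 p2 (divr_ge0 (ltW c10) (ltW nu1))) (powR_ge0 _ _)).
Qed.

(** As nu < 1, theta beta(theta) is integrable at 0, so a first-order bound along the jumps controls
    the whole operator. The angles removed by the level [L] lie below G(L/a), where the same
    integral is of order (a/L)^(1/nu - 1). *)
Lemma boltzmannA_coll phi v w B : bmeas phi -> 0 <= B ->
 (forall e th ph, dot3 e e = 1 -> dot3 e (v - w) = 0 -> 0 < th <= pi / 2 ->
  `|phi (v + jmpe e (v - w) th ph) - phi v| <= B * th) -> let a := norm3 (v - w) `^ gamma in
 `|boltzmannA gamma beta I phi v w| <= 2 * pi * theta_cst nu c1 * (a * B) /\
 forall L, 0 < L -> `|boltzmannA gamma beta I phi v w - coll I gamma beta L phi v (v - w)| <=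
  rate_cst * (a * B * (a / L) `^ (nu^-1 - 1)).
move=> bp B0 H a; have [e [ee eX _]] := exists_unit_ortho (v - w) 0.
have p2 := pi2_ge0 R.
have [vw|vw] := eqVneq v w.
 rewrite /boltzmannA vw eqxx normr0 subrr; split.
  exact: (mulr_ge0 (mulr_ge0 p2 (ltW (theta_cst_gt0 Hk))) (mulr_ge0 (powR_ge0 _ _) B0)).
 move=> L L0; rewrite coll0 ?(ltW L0)// subrr normr0; apply: (mulr_ge0 rate_cst_ge0). routine.
have X0 : 0 < norm3 (v - w) by rewrite norm3_gt0 subr_eq0.
have a0 : 0 < a by rewrite powR_gt0.
have bc := bmeas_circ1 HI v (v - w) bp.
have FC x : 0 < x <= pi / 2 -> `|circ I phi v (v - w) x| <= 2 * pi * B * x.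
 move=> hx; rewrite (circE HI _ _ bp ee eX). have bj := bmeas_jmpe e v (v - w) x bp.
 have := bfun_norm_le (iint_bfun 0 (2 * pi)) bj (fun ph => H e x ph ee eX hx).
 by rewrite iint_cst// subr0 mulr1; move/le_trans; apply; rewrite mulrC mulrA.
have C0 : 0 <= 2 * pi * B by routine.
have E : boltzmannA gamma beta I phi v w = a * \int[leb]_(x in `]0, pi / 2]) (beta x * circ I phi v (v - w) x).
 rewrite /boltzmannA (negbTE vw) -/a; apply: (congr1 (fun t => a * t)).
 apply: eq_Rintegral => x _; apply: (congr1 (fun t => beta x * t)). by apply: eq_iint => ph _; rewrite jmpE.
rewrite E; split.
 rewrite normrM (gtr0_norm a0). have -> : 2 * pi * theta_cst nu c1 * (a * B) = a * (2 * pi * B * theta_cst nu c1).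
  by move: (theta_cst nu c1) (2 * pi) (a) => t p x; ring.
 exact: (ler_wpM2l (ltW a0) (kernel_bound C0 bc FC)).
move=> L L0; rewrite /coll -/a (iint_angle Hk a0 (ltW L0) bc).
have [g0 _] := angularGP Hk (divr_ge0 (ltW L0) (ltW a0)).
rewrite -mulrBr normrM (gtr0_norm a0).
upto (ler_wpM2l (ltW a0) (kernel_cut g0 C0 bc FC)).
have h := angle_rate_le Hk L0 a0; rewrite /rate_cst.
have k0 : 0 <= a * (2 * pi * B) * (c1 / (1 - nu)).
 exact: (mulr_ge0 (mulr_ge0 (ltW a0) C0) (divr_ge0 (ltW c10) (ltW nu1))).
nra.
Qed.

End BoltzmannCutoff.

Section DoubleIntegral.
Context d (T : measurableType d) (R : realType) (P : probability T R).
Implicit Types (g h k : T -> R) (e c : R).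

Lemma prob_int_dist g h k e c : mfun g -> bmeas h ->
 integ P k -> 0 <= e -> 0 <= c -> (forall x, 0 <= k x) ->
 (forall x, `|g x - h x| <= e * k x + c) ->
 integ P g /\ `|\int[P]_x g x - \int[P]_x h x| <= e * (\int[P]_x k x) + c.
move=> mg bh ik e0 c0 k0 H.
have ih := bmeas_integrable P bh.
have iek : integ P (fun x => e * k x).
 have := integrableZl measurableT e ik; apply: eq_integrable => // x _.
have ic := bmeas_integrable P (bmeas_cst T c).
have iek' : integ P (fun x => e * k x + c).
 have := integrableD measurableT iek ic; apply: eq_integrable => // x _.
have mgh : mfun (fun x => g x - h x) by apply: mfunB => //; case: bh.
have igh : integ P (fun x => g x - h x).
 apply: (le_integrable measurableT _ _ iek'); first exact/mEFinP.
 by move=> x _; rewrite /= lee_fin (le_trans (H x))// ler_norm.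
have ig : integ P g.
 have := integrableD measurableT igh ih; apply: eq_integrable => // x _. by rewrite /= -EFinD subrK.
split=> //; rewrite -RintegralB//.
upto (le_normr_Rintegral _ igh) => //.
upto (le_Rintegral measurableT (integrable_norm igh) iek' (fun x _ => H x)).
by rewrite RintegralD// RintegralZl// prob_cst.
Qed.

End DoubleIntegral.

(** * Double integrals of an unbounded function approximated by bounded ones *)

Section DoubleLimit.
Context d (T : measurableType d) (R : realType) (P : probability T R).
Variables (g : T * T -> R) (h : nat -> T * T -> R) (k : T -> R) (e : nat -> R).
Hypotheses (bh : forall n, bmeas (h n)) (ik : integ P k) (k0 : forall x, 0 <= k x) (e0 : forall n, 0 <= e n) (ecv : e n @[n --> \oo] --> (0 : R)) (H : forall n x y, `|g (x, y) - h n (x, y)| <= e n * (k x + k y)).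

Lemma cvg_of_dist (u : nat -> R) (l c : R) : (forall n, `|l - u n| <= e n * c) -> u n @[n --> \oo] --> l.
move=> uH; apply/cvgrPdist_le => eps eps0.
have cv : e n * c @[n --> \oo] --> (0 : R) by rewrite -[X in _ --> X](mul0r c); apply: cvgM => //; exact: cvg_cst.
near=> n; upto (uH n).
have : `|0 - e n * c| <= eps by near: n; move/cvgrPdist_le : cv; exact.
by rewrite sub0r normrN; apply: le_trans; exact: ler_norm.
Unshelve. all: by end_near. Qed.

Lemma double_measurable : mfun g.
apply: (@measurable_fun_cvg _ _ _ setT h) => [n|[x y] _]; first by case: (bh n).
exact: (@cvg_of_dist _ _ (k x + k y)).
Qed.

Lemma double_inner (h' : T * T -> R) (c : R) x : bmeas h' -> 0 <= c ->
 (forall x y, `|g (x, y) - h' (x, y)| <= c * (k x + k y)) ->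
 `|\int[P]_y g (x, y) - \int[P]_y h' (x, y)| <= c * (k x + \int[P]_y k y).
move=> bh' c0' H'.
have HH y : `|g (x, y) - h' (x, y)| <= c * k y + c * k x by rewrite -mulrDr [k y + _]addrC; exact: H'.
have mg : mfun (fun y => g (x, y)).
 exact: (mcomp double_measurable (measurable_pair1 x)).
have [_ B] := prob_int_dist mg (bmeas_pair1 x bh') ik c0' (mulr_ge0 c0' (k0 x)) k0 HH.
lra.
Qed.

Lemma double_int_measurable : mfun (fun x => \int[P]_y g (x, y)).
apply: (@measurable_fun_cvg _ _ _ setT (fun n x => \int[P]_y h n (x, y))) => [n|x _].
 by case: (bfun_param (bfun_prob P) (bh n)).
exact: (@cvg_of_dist _ _ (k x + \int[P]_y k y) (fun n => double_inner x (bh n) (e0 n) (H n))).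
Qed.

Lemma double_int_dist (h' : T * T -> R) (c : R) : bmeas h' -> 0 <= c ->
 (forall x y, `|g (x, y) - h' (x, y)| <= c * (k x + k y)) ->
 `|\int[P]_x \int[P]_y g (x, y) - \int[P]_x \int[P]_y h' (x, y)| <= c * (2 * \int[P]_y k y).
move=> bh' c0' H'; have k1 : 0 <= \int[P]_y k y by apply: Rintegral_ge0.
have HH x : `|\int[P]_y g (x, y) - \int[P]_y h' (x, y)| <= c * k x + c * \int[P]_y k y.
 by rewrite -mulrDr; exact: double_inner.
have [_] := prob_int_dist double_int_measurable (bfun_param (bfun_prob P) bh') ik c0' (mulr_ge0 c0' k1) k0 HH.
lra.
Qed.

End DoubleLimit.

Lemma powR_le_1D (R : realType) (x t : R) : 0 < x -> 0 <= t <= 1 -> x `^ t <= 1 + x.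
move=> x0 /andP[t0 t1]; have [x1|x1] := leP x 1.
 have := @ge0_ler_powR R t t0 x 1; rewrite !nnegrE (ltW x0) ler01 powR1 => /(_ isT isT x1). lra.
have := ler_powR (ltW x1) t1; rewrite powRr1 ?(ltW x0)//; move/le_trans; apply.
lra.
Qed.

(** * Regularity in time of the weak solution *)

Section Solution.
Context (R : realType) (I : vec3 R -> vec3 R) (gamma nu c0 c1 : R) (beta : R -> R) (f : R -> probability (vec3 R) R).
Hypotheses (HI : frame_choice I) (Hk : kernel_bounds nu c0 c1 beta) (Hg : -1 < gamma < 0) (Hgn : 0 < gamma + nu) (Hw : weak_solution gamma beta I f).
Implicit Types (v w : vec3 R) (phi : vec3 R -> R) (r s t L K : R).
(** Frozen at [f 0] for negative times, hence a measurable family on the whole line. *)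
Definition ft r := f (Num.max r 0).
Definition kv v : R := 1 + norm3 v ^+ 2.
Definition energy : R := fine (moment 2 (f 0)).

Lemma kv_ge0 v : 0 <= kv v. Proof. routine. Qed.

Lemma norm3_kv v w : 1 + norm3 (v - w) <= kv v + kv w.
have := norm3D v (- w); rewrite norm3N /kv; have := sqr_ge0 (norm3 v - 1); have := sqr_ge0 (norm3 w - 1).
nra.
Qed.

Lemma sol_energy r : (ft r).-integrable setT (EFin \o kv) /\ \int[ft r]_v kv v = 1 + energy.
case: Hw => _ m0 _ me _; have r0 : 0 <= Num.max r 0 by rewrite le_max lexx orbT.
have E := me _ r0; have e2 (P : probability (vec3 R) R) : moment 2 P = (\int[P]_v (norm3 v ^+ 2)%:E)%E.
 by apply: eq_integral => v _; rewrite powR_mulrn// norm3_ge0.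
have mn : mfun (fun v : vec3 R => norm3 v ^+ 2) by apply: mfunX; exact: mnorm3.
have fin : (\int[ft r]_v (norm3 v ^+ 2)%:E < +oo)%E by rewrite -e2 /ft E.
have i2 : (ft r).-integrable setT (EFin \o (fun v => norm3 v ^+ 2)).
 apply/integrableP; split; first exact/mEFinP. apply: le_lt_trans fin; apply: ge0_le_integral => //.
 - by apply: mcomp => //; exact/mEFinP.
 - exact/mEFinP.
 - by move=> x _; rewrite /= ger0_norm ?sqr_ge0.
have i1 := bmeas_integrable (ft r) (bmeas_cst (vec3 R) 1).
split.
 have := integrableD measurableT i1 i2; apply: eq_integrable => // v _.
rewrite RintegralD// prob_cst /energy -E e2.
by [].
Qed.

Lemma energy_ge0 : 0 <= energy.
by apply/fine_ge0/integral_ge0 => v _; routine. Qed.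

Lemma msol (B : set (vec3 R)) : measurable B -> mfun (fun r => \int[ft r]_v \1_B v).
move=> mB; have -> : (fun r => \int[ft r]_v \1_B v) = (fun r => fine (f (Num.max r 0) B)).
 by apply/funext => r; rewrite prob_indic.
case: Hw => mf _ _ _ _.
have mff : measurable_fun (`[0, +oo[%classic : set R) (fun t => fine (f t B)) by apply: (mcomp _ (mf B mB)).
refine (measurable_comp (f := fun t => fine (f t B)) (g := fun r => Num.max r 0) _ _ mff _).
- exact: measurable_itv.
- by move=> _ [r _ <-]; rewrite /= in_itv/= andbT le_max lexx orbT.
- by apply: measurable_maxr => //; routine.
Qed.

Lemma bmeas_sol d (T : measurableType d) (r : T -> R) (psi : T * vec3 R -> R) :
 mfun r -> bmeas psi -> bmeas (fun x => \int[ft (r x)]_v psi (x, v)).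
move=> mr bp.
apply: (@bfun_param_family _ _ _ _ _ (fun x psi => \int[ft (r x)]_v psi v) 1) => //.
- by move=> x; exact: bfun_prob.
- by move=> x; rewrite prob_cst.
- by move=> B mB; exact: (mcomp (msol mB) mr).
Qed.

Definition lip3 L phi := forall x y, `|phi x - phi y| <= L * dist3 x y.

Definition cut_err L K : R := rate_cst nu c1 * L * K `^ (1 - nu^-1).

(** Rate times jump length is |v - w|^(1 + gamma), and the cutoff error carries |v - w|^(1 +
    gamma/nu). Both exponents lie in [0, 1], the second because gamma + nu > 0, so both powers are
    at most 1 + |v - w|. *)
Lemma boltzmannA_lip phi L v w : bmeas phi -> 0 <= L -> lip3 L phi ->
 `|boltzmannA gamma beta I phi v w| <= 2 * pi * theta_cst nu c1 * L * (kv v + kv w) /\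
 forall K, 0 < K -> `|boltzmannA gamma beta I phi v w - coll I gamma beta K phi v (v - w)| <=
  cut_err L K * (kv v + kv w).
move=> bp L0 lp.
have nu0 : 0 < nu by case: Hk => /andP[].
have Hj e th ph : dot3 e e = 1 -> dot3 e (v - w) = 0 -> 0 < th <= pi / 2 ->
  `|phi (v + jmpe e (v - w) th ph) - phi v| <= L * norm3 (v - w) * th.
 move=> ee eX /andP[th0 _]; upto (lp _ _); rewrite -mulrA ler_wpM2l//.
 by rewrite /dist3 addrAC subrr add0r; apply: norm3_jmpe => //; exact: ltW.
have [h1 h2] := boltzmannA_coll gamma HI Hk bp (mulr_ge0 L0 (norm3_ge0 _)) Hj.
have kk := norm3_kv v w; have [g1 g0] := andP Hg.
have th0 := theta_cst_gt0 Hk; have rc0 := rate_cst_ge0 Hk.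
have p2 := pi2_ge0 R.
have n0 := norm3_ge0 (v - w).
have nn (t : R) : 0 <= t <= 1 -> norm3 (v - w) > 0 -> norm3 (v - w) `^ t <= kv v + kv w.
 by move=> t01 n1; upto (powR_le_1D n1 t01).
have kv0 : 0 <= kv v + kv w by rewrite addr_ge0 ?kv_ge0.
have [nz|nz] := eqVneq (norm3 (v - w)) 0.
 have z : norm3 (v - w) `^ gamma * (L * norm3 (v - w)) = 0 by rewrite nz !mulr0. split.
  apply: (le_trans h1); rewrite z mulr0. exact: (mulr_ge0 (mulr_ge0 (mulr_ge0 p2 (ltW th0)) L0) kv0).
 move=> K K0; upto (h2 K K0); rewrite z mul0r mulr0. routine.
have n1 : 0 < norm3 (v - w) by rewrite lt_neqAle eq_sym nz.
have na : norm3 (v - w) * norm3 (v - w) `^ gamma = norm3 (v - w) `^ (1 + gamma).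
 by rewrite powRD ?(gt_eqF n1) ?implybT// powRr1// ltW.
split.
 apply: (le_trans h1); rewrite -(mulrA (2 * pi * theta_cst nu c1)); apply: ler_wpM2l.
  exact: (mulr_ge0 p2 (ltW th0)).
 rewrite mulrCA [_ `^ _ * _]mulrC na; apply: ler_wpM2l => //. by apply: nn => //; lra.
move=> K K0; upto (h2 K K0); rewrite /cut_err -!(mulrA (rate_cst nu c1)).
apply: ler_wpM2l => //.
have -> : norm3 (v - w) `^ gamma * (L * norm3 (v - w)) * (norm3 (v - w) `^ gamma / K) `^ (nu^-1 - 1) =
  L * (K `^ (1 - nu^-1) * (norm3 (v - w) * (norm3 (v - w) `^ gamma) `^ nu^-1)).
 have -> : norm3 (v - w) `^ gamma / K = norm3 (v - w) `^ gamma * K `^ (- 1) by rewrite powR_inv1 ?ltW.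
 rewrite powRM ?powR_ge0// -[(K `^ _) `^ _]powRrM mulN1r opprB.
 have -> : (norm3 (v - w) `^ gamma) `^ nu^-1 = norm3 (v - w) `^ gamma * (norm3 (v - w) `^ gamma) `^ (nu^-1 - 1).
  have a0 : 0 < norm3 (v - w) `^ gamma by rewrite powR_gt0.
  have e : nu^-1 = 1 + (nu^-1 - 1) by rewrite addrCA subrr addr0.
  by rewrite {1}e powRD ?(gt_eqF a0) ?implybT// powRr1 ?ltW.
 lra.
rewrite -mulrA; apply: ler_wpM2l => //; apply: ler_wpM2l; first routine.
rewrite -powRrM -[X in X * _](powRr1 n0) -powRD ?(gt_eqF n1) ?implybT//.
apply: nn => //; have i0 : 0 < nu^-1 by rewrite invr_gt0.
have := mulr_ge0_le0 (ltW i0) (ltW g0); rewrite mulrC => gn.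
have : -1 <= gamma / nu by rewrite ler_pdivlMr// mulN1r; have := Hgn; lra.
by move=> gn'; apply/andP; split; lra.
Qed.

Definition collQ K phi r : R := \int[ft r]_v \int[ft r]_w coll I gamma beta K phi v (v - w).
Definition boltzQ phi r : R := \int[ft r]_v \int[ft r]_w boltzmannA gamma beta I phi v w.

Lemma bmeas_coll2 K phi : bmeas phi -> bmeas (fun z : vec3 R * vec3 R => coll I gamma beta K phi z.1 (z.1 - z.2)).
move=> bp; refine (bmeas_coll gamma HI Hk K (phi := fun z : (vec3 R * vec3 R) * vec3 R => phi z.2)
 (v := fun z => z.1) (X := fun z => z.1 - z.2) _ _ _).
- exact: bmeas_comp bp msnd.
- exact: mfst.
- exact: (mvec3B mfst msnd).
Qed.

Lemma bmeas_collQ K phi : bmeas phi -> bmeas (collQ K phi).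
move=> bp; apply: (bmeas_sol (r := fun r => r) (psi := fun z : R * vec3 R => \int[ft z.1]_w coll I gamma beta K phi z.2 (z.2 - w))) => //.
apply: (bmeas_sol (r := fun z : R * vec3 R => z.1) (psi := fun z : (R * vec3 R) * vec3 R => coll I gamma beta K phi z.1.2 (z.1.2 - z.2))); first routine.
have mS : mfun (fun z : (R * vec3 R) * vec3 R => (z.1.2, z.2)).
 by apply: mfun_pair => //; exact: mcomp.
exact: (bmeas_comp (bmeas_coll2 K bp) mS).
Qed.

Lemma powR_neg_cvg (e : R) : 0 < e -> n.+1%:R `^ (- e) @[n --> \oo] --> (0 : R).
move=> e0; apply/cvgrPdist_le => eps eps0; near=> n.
rewrite sub0r normrN ger0_norm ?powR_ge0//.
have X0 : 0 < eps `^ (- e^-1) by rewrite powR_gt0.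
have Xn : eps `^ (- e^-1) <= n.+1%:R.
 apply: (@le_trans _ _ n%:R); last by lra. by near: n; exact: nbhs_infty_ger.
have := @powR_le_neg R _ _ (- e) X0 Xn; rewrite oppr_le0 (ltW e0) => /(_ isT).
by rewrite -powRrM mulrNN mulVf ?gt_eqF// powRr1// ltW.
Unshelve. all: by end_near. Qed.

Lemma cut_err_cvg L : cut_err L n.+1%:R @[n --> \oo] --> (0 : R).
have nu0 : 0 < nu /\ nu < 1 by case: Hk => /andP[].
have e0 : 0 < nu^-1 - 1 by rewrite subr_gt0 invf_gt1; case: nu0.
rewrite /cut_err -[X in _ --> X](mulr0 (rate_cst nu c1 * L)); apply: cvgM; first exact: cvg_cst.
by have := powR_neg_cvg e0; rewrite opprB.
Qed.

Lemma boltzQ_facts phi L : bmeas phi -> 0 <= L -> lip3 L phi -> [/\ bmeas (boltzQ phi),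
   forall r, `|boltzQ phi r| <= 2 * pi * theta_cst nu c1 * L * (2 * (1 + energy)) &
   forall K r, 0 < K -> `|boltzQ phi r - collQ K phi r| <= cut_err L K * (2 * (1 + energy))].
move=> bp L0 lp.
have B v w := boltzmannA_lip v w bp L0 lp.
have p2 := pi2_ge0 R.
have C0 : 0 <= 2 * pi * theta_cst nu c1 * L by exact: (mulr_ge0 (mulr_ge0 p2 (ltW (theta_cst_gt0 Hk))) L0).
have ce0 K : 0 <= cut_err L K by exact: (mulr_ge0 (mulr_ge0 (rate_cst_ge0 Hk) L0) (powR_ge0 _ _)).
pose h n := fun z : vec3 R * vec3 R => coll I gamma beta n.+1%:R phi z.1 (z.1 - z.2).
have bh n : bmeas (h n) by exact: bmeas_coll2.
pose g := fun z : vec3 R * vec3 R => boltzmannA gamma beta I phi z.1 z.2.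
have H n x y : `|g (x, y) - h n (x, y)| <= cut_err L n.+1%:R * (kv x + kv y).
 by have [_ ->] := B x y.
have D r h' c := @double_int_dist _ _ _ (ft r) g h kv (fun n => cut_err L n.+1%:R) bh (sol_energy r).1 kv_ge0
 (fun n => ce0 n.+1%:R) (cut_err_cvg L) H h' c.
have DK K r : 0 < K -> `|boltzQ phi r - collQ K phi r| <= cut_err L K * (2 * (1 + energy)).
 move=> K0; have [_ <-] := sol_energy r; apply: (D r _ _ (bmeas_coll2 K bp) (ce0 K)) => x y.
 by have [_] := B x y; exact.
have Db r : `|boltzQ phi r| <= 2 * pi * theta_cst nu c1 * L * (2 * (1 + energy)).
 have [_ <-] := sol_energy r; have := D r (fun=> 0) _ (bmeas_cst _ 0) C0.
 rewrite (_ : (fun x => \int[ft r]_y 0) = (fun=> 0)); last by apply/funext => x; rewrite prob_cst.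
 by rewrite prob_cst subr0; apply => x y; rewrite subr0; have [] := B x y.
split => //; split; last by exists (2 * pi * theta_cst nu c1 * L * (2 * (1 + energy))).
apply: (@measurable_fun_cvg _ _ _ setT (fun n r => collQ n.+1%:R phi r)) => [n|r _].
 by case: (bmeas_collQ n.+1%:R bp).
exact: (@cvg_of_dist _ (fun n => cut_err L n.+1%:R) (cut_err_cvg L) _ _ (2 * (1 + energy)) (fun n => DK _ r (ltr0Sn _ _))).
Qed.

Lemma sol_flow phi L s t : bmeas phi -> 0 <= L -> lip3 L phi -> 0 <= s <= t ->
 \int[ft t]_v phi v - \int[ft s]_v phi v = iint s t (boltzQ phi).
move=> bp L0 lp /andP[s0 st]; have t0 := le_trans s0 st.
have [bQ _ _] := boltzQ_facts bp L0 lp; case: Hw => _ _ _ _ W.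
have bl : bounded_lipschitz (@dist3 R) phi by split; [case: bp|exists L].
have E r : 0 <= r -> \int[ft r]_v phi v = \int[f 0]_v phi v + iint 0 r (boltzQ phi).
 move=> r0; rewrite /ft max_l// (W _ bl _ r0); congr (_ + _); apply: eq_iint => x /andP[x0 _].
 by rewrite /boltzQ /ft max_l.
rewrite !E// (@iint_add _ 0 s t)//; last exact: itv_integrable.
by rewrite opprD addrACA subrr add0r addrC addrA addNr add0r.
Qed.

Lemma sol_lip phi L s t : bmeas phi -> 0 <= L -> lip3 L phi -> 0 <= s <= t ->
 `|\int[ft t]_v phi v - \int[ft s]_v phi v| <= 4 * pi * theta_cst nu c1 * (1 + energy) * L * (t - s).
move=> bp L0 lp st; have [bQ Qb _] := boltzQ_facts bp L0 lp.
rewrite (sol_flow bp L0 lp st); have := bfun_norm_le (iint_bfun s t) bQ Qb.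
case/andP: st => _ st; rewrite iint_cst// mulr1; move/le_trans; apply.
lra.
Qed.

Lemma sol_cut phi L K s t : bmeas phi -> 0 <= L -> lip3 L phi -> 0 < K -> 0 <= s <= t ->
 `|\int[ft t]_v phi v - \int[ft s]_v phi v - iint s t (collQ K phi)| <= 2 * (1 + energy) * cut_err L K * (t - s).
move=> bp L0 lp K0 st; have [bQ _ Qd] := boltzQ_facts bp L0 lp.
rewrite (sol_flow bp L0 lp st) -(bfunB (iint_bfun s t) bQ (bmeas_collQ K bp)).
have := bfun_norm_le (iint_bfun s t) (bmeasB bQ (bmeas_collQ K bp)) (fun r => Qd K r K0).
by case/andP: st => _ st; rewrite iint_cst// mulr1 [cut_err _ _ * _]mulrC.
Qed.

End Solution.

(** * Discrete Gronwall inequality *)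

Lemma le_invn (R : realType) (x y c : R) : 0 <= c -> (forall n, x <= y + c / n.+1%:R) -> x <= y.
move=> c0 H; apply/ler_addgt0Pr => e e0.
upto (H (Num.bound (c / e))); rewrite lerD2l ler_pdivrMr// mulrC -ler_pdivrMr//.
have ce : 0 <= c / e by routine.
by upto (ltW (archi_boundP ce)); rewrite ler_nat.
Qed.

Lemma gronwall_algebra (R : realType) (x y z C e T m : R) : m != 0 ->
 x * (z + C * (T / m) * y + m * (C * (T / m) ^+ 2 + e * (T / m))) = x * (z + e * T) + x * (C * (T * y) + C * T ^+ 2) / m.
by move=> m0; field. Qed.

(** Over n + 1 equal steps the terms in [C] add up to O(1/n), and n tends to infinity. Only
    increments of [a] occur, so it may be any nondecreasing function; [k] absorbs a source
    proportional to these increments. *)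
Lemma discrete_gronwall (R : realType) (u a : R -> R) (k C e T : R) : 0 <= T -> 0 <= k -> 0 <= C -> 0 <= e ->
 (forall s t, 0 <= s -> s <= t -> t <= T -> a s <= a t) -> (forall s, 0 <= s <= T -> 0 <= u s + k) ->
 (forall s t, 0 <= s -> s <= t -> t <= T ->
   u t <= u s + (a t - a s) * (u s + k + C * (t - s)) + C * (t - s) ^+ 2 + e * (t - s)) ->
 u T + k <= expR (a T - a 0) * (u 0 + k + e * T).
move=> T0 k0 C0 e0 am u0 H.
have aT : 0 <= a T - a 0 by rewrite subr_ge0 am.
apply: (@le_invn _ _ _ (expR (a T - a 0) * (C * (T * (a T - a 0)) + C * T ^+ 2))).
 routine.
move=> n; pose h := T / n.+1%:R; have h0 : 0 <= h by routine.
pose ti (i : nat) := i%:R * h.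
have tS i : ti i.+1 = ti i + h by rewrite /ti -natr1 mulrDl mul1r.
have tn : ti n.+1 = T by rewrite /ti /h mulrC divfK.
have t0 i : 0 <= ti i by routine.
have tT i : (i <= n.+1)%N -> ti i <= T by move=> li; rewrite -tn ler_wpM2r// ler_nat.
suff W i : (i <= n.+1)%N -> u (ti i) + k <= expR (a (ti i) - a 0) *
  (u 0 + k + C * h * (a (ti i) - a 0) + i%:R * (C * h ^+ 2 + e * h)).
 have := W n.+1 (leqnn _); rewrite tn; move/le_trans; apply; apply: eq_ler. have n1 : n.+1%:R != 0 :> R by [].
 exact: gronwall_algebra.
elim: i => [_|i IH li].
 by rewrite /ti mul0r subrr expR0 mulr0 mul0r !addr0 mul1r.
have {}IH := IH (ltnW li).
have st : ti i <= ti i.+1 by rewrite tS lerDl.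
have := H _ _ (t0 i) st (tT _ li); have -> : ti i.+1 - ti i = h by rewrite tS addrAC subrr add0r.
move=> Hi.
have dl : 0 <= a (ti i.+1) - a (ti i) by rewrite subr_ge0 am// tT.
have Ai : 0 <= a (ti i) - a 0 by rewrite subr_ge0 am// tT// ltnW.
have ui : 0 <= u (ti i) + k by rewrite u0// t0 tT// ltnW.
have u00 : 0 <= u 0 + k by rewrite u0// lexx.
rewrite (_ : a (ti i.+1) - a 0 = (a (ti i.+1) - a (ti i)) + (a (ti i) - a 0)); last by rewrite addrA subrK.
move: (a (ti i.+1) - a (ti i)) (a (ti i) - a 0) dl Ai Hi IH => d A d0 A0 Hi IH.
have ed := expR_ge1Dx d; have eA := expR_ge1Dx A.
rewrite expRD -natr1.
have g0 : 0 <= C * h ^+ 2 + e * h by routine.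
have Ch : 0 <= C * h by routine.
have iG : 0 <= i%:R * (C * h ^+ 2 + e * h) by routine.
have e1 : 1 <= expR d by apply: le_trans ed; rewrite lerDl.
have e2 : 1 <= expR A by apply: le_trans eA; rewrite lerDl.
have e3 : 1 <= expR d * expR A by rewrite -[leLHS]mulr1; apply: ler_pM.
have f1 : (1 + d) * (u (ti i) + k) <= expR d * (u (ti i) + k) by exact: ler_wpM2r.
have f2 := ler_wpM2l (expR_ge0 d) IH.
have dG : 0 <= C * h * d + (C * h ^+ 2 + e * h) by routine.
have f3 : C * h * d + (C * h ^+ 2 + e * h) <= expR d * expR A * (C * h * d + (C * h ^+ 2 + e * h)).
 by rewrite ler_peMl.
lra.
Qed.

(** * A truncated sixth moment *)

Section TruncatedMoment.
Context (R : realType).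
Implicit Types (x y Q : R) (v w : vec3 R).

(* Linear growth, but comparable with x ^+ 6 below Q. *)
Definition tmom Q x : R := x * Num.min x Q ^+ 5.

Lemma min_ge0 x Q : 0 <= x -> 0 <= Q -> 0 <= Num.min x Q.
by move=> x0 Q0; rewrite le_min x0. Qed.

Lemma tmom_ge0 Q x : 0 <= Q -> 0 <= x -> 0 <= tmom Q x.
by move=> Q0 x0; rewrite mulr_ge0// exprn_ge0// min_ge0. Qed.

Lemma tmom_mono Q x y : 0 <= Q -> 0 <= x -> x <= y -> tmom Q x <= tmom Q y.
move=> Q0 x0 xy; have m : Num.min x Q <= Num.min y Q by rewrite le_min !ge_min xy lexx !orbT.
apply: ler_pM => //; first by rewrite exprn_ge0// min_ge0.
by rewrite ler_pXn2r// nnegrE min_ge0// (le_trans x0).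
Qed.

Lemma tmom_double Q x : 0 <= Q -> 0 <= x -> tmom Q (2 * x) <= 64 * tmom Q x.
move=> Q0 x0; have m : Num.min (2 * x) Q <= 2 * Num.min x Q.
 rewrite minr_pMr//; rewrite le_min !ge_min lexx /=. lra.
have x2 : 0 <= 2 * x by lra.
have m5 : Num.min (2 * x) Q ^+ 5 <= (2 * Num.min x Q) ^+ 5.
 by rewrite ler_pXn2r// nnegrE ?min_ge0// mulr_ge0// min_ge0.
have := ler_wpM2l x2 m5; rewrite /tmom exprMn; move: (Num.min x Q ^+ 5) => z; lra.
Qed.

Lemma tmom_diff Q x y : 0 <= Q -> 0 <= x -> 0 <= y ->
 `|tmom Q x - tmom Q y| <= 6 * Num.min (Num.max x y) Q ^+ 5 * `|x - y|.
move=> Q0; wlog xy : x y / x <= y.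
 move=> H x0 y0; case/orP: (le_total x y) => [xy|yx]; first exact: H. by rewrite distrC (distrC x) maxC; exact: H.
move=> x0 y0; rewrite distrC (distrC x) (max_r xy) !ger0_norm ?subr_ge0 ?tmom_mono//.
have mx := min_ge0 x0 Q0; have my := min_ge0 y0 Q0.
have m : Num.min x Q <= Num.min y Q by rewrite le_min !ge_min xy lexx !orbT.
have p5 (p q : R) : 0 <= p -> p <= q -> q ^+ 5 - p ^+ 5 <= 5 * q ^+ 4 * (q - p).
 move=> p0 pq; have q0 := le_trans p0 pq.
 have -> : q ^+ 5 - p ^+ 5 = (q ^+ 4 + q ^+ 3 * p + q ^+ 2 * p ^+ 2 + q * p ^+ 3 + p ^+ 4) * (q - p) by ring.
 apply: ler_wpM2r; first by lra. have h1 : p ^+ 4 <= q ^+ 4 by rewrite ler_pXn2r.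
 have h2 : q * p ^+ 3 <= q * q ^+ 3 by rewrite ler_wpM2l// ler_pXn2r. nra.
have k : x * (Num.min y Q ^+ 5 - Num.min x Q ^+ 5) <= 5 * Num.min y Q ^+ 5 * (y - x).
 have [Qx|xQ] := leP Q x.
  rewrite !min_r// ?(le_trans Qx)// subrr mulr0 mulr_ge0 ?subr_ge0// mulr_ge0// exprn_ge0//.
 have xm : x <= Num.min y Q by rewrite le_min xy ltW. have my' : Num.min y Q <= y by rewrite ge_min lexx.
 upto (ler_wpM2l x0 (p5 _ _ x0 xm)). have q4 : 0 <= 5 * Num.min y Q ^+ 4 by routine.
 have -> : x * (5 * Num.min y Q ^+ 4 * (Num.min y Q - x)) = 5 * Num.min y Q ^+ 4 * (x * (Num.min y Q - x)) by ring.
 have -> : 5 * Num.min y Q ^+ 5 * (y - x) = 5 * Num.min y Q ^+ 4 * (Num.min y Q * (y - x)) by ring.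
 apply: ler_wpM2l => //; apply: ler_pM => //; first by lra. lra.
have -> : tmom Q y - tmom Q x = (y - x) * Num.min y Q ^+ 5 + x * (Num.min y Q ^+ 5 - Num.min x Q ^+ 5).
 by rewrite /tmom; ring.
lra.
Qed.

Lemma tmom_scale Q x : 0 <= Q -> 0 <= x -> (1 + x) * Num.min x Q ^+ 5 <= 1 + 2 * tmom Q x.
move=> Q0 x0; rewrite mulrDl mul1r -/(tmom Q x) mulr2n mulrDl mul1r addrA lerD2r.
have m0 := min_ge0 x0 Q0; have [x1|x1] := leP x 1.
 apply: (@le_trans _ _ 1); last by rewrite lerDl tmom_ge0. have mx1 : Num.min x Q <= 1 by rewrite ge_min x1.
 by rewrite -[leRHS](expr1n R 5) ler_pXn2r// nnegrE.
via (tmom Q x); last by lra.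
by rewrite /tmom ler_peMl ?exprn_ge0// ltW.
Qed.

Lemma tmom_lin Q x : 0 <= Q -> 0 <= x -> tmom Q x <= Q ^+ 5 * x.
move=> Q0 x0; rewrite /tmom mulrC ler_wpM2r// ler_pXn2r ?nnegrE ?min_ge0//.
by rewrite ge_min lexx orbT.
Qed.

Lemma tmom_ge6 Q x : 0 <= Q -> 0 <= x -> Num.min x Q ^+ 6 <= tmom Q x.
by move=> Q0 x0; rewrite exprS ler_wpM2r ?exprn_ge0 ?min_ge0// ge_min lexx. Qed.

Lemma tmom_le6 Q x : 0 <= Q -> 0 <= x -> tmom Q x <= x ^+ 6.
by move=> Q0 x0; rewrite exprS ler_wpM2l// ler_pXn2r ?nnegrE ?min_ge0// ge_min lexx.
Qed.

Lemma tmomD Q x y : 0 <= Q -> 0 <= x -> 0 <= y -> tmom Q (x + y) <= 64 * (tmom Q x + tmom Q y).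
move=> Q0; wlog xy : x y / x <= y.
 move=> H x0 y0; case/orP: (le_total x y) => [xy|yx]; first exact: H. by rewrite addrC [tmom Q x + _]addrC; exact: H.
move=> x0 y0; via (tmom Q (2 * y)).
 by apply: tmom_mono => //; [routine|rewrite mulr2n mulrDl mul1r lerD2r].
upto (tmom_double Q0 y0); rewrite ler_pM2l// lerDr; exact: tmom_ge0.
Qed.

Lemma tmom_jump Q x y z n th : 0 <= Q -> 0 <= x -> 0 <= y -> 0 <= z -> 0 <= th ->
 `|z - x| <= n * th -> z <= 4 * (x + y) -> 0 <= n -> n <= x + y ->
 `|tmom Q z - tmom Q x| <= 6 * Num.min (4 * (x + y)) Q ^+ 5 * n * th.
move=> Q0 x0 y0 z0 t0 d zs n0 ns; have s0 : 0 <= x + y by lra.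
upto (tmom_diff Q0 z0 x0); rewrite -[leRHS]mulrA; apply: ler_pM => //.
 by rewrite mulr_ge0// exprn_ge0// min_ge0// le_max z0.
rewrite ler_pM2l// ler_pXn2r ?nnegrE ?min_ge0 ?le_max ?z0 ?mulr_ge0//.
rewrite le_min !ge_min ge_max zs /= lexx orbT andbT.
lra.
Qed.

(** Three factors 64 = 2^6, two for doublings and one for the sum, times the 2 of [tmom_scale]. *)
Lemma tmom_sum Q x y : 0 <= Q -> 0 <= x -> 0 <= y ->
 (1 + (x + y)) * Num.min (4 * (x + y)) Q ^+ 5 <= 1 + 2 ^+ 19 * (tmom Q x + tmom Q y).
move=> Q0 x0 y0; have s0 : 0 <= x + y by lra.
have s4 : 0 <= 4 * (x + y) by lra.
have m0 := min_ge0 s4 Q0.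
via ((1 + 4 * (x + y)) * Num.min (4 * (x + y)) Q ^+ 5).
 by apply: ler_wpM2r; [routine|lra].
upto (tmom_scale Q0 s4); rewrite lerD2l.
have h1 := tmomD Q0 x0 y0; have h2 := tmom_double Q0 s0.
have s2 : 0 <= 2 * (x + y) by lra.
have h3 := tmom_double Q0 s2; rewrite mulrA (_ : 2 * 2 = 4) in h3; last by ring.
lra.
Qed.

End TruncatedMoment.

Lemma prob_dominated_cvg d (T : measurableType d) (R : realType) (P : probability T R) (F : nat -> T -> R) (g h : T -> R) :
 (forall n, mfun (F n)) -> integ P h ->
 (forall n x, `|F n x| <= h x) -> (forall x, F n x @[n --> \oo] --> g x) ->
 \int[P]_x F n x @[n --> \oo] --> \int[P]_x g x.
move=> mF ih FH cF.
have mg : mfun g by apply: (measurable_fun_cvg mF) => x _; exact: cF.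
have gh x : `|g x| <= h x.
 have := cF x => /cvg_norm nF; rewrite -(cvg_lim _ nF)//; apply: limr_le; first exact: cvgP nF. by apply: nearW.
have iF (k : T -> R) : mfun k -> (forall x, `|k x| <= h x) -> integ P k.
 move=> mk kh; apply: (le_integrable measurableT _ _ ih); first exact/mEFinP.
 by move=> x _; rewrite /= lee_fin (le_trans (kh x))// ler_norm.
apply: fine_cvg; rewrite fineK; last by apply: integrable_fin_num => //; exact: (iF _ mg gh).
apply: (@dominated_cvg _ _ _ P setT measurableT (fun n x => (F n x)%:E) (fun x => (g x)%:E) (fun x => (h x)%:E)) => //.
- by move=> n; exact/mEFinP.
- by move=> x _; apply: cvg_EFin; [exact: nearW|exact: cF].
- by move=> n x _; rewrite lee_fin.
Qed.

Lemma iint_norm_le (R : realType) (s t M : R) (g : R -> R) : s <= t -> bmeas g ->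
 (forall r, s <= r <= t -> `|g r| <= M) -> `|iint s t g| <= M * (t - s).
move=> st bg gM; pose c r := Num.max s (Num.min r t).
have cE r : s <= r <= t -> c r = r by move=> /andP[h1 h2]; rewrite /c min_l// max_r.
have cb r : s <= c r <= t by rewrite le_max lexx /= ge_max st ge_min lexx orbT.
have mc : mfun c.
 by apply: measurable_maxr; routine.
rewrite (@eq_iint _ s t g (fun r => g (c r))); last by move=> r h; rewrite cE.
have := bfun_norm_le (iint_bfun s t) (bmeas_comp bg mc) (fun r => gM _ (cb r)).
by rewrite iint_cst// mulr1.
Qed.

(** * Propagation of the sixth moment by the solution *)

Section SolutionMoment.
Context (R : realType) (I : vec3 R -> vec3 R) (gamma nu c0 c1 : R) (beta : R -> R) (f : R -> probability (vec3 R) R).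
Hypotheses (HI : frame_choice I) (Hk : kernel_bounds nu c0 c1 beta) (Hg : -1 < gamma < 0) (Hgn : 0 < gamma + nu) (Hw : weak_solution gamma beta I f).
Implicit Types (v w : vec3 R) (s t r Q : R).

Section Level.
Variables (Q : R).
Hypothesis Q0 : 0 <= Q.
Let psi v := tmom Q (norm3 v).
Let phin (n : nat) v := Num.min (psi v) n%:R.
Let kk v := kv v + psi v.
Let Cm := 12 * pi * theta_cst nu c1 * 2 ^+ 19.
Let Cm0 : 0 <= Cm.
by rewrite /Cm mulr_ge0 ?exprn_ge0// mulr_ge0 ?(ltW (theta_cst_gt0 Hk))// mulr_ge0 ?pi_ge0. Qed.

Lemma tmom3_ge0 v : 0 <= psi v. Proof. exact: tmom_ge0 (norm3_ge0 v). Qed.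

Lemma mtmom3 : mfun psi.
apply: mfunM; first routine.
apply: mfunX; apply: measurable_minr; routine.
Qed.

Lemma bmeas_tmom3 n : bmeas (phin n).
by apply: bmeas_min; [exact: mtmom3|exact: tmom3_ge0|]. Qed.

Lemma minr_dist (x y c : R) : `|Num.min x c - Num.min y c| <= `|x - y|.
have H (a b : R) : a <= b -> `|Num.min a c - Num.min b c| <= `|a - b|.
 move=> ab; rewrite distrC (distrC a) !ger0_norm ?subr_ge0//; last by rewrite le_min !ge_min ab lexx !orbT.
 by case: (leP a c); case: (leP b c); lra.
case/orP: (le_total x y) => [xy|yx]; first exact: H.
by rewrite distrC (distrC x); exact: H.
Qed.

Lemma tmom3_lip n : lip3 (6 * Q ^+ 5) (phin n).
move=> x y; upto (minr_dist _ _ _).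
upto (tmom_diff Q0 (norm3_ge0 x) (norm3_ge0 y)).
apply: ler_pM; [|routine| |exact: norm3_dist].
 by rewrite mulr_ge0// exprn_ge0// min_ge0// le_max norm3_ge0.
by rewrite ler_pM2l// ler_pXn2r ?nnegrE ?min_ge0 ?le_max ?norm3_ge0// ge_min lexx orbT.
Qed.

(** Rate times jump length is at most 1 + |v| + |w|, and along a jump the slope of [tmom] is at most
    6 min(4(|v| + |w|), Q)^5, so the increment has the size of the moment itself. The constant [Cm]
    is independent of [Q] and [n]. *)
Lemma tmom3_A n v w : `|boltzmannA gamma beta I (phin n) v w| <= Cm * (kk v + kk w).
have x0 := norm3_ge0 v; have y0 := norm3_ge0 w; have n0 := norm3_ge0 (v - w).
have ns : norm3 (v - w) <= norm3 v + norm3 w by have := norm3D v (- w); rewrite norm3N.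
set B := 6 * Num.min (4 * (norm3 v + norm3 w)) Q ^+ 5 * norm3 (v - w).
have m0 : 0 <= Num.min (4 * (norm3 v + norm3 w)) Q ^+ 5.
 by rewrite exprn_ge0// min_ge0// mulr_ge0// addr_ge0.
have B0 : 0 <= B by routine.
have Hj e th ph : dot3 e e = 1 -> dot3 e (v - w) = 0 -> 0 < th <= pi / 2 ->
  `|phin n (v + jmpe e (v - w) th ph) - phin n v| <= B * th.
 move=> ee eX /andP[th0 thp]; upto (minr_dist _ _ _). have j1 := norm3_jmpe ph ee eX (ltW th0).
 have j2 := norm3_dist (v + jmpe e (v - w) th ph) v. rewrite /dist3 addrAC subrr add0r in j2.
 have p4 : th <= 2 by apply: (le_trans thp); have /andP[_ /ltW] := @pihalf_02 R.
 apply: tmom_jump => //; [routine|exact: ltW|exact: le_trans j1|].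
 have := norm3D v (jmpe e (v - w) th ph); have := ler_wpM2l n0 p4; lra.
have [h1 _] := boltzmannA_coll gamma HI Hk (bmeas_tmom3 n) B0 Hj.
apply: (le_trans h1).
have th0 := ltW (theta_cst_gt0 Hk); have p2 := pi2_ge0 R.
have [g1 g0] := andP Hg.
have aX : norm3 (v - w) `^ gamma * norm3 (v - w) <= 1 + (norm3 v + norm3 w).
 have [->|nz] := eqVneq (norm3 (v - w)) 0; first by rewrite mulr0 !addr_ge0.
 have n1 : 0 < norm3 (v - w) by rewrite lt_neqAle eq_sym nz.
 rewrite mulrC -[X in X * _](powRr1 n0) -powRD ?(gt_eqF n1) ?implybT//.
 by upto (powR_le_1D n1 _); [lra|rewrite lerD2l].
have t1 := tmom_sum Q0 x0 y0.
have -> : Cm * (kk v + kk w) = 2 * pi * theta_cst nu c1 * (6 * (2 ^+ 19 * (kk v + kk w))).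
 by rewrite /Cm; move: (theta_cst nu c1) (kk v) (kk w) => t a b; ring.
apply: ler_wpM2l; first routine.
rewrite /B.
have -> : norm3 (v - w) `^ gamma * (6 * Num.min (4 * (norm3 v + norm3 w)) Q ^+ 5 * norm3 (v - w)) =
 6 * ((norm3 (v - w) `^ gamma * norm3 (v - w)) * Num.min (4 * (norm3 v + norm3 w)) Q ^+ 5). lra.
rewrite ler_pM2l//; upto (ler_wpM2r m0 aX); apply: (le_trans t1).
have p1 : 1 <= 2 ^+ 19 :> R by rewrite exprn_ege1// ler1n.
have hk : 1 <= kv v + kv w by apply: le_trans (norm3_kv v w); rewrite lerDl.
have -> : kk v + kk w = kv v + kv w + (psi v + psi w) by rewrite /kk addrACA.
rewrite [leRHS]mulrDr; apply: lerD => //; apply: (le_trans hk); rewrite ler_peMl//.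
routine.
Qed.

Let y r := \int[ft f r]_v psi v.

Lemma tmom3_kv v : psi v <= Q ^+ 5 * kv v.
upto (tmom_lin Q0 (norm3_ge0 v)); rewrite ler_wpM2l ?exprn_ge0//.
by rewrite /kv; have := sqr_ge0 (norm3 v - 1); have := sqr_ge0 (norm3 v); rewrite sqrrB mulr1 expr1n; lra.
Qed.

Lemma tmom3_integrable r : (ft f r).-integrable setT (EFin \o psi).
have iZ : (ft f r).-integrable setT (EFin \o (fun v => Q ^+ 5 * kv v)).
 by have := integrableZl measurableT (Q ^+ 5) (sol_energy Hw r).1; apply: eq_integrable => // x _.
apply: (le_integrable measurableT _ _ iZ); first by apply/mEFinP; exact: mtmom3.
by move=> v _; rewrite /= lee_fin ger0_norm ?tmom3_ge0// (le_trans (tmom3_kv v))// ler_norm.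
Qed.

Lemma tmom3_le r : y r <= Q ^+ 5 * (1 + energy f).
have [ik <-] := sol_energy Hw r; rewrite -RintegralZl//.
apply: le_Rintegral => //; first exact: tmom3_integrable.
 by have := integrableZl measurableT (Q ^+ 5) ik; apply: eq_integrable => // x _.
by move=> v _; exact: tmom3_kv.
Qed.

Lemma tmom3_Q n r : `|boltzQ I gamma beta f (phin n) r| <= Cm * (2 * (1 + energy f + y r)).
have L0 : 0 <= 6 * Q ^+ 5 by routine.
have ce0 K : 0 <= cut_err nu c1 (6 * Q ^+ 5) K.
 exact: (mulr_ge0 (mulr_ge0 (rate_cst_ge0 Hk) L0) (powR_ge0 _ _)).
have kk0 v : 0 <= kk v by rewrite addr_ge0 ?kv_ge0 ?tmom3_ge0.
have ikk : (ft f r).-integrable setT (EFin \o kk).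
 by have := integrableD measurableT (sol_energy Hw r).1 (tmom3_integrable r); apply: eq_integrable => // x _.
have -> : 1 + energy f + y r = \int[ft f r]_v kk v.
 by rewrite /kk RintegralD//; [case: (sol_energy Hw r) => _ ->|exact: (sol_energy Hw r).1|exact: tmom3_integrable].
pose g := fun z : vec3 R * vec3 R => boltzmannA gamma beta I (phin n) z.1 z.2.
pose h m := fun z : vec3 R * vec3 R => coll I gamma beta m.+1%:R (phin n) z.1 (z.1 - z.2).
have bh m : bmeas (h m) by exact: (bmeas_coll2 gamma HI Hk _ (bmeas_tmom3 n)).
have H m x z : `|g (x, z) - h m (x, z)| <= cut_err nu c1 (6 * Q ^+ 5) m.+1%:R * (kk x + kk z).
 have [_ B] := boltzmannA_lip HI Hk Hg Hgn x z (bmeas_tmom3 n) L0 (@tmom3_lip n).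
 upto (B m.+1%:R _) => //; apply: ler_wpM2l => //. by apply: lerD; rewrite lerDl tmom3_ge0.
have th0 := ltW (theta_cst_gt0 Hk).
have := @double_int_dist _ _ _ (ft f r) g h kk (fun m => cut_err nu c1 (6 * Q ^+ 5) m.+1%:R) bh ikk kk0
 (fun m => ce0 m.+1%:R) (cut_err_cvg Hk _) H (fun=> 0) Cm (bmeas_cst _ 0) Cm0.
rewrite (_ : (fun x => \int[ft f r]_y 0) = (fun=> 0)); last by apply/funext => x; rewrite prob_cst.
by rewrite prob_cst subr0; apply => v w; rewrite subr0; exact: tmom3_A.
Qed.

(** The weak formulation accepts bounded functions only: it is applied to the moment cut at height
    [n], and [n] tends to infinity by dominated convergence. *)
Lemma tmom3_flow s t Y : 0 <= s -> s <= t -> (forall r, s <= r <= t -> y r <= Y) ->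
 `|y t - y s| <= Cm * (2 * (1 + energy f + Y)) * (t - s).
move=> s0 st yY; have L0 : 0 <= 6 * Q ^+ 5 by routine.
have th0 := ltW (theta_cst_gt0 Hk).
have cv r : \int[ft f r]_v phin n v @[n --> \oo] --> y r.
 apply: (prob_dominated_cvg _ (tmom3_integrable r)).
 - by move=> n; case: (bmeas_tmom3 n).
 - by move=> n v; rewrite ger0_norm ?ge_min ?lexx// le_min tmom3_ge0/=.
 - move=> v; apply: cvg_near_cst; near=> n; rewrite /phin min_l//. by near: n; exact: nbhs_infty_ger.
have D n : `|\int[ft f t]_v phin n v - \int[ft f s]_v phin n v| <= Cm * (2 * (1 + energy f + Y)) * (t - s).
 have st' : 0 <= s <= t by lra. rewrite (sol_flow HI Hk Hg Hgn Hw (bmeas_tmom3 n) L0 (@tmom3_lip n) st').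
 apply: iint_norm_le => //; first by case: (boltzQ_facts HI Hk Hg Hgn Hw (bmeas_tmom3 n) L0 (@tmom3_lip n)).
 move=> r rst; upto (tmom3_Q n r); apply: ler_wpM2l => //. by rewrite ler_pM2l// lerD2l yY.
have c2 : `|\int[ft f t]_v phin n v - \int[ft f s]_v phin n v| @[n --> \oo] --> `|y t - y s|.
 by apply: cvg_norm; apply: cvgB; exact: cv.
rewrite -(cvg_lim _ c2)//; apply: limr_le; first exact: cvgP c2.
by apply: nearW.
Unshelve. all: by end_near. Qed.

(** The Lipschitz constant [CQ] depends on [Q], but it serves only as the constant [C] of
    [discrete_gronwall], which leaves no trace in the conclusion. *)
Lemma tmom3_gronwall T : 0 <= T -> y T + (1 + energy f) <= expR (2 * Cm * T) * (y 0 + (1 + energy f)).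
move=> T0; have e0 := energy_ge0 f; have e1 : 0 <= 1 + energy f by rewrite addr_ge0.
have y0 r : 0 <= y r by apply: Rintegral_ge0 => // v _; exact: tmom3_ge0.
have th0 := ltW (theta_cst_gt0 Hk).
set B := Q ^+ 5 * (1 + energy f); pose CQ := Cm * (2 * (1 + energy f + B)).
have B0 : 0 <= B by apply: le_trans (tmom3_le 0); exact: y0.
have CQ0 : 0 <= CQ by apply: mulr_ge0 => //; rewrite mulr_ge0// addr_ge0.
have lip s t : 0 <= s -> s <= t -> `|y t - y s| <= CQ * (t - s).
 by move=> s0 st; apply: tmom3_flow => // r _; exact: tmom3_le.
have := @discrete_gronwall R y (fun t => 2 * Cm * t) (1 + energy f) CQ 0 T T0 e1 CQ0 (lexx 0).
rewrite mulr0 subr0 mul0r addr0; apply.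
- by move=> s t s0 st _; apply: ler_wpM2l => //; routine.
- by move=> s _; routine.
move=> s t s0 st tT; have h r : s <= r <= t -> y r <= y s + CQ * (t - s).
 move=> /andP[sr rt]; have := lip s r s0 sr; rewrite ler_norml => /andP[_ h1].
 have := ler_wpM2l CQ0 (lerB rt (lexx s)); lra.
have := tmom3_flow s0 st h; rewrite ler_norml => /andP[_ h2].
have z := mulr_ge0 CQ0 (sqr_ge0 (t - s)).
move: (y t) (y s) Cm (energy f) h2 z => yt ys cm en h2 z; lra.
Qed.

End Level.

(** Uniformity in [Q] makes this a bound on the sixth moment. At time 0 it comes from x^6 <= 1 +
    x^q. *)
Lemma sol_moment T q : 0 <= T -> 6 < q -> (moment q (f 0) < +oo)%E ->
 exists2 M : R, 0 <= M & forall t Q, 0 <= t <= T -> 0 <= Q -> \int[ft f t]_v tmom Q (norm3 v) <= M.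
move=> T0 q6 mq; have e0 := energy_ge0 f.
have mn : mfun (fun v : vec3 R => 1 + norm3 v `^ q).
 apply: mfunD; first routine. by apply: (mcomp (@measurable_powR R q)); routine.
have mq' : mfun (fun v : vec3 R => norm3 v `^ q).
 by apply: (mcomp (@measurable_powR R q)); routine.
have iq : (ft f 0).-integrable setT (EFin \o (fun v : vec3 R => norm3 v `^ q)).
 apply/integrableP; split; first exact/mEFinP.
 rewrite /ft max_l//; apply: le_lt_trans mq; apply: ge0_le_integral => //.
 - by apply: mcomp => //; exact/mEFinP.
 - exact/mEFinP.
 - by move=> v _; rewrite /= ger0_norm ?powR_ge0.
have iq1 : (ft f 0).-integrable setT (EFin \o (fun v : vec3 R => 1 + norm3 v `^ q)).
 by have := integrableD measurableT (bmeas_integrable (ft f 0) (bmeas_cst _ 1)) iq; apply: eq_integrable => // x _.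
pose M0 := \int[ft f 0]_v (1 + norm3 v `^ q).
have y0 Q : 0 <= Q -> \int[ft f 0]_v tmom Q (norm3 v) <= M0.
 move=> Q0; apply: le_Rintegral => //; first exact: tmom3_integrable. move=> v _; upto (tmom_le6 Q0 (norm3_ge0 v)).
 have [v1|v1] := leP (norm3 v) 1.
  have : norm3 v ^+ 6 <= 1 ^+ 6 by rewrite ler_pXn2r ?nnegrE ?norm3_ge0.
  by rewrite expr1n; move/le_trans; apply; rewrite lerDl powR_ge0.
 rewrite -powR_mulrn ?norm3_ge0//; via (norm3 v `^ q); last by rewrite lerDr. by apply: ler_powR; exact: ltW.
have M00 : 0 <= M0 by apply: Rintegral_ge0 => // v _; rewrite addr_ge0 ?powR_ge0.
have th0 := ltW (theta_cst_gt0 Hk).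
set Cm := 12 * pi * theta_cst nu c1 * 2 ^+ 19.
have Cm0 : 0 <= Cm by rewrite /Cm; apply: mulr_ge0; [apply: (mulr_ge0 _ th0); rewrite mulr_ge0 ?pi_ge0|exact: exprn_ge0].
exists (expR (2 * Cm * T) * (M0 + (1 + energy f))).
 routine.
move=> t Q /andP[t0 tT] Q0; have := tmom3_gronwall Q0 t0.
rewrite -/Cm => h; via (\int[ft f t]_v tmom Q (norm3 v) + (1 + energy f)).
 by rewrite lerDl addr_ge0.
apply: (le_trans h); apply: ler_pM.
- exact: expR_ge0.
- by rewrite addr_ge0 ?addr_ge0//; apply: Rintegral_ge0 => // v _; exact: tmom3_ge0.
- by rewrite ler_expR ler_wpM2l// mulr_ge0.
- by rewrite lerD2r y0.
Qed.

End SolutionMoment.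

Lemma bfun_eq_indic d (T : measurableType d) (R : realType) (I J : (T -> R) -> R) : bfun I -> bfun J ->
 (forall B, measurable B -> I (\1_B) = J (\1_B)) -> forall g, bmeas g -> I g = J g.
move=> bI bJ E; apply: (@bfun_unique _ T R I J (@measurable _ T)) => //.
- by rewrite sigma_algebra_id//; exact: sigma_algebra_measurable.
- by move=> A B mA mB; routine.
- by have := E setT measurableT; rewrite indicT.
Qed.

(** * Sup bounds on collision operators *)

Section CollBounds.
Context (R : realType) (I : vec3 R -> vec3 R) (gamma nu c0 c1 : R) (beta : R -> R).
Hypotheses (HI : frame_choice I) (Hk : kernel_bounds nu c0 c1 beta).
Implicit Types (v X e : vec3 R) (phi : vec3 R -> R) (K O : R).

Lemma coll_ub phi v X K O : 0 <= K -> bmeas phi ->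
 (forall e th ph, dot3 e e = 1 -> dot3 e X = 0 -> 0 <= th <= pi / 2 -> phi (v + jmpe e X th ph) - phi v <= O) ->
 coll I gamma beta K phi v X <= 2 * pi * K * O.
move=> K0 bp H; have [e [ee eX _]] := exists_unit_ortho X 0.
have p2 := pi2_ge0 R.
have -> : 2 * pi * K * O = iint 0 K (fun=> 2 * pi * O) by rewrite iint_cst// subr0; ring.
apply: (bfun_le (iint_bfun 0 K)); [exact: (bmeas_circ_angle gamma HI Hk)|routine|].
move=> z; rewrite (circE HI _ _ bp ee eX).
have -> : 2 * pi * O = iint 0 (2 * pi) (fun=> O) by rewrite iint_cst// subr0.
apply: (bfun_le (iint_bfun 0 (2 * pi))); [|routine|].
 apply: bmeasB; last routine. apply: (bmeas_comp bp); apply: mvec3D; first routine.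
 apply: mvec3D => //; apply: mscale3 => //; apply: mvec3D.
  by apply: mscale3 => //; apply: mfunM => //; exact: mcosf.
 routine.
by move=> ph; apply: H => //; rewrite (angle_ge0 Hk) (angle_le Hk).
Qed.

Lemma coll_opp phi v X K : bmeas phi -> coll I gamma beta K (fun x => - phi x) v X = - coll I gamma beta K phi v X.
move=> bp; rewrite /coll -(bfunN (iint_bfun 0 K)); last exact: (bmeas_circ_angle gamma HI Hk).
apply: eq_iint => z _; rewrite /circ -(bfunN (iint_bfun 0 (2 * pi))).
 by apply: eq_iint => ph _; rewrite opprB opprK addrC.
apply: bmeasB; last routine.
apply: (bmeas_comp bp); apply: mvec3D; first routine.
exact: mjmp.
Qed.

Lemma coll_norm phi v X K O : 0 <= K -> bmeas phi -> (forall x, `|phi x - phi v| <= O) ->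
 `|coll I gamma beta K phi v X| <= 2 * pi * K * O.
move=> K0 bp H; rewrite ler_norml lerNl -(coll_opp _ _ _ bp); apply/andP; split; apply: coll_ub => //.
- exact: bmeasN.
- by move=> e th ph _ _ _; rewrite opprK addrC (le_trans (ler_norm _))// distrC.
- by move=> e th ph _ _ _; rewrite (le_trans (ler_norm _)).
Qed.

Section Generator.
Variables (N : nat) (K : R).
Hypotheses (N0 : (0 < N)%N) (K0 : 0 < K).
Notation E := (N.-tuple (vec3 R)).
Implicit Types (w : E) (psi : E -> R).

Lemma bmeas_generator psi : bmeas psi -> bmeas (particle_generator gamma beta K psi).
move=> bp; have -> : particle_generator gamma beta K psi = fun w => N%:R^-1 * \sum_(i < N) \sum_(j < N | i != j)
  coll I gamma beta K (fun y => psi (upd w i y)) (tnth w i) (tnth w i - tnth w j).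
 by apply/funext => w; rewrite (particle_generatorE gamma HI Hk)//.
apply: bmeasZ; apply: bmeas_sum => i _; apply: bmeas_sum => j _.
apply: (bmeas_coll gamma HI Hk K (phi := fun z : E * vec3 R => psi (upd z.1 i z.2))).
- apply: (bmeas_comp bp); exact: mupd.
- exact: mtnth.
- by apply: mvec3B; routine.
Qed.

Lemma generator_norm psi O w : bmeas psi -> (forall x y, `|psi x - psi y| <= O) ->
 `|particle_generator gamma beta K psi w| <= 2 * pi * N%:R * K * O.
move=> bp H; rewrite (particle_generatorE gamma HI Hk)// normrM ger0_norm//.
have O0 : 0 <= O by apply: le_trans (H w w).
have nn : 0 < N%:R :> R by rewrite ltr0n.
have p2 := pi2_ge0 R.
rewrite mulrC ler_pdivrMr//.
upto (ler_norm_sum _ _ _); via (\sum_(i < N) \sum_(j < N) 2 * pi * K * O).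
 apply: ler_sum => i _; upto (ler_norm_sum _ _ _). rewrite [leRHS](bigID (fun j => i != j))/=; apply: ler_wpDr.
  routine.
 apply: ler_sum => j _; apply: coll_norm; [exact: ltW|routine|]. by [].
rewrite sumr_const card_ord sumr_const card_ord -[leLHS]mulr_natr -[X in X * _]mulr_natr.
lra.
Qed.

End Generator.
End CollBounds.

Lemma le_eps_mul (R : realType) (x y c : R) : (forall eps, 0 < eps -> x <= y + c * eps) -> x <= y.
move=> H; apply: (@le_invn _ _ _ `|c|) => // n; have := H n.+1%:R^-1; rewrite invr_gt0 ltr0n => /(_ isT) /le_trans; apply.
by rewrite lerD2l; apply: ler_wpM2r; rewrite ?invr_ge0// ler_norm.
Qed.

(** * Second-order expansion of a Markov semigroup with bounded generator *)

Section Semigroup.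
Context (R : realType) d (E : measurableType d) (kappa : R -> R.-pker E ~> E).
Variables (D : set (E -> R)) (Lop : (E -> R) -> E -> R) (Lam : R).
Hypotheses (Hsg : markov_semigroup kappa) (Hgen : has_generator_on kappa D Lop) (Lam0 : 0 <= Lam).
Hypothesis HL : forall (phi : E -> R) (B : R), D phi -> bmeas phi -> (forall x, `|phi x| <= B) ->
 bmeas (Lop phi) /\ forall x, `|Lop phi x| <= Lam * B.
(* The bounded Lipschitz test functions approximate the indicator of the complement of a point. *)
Hypothesis Hsep : forall x : E, exists F : nat -> E -> R, forall m,
 [/\ D (F m), bmeas (F m), F m x = 0, (forall y, 0 <= F m y <= 1) &
   forall y, y != x -> F n y @[n --> \oo] --> (1 : R)].
Implicit Types (x y : E) (h s t B : R) (phi psi : E -> R).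
Definition sgp h phi x : R := \int[kappa h x]_y phi y.

Lemma kappa1 h x : kappa h x setT = 1%E. Proof. exact: prob_kernel. Qed.

Lemma sgp_bfun h x : bfun (fun phi => sgp h phi x).
have := @bfun_Rintegral _ E R (kappa h x) setT (fun=> 1) measurableT.
have -> : (fun f : E -> R => \int[kappa h x]_y (f y * 1)) = fun phi => sgp h phi x.
 by apply/funext => f; apply: eq_Rintegral => y _; rewrite mulr1.
apply => //.
apply/integrableP; split; first routine.
rewrite (eq_integral (cst 1%E)); last by move=> y _ /=; rewrite normr1.
by rewrite integral_cst// mul1e [X in (X < _)%E]kappa1 ltry.
Qed.

Lemma sgp_indic h x (B : set E) : measurable B -> sgp h (\1_B) x = fine (kappa h x B).
by move=> mB; rewrite /sgp /Rintegral integral_indic// setIT. Qed.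

Lemma sgp1 h x : sgp h (fun=> 1) x = 1.
by rewrite -[X in sgp h X](@indicT E R) sgp_indic// kappa1. Qed.

Lemma sgp_bmeas h phi : bmeas phi -> bmeas (sgp h phi).
move=> bp; apply: (@bfun_param_family _ _ E E R (fun x psi => sgp h psi x) 1 _ _ _ (fun z : E * E => phi z.2)).
- by move=> x; exact: sgp_bfun.
- by move=> x; rewrite sgp1.
- move=> B mB; have -> : (fun x => sgp h (\1_B) x) = fun x => fine (kappa h x B) by apply/funext => x; exact: sgp_indic.
 by apply: mcomp => //; exact: measurable_kernel.
- exact: (bmeas_comp bp).
Qed.

Lemma sgp_le h phi B x : bmeas phi -> (forall y, `|phi y| <= B) -> `|sgp h phi x| <= B.
by move=> bp /(bfun_norm_le (sgp_bfun h x) bp); rewrite sgp1 mulr1. Qed.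

Lemma sgp0 phi x : bmeas phi -> sgp 0 phi x = phi x.
move=> bp; apply: (bfun_eq_indic (sgp_bfun 0 x) (J := fun psi => psi x) _ _ bp).
 by split.
by move=> B mB; rewrite sgp_indic// Hsg.1// diracE.
Qed.

Lemma sgpD s t phi x : 0 <= s -> 0 <= t -> bmeas phi -> sgp (s + t) phi x = sgp s (sgp t phi) x.
move=> s0 t0 bp; have bI := bfun_mix (sgp_bfun s x) (J := fun y psi => sgp t psi y) (C := 1) (fun y => sgp_bfun t y) _ _.
apply: (bfun_eq_indic (sgp_bfun _ x) (J := fun psi => sgp s (sgp t psi) x) _ _ bp).
 apply: bI; first by move=> y; rewrite sgp1. by move=> B mB; have [] := sgp_bmeas t (bmeas_indic R mB).
move=> B mB; rewrite sgp_indic// Hsg.2// /sgp /Rintegral; congr fine; apply: eq_integral => y _.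
transitivity ((sgp t (\1_B) y)%:E); last by [].
rewrite sgp_indic// fineK// ge0_fin_numE//.
by apply: (@le_lt_trans _ _ (kappa t y setT)); [exact: le_measure (mem_set _) (mem_set _) _|rewrite kappa1 ltry].
Qed.

Lemma gen_small phi eps : D phi -> 0 < eps -> exists2 h0, 0 < h0 &
 forall h x, 0 < h < h0 -> `|sgp h phi x - phi x - h * Lop phi x| <= h * eps.
move=> Dp e0; have [/= h0 h00 H] := Hgen Dp e0; exists h0 => // h x /andP[hp hh].
have {H} := H h; rewrite /ball_/= sub0r normrN gtr0_norm// => /(_ hh hp x).
have -> : sgp h phi x - phi x - h * Lop phi x = h * ((sgp h phi x - phi x) / h - Lop phi x).
 by rewrite mulrBr mulrCA mulfV ?mulr1// gt_eqF.
by move=> H; rewrite normrM gtr0_norm// ler_pM2l.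
Qed.

(* A discrete telescope along the semigroup. *)
Lemma sgp_chain h n phi k x (g : E -> R) (b : R) : 0 <= h -> bmeas phi -> bmeas g ->
 (forall y, `|sgp h phi y - phi y - h * g y| <= h * b) ->
 (forall m, (m < n)%N -> `|sgp (m%:R * h) g x - g x| <= k) ->
 `|sgp (n%:R * h) phi x - phi x - n%:R * h * g x| <= n%:R * h * (b + k).
move=> h0 bp bg H; elim: n => [|n IH] Hk; first by rewrite !mul0r sgp0// !subrr normr0.
have {}IH := IH (fun m mn => Hk m (leq_trans mn (leqnSn n))); have {}Hk := Hk n (ltnSn n).
have nh : 0 <= n%:R * h by routine.
rewrite -natr1 mulrDl mul1r sgpD//.
have bs := bmeasB (sgp_bmeas h bp) bp.
have E1 : sgp (n%:R * h) (sgp h phi) x = sgp (n%:R * h) (fun y => sgp h phi y - phi y - h * g y) x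
  + sgp (n%:R * h) phi x + h * sgp (n%:R * h) g x.
 rewrite (bfunB (sgp_bfun _ x) bs (bmeasZ h bg)) (bfunB (sgp_bfun _ x) (sgp_bmeas h bp) bp) (bfunZ (sgp_bfun _ x))//.
 lra.
have := sgp_le (n%:R * h) x (bmeasB bs (bmeasZ h bg)) H; rewrite E1.
move: (sgp _ (fun y => _) x) (sgp _ phi x) (sgp _ g x) IH Hk => u v w IH Hk Hu.
have -> : u + v + h * w - phi x - (n%:R * h + h) * g x = (v - phi x - n%:R * h * g x) + u + h * (w - g x) by ring.
have Hw : `|h * (w - g x)| <= h * k by rewrite normrM (ger0_norm h0) ler_wpM2l.
upto (ler_normD _ _); upto (lerD (ler_normD _ _) Hw).
lra.
Qed.

Lemma exists_fine_step t h0 : 0 < t -> 0 < h0 -> exists n : nat, let h := t / n.+1%:R in 0 < h < h0 /\ n.+1%:R * h = t.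
move=> t0 h00; exists (Num.truncn (t / h0)) => h; have n0 : 0 < (Num.truncn (t / h0)).+1%:R :> R by [].
split; last by rewrite /h mulrCA mulfV ?mulr1// gt_eqF.
rewrite divr_gt0//= ltr_pdivrMr// mulrC -ltr_pdivrMr//.
by apply: truncnS_gt.
Qed.

Lemma sgp_lip phi B t x : D phi -> bmeas phi -> (forall y, `|phi y| <= B) -> 0 <= t ->
 `|sgp t phi x - phi x| <= t * (Lam * B).
move=> Dp bp pB; rewrite le_eqVlt => /orP[/eqP<-|t0]; first by rewrite sgp0// subrr normr0 mul0r.
apply: (@le_eps_mul _ _ _ t) => eps e0; have [h0 h00 H] := gen_small Dp e0.
have [n [hh nE]] := exists_fine_step t0 h00; set h := t / n.+1%:R in hh nE; have [hp _] := andP hh.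
have [bL LB] := HL Dp bp pB.
have := @sgp_chain h n.+1 phi 0 x (fun=> 0) (Lam * B + eps) (ltW hp) bp (bmeas_cst _ 0).
rewrite nE !mulr0 addr0 subr0 -mulrDr; apply => [y|m _]; last by rewrite (bfun_cst (sgp_bfun _ x)) mul0r subrr normr0.
rewrite subr0; have -> : sgp h phi y - phi y = (sgp h phi y - phi y - h * Lop phi y) + h * Lop phi y by ring.
rewrite (le_trans (ler_normD _ _))// mulrDr [leRHS]addrC; apply: lerD; first exact: H.
by rewrite normrM (gtr0_norm hp) ler_wpM2l ?LB// ltW.
Qed.

(** The functions of [Hsep] vanish at [x] and tend to 1 elsewhere, so by [sgp_lip] the probability
    of being away from [x] at time [t] is at most [t * Lam]. The estimate will be applied to
    [Lop phi], which is bounded but may lie outside [D]. *)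
Lemma sgp_cont psi B t x : bmeas psi -> (forall y, `|psi y| <= B) -> 0 <= t ->
 `|sgp t psi x - psi x| <= 2 * B * (t * Lam).
move=> bp pB t0; have [F HF] := Hsep x.
have B0 : 0 <= B by apply: le_trans (pB x).
have bd : bmeas (fun y => psi y - psi x) by routine.
have bn : bmeas (fun y => `|psi y - psi x|).
 have [m [M HM]] := bd; split; first exact: mcomp. by exists M => y; rewrite normr_id.
have dB y : `|psi y - psi x| <= 2 * B by rewrite (le_trans (ler_normB _ _))// mulrDl mul1r lerD.
have -> : sgp t psi x - psi x = sgp t (fun y => psi y - psi x) x.
 by rewrite (bfunB (sgp_bfun t x) bp (bmeas_cst _ _)) [sgp t (fun=> psi x) x](bfun_cst (sgp_bfun t x)) sgp1 mulr1.
upto (bfun_norm (sgp_bfun t x) bd).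
have C : sgp t (fun y => `|psi y - psi x| * F n y) x @[n --> \oo] --> sgp t (fun y => `|psi y - psi x|) x.
 apply: (bfun_cvg (sgp_bfun t x) (M := 2 * B)).
 - by move=> n; have [_ bF _ _ _] := HF n; have [] := bmeasM bn bF.
 - move=> n y; have [_ _ _ F01 _] := HF n; have /andP[F0 F1] := F01 y.
  by rewrite ger0_norm ?mulr_ge0// -[leRHS]mulr1 ler_pM.
 - move=> y; have [->|yx] := eqVneq y x; first by rewrite subrr normr0; under eq_fun do rewrite mul0r; exact: cvg_cst.
  have [_ _ _ _ Fy] := HF 0%N; rewrite -[X in _ --> X]mulr1; apply: cvgM; [exact: cvg_cst|exact: Fy].
rewrite -(cvg_lim _ C)//; apply: limr_le; first by apply/cvg_ex; eexists; exact: C.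
apply: nearW => n; have [DF bF F0 F01 _] := HF n.
via (sgp t (fun y => 2 * B * F n y) x).
 apply: (bfun_le (sgp_bfun t x)); [exact: bmeasM|exact: bmeasZ|move=> y].
 by have /andP[? _] := F01 y; exact: ler_wpM2r.
rewrite (bfunZ (sgp_bfun t x))//; apply: ler_wpM2l; first by lra.
have := sgp_lip x DF bF (B := 1) _ t0; rewrite F0 subr0 mulr1 => /(_ _) H; apply: le_trans (ler_norm _) (H _).
by move=> y; have /andP[? ?] := F01 y; rewrite ger0_norm.
Qed.

(** Along a chain of fine steps, [Lop phi] at the running point is compared with its value at [x] by
    [sgp_cont]; this makes the remainder quadratic in [t]. *)
Lemma sgp_expand phi B t x : D phi -> bmeas phi -> (forall y, `|phi y| <= B) -> 0 <= t ->
 `|sgp t phi x - phi x - t * Lop phi x| <= 2 * Lam ^+ 2 * B * t ^+ 2.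
move=> Dp bp pB; have [bL LB] := HL Dp bp pB.
rewrite le_eqVlt => /orP[/eqP<-|t0]; first by rewrite sgp0// mul0r !subrr normr0 expr0n mulr0.
apply: (@le_eps_mul _ _ _ t) => eps e0; have [h0 h00 H] := gen_small Dp e0.
have [n [hh nE]] := exists_fine_step t0 h00; set h := t / n.+1%:R in hh nE; have [hp _] := andP hh.
have := @sgp_chain h n.+1 phi (2 * (Lam * B) * (t * Lam)) x (Lop phi) eps (ltW hp) bp bL (fun y => H h y hh).
rewrite nE => E1; apply: le_trans (E1 _) _; last by apply: eq_ler; ring.
move=> m mn; have B0 : 0 <= Lam * B by apply: le_trans (LB x).
upto (sgp_cont x bL LB _); first routine.
apply: ler_wpM2l; first routine.
by apply: ler_wpM2r => //; rewrite -nE; apply: ler_wpM2r; [exact: ltW|rewrite ler_nat ltnW].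
Qed.

Context d' (Omega : measurableType d') (P : probability Omega R) (X : R -> {RV P >-> E}).
Hypothesis HX : markov_process P kappa X.
Definition law t psi : R := \int[P]_w psi (X t w).

Lemma law_bfun t : bfun (law t).
by apply: (bfun_comp (bfun_prob P)); routine. Qed.

Lemma law1 t : law t (fun=> 1) = 1. Proof. exact: prob_cst. Qed.

Lemma law_le t phi B : bmeas phi -> (forall y, `|phi y| <= B) -> `|law t phi| <= B.
by move=> bp /(bfun_norm_le (law_bfun t) bp); rewrite law1 mulr1. Qed.

Lemma law_markov s t phi : 0 <= s -> 0 <= t -> bmeas phi -> law (s + t) phi = law s (sgp t phi).
move=> s0 t0 bp; have bI := bfun_mix (law_bfun s) (J := fun y psi => sgp t psi y) (C := 1) (fun y => sgp_bfun t y) _ _.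
apply: (bfun_eq_indic (law_bfun _) (J := fun psi => law s (sgp t psi)) _ _ bp).
 apply: bI; first by move=> y; rewrite sgp1. by move=> B mB; have [] := sgp_bmeas t (bmeas_indic R mB).
move=> B mB; have pT : past_events X s setT.
 by apply: sub_sigma_algebra; exists s, setT; split; rewrite ?lexx ?s0.
have := HX s0 t0 pT mB; rewrite setTI => HB.
rewrite /law (_ : (fun w => \1_B (X (s + t) w)) = \1_(X (s + t) @^-1` B))//.
rewrite prob_indic; last by rewrite -[X in measurable X]setTI; exact: (measurable_funPT (X (s + t))).
rewrite HB /Rintegral; congr fine; apply: eq_integral => w _.
rewrite sgp_indic// fineK// ge0_fin_numE//.
by apply: (@le_lt_trans _ _ (kappa t (X s w) setT)); [exact: le_measure (mem_set _) (mem_set _) _|rewrite kappa1 ltry].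
Qed.

Lemma law_lip phi B s t : D phi -> bmeas phi -> (forall y, `|phi y| <= B) -> 0 <= s -> s <= t ->
 `|law t phi - law s phi| <= (t - s) * (Lam * B).
move=> Dp bp pB s0 st; have ts : 0 <= t - s by lra.
have {1}-> : t = s + (t - s) by lra.
rewrite law_markov// -(bfunB (law_bfun s) (sgp_bmeas _ bp) bp).
by apply: law_le => [|y]; [apply: bmeasB => //; exact: sgp_bmeas|exact: sgp_lip].
Qed.

(** The generator may be evaluated at any intermediate time [r]: it must later be added to the
    nonlinear generator at the same time, and the bound on their sum depends on [r]. *)
Lemma law_step phi B s r t : D phi -> bmeas phi -> (forall y, `|phi y| <= B) -> 0 <= s -> s <= r -> r <= t ->
 `|law t phi - law s phi - (t - s) * law r (Lop phi)| <= 4 * Lam ^+ 2 * B * (t - s) ^+ 2.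
move=> Dp bp pB s0 sr rt; have [bL LB] := HL Dp bp pB.
have ts : 0 <= t - s by lra.
have E1 : `|law t phi - law s phi - (t - s) * law s (Lop phi)| <= 2 * Lam ^+ 2 * B * (t - s) ^+ 2.
 have {1}-> : t = s + (t - s) by lra. have bs := sgp_bmeas (t - s) bp.
 rewrite law_markov// -(bfunB (law_bfun s) bs bp) -(bfunZ (law_bfun s))//.
 rewrite -(bfunB (law_bfun s) (bmeasB bs bp) (bmeasZ _ bL)). by apply: law_le => [|y]; [routine|exact: sgp_expand].
have E2 : `|law r (Lop phi) - law s (Lop phi)| <= 2 * (Lam * B) * ((t - s) * Lam).
 have {1}-> : r = s + (r - s) by lra. have rs : 0 <= r - s by lra.
 have bs := sgp_bmeas (r - s) bL; rewrite law_markov// -(bfunB (law_bfun s) bs bL).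
 apply: law_le => [|y]; first routine. have B0 : 0 <= Lam * B by apply: le_trans (LB y).
 upto (sgp_cont y bL LB rs); apply: ler_wpM2l; first by lra. by apply: ler_wpM2r => //; rewrite lerD2r.
have -> : law t phi - law s phi - (t - s) * law r (Lop phi) =
 (law t phi - law s phi - (t - s) * law s (Lop phi)) + - ((t - s) * (law r (Lop phi) - law s (Lop phi))) by ring.
upto (ler_normD _ _); rewrite normrN normrM (ger0_norm ts).
nra.
Qed.

End Semigroup.

Lemma prodf_tnth (R : realType) (N : nat) (g : 'I_N -> probability (vec3 R) R) (h : vec3 R -> R) i :
 bmeas h -> prodf g (fun w => h (tnth w i)) = \int[g i]_x h x.
move=> bh; have := @prodf_prod R N g (fun k => if k == i then h else fun=> 1).
have -> : (fun w : N.-tuple (vec3 R) => \prod_k (if k == i then h else fun=> 1) (tnth w k)) = fun w => h (tnth w i).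
 by apply/funext => w; rewrite (bigD1 i)//= eqxx big1 ?mulr1// => k /negPf->.
move=> ->; last by move=> k; case: ifP => // _; routine.
by rewrite (bigD1 i)//= eqxx big1 ?mulr1// => k /negPf->; exact: prob_cst.
Qed.

(** * A capped sixth moment *)

Section Min6.
Context (R : realType) (Q : R).
Hypothesis Q0 : 0 <= Q.
Implicit Types (x y : vec3 R).
(** Bounded and Lipschitz, so that its sum over the particles is a test function for their
    generator, whereas [tmom] is unbounded. *)
Definition min6 x : R := Num.min (norm3 x) Q ^+ 6.

Lemma min6_ge0 x : 0 <= min6 x.
by apply: exprn_ge0; apply: min_ge0; routine. Qed.

Lemma min6_le x : min6 x <= Q ^+ 6.
by apply: lerXn2r; rewrite ?nnegrE ?min_ge0 ?norm3_ge0// ge_min lexx orbT. Qed.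

Lemma min6_lip x y : `|min6 x - min6 y| <= 6 * Q ^+ 5 * dist3 x y.
rewrite /min6 subrXX normrM mulrC; apply: ler_pM => //; last first.
 by upto (minr_dist _ _ _); exact: norm3_dist.
have q z : 0 <= Num.min (norm3 z) Q <= Q by rewrite min_ge0 ?norm3_ge0// ge_min lexx orbT.
have /andP[a0 aQ] := q x; have /andP[b0 bQ] := q y.
upto (ler_norm_sum _ _ _); via (\sum_(i < 6) Q ^+ 5); last by rewrite sumr_const card_ord mulr_natl.
apply: ler_sum => i _; rewrite ger0_norm ?mulr_ge0 ?exprn_ge0//.
have -> : Q ^+ 5 = Q ^+ (6.-1 - i) * Q ^+ i by rewrite -exprD subnK// -ltnS ltn_ord.
by apply: ler_pM; rewrite ?exprn_ge0//; apply: lerXn2r; rewrite ?nnegrE.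
Qed.

Lemma min6_bmeas : bmeas min6.
apply: (bmeas_bound (a := 0) (b := Q ^+ 6)); last by move=> x; rewrite min6_ge0 min6_le.
apply: mfunX; apply: measurable_minr; routine.
Qed.

Lemma min6_jump x y (th ph : R) e : dot3 e e = 1 -> dot3 e (x - y) = 0 -> 0 <= th <= pi / 2 ->
 min6 (x + jmpe e (x - y) th ph) <= 6 ^+ 6 * (min6 x + min6 y).
move=> ee eX /andP[th0 th2].
have th2' : th <= 2 by have /andP[_] := @pihalf_02 R; move: th2; lra.
have H : norm3 (x + jmpe e (x - y) th ph) <= 6 * Num.max (norm3 x) (norm3 y).
 upto (norm3D _ _); upto (lerD (lexx _) (norm3_jmpe _ ee eX th0)). have := norm3D x (- y); rewrite norm3N => D.
 have : norm3 x <= Num.max (norm3 x) (norm3 y) by rewrite le_max lexx.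
 have : norm3 y <= Num.max (norm3 x) (norm3 y) by rewrite le_max lexx orbT.
 have := norm3_ge0 (x - y); have := norm3_ge0 x. nra.
set z := norm3 (x + jmpe e (x - y) th ph) in H *; have Hz := H; have z0 : 0 <= z by routine.
have m0 v : 0 <= Num.min (norm3 v) Q by apply: min_ge0 (norm3_ge0 v) Q0.
have : Num.min z Q <= 6 * Num.max (Num.min (norm3 x) Q) (Num.min (norm3 y) Q).
 rewrite -min_maxl; have M0 : 0 <= Num.max (norm3 x) (norm3 y) by lra.
 case/orP: (le_total (Num.max (norm3 x) (norm3 y)) Q) => h; first by rewrite (min_l h) ge_min Hz.
 by rewrite (min_r h) ge_min (_ : Q <= 6 * Q) ?orbT//; move: Q0; lra.
move=> Hm; rewrite /min6 -/z; via ((6 * Num.max (Num.min (norm3 x) Q) (Num.min (norm3 y) Q)) ^+ 6).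
 by apply: lerXn2r; rewrite ?nnegrE ?mulr_ge0 ?le_max ?m0.
rewrite exprMn; apply: ler_wpM2l; first routine.
by case/orP: (le_total (Num.min (norm3 x) Q) (Num.min (norm3 y) Q)) => h; rewrite (max_l h, max_r h) ?lerDr ?lerDl exprn_ge0.
Qed.

End Min6.

(** * The law of the particle system *)

Section ParticleFlow.
Context (R : realType) (I : vec3 R -> vec3 R) (gamma nu c0 c1 : R) (beta : R -> R).
Hypotheses (HI : frame_choice I) (Hk : kernel_bounds nu c0 c1 beta).
Context (N : nat) (K : R) d (Omega : measurableType d) (P : probability Omega R).
Variable V : R -> {RV P >-> N.-tuple (vec3 R)}.
Hypotheses (N0 : (0 < N)%N) (K0 : 0 < K) (Hp : particle_process gamma beta K P V).
Notation E := (N.-tuple (vec3 R)).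
Implicit Types (w : E) (phi psi : E -> R) (s t r L B Q : R).
(** Bound on the generator in sup norm: 2 pi N K bounds the total jump rate, and the other 2 the
    oscillation of a function by its sup norm. *)
Definition jump_rate (N : nat) K : R := 4 * pi * N%:R * K.

Let D := bounded_lipschitz (@distN R N).
Let Lop := @particle_generator R gamma beta N K.

Lemma bounded_lip_bmeas phi : D phi -> bmeas phi.
move=> [[M HM] [L HL]]; split; last by exists M.
apply: (@lipN_measurable _ _ `|L|) => v w; upto (HL v w).
via (`|L| * distN v w); first by apply: ler_wpM2r; [exact: sqrtr_ge0|exact: ler_norm].
by apply: ler_wpM2l; rewrite ?distN_dist1.
Qed.

Lemma generator_rate phi B : D phi -> bmeas phi -> (forall x, `|phi x| <= B) ->
 bmeas (Lop phi) /\ forall x, `|Lop phi x| <= jump_rate N K * B.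
move=> _ bp pB; split => [|x]; first exact: (bmeas_generator gamma HI Hk K0).
have -> : jump_rate N K * B = 2 * pi * N%:R * K * (2 * B) by rewrite /jump_rate; ring.
apply: (generator_norm gamma HI Hk N0 K0 _ bp) => y z; rewrite (le_trans (ler_normB _ _))//.
by rewrite mulrDl mul1r lerD.
Qed.

Lemma separating_lipschitz w : exists F : nat -> E -> R, forall m,
 [/\ D (F m), bmeas (F m), F m w = 0, (forall y, 0 <= F m y <= 1) &
   forall y, y != w -> F n y @[n --> \oo] --> (1 : R)].
pose F (m : nat) y := Num.min (m%:R * dist1 w y) (1 : R); exists F => m.
have F01 y : 0 <= F m y <= 1 by rewrite /F ge_min lexx orbT andbT min_ge0// mulr_ge0// dist1_ge0.
have DF : D (F m).
 apply: (lipN_bounded_lip (L := m%:R) (B := 1)) => // [y z|y]; last by have /andP[? ?] := F01 y; rewrite ger0_norm.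
 upto (minr_dist _ _ _); rewrite -mulrBr normrM ger0_norm//; apply: ler_wpM2l => //.
 rewrite /dist1 -sumrB; upto (ler_norm_sum _ _ _); apply: ler_sum => i _.
 rewrite ler_norml; have := dist3_tri (tnth y i) (tnth w i) (tnth z i); have := dist3_tri (tnth z i) (tnth w i) (tnth y i).
 by rewrite (dist3C (tnth z i) (tnth y i)); lra.
split=> //; first exact: bounded_lip_bmeas.
 by rewrite /F /dist1 big1 ?mulr0 ?min_l// => i _; rewrite dist3xx.
move=> y yw; have dp : 0 < dist1 w y.
 rewrite lt_neqAle dist1_ge0 andbT eq_sym; apply: contra_neq yw => d0; apply: eq_from_tnth => i.
 have := d0; rewrite /dist1 => /psumr_eq0P/(_ i isT) => /(_ (fun _ _ => dist3_ge0 _ _))/eqP.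
 by rewrite /dist3 norm3_eq0 subr_eq0 => /eqP.
apply: cvg_near_cst; near=> n; rewrite /F min_r// -ler_pdivrMr// div1r; near: n; exact: nbhs_infty_ger.
Unshelve. all: by end_near. Qed.

Definition pflow t psi : R := law V t psi.

Lemma pflow_bfun t : bfun (pflow t). Proof. exact: law_bfun. Qed.

Lemma pflow1 t : pflow t (fun=> 1) = 1. Proof. exact: law1. Qed.

Lemma rate_ge0 : 0 <= jump_rate N K.
by rewrite /jump_rate !mulr_ge0 ?pi_ge0// ltW. Qed.

Lemma pflow_lip L phi B s t : 0 <= L -> lipN L phi -> (forall y, `|phi y| <= B) -> 0 <= s -> s <= t ->
 `|pflow t phi - pflow s phi| <= (t - s) * (jump_rate N K * B).
move=> L0 pL pB s0 st; have [_ [kappa [H1 H2 H3]]] := Hp; have Dp := lipN_bounded_lip L0 pL pB.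
exact: (law_lip H1 H2 generator_rate H3 Dp (bounded_lip_bmeas Dp) pB).
Qed.

Lemma pflow_step L phi B s r t : 0 <= L -> lipN L phi -> (forall y, `|phi y| <= B) -> 0 <= s -> s <= r -> r <= t ->
 `|pflow t phi - pflow s phi - (t - s) * pflow r (Lop phi)| <= 4 * jump_rate N K ^+ 2 * B * (t - s) ^+ 2.
move=> L0 pL pB s0 sr rt; have [_ [kappa [H1 H2 H3]]] := Hp; have Dp := lipN_bounded_lip L0 pL pB.
exact: (law_step H1 H2 rate_ge0 generator_rate separating_lipschitz H3 Dp (bounded_lip_bmeas Dp) pB).
Qed.

Definition summ6 Q w : R := \sum_(i < N) min6 Q (tnth w i).

Lemma summ6_lip Q : 0 <= Q -> lipN (6 * Q ^+ 5) (summ6 Q).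
move=> Q0 v w; rewrite /summ6 -sumrB; upto (ler_norm_sum _ _ _); rewrite /dist1 mulr_sumr.
by apply: ler_sum => i _; exact: min6_lip.
Qed.

Lemma summ6_ge0 Q w : 0 <= Q -> 0 <= summ6 Q w.
by move=> Q0; apply: sumr_ge0 => i _; exact: min6_ge0. Qed.

Lemma summ6_le Q w : 0 <= Q -> `|summ6 Q w| <= N%:R * Q ^+ 6.
move=> Q0; rewrite ger0_norm ?summ6_ge0//; via (\sum_(i < N) Q ^+ 6); last by rewrite sumr_const card_ord mulr_natl.
by apply: ler_sum => i _; exact: min6_le.
Qed.

Lemma generator_summ6 Q w : 0 <= Q -> Lop (summ6 Q) w <= 4 * pi * K * 6 ^+ 6 * summ6 Q w.
move=> Q0; have bm := min6_bmeas Q0.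
have bs : bmeas (summ6 Q) by apply: bmeas_sum => i _; exact: bmeas_tnth.
rewrite /Lop (particle_generatorE gamma HI Hk)//.
have nn : 0 < N%:R :> R by rewrite ltr0n.
have p2 : 0 <= 2 * pi * K * 6 ^+ 6 :> R by rewrite mulr_ge0 ?exprn_ge0// mulr_ge0 ?mulr_ge0 ?pi_ge0// ltW.
rewrite mulrC ler_pdivrMr//.
via (\sum_(i < N) \sum_(j < N) 2 * pi * K * 6 ^+ 6 * (min6 Q (tnth w i) + min6 Q (tnth w j))).
 apply: ler_sum => i _; rewrite [leRHS](bigID (fun j => i != j))/=; apply: ler_wpDr.
  by apply: sumr_ge0 => j _; apply: (mulr_ge0 p2); apply: addr_ge0; exact: min6_ge0.
 apply: ler_sum => j _; rewrite -[leRHS](mulrA (2 * pi * K)); apply: (coll_ub gamma HI Hk (ltW K0)); first exact: bmeas_upd.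
 move=> e th ph ee eX th2; apply: le_trans (min6_jump Q0 ph ee eX th2).
 rewrite /summ6 (bigD1 i)//= [X in _ - X](bigD1 i)//= !tnth_upd eqxx.
 rewrite (eq_bigr (fun k => min6 Q (tnth w k))); last by move=> k /negPf ki; rewrite tnth_upd ki.
 rewrite [X in _ - (_ + X)](eq_bigr (fun k => min6 Q (tnth w k))); last by move=> k /negPf ki; rewrite tnth_upd ki.
 by rewrite opprD addrACA subrr addr0 gerBl min6_ge0.
move: p2; set c := 2 * pi * K * _ => p2.
have inner (i : 'I_N) : \sum_(j < N) c * (min6 Q (tnth w i) + min6 Q (tnth w j)) = c * (N%:R * min6 Q (tnth w i) + summ6 Q w).
 by rewrite -mulr_sumr big_split/= sumr_const card_ord -[min6 Q (tnth w i) *+ N]mulr_natl.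
rewrite (eq_bigr _ (fun i _ => inner i)) -mulr_sumr big_split/= -mulr_sumr sumr_const card_ord -[summ6 Q w *+ N]mulr_natl.
have -> : 4 * pi * K * 6 ^+ 6 = 2 * c by rewrite /c; move: (6 ^+ 6) => z; ring.
by rewrite -[\sum_(i < N) _]/(summ6 Q w); clear p2 inner; move: c (summ6 Q w) => c x; apply: eq_ler; ring.
Qed.

(** The growth exponential in [K] is affordable: this bound is only used with a factor M^-2, at
    fixed [N] and [K], before M tends to infinity. *)
Lemma pflow_moment Q T : 0 <= Q -> 0 <= T -> pflow T (summ6 Q) <= expR (4 * pi * K * 6 ^+ 6 * T) * pflow 0 (summ6 Q).
move=> Q0 T0; have L0 : 0 <= 6 * Q ^+ 5 by rewrite mulr_ge0// exprn_ge0.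
have bs : bmeas (summ6 Q) by apply: bmeas_sum => i _; apply: bmeas_tnth; exact: min6_bmeas.
set Cm := 4 * pi * K * 6 ^+ 6.
have C0 : 0 <= Cm by rewrite mulr_ge0 ?exprn_ge0// mulr_ge0 ?mulr_ge0 ?pi_ge0// ltW.
set B := N%:R * Q ^+ 6; have B0 : 0 <= B by rewrite mulr_ge0// exprn_ge0.
have u0 s : 0 <= pflow s (summ6 Q) by apply: (bfun_ge0 (pflow_bfun s)) => // w; exact: summ6_ge0.
have := @discrete_gronwall R (fun t => pflow t (summ6 Q)) (fun t => Cm * t) 0 (4 * jump_rate N K ^+ 2 * B) 0 T.
rewrite !mul0r !addr0 mulr0 subr0; apply => //.
- by apply: mulr_ge0 => //; apply: mulr_ge0 => //; apply: exprn_ge0; exact: rate_ge0.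
- by move=> s t _ st _; exact: ler_wpM2l.
- by move=> s _; rewrite addr0.
move=> s t s0 st _; have := pflow_step L0 (summ6_lip Q0) (fun w => summ6_le w Q0) s0 (lexx s) st.
have [bL _] := generator_rate (lipN_bounded_lip L0 (summ6_lip Q0) (fun w => summ6_le w Q0)) bs (fun w => summ6_le w Q0).
have : pflow s (Lop (summ6 Q)) <= Cm * pflow s (summ6 Q).
 rewrite -(bfunZ (pflow_bfun s))//; apply: (bfun_le (pflow_bfun s)) => //; first routine.
 by move=> w; exact: generator_summ6.
have := u0 s; have ts : 0 <= t - s by rewrite subr_ge0.
have : 0 <= 4 * jump_rate N K ^+ 2 * B by apply: mulr_ge0 => //; apply: mulr_ge0 => //; apply: exprn_ge0; exact: rate_ge0.
rewrite -/B; move: (pflow t _) (pflow s _) (pflow s _) (4 * jump_rate N K ^+ 2 * B) Cm C0 => x y z k c.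
have -> : c * t - c * s = c * (t - s) by rewrite mulrBr.
move: (t - s) ts => h h0 c00 k0 y0 Hz.
move/(le_trans (ler_norm _)); rewrite lerBlDr => H.
have := ler_wpM2l h0 Hz; have : 0 <= c * h * (k * h) by routine.
by rewrite mul0r !addr0 mulrDr; lra.
Qed.

End ParticleFlow.

(** * Changing the factors of a product law one at a time *)

Section Telescope.
Context (R : realType) (N : nat).
Notation E := (N.-tuple (vec3 R)).
Notation prob := (probability (vec3 R) R).
Implicit Types (w : E) (psi : E -> R) (m : 'I_N -> prob).

Lemma bmeas_upd2 psi i : bmeas psi -> bmeas (fun z : vec3 R * E => psi (upd z.2 i z.1)).
by move=> bp; apply: (bmeas_comp bp); apply: mupd; routine. Qed.

Definition section_at m psi (i : 'I_N) (x : vec3 R) : R := prodf m (fun w => psi (upd w i x)).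

Lemma bmeas_section m psi i : bmeas psi -> bmeas (section_at m psi i).
by move=> bp; exact: (bfun_param (prodf_bfun m) (bmeas_upd2 i bp)). Qed.

Lemma prodf_section m psi i (g : prob) : bmeas psi -> prodf (subst m i g) psi = \int[g]_x section_at m psi i x.
move=> bp; rewrite prodf_subst//.
exact: (esym (bfun_fubini (bfun_prob g) (prodf_bfun m) (bmeas_upd2 i bp))).
Qed.

Lemma section_lip m psi i (L : R) : bmeas psi ->
 (forall w x y, `|psi (upd w i x) - psi (upd w i y)| <= L * dist3 x y) -> lip3 L (section_at m psi i).
move=> bp H x y; have b z : bmeas (fun w : E => psi (upd w i z)) by exact: (bmeas_pair1 z (bmeas_upd2 i bp)).
rewrite /section_at -(bfunB (prodf_bfun m) (b x) (b y)).
by have := bfun_norm_le (prodf_bfun m) (bmeasB (b x) (b y)) (fun w => H w x y); rewrite prodf1 mulr1.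
Qed.

Definition mix m m' (n : nat) : 'I_N -> prob := fun k => if (k < n)%N then m' k else m k.

Lemma prodf_telescope m m' psi : bmeas psi -> prodf m' psi - prodf m psi =
 \sum_(i < N) (\int[m' i]_x section_at (mix m m' i) psi i x - \int[m i]_x section_at (mix m m' i) psi i x).
move=> bp; transitivity (\sum_(0 <= n < N) (prodf (mix m m' n.+1) psi - prodf (mix m m' n) psi)).
 rewrite telescope_sumr//; have -> : mix m m' N = m' by apply/funext => k; rewrite /mix ltn_ord. by [].
rewrite big_mkord; apply: eq_bigr => i _; rewrite -!prodf_section//.
congr (_ - _); congr (prodf _ psi); apply/funext => k; rewrite /subst /mix; case: eqVneq => [->|ki].
- by rewrite ltnSn.
- by rewrite ltnS leq_eqVlt (negPf (ki : (k : nat) != i)).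
- by rewrite ltnn.
- by [].
Qed.

(** The alternative per coordinate is for functions such as [genf1], whose Lipschitz bound covers
    all coordinates but the colliding one; there the two laws will coincide. *)
Lemma prodf_close m m' psi (L c : R) : bmeas psi -> 0 <= L -> 0 <= c ->
 (forall i, m i = m' i \/ forall w x y, `|psi (upd w i x) - psi (upd w i y)| <= L * dist3 x y) ->
 (forall i eta, bmeas eta -> lip3 L eta -> `|\int[m' i]_x eta x - \int[m i]_x eta x| <= c * L) ->
 `|prodf m' psi - prodf m psi| <= N%:R * (c * L).
move=> bp L0 c0 H1 H2; rewrite prodf_telescope//; upto (ler_norm_sum _ _ _).
via (\sum_(i < N) c * L); last by rewrite sumr_const card_ord mulr_natl.
apply: ler_sum => i _; have [->|H] := H1 i; first by rewrite subrr normr0 mulr_ge0.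
by apply: H2; [exact: bmeas_section|exact: section_lip].
Qed.

End Telescope.

(** * The flow of independent copies of the solution *)

Section ProductFlow.
Context (R : realType) (I : vec3 R -> vec3 R) (gamma nu c0 c1 : R) (beta : R -> R) (f : R -> probability (vec3 R) R).
Hypotheses (HI : frame_choice I) (Hk : kernel_bounds nu c0 c1 beta) (Hg : -1 < gamma < 0) (Hgn : 0 < gamma + nu) (Hw : weak_solution gamma beta I f).
Variable N : nat.
Notation E := (N.-tuple (vec3 R)).
Implicit Types (v : vec3 R) (w : E) (psi : E -> R) (s t r L Lam : R).

Lemma coll_sub (K : R) (phi phi' : vec3 R -> R) v X : bmeas phi -> bmeas phi' ->
 coll I gamma beta K (fun x => phi x - phi' x) v X = coll I gamma beta K phi v X - coll I gamma beta K phi' v X.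
move=> bp bp'; have c (p : vec3 R -> R) th : bmeas p -> bmeas (fun ph : R => p (v + jmp I X th ph) - p v).
 move=> b; apply: bmeasB; last routine.
 by apply: (bmeas_comp b); apply: mvec3D => //; exact: (mjmp HI).
rewrite /coll -(bfunB (iint_bfun 0 K) (bmeas_circ_angle gamma HI Hk v X bp) (bmeas_circ_angle gamma HI Hk v X bp')).
apply: eq_iint => z _; rewrite /circ -(bfunB (iint_bfun 0 (2 * pi)) (c _ _ bp) (c _ _ bp')).
by apply: eq_iint => ph _; ring.
Qed.

Lemma coll_fubini d (T : measurableType d) (J : (T -> R) -> R) (K : R) (phi : T * vec3 R -> R) v X : bfun J -> bmeas phi ->
 coll I gamma beta K (fun x => J (fun u => phi (u, x))) v X = J (fun u => coll I gamma beta K (fun x => phi (u, x)) v X).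
move=> bJ bp; rewrite /coll.
have mj d' (T' : measurableType d') (h : T' -> R) (p : T' -> R) : mfun h -> mfun p ->
  mfun (fun x => v + jmp I X (h x) (p x)).
 by move=> mh mp; apply: mvec3D => //; exact: (mjmp HI).
have b2 z : bmeas (fun x : T * R => phi (x.1, v + jmp I X (angle beta (z / norm3 X `^ gamma)) x.2) - phi (x.1, v)).
 apply: bmeasB; apply: (bmeas_comp bp); apply: mfun_pair => //. exact: mj.
transitivity (iint 0 K (fun z => J (fun u => circ I (fun x => phi (u, x)) v X (angle beta (z / norm3 X `^ gamma))))).
 apply: eq_iint => z _; rewrite /circ. have := bfun_fubini (iint_bfun 0 (2 * pi)) bJ (bmeas_swap (b2 z)) => /= <-.
 apply: eq_iint => ph _; rewrite (bfunB bJ)//; routine.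
have b1 : bmeas (fun x : T * R => circ I (fun y => phi (x.1, y)) v X (angle beta (x.2 / norm3 X `^ gamma))).
 apply: (bmeas_circ HI (phi := fun z : (T * R) * vec3 R => phi (z.1.1, z.2))) => //.
 - apply: (bmeas_comp bp); apply: mfun_pair; last routine. routine.
 - exact: (mcomp (mangle_div Hk (norm3 X `^ gamma)) msnd).
exact: (bfun_fubini (iint_bfun 0 K) bJ (bmeas_swap b1)).
Qed.

Definition gflow r psi : R := prodf (fun=> ft f r) psi.

Lemma gflow_bfun r : bfun (gflow r). Proof. exact: prodf_bfun. Qed.

Lemma gflow1 r : gflow r (fun=> 1) = 1. Proof. exact: prodf1. Qed.

Definition sol_cst : R := 4 * pi * theta_cst nu c1 * (1 + energy f).

Lemma sol_cst_ge0 : 0 <= sol_cst.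
by rewrite /sol_cst; apply: mulr_ge0; [apply: mulr_ge0 (ltW (theta_cst_gt0 Hk)); rewrite mulr_ge0 ?pi_ge0|rewrite addr_ge0 ?energy_ge0].
Qed.

Lemma sol_close r t h L (eta : vec3 R -> R) : 0 <= r -> 0 <= t -> `|t - r| <= h -> 0 <= L -> bmeas eta -> lip3 L eta ->
 `|\int[ft f t]_x eta x - \int[ft f r]_x eta x| <= sol_cst * h * L.
move=> r0 t0 rh L0 be le; rewrite (mulrAC sol_cst); have C0 := mulr_ge0 sol_cst_ge0 L0.
apply: le_trans (ler_wpM2l C0 rh).
case/orP: (le_total r t) => rt.
 have rt' : 0 <= r <= t by lra.
 by rewrite (ger0_norm (x := t - r)) ?subr_ge0//; exact: (sol_lip HI Hk Hg Hgn Hw be L0 le rt').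
have rt' : 0 <= t <= r by lra.
by rewrite distrC (distrC t r) (ger0_norm (x := r - t)) ?subr_ge0//; exact: (sol_lip HI Hk Hg Hgn Hw be L0 le rt').
Qed.

Lemma gflow_lip L psi s t : 0 <= L -> bmeas psi -> lipN L psi -> 0 <= s -> s <= t ->
 `|gflow t psi - gflow s psi| <= N%:R * (sol_cst * (t - s) * L).
move=> L0 bp lp s0 st; have ts : 0 <= t - s by lra.
apply: prodf_close => // [|i|i eta be le]; first exact: mulr_ge0 sol_cst_ge0 ts.
 by right=> w x y; upto (lp _ _); rewrite dist1_upd.
by apply: sol_close => //; rewrite ?ger0_norm// (le_trans s0).
Qed.

(** Part [j] of the generator, at time [r], of independent nonlinear processes, each meeting
    partners drawn from [f r]; the level [Lam] makes it a bounded operator. *)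
Definition genf1 Lam r psi (j : 'I_N) w : R :=
 \int[ft f r]_y coll I gamma beta Lam (fun x => psi (upd w j x)) (tnth w j) (tnth w j - y).

Definition genf Lam r psi w : R := \sum_(j < N) genf1 Lam r psi j w.

Lemma bmeas_genf1_pair Lam psi j : bmeas psi ->
 bmeas (fun z : E * vec3 R => coll I gamma beta Lam (fun x => psi (upd z.1 j x)) (tnth z.1 j) (tnth z.1 j - z.2)).
move=> bp; have mt : mfun (fun z : E * vec3 R => tnth z.1 j).
 by apply: (mcomp (f := fun w : E => tnth w j)) => //; exact: mtnth.
apply: (bmeas_coll gamma HI Hk Lam (phi := fun z : (E * vec3 R) * vec3 R => psi (upd z.1.1 j z.2))) => //.
- apply: (bmeas_comp bp); apply: mupd; last routine. by apply: mcomp; routine.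
- by apply: mvec3B => //; routine.
Qed.

Lemma bmeas_genf1 Lam r psi j : bmeas psi -> bmeas (genf1 Lam r psi j).
by move=> bp; exact: (bfun_param (bfun_prob (ft f r)) (bmeas_genf1_pair Lam j bp)). Qed.

Lemma bmeas_genf Lam r psi : bmeas psi -> bmeas (genf Lam r psi).
by move=> bp; apply: bmeas_sum => j _; exact: bmeas_genf1. Qed.

Lemma genf1_section Lam r psi (m : 'I_N -> probability (vec3 R) R) i : bmeas psi ->
 collQ I gamma beta f Lam (section_at m psi i) r = prodf (subst m i (ft f r)) (genf1 Lam r psi i).
move=> bp; rewrite (prodf_section _ _ _ (bmeas_genf1 Lam r i bp)); apply: eq_Rintegral => x _.
have bu : bmeas (fun z : E * vec3 R => psi (upd z.1 i z.2)) by exact: bmeas_swap (bmeas_upd2 i bp).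
transitivity (\int[ft f r]_y prodf m (fun w => coll I gamma beta Lam (fun x => psi (upd w i x)) x (x - y))).
 by apply: eq_Rintegral => y _; exact: (coll_fubini Lam x (x - y) (prodf_bfun m) bu).
have bc : bmeas (fun z : E * vec3 R => coll I gamma beta Lam (fun x => psi (upd z.1 i x)) x (x - z.2)).
 apply: (bmeas_coll gamma HI Hk Lam (phi := fun z : (E * vec3 R) * vec3 R => psi (upd z.1.1 i z.2))) => //.
 - apply: (bmeas_comp bp); apply: mupd; last routine. by apply: mcomp; routine.
 - by apply: mvec3B => //; routine.
have := bfun_fubini (bfun_prob (ft f r)) (prodf_bfun m) (bmeas_swap bc) => /= ->.
rewrite /section_at; apply: (congr1 (prodf m)); apply/funext => w; rewrite /genf1; apply: eq_Rintegral => y _; rewrite tnth_upd eqxx.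
by have -> : (fun z => psi (upd (upd w i x) i z)) = fun z => psi (upd w i z) by apply/funext => z; rewrite upd_upd.
Qed.

Lemma genf1_lip Lam r psi L i k w x y : 0 <= Lam -> bmeas psi -> lipN L psi -> k != i ->
 `|genf1 Lam r psi i (upd w k x) - genf1 Lam r psi i (upd w k y)| <= 4 * pi * Lam * L * dist3 x y.
move=> Lam0 bp lp ki; have b z := bmeas_pair1 (upd w k z) (bmeas_genf1_pair Lam i bp).
rewrite /genf1 -(bfunB (bfun_prob _) (b x) (b y)).
have := bfun_norm_le (bfun_prob (ft f r)) (bmeasB (b x) (b y)) (M := 4 * pi * Lam * L * dist3 x y) _.
rewrite prob_cst mulr1; apply=> z /=; rewrite !tnth_upd eq_sym (negPf ki).
have bu u : bmeas (fun x => psi (upd (upd w k u) i x)) by exact: bmeas_upd.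
rewrite -coll_sub//; have -> : 4 * pi * Lam * L * dist3 x y = 2 * pi * Lam * (2 * (L * dist3 x y)) by ring.
have D u : `|psi (upd (upd w k x) i u) - psi (upd (upd w k y) i u)| <= L * dist3 x y.
 by rewrite !(upd_updC _ _ _ ki); upto (lp _ _); rewrite dist1_upd.
apply: (coll_norm gamma HI Hk _ Lam0 (bmeasB (bu x) (bu y))) => u.
by rewrite (le_trans (ler_normB _ _))// mulrDl mul1r lerD.
Qed.

(** In the telescope, term i has the law f_t before i and f_s after i. With [q] the sum of the
    collision integrals of these sections, only the cutoff error remains after integration in time;
    replacing the mixed laws by f_r then costs O(t - s) by [sol_close]. *)
Lemma gflow_step L Lam psi s t : 0 <= L -> bmeas psi -> lipN L psi -> 0 < Lam -> 0 <= s -> s <= t ->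
 exists2 q : R -> R, bmeas q &
 `|gflow t psi - gflow s psi - iint s t q| <= N%:R * (2 * (1 + energy f) * cut_err nu c1 L Lam * (t - s)) /\
 forall r, s <= r <= t ->
  `|q r - gflow r (genf Lam r psi)| <= N%:R * (N%:R * (sol_cst * (t - s) * (4 * pi * Lam * L))).
move=> L0 bp lp Lam0 s0 st; have ts : 0 <= t - s by lra.
pose m (i : 'I_N) := @mix R N (fun=> ft f s) (fun=> ft f t) i.
have lpu (i : 'I_N) w x y : `|psi (upd w i x) - psi (upd w i y)| <= L * dist3 x y.
 by upto (lp _ _); rewrite dist1_upd.
exists (fun r => \sum_(i < N) collQ I gamma beta f Lam (section_at (m i) psi i) r).
 by apply: bmeas_sum => i _; apply: (bmeas_collQ HI Hk Hw); exact: bmeas_section.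
split.
 rewrite /gflow prodf_telescope// (bfun_sum (iint_bfun s t)); last first.
  by move=> i _; apply: (bmeas_collQ HI Hk Hw); exact: bmeas_section.
 rewrite -sumrB; upto (ler_norm_sum _ _ _).
 via (\sum_(i < N) 2 * (1 + energy f) * cut_err nu c1 L Lam * (t - s)); last by rewrite sumr_const card_ord -[leLHS]mulr_natl.
 apply: ler_sum => i _; apply: (sol_cut HI Hk Hg Hgn Hw) => //; [exact: bmeas_section|exact: section_lip|by rewrite s0 st].
move=> r /andP[sr rt]; rewrite /genf (bfun_sum (gflow_bfun r)); last by move=> i _; exact: bmeas_genf1.
rewrite -sumrB; upto (ler_norm_sum _ _ _).
via (\sum_(i < N) N%:R * (sol_cst * (t - s) * (4 * pi * Lam * L))); last by rewrite sumr_const card_ord -[leLHS]mulr_natl.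
apply: ler_sum => i _; rewrite genf1_section//.
have r0 := le_trans s0 sr; have t0 := le_trans s0 st.
apply: prodf_close => //; [exact: bmeas_genf1|by rewrite !mulr_ge0 ?pi_ge0// ltW|exact: mulr_ge0 sol_cst_ge0 ts| |].
 move=> k; case: (eqVneq k i) => [->|ki]; first by left; rewrite /subst eqxx.
 by right=> w x y; apply: genf1_lip => //; exact: ltW.
move=> k eta be le; have K0 : 0 <= 4 * pi * Lam * L by rewrite !mulr_ge0 ?pi_ge0// ltW.
rewrite /subst /m /mix; case: eqP => _; first by apply: sol_close => //; rewrite subrr normr0.
case: ifP => _; apply: sol_close => //; first by rewrite ger0_norm ?subr_ge0// lerD2l lerN2.
by rewrite distrC ger0_norm ?subr_ge0// lerD2r.
Qed.

End ProductFlow.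

Lemma Rintegral_le_quad d (T : measurableType d) (R : realType) (P : probability T R) (h b u k : T -> R) (a c : R) :
 bmeas h -> bmeas b -> integ P u -> integ P k ->
 (forall x, h x <= b x + a * u x + c * k x) ->
 \int[P]_x h x <= \int[P]_x b x + a * \int[P]_x u x + c * \int[P]_x k x.
move=> bh bb iu ik H; have ih := bmeas_integrable P bh; have ib := bmeas_integrable P bb.
have iu' : integ P (fun x => a * u x).
 by apply: eq_integrable (integrableZl measurableT a iu) => //.
have ik' : integ P (fun x => c * k x).
 by apply: eq_integrable (integrableZl measurableT c ik) => //.
have ibu : integ P (fun x => b x + a * u x).
 by apply: eq_integrable (integrableD measurableT ib iu') => //.
have isum : integ P (fun x => b x + a * u x + c * k x).
 by apply: eq_integrable (integrableD measurableT ibu ik') => //.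
via (\int[P]_x (b x + a * u x + c * k x)); first by apply: le_Rintegral.
by rewrite (RintegralD _ ibu ik')// (RintegralD _ ib iu')// RintegralZl// RintegralZl.
Qed.

Lemma weighted_split (R : realType) n (W A : 'I_n -> R) (b : R) : \sum_j W j = 1 ->
 \sum_j W j * (A j + b) = \sum_j A j * W j + b.
by move=> W1; under eq_bigr do rewrite mulrDr (mulrC _ (A _)); rewrite big_split/= -mulr_suml W1 mul1r.
Qed.

(** * Splitting a law among the points of a configuration *)

Section Allocation.
Context (R : realType) (N : nat) (P : probability (vec3 R) R).
Implicit Types (W : 'I_N -> vec3 R -> R) (w : N.-tuple (vec3 R)).

(* Densities with respect to P which split P into N pieces of equal mass: a coupling with an empirical measure. *)
Definition allocation W : Prop := [/\ forall j, mfun (W j), forall j y, 0 <= W j y, forall y, \sum_j W j y = 1 &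
   forall j, \int[P]_y W j y = N%:R^-1].

(** Its integral against P is the quadratic cost of the coupling that [W] describes. *)
Definition spread2 W w (y : vec3 R) : R := \sum_j W j y * norm3 (tnth w j - y) ^+ 2.

Lemma allocation_le1 W j y : allocation W -> W j y <= 1.
by move=> [_ W0 W1 _]; rewrite -(W1 y) (bigD1 j)//= lerDl; routine. Qed.

Lemma allocation_bmeas W j : allocation W -> bmeas (W j).
move=> aW; have [mW W0 _ _] := aW; apply: (bmeas_bound (a := 0) (b := 1)) => // y.
by rewrite W0 (allocation_le1 _ _ aW).
Qed.

Lemma spread2_integrable W w : allocation W -> P.-integrable setT (EFin \o @kv R) -> P.-integrable setT (EFin \o spread2 W w).
move=> aW ik; have [mW W0 W1 _] := aW; set c := 2 + 2 * \sum_j norm3 (tnth w j) ^+ 2.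
have mk : mfun (@kv R).
 routine.
have ick : integ P (fun v => c * kv v) by apply: eq_integrable (integrableZl measurableT c ik).
apply: (le_integrable measurableT _ _ ick).
 apply/mEFinP; apply: measurable_sum => j; apply: mfunM => //; apply: mfunX.
 by apply: mnorm3; apply: mvec3B.
move=> y _ /=; rewrite lee_fin ger0_norm; last first.
 routine.
rewrite ger0_norm; last routine.
via (\sum_j W j y * (c * kv y)); last by rewrite -mulr_suml W1 mul1r.
apply: ler_sum => j _; apply: ler_wpM2l => //; upto (norm3_sub2 _ _).
have : norm3 (tnth w j) ^+ 2 <= \sum_j norm3 (tnth w j) ^+ 2.
 by rewrite [leRHS](bigD1 j)//= lerDl; routine.
have := sqr_ge0 (norm3 (tnth w j)); have := sqr_ge0 (norm3 y).
by rewrite /kv /c; move: (norm3 y ^+ 2) (norm3 (tnth w j) ^+ 2) (\sum_j _) => a b s; nra.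
Qed.

Lemma spread2_ge0 W w y : allocation W -> 0 <= spread2 W w y.
by move=> [_ W0 _ _]; routine. Qed.

End Allocation.

Lemma point_algebra (R : realType) (n D p a e k s t u x z1 z2 y : R) :
 p * (x + k * z1) <= p * (s * (2 * t + 2 * u) + k * (z2 - 2 * n + 2 * n * y)) ->
 n * D + p * (a + x + n * e + k * z1) <=
 n * D + p * (n * e + k * (z2 - 2 * n)) + p * (a + 2 * s * t) + p * (2 * s) * u + p * (k * (2 * n)) * y.
lra. Qed.

Lemma point_algebra2 (R : realType) (n m P L c p a b e k s t u z en : R) : p * a <= p * b ->
 n * (2 * P * L * c) + p * (n * e + k * (z - 2 * n)) + p * (a + 2 * s * (m * t)) + p * (2 * s) * u + p * (k * (2 * n)) * (1 + en) <=
 2 * P * n * L * c + p * (b + s * (2 * m * t + 2 * u) + n * e + k * (z + 2 * n * en)).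
lra. Qed.

(** * Sum of the two generators at a pair of configurations *)

Section PointBound.
Context (R : realType) (I : vec3 R -> vec3 R) (gamma nu c0 c1 : R) (beta : R -> R) (f : R -> probability (vec3 R) R).
Hypotheses (HI : frame_choice I) (Hk : kernel_bounds nu c0 c1 beta) (Hg : -1 < gamma < 0) (Hgn : 0 < gamma + nu) (Hw : weak_solution gamma beta I f).
Variable N : nat.
Hypothesis N0 : (0 < N)%N.
Notation E := (N.-tuple (vec3 R)).
Implicit Types (v w : E) (y : vec3 R) (phi psi : E -> R).

Lemma bmeas_lsing eps d (T : measurableType d) (g : T -> R) : 0 < eps -> mfun g -> bmeas (fun x => lsing gamma eps (g x)).
move=> e0 mg; apply: (bmeas_bound (a := 0) (b := eps `^ gamma)); last first.
 by move=> x; rewrite ltW ?lsing_gt0//= (lsing_le Hg).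
apply: (mcomp (measurable_powR gamma)); routine.
Qed.

Section At.
Variables (M K Lam eps r S C : R) (v w : E) (phi psi : E -> R) (W : 'I_N -> vec3 R -> R).
Hypotheses (M0 : 0 <= M) (K1 : 1 <= K) (KL : K <= Lam) (e0 : 0 < eps) (bp : bmeas phi) (bs : bmeas psi) (Hc : forall v w, phi v + psi w <= costN M v w) (aW : allocation (ft f r) W) (HS : forall y, \sum_i lsing gamma eps (norm3 (tnth w i - y)) <= S) (HC : forall x, \int[ft f r]_y lsing gamma eps (norm3 (x - y)) <= C).
Let K0 : 0 < K. Proof. exact: lt_le_trans K1. Qed.
Let pc := 2 * pi * pair_cst nu c0 c1.
Let pc0 : 0 <= pc. Proof. by rewrite /pc mulr_ge0 ?(pair_cst_ge0 Hk)// mulr_ge0 ?pi_ge0. Qed.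
Let A i j := coll I gamma beta K (fun x => phi (upd v i x)) (tnth v i) (tnth v i - tnth v j).
Let B i y := coll I gamma beta Lam (fun x => psi (upd w i x)) (tnth w i) (tnth w i - y).
Let l i y := lsing gamma eps (norm3 (tnth w i - y)).
Let cc i := costM M (tnth v i) (tnth w i).
Let kap := K `^ (1 - 2 / nu).

(** The diagonal is added for free, a collision at zero relative velocity being void. With it the
    sum over partners matches the sum over the pieces of an allocation. *)
Lemma generator_full : particle_generator gamma beta K phi v = N%:R^-1 * \sum_i \sum_j A i j.
rewrite (particle_generatorE gamma HI Hk _ bp K0); congr (_ * _); apply: eq_bigr => i _.
by rewrite [RHS](bigD1 i)//= /A subrr coll0 ?add0r ?ltW//; apply: eq_bigl => j; rewrite eq_sym.
Qed.

Lemma pair_at i j y : A i j + B i y <= 2 * pi * Lam * (costN M v w - phi v - psi w) +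
 pc * (l i y * (cc i + norm3 (tnth v j - y) ^+ 2) + eps `^ (2 + gamma) + kap * (1 + norm3 (tnth w i - y) ^+ 2)).
have := @coll_pair_le R I gamma nu c0 c1 beta HI Hk Hg Hgn (fun x => phi (upd v i x)) (fun x => psi (upd w i x)) M
 (costN M v w - cc i) (tnth v i) (tnth w i) (tnth v i - tnth v j) (tnth w i - y) K Lam (tnth v j - y) eps
 (bmeas_upd v i bp) (bmeas_upd w i bs) e0 M0 K1 KL.
rewrite !upd_tnth -/(cc i) [cc i + _]addrCA subrr addr0; apply.
 by apply: vec3_eq; rewrite /=; ring.
by move=> x x'; apply: le_trans (Hc _ _) _; rewrite costN_upd addrC.
Qed.

Lemma bmeas_l i : bmeas (l i).
by apply: bmeas_lsing => //; apply: mnorm3; exact: mvec3B. Qed.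

Lemma bmeas_B i : bmeas (B i).
apply: (bmeas_coll gamma HI Hk Lam (phi := fun z : vec3 R * vec3 R => psi (upd w i z.2)) (v := fun=> tnth w i) (X := fun y => tnth w i - y)) => //.
- by apply: (bmeas_comp bs); exact: mupd.
- exact: mvec3B.
Qed.

Let d2 j := norm3 (tnth v j - tnth w j) ^+ 2.
Let cst := N%:R * (2 * pi * Lam * (costN M v w - phi v - psi w)) +
 pc * (N%:R * eps `^ (2 + gamma) + kap * (\sum_i (1 + 2 * norm3 (tnth w i) ^+ 2) - 2 * N%:R)).
Let bd y := cst + pc * (\sum_i l i y * cc i + 2 * S * \sum_j W j y * d2 j).
Let hh y := \sum_i \sum_j W j y * (A i j + B i y).

Lemma S_ge0 : 0 <= S.
by apply: le_trans (HS 0); routine. Qed.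

Lemma point_integrand y : hh y <= bd y + pc * (2 * S) * spread2 W w y + pc * (kap * (2 * N%:R)) * kv y.
have [_ W0 W1 _] := aW.
have kap0 : 0 <= kap by routine.
set D := 2 * pi * Lam * (costN M v w - phi v - psi w); set ee := eps `^ (2 + gamma).
have step1 : hh y <= \sum_i \sum_j W j y * (D + pc * (l i y * (cc i + norm3 (tnth v j - y) ^+ 2) + ee + kap * (1 + norm3 (tnth w i - y) ^+ 2))).
 by apply: ler_sum => i _; apply: ler_sum => j _; apply: ler_wpM2l => //; exact: pair_at.
set q := \sum_j W j y * norm3 (tnth v j - y) ^+ 2.
have step2 i : \sum_j W j y * (D + pc * (l i y * (cc i + norm3 (tnth v j - y) ^+ 2) + ee + kap * (1 + norm3 (tnth w i - y) ^+ 2))) =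
  D + pc * (l i y * cc i + l i y * q + ee + kap * (1 + norm3 (tnth w i - y) ^+ 2)).
 rewrite (eq_bigr (fun j => W j y * (D + pc * (l i y * cc i + ee + kap * (1 + norm3 (tnth w i - y) ^+ 2)))
   + pc * l i y * (W j y * norm3 (tnth v j - y) ^+ 2))); last by move=> j _; ring.
 by rewrite big_split/= -mulr_suml W1 -mulr_sumr -/q; ring.
apply: (le_trans step1); rewrite (eq_bigr _ (fun i _ => step2 i)) big_split/= sumr_const card_ord -mulr_sumr.
rewrite !big_split/= -mulr_suml sumr_const card_ord -mulr_sumr -[D *+ N]mulr_natl -[ee *+ N]mulr_natl.
have l0 i : 0 <= l i y by routine.
have q0 : 0 <= q by apply: sumr_ge0 => j _; rewrite mulr_ge0 ?sqr_ge0.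
have H1 : (\sum_i l i y) * q <= S * (2 * \sum_j W j y * d2 j + 2 * spread2 W w y).
 via (S * q); first by apply: ler_wpM2r => //; exact: HS.
 apply: (ler_wpM2l S_ge0); rewrite /spread2 !mulr_sumr -big_split/=; apply: ler_sum => j _.
 have /(ler_wpM2l (W0 j y)) := dist3_sqr_le (tnth v j) (tnth w j) y.
 by move/le_trans; apply; rewrite /d2 /dist3; apply: eq_ler; ring.
have H2 : \sum_i (1 + norm3 (tnth w i - y) ^+ 2) <= \sum_i (1 + 2 * norm3 (tnth w i) ^+ 2) - 2 * N%:R + 2 * N%:R * kv y.
 rewrite -addrA (_ : - (2 * N%:R) + 2 * N%:R * kv y = \sum_(i < N) 2 * norm3 y ^+ 2).
  by rewrite -big_split/=; apply: ler_sum => i _; rewrite -addrA lerD2l norm3_sub2.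
 by rewrite sumr_const card_ord -[RHS]mulr_natl /kv; ring.
have H2' := ler_wpM2l kap0 H2.
exact: point_algebra (ler_wpM2l pc0 (lerD H1 H2')).
Qed.

(** [pair_at] is summed over i, j with weight W_j(y) and integrated in y. As the W_j sum to 1, the
    terms [B i y] give [genf]; as each W_j has integral 1/N, the terms [A i j] give the particle
    generator. *)
Lemma point_bound : particle_generator gamma beta K phi v + genf I gamma beta f Lam r psi w <=
 2 * pi * N%:R * Lam * (costN M v w - phi v - psi w) +
 pc * (C * costN M v w + S * (2 * N%:R^-1 * \sum_j d2 j + 2 * \int[ft f r]_y spread2 W w y) + N%:R * eps `^ (2 + gamma) +
  kap * (\sum_i (1 + 2 * norm3 (tnth w i) ^+ 2) + 2 * N%:R * energy f)).
have [mW W0 W1 WN] := aW; have bW j := allocation_bmeas j aW; have bP := bfun_prob (ft f r).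
have bh : bmeas hh.
 by apply: bmeas_sum => i _; apply: bmeas_sum => j _; apply: (bmeasM (bW j)); apply: bmeasD (bmeas_B i); routine.
have -> : particle_generator gamma beta K phi v + genf I gamma beta f Lam r psi w = \int[ft f r]_y hh y.
 rewrite generator_full /genf mulr_sumr -big_split/= (bfun_sum bP); last first.
  by move=> i _; apply: bmeas_sum => j _; apply: (bmeasM (bW j)); apply: bmeasD (bmeas_B i); routine.
 apply: eq_bigr => i _; rewrite mulr_sumr. transitivity (\int[ft f r]_y (\sum_j A i j * W j y + B i y)); last first.
  by apply: eq_Rintegral => y _; exact: (esym (weighted_split (A i) (B i y) (W1 y))).
 rewrite (bfunD bP _ (bmeas_B i)); last routine. rewrite (bfun_sum bP); last by move=> j _; routine.
 by congr (_ + _); apply: eq_bigr => j _; rewrite (bfunZ bP _ (bW j)) WN mulrC.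
have bb1 : bmeas (fun y => \sum_i l i y * cc i).
 by apply: bmeas_sum => i _; apply: (bmeasM (bmeas_l i)); routine.
have bb2 : bmeas (fun y => \sum_j W j y * d2 j).
 routine.
have bb : bmeas bd.
 routine.
have [ik kE] := sol_energy Hw r.
have := Rintegral_le_quad bh bb (spread2_integrable w aW ik) ik point_integrand; rewrite kE.
move/le_trans; apply.
have Ib : \int[ft f r]_y bd y = cst + pc * (\int[ft f r]_y (\sum_i l i y * cc i) + 2 * S * (N%:R^-1 * \sum_j d2 j)).
 rewrite /bd (bfunD bP (bmeas_cst _ _) (bmeasZ _ (bmeasD bb1 (bmeasZ _ bb2)))) prob_cst.
 rewrite (bfunZ bP _ (bmeasD bb1 (bmeasZ _ bb2))) (bfunD bP bb1 (bmeasZ _ bb2)) (bfunZ bP _ bb2).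
 rewrite [\int[_]_x \sum_j W j x * d2 j](bfun_sum bP) => [|j _]; last routine.
 congr (_ + _ * (_ + _ * _)); rewrite mulr_sumr; apply: eq_bigr => j _. under eq_Rintegral do rewrite mulrC.
 by rewrite (bfunZ bP _ (bW j)) WN mulrC.
have H1 : \int[ft f r]_y (\sum_i l i y * cc i) <= C * costN M v w.
 rewrite (bfun_sum bP) => [|i _]; last by apply: (bmeasM (bmeas_l i)); routine.
 rewrite /costN mulr_sumr; apply: ler_sum => i _; under eq_Rintegral do rewrite mulrC.
 by rewrite (bfunZ bP _ (bmeas_l i)) mulrC; apply: ler_wpM2r (HC _); exact: costM_ge0.
rewrite Ib; exact: point_algebra2 (ler_wpM2l pc0 H1).
Qed.

End At.

End PointBound.

Lemma expR_le_half (R : realType) (u : R) : 0 <= u <= 2^-1 -> expR u <= 1 + 2 * u.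
move=> /andP[u0 u1]; have h : 0 < 1 - u by lra.
have : 1 - u <= expR (- u) by apply: expR_ge1Dx.
rewrite expRN -[X in X <= _]invrK lef_pV2 ?posrE ?expR_gt0 ?invr_gt0// => /le_trans; apply.
by rewrite -div1r ler_pdivrMr//; nra.
Qed.

Lemma expRN_le_cube (R : realType) (x : R) : 0 < x -> expR (- x) <= 27 / x ^+ 3.
move=> x0; rewrite expRN -div1r ler_pdivrMr ?expR_gt0// mulrAC ler_pdivlMr ?exprn_gt0// mul1r.
have -> : expR x = expR (x / 3) ^+ 3 by rewrite -expRM_natl; congr expR; field.
have h : x / 3 <= expR (x / 3) by apply: le_trans (expR_ge1Dx _); rewrite lerDr.
have -> : 27 * expR (x / 3) ^+ 3 = (3 * expR (x / 3)) ^+ 3 by lra.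
have z0 := ltW x0; have := expR_ge0 (x / 3); move: h; move: (expR _) => e h e0.
by apply: lerXn2r; rewrite ?nnegrE//; move: h; lra.
Qed.

(** * Upper integrals *)

Section UpperBound.
Context d (T : measurableType d) (R : realType) (F : (T -> R) -> R).
Hypotheses (bF : bfun F) (F1 : F (fun=> 1) = 1).
Implicit Types (h g : T -> R) (c a B : R).

(* The upper integral of a possibly unbounded nonnegative function is at most c. *)
Definition upper_le h c : Prop :=
 [/\ mfun h, forall x, 0 <= h x & forall B, 0 <= B -> F (fun x => Num.min (h x) B) <= c].

Lemma upper_le_bmeas h c : bmeas h -> (forall x, 0 <= h x) -> F h <= c -> upper_le h c.
move=> bh h0 Fc; have [mh _] := bh; split=> // B B0; apply: le_trans Fc.
by apply: (bfun_le bF) => // [|x]; [routine|rewrite ge_min lexx].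
Qed.

Lemma upper_le_cst c : 0 <= c -> upper_le (fun=> c) c.
by move=> c0; apply: upper_le_bmeas; [routine| |rewrite (bfun_cst bF) F1 mulr1]. Qed.

Lemma upper_leW h c c' : c <= c' -> upper_le h c -> upper_le h c'.
by move=> cc [mh h0 H]; split=> // B B0; exact: le_trans (H B B0) cc. Qed.

Lemma upper_leD h g c c' : upper_le h c -> upper_le g c' -> upper_le (fun x => h x + g x) (c + c').
move=> [mh h0 H] [mg g0 G]; split => [|x|B B0]; [routine|exact: addr_ge0|].
apply: le_trans (lerD (H B B0) (G B B0)); rewrite -(bfunD bF (bmeas_min mh h0 B0) (bmeas_min mg g0 B0)).
apply: (bfun_le bF) => [||x].
- by apply: bmeas_min => //; [routine|move=> x; exact: addr_ge0].
- exact: bmeasD (bmeas_min mh h0 B0) (bmeas_min mg g0 B0).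
have := h0 x; have := g0 x; rewrite ge_min; move: (h x) (g x) => a b b0 a0.
case/orP: (le_total a B) => aB; case/orP: (le_total b B) => bB;
 rewrite ?(min_l aB) ?(min_r aB) ?(min_l bB) ?(min_r bB); apply/orP; first (by left); by right; lra.
Qed.

Lemma upper_leZ a h c : 0 <= a -> upper_le h c -> upper_le (fun x => a * h x) (a * c).
move=> a0 [mh h0 H]; split => [|x|B B0]; [routine|exact: mulr_ge0|].
have [ae|an] := eqVneq a 0.
 have -> : (fun x => Num.min (a * h x) B) = fun=> 0 by apply/funext => x; rewrite ae mul0r min_l.
 by rewrite (bfun_cst bF) ae !mul0r.
have ap : 0 < a by lra.
have aB : 0 <= B / a by routine.
have -> : (fun x => Num.min (a * h x) B) = fun x => a * Num.min (h x) (B / a).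
 by apply/funext => x; rewrite minr_pMr// mulrCA mulfV ?mulr1.
by rewrite (bfunZ bF); [apply: ler_wpM2l (H _ aB)|routine].
Qed.

Lemma upper_le_sum n (h : 'I_n -> T -> R) c : (forall i, upper_le (h i) c) -> upper_le (fun x => \sum_i h i x) (n%:R * c).
elim: n h => [|n IH] h H.
 by rewrite mul0r; under eq_fun do rewrite big_ord0; apply: upper_le_cst.
under eq_fun do rewrite big_ord_recl; rewrite -natr1 mulrDl mul1r addrC.
by apply: upper_leD => //; apply: IH => i; exact: H.
Qed.

End UpperBound.

Section DualStep.
Context (R : realType) (N : nat).
Notation E := (N.-tuple (vec3 R)).

(** Truncating [b1] and [b2] at a height above the bounded function phi + psi preserves the
    pointwise inequality, so [dual_step] applies to the truncations. *)
Lemma dual_step_upper (F G : (E -> R) -> R) (M A U C1 C2 : R) (phi psi b1 b2 : E -> R) :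
 0 <= M -> 0 < A -> bfun F -> bfun G -> F (fun=> 1) = 1 -> G (fun=> 1) = 1 ->
 (forall phi psi, admissible M phi psi -> F phi + G psi <= U) ->
 bmeas phi -> bmeas psi -> upper_le F b1 C1 -> upper_le G b2 C2 ->
 (forall v w, phi v + psi w <= A * costN M v w + (b1 v + b2 w)) -> F phi + G psi <= A * U + (C1 + C2).
move=> M0 A0 bF bG F1 G1 HU bp bs [m1 p1 H1] [m2 p2 H2] H.
have [_ [B1 HB1]] := bp; have [_ [B2 HB2]] := bs.
pose B := `|B1| + `|B2|; have B0 : 0 <= B by routine.
have := @dual_step R N F G M A U phi psi (fun v => Num.min (b1 v) B) (fun w => Num.min (b2 w) B) M0 A0 bF bG F1 G1 HU bp bs
 (bmeas_min m1 p1 B0) (bmeas_min m2 p2 B0).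
move/(_ _)/le_trans; apply; last by rewrite lerD2l lerD ?H1 ?H2.
move=> v w; have c0 := mulr_ge0 (ltW A0) (costN_ge0 v w M0).
have L : phi v + psi w <= B.
 apply: lerD; first exact: le_trans (ler_norm _) (le_trans (HB1 v) (ler_norm _)).
 exact: le_trans (ler_norm _) (le_trans (HB2 w) (ler_norm _)).
have := H v w; have := p1 v; have := p2 w; move: (b1 v) (b2 w) (phi v + _) (A * _) c0 L => a b l c c0 L b0 a0 Hl.
by case/orP: (le_total a B) => aB; case/orP: (le_total b B) => bB;
 rewrite ?(min_l aB) ?(min_r aB) ?(min_l bB) ?(min_r bB); lra.
Qed.

Lemma prodf_upper (P : probability (vec3 R) R) (g : vec3 R -> R) c (i : 'I_N) :
 mfun g -> (forall x, 0 <= g x) -> (forall B, 0 <= B -> \int[P]_x Num.min (g x) B <= c) ->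
 upper_le (prodf (fun=> P)) (fun w : E => g (tnth w i)) c.
move=> mg g0 H; split => [|w|B B0]; [|exact: g0|].
 by apply: (mcomp mg); exact: mtnth.
rewrite (prodf_tnth (fun=> P) i (h := fun x => Num.min (g x) B)); first exact: H.
routine.
Qed.

End DualStep.

(** * Crowded configurations are exponentially rare *)

Section BadEvent.
Context (R : realType) (gamma : R) (N : nat).
Hypotheses (Hg : -1 < gamma < 0) (N0 : (0 < N)%N).
Notation E := (N.-tuple (vec3 R)).
Implicit Types (w : E) (eps C lam : R) (x y : vec3 R).
(** Excess of the singular weight felt by particle [k] over about twice the bound N C on its
    mean. *)
Definition crowd eps C w (k : 'I_N) : R :=
 \sum_(i < N | i != k) lsing gamma eps (norm3 (tnth w i - tnth w k)) - N%:R * (2 * C + 1).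

(** At least 1 as soon as one particle is crowded: the function of the exponential Markov
    inequality. *)
Definition badf lam eps C w : R := \sum_k expR (lam * crowd eps C w k).

Lemma lsing_half eps (a b : R) : 0 < eps -> b <= 2 * a -> lsing gamma eps a <= 2 * lsing gamma eps b.
move=> e0 ba; have g0 : - gamma <= 1 by case/andP: Hg; lra.
have m0 : 0 < Num.max a eps by rewrite lt_max e0 orbT.
have H : Num.max b eps <= 2 * Num.max a eps.
 rewrite ge_max; apply/andP; split; first by apply: (le_trans ba); apply: ler_wpM2l => //; rewrite le_max lexx.
 by via (Num.max a eps); [rewrite le_max lexx orbT|move: m0; lra].
have b0 : 0 < Num.max b eps by rewrite lt_max e0 orbT.
have := powg_anti Hg b0 H; have -> : (2 * Num.max a eps) `^ gamma = 2 `^ gamma * Num.max a eps `^ gamma by rewrite powRM// ltW.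
have := powR_ge0 (Num.max a eps) gamma; rewrite /lsing.
move: (Num.max a eps `^ gamma) (Num.max b eps `^ gamma) => p q p0 H'.
have t1 : 2^-1 <= 2 `^ gamma :> R.
 rewrite -[X in X <= _]powR_inv1//; apply: ler_powR; first by lra. lra.
nra.
Qed.

(** If [k] is the particle closest to [y], then |w_i - w_k| <= 2 |w_i - y|. So the N sums centred at
    particles control the sum centred at an arbitrary point. *)
Lemma closest_sum eps w y S : 0 < eps -> (forall k, \sum_i lsing gamma eps (norm3 (tnth w i - tnth w k)) <= S) ->
 \sum_i lsing gamma eps (norm3 (tnth w i - y)) <= 2 * S.
move=> e0 H; case: (@arg_minP _ _ _ (Ordinal N0) xpredT (fun i => norm3 (tnth w i - y)) isT) => k _ Hm.
apply: (le_trans _ (ler_wpM2l _ (H k))) => //; rewrite mulr_sumr; apply: ler_sum => i _; apply: lsing_half => //.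
have -> : tnth w i - tnth w k = (tnth w i - y) + - (tnth w k - y) by apply: vec3_eq; rewrite /=; ring.
upto (norm3D _ _); rewrite norm3N mulrDl mul1r lerD2l; exact: Hm.
Qed.

Lemma bmeas_badf_term lam eps C k : 0 < eps -> 0 <= lam -> bmeas (fun w : E => expR (lam * crowd eps C w k)).
move=> e0 l0.
have bc : bmeas (fun w : E => crowd eps C w k).
 apply: bmeasB; last routine.
 apply: bmeas_sum => i _; apply: (bmeas_lsing Hg) => //; apply: mnorm3; apply: mvec3B; routine.
have [mc [B HB]] := bc.
apply: (bmeas_bound (a := 0) (b := expR (lam * `|B|))); first by apply: mcomp => //; routine.
move=> w; rewrite expR_ge0 ler_expR; apply: ler_wpM2l => //.
exact: le_trans (ler_norm _) (le_trans (HB w) (ler_norm _)).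
Qed.

(** Chosen so that its product with the largest weight eps^gamma is 1/2, the range of
    [expR_le_half]. *)
Definition chernoff_rate eps : R := (2 * eps `^ gamma)^-1.

(** Given w_k, the other weights are independent, and exp(u) <= 1 + 2u on [0, 1/2] bounds each
    exponential moment by exp(2 lam C). The threshold N (2C + 1) leaves exp(- lam N) for each of the
    N particles. *)
Lemma chernoff (P : probability (vec3 R) R) eps C : 0 < eps -> 0 <= C ->
 (forall x, \int[P]_y lsing gamma eps (norm3 (x - y)) <= C) ->
 prodf (fun=> P) (badf (chernoff_rate eps) eps C) <= N%:R * expR (- (chernoff_rate eps * N%:R)).
move=> e0 C0 HC; set lam := chernoff_rate eps; have eg : 0 < eps `^ gamma by rewrite powR_gt0.
have lam0 : 0 < lam by rewrite invr_gt0 mulr_gt0.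
rewrite /badf (bfun_sum (prodf_bfun _)) => [|k _]; last by apply: bmeas_badf_term => //; exact: ltW.
via (\sum_(k < N) expR (- (lam * N%:R))); last by rewrite sumr_const card_ord mulr_natl.
apply: ler_sum => k _; set h := fun w : E => _.
have bh : bmeas h by apply: bmeas_badf_term => //; exact: ltW.
have -> : prodf (fun=> P) h = prodf (subst (fun=> P) k P) h.
 by congr (prodf _ h); apply/funext => i; rewrite /subst; case: ifP.
rewrite prodf_section//; set b := expR (- (lam * N%:R)).
have -> : b = \int[P]_x b by rewrite prob_cst.
apply: (bfun_le (bfun_prob P)); [exact: bmeas_section|exact: bmeas_cst|move=> x].
pose g (i : 'I_N) (y : vec3 R) : R := if i == k then 1 else expR (lam * lsing gamma eps (norm3 (y - x))).
have bl : bmeas (fun y : vec3 R => lsing gamma eps (norm3 (y - x))).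
 by apply: (bmeas_lsing Hg) => //; apply: mnorm3; exact: mvec3B.
have le1 y : 0 <= lam * lsing gamma eps (norm3 (y - x)) <= 2^-1.
 apply/andP; split; first routine. upto (ler_wpM2l (ltW lam0) (lsing_le Hg _ e0)).
 by rewrite /lam /chernoff_rate invfM -mulrA mulVf ?mulr1// gt_eqF.
have bg i : bmeas (g i).
 rewrite /g; case: eqP => _; first routine.
 apply: (bmeas_bound (a := 0) (b := 2)); first by apply: mcomp => //; have [] := bmeasZ lam bl.
 move=> y; rewrite expR_ge0/=; have /expR_le_half/le_trans := le1 y; apply. by have /andP[_] := le1 y; lra.
set c := expR (- (lam * (N%:R * (2 * C + 1)))).
have hE w : h (upd w k x) = c * \prod_i g i (tnth w i).
 rewrite /h /crowd mulrBr expRD mulrC; congr (_ * _); rewrite mulr_sumr expR_sum [RHS](bigD1 k)//= /g eqxx mul1r.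
 by apply: eq_bigr => i ik; rewrite !tnth_upd eqxx (negPf ik).
have bprod : bmeas (fun w : E => \prod_i g i (tnth w i)).
 have -> : (fun w : E => \prod_i g i (tnth w i)) = fun w => c^-1 * h (upd w k x).
  by apply/funext => w; rewrite hE mulKf// gt_eqF// expR_gt0.
 by apply: bmeasZ; exact: (bmeas_pair1 x (bmeas_upd2 k bh)).
have -> : section_at (fun=> P) h k x = c * \prod_i \int[P]_y g i y.
 rewrite -(prodf_prod (fun=> P) bg) -(bfunZ (prodf_bfun _) _ bprod) /section_at.
 by apply: (congr1 (prodf _)); apply/funext => w.
rewrite /c.
via (expR (- (lam * (N%:R * (2 * C + 1)))) * \prod_(i < N) expR (lam * (2 * C))).
 apply: ler_wpM2l; first routine. apply: ler_prod => i _; apply/andP; split.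
  by apply: (bfun_ge0 (bfun_prob P)) => // y; rewrite /g; case: ifP => // _; routine.
 rewrite /g; case: eqP => ik; first by rewrite prob_cst -expR0 ler_expR mulr_ge0 ?mulr_ge0// ltW.
 have bl2 : bmeas (fun y : vec3 R => 1 + 2 * (lam * lsing gamma eps (norm3 (y - x)))).
  routine.
 via (\int[P]_y (1 + 2 * (lam * lsing gamma eps (norm3 (y - x))))).
  apply: (bfun_le (bfun_prob P)) => //; first by have := bg i; rewrite /g (introF eqP ik).
  by move=> y; exact: expR_le_half.
 rewrite (bfunD (bfun_prob P) (bmeas_cst _ 1) (bmeasZ 2 (bmeasZ lam bl))) prob_cst (bfunZ (bfun_prob P) 2 (bmeasZ lam bl)) (bfunZ (bfun_prob P) lam bl).
 apply: le_trans (expR_ge1Dx _); rewrite lerD2l mulrCA; apply: ler_wpM2l; first exact: ltW.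
 apply: ler_wpM2l => //; apply: le_trans (HC x). by apply: eq_ler; apply: eq_Rintegral => y _; rewrite -norm3N opprB.
rewrite prodr_const card_ord -expRM_natl -expRD /b ler_expR; apply: eq_ler.
lra.
Qed.

End BadEvent.

(** * Greedy transport along nested partitions *)

Section Greedy.
Context (R : realType) (X C : finType).
Implicit Types (a b al be : X -> R) (M : X -> X -> R) (q : X -> C) (D : C -> R) (x y : X) (c : C).
Definition cellsum q a c : R := \sum_(x | q x == c) a x.

Lemma sum_cells q a D : \sum_x a x * D (q x) = \sum_c cellsum q a c * D c.
rewrite (partition_big q xpredT)//=; apply: eq_bigr => c _; rewrite /cellsum mulr_suml.
by apply: eq_big => // x /eqP->.
Qed.

Record partial_plan q a b M : Prop := PartialPlan { plan_ge0 : forall x y, 0 <= M x y;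
 plan_row : forall x, \sum_y M x y <= a x; plan_col : forall y, \sum_x M x y <= b y;
 plan_cell : forall x y, q x != q y -> M x y = 0;
 plan_full : forall c, cellsum q (fun x => a x - \sum_y M x y) c = 0 \/ cellsum q (fun y => b y - \sum_x M x y) c = 0 }.

(* Within a cell, the plan is proportional to the product of the masses. *)
Lemma greedy_step q al be : (forall x, 0 <= al x) -> (forall x, 0 <= be x) -> exists m, partial_plan q al be m.
move=> a0 b0; pose A := cellsum q al; pose B := cellsum q be; pose T c := (Num.max (A c) (B c))^-1.
have A0 c : 0 <= A c by routine. have B0 c : 0 <= B c by routine.
have T0 c : 0 <= T c by rewrite invr_ge0 le_max A0.
pose m x y := if q x == q y then al x * be y * T (q x) else 0.
have row x : \sum_y m x y = al x * (B (q x) * T (q x)).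
 rewrite -big_mkcond/= mulrA -mulr_suml -mulr_sumr /B /cellsum; congr (_ * _ * _).
 by apply: eq_bigl => y; rewrite eq_sym.
have col y : \sum_x m x y = be y * (A (q y) * T (q y)).
 rewrite -big_mkcond/= mulrA /A /cellsum mulr_sumr mulr_suml. by apply: eq_bigr => x /eqP->; rewrite [al x * _]mulrC.
have le1 (u c : R) : 0 <= u -> u <= c -> 0 <= u * c^-1 <= 1.
 move=> u0 uc; have c0 := le_trans u0 uc; rewrite mulr_ge0 ?invr_ge0//=.
 by have [->|cn] := eqVneq c 0; [rewrite invr0 mulr0|rewrite ler_pdivrMr ?mul1r// lt_neqAle eq_sym cn].
have BT c : 0 <= B c * T c <= 1 by apply: le1 => //; rewrite le_max lexx orbT.
have AT c : 0 <= A c * T c <= 1 by apply: le1 => //; rewrite le_max lexx.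
exists m; split.
- by move=> x y; rewrite /m; case: ifP => // _; routine.
- by move=> x; rewrite row -[leRHS]mulr1; apply: ler_wpM2l => //; have /andP[] := BT (q x).
- by move=> y; rewrite col -[leRHS]mulr1; apply: ler_wpM2l => //; have /andP[] := AT (q y).
- by move=> x y /negPf h; rewrite /m h.
move=> c.
have Ea : cellsum q (fun x => al x - \sum_y m x y) c = A c * (1 - B c * T c).
 rewrite /A /cellsum mulr_suml; apply: eq_bigr => x /eqP<-; rewrite row; ring.
have Eb : cellsum q (fun y => be y - \sum_x m x y) c = B c * (1 - A c * T c).
 rewrite /B /cellsum mulr_suml; apply: eq_bigr => x /eqP<-; rewrite col; ring.
rewrite Ea Eb /T; case/orP: (le_total (A c) (B c)) => h; rewrite ?(max_r h) ?(max_l h); [left|right].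
 have [Bz|Bn] := eqVneq (B c) 0; last by rewrite mulfV// subrr mulr0.
 by have -> : A c = 0 by [apply/le_anti; rewrite A0 andbT -Bz]; rewrite mul0r.
have [Az|An] := eqVneq (A c) 0; last by rewrite mulfV// subrr mulr0.
by have -> : B c = 0 by [apply/le_anti; rewrite B0 andbT -Az]; rewrite mul0r.
Qed.

Lemma cell_balance q a b M c : partial_plan q a b M ->
 cellsum q (fun x => a x - \sum_y M x y) c - cellsum q (fun y => b y - \sum_x M x y) c = cellsum q a c - cellsum q b c.
move=> [_ _ _ supp _]; rewrite /cellsum !sumrB.
have -> : \sum_(x | q x == c) \sum_y M x y = \sum_(y | q y == c) \sum_x M x y.
 transitivity (\sum_(x | q x == c) \sum_(y | q y == c) M x y).
  apply: eq_bigr => x /eqP xc; rewrite (bigID (fun y => q y == c))/= [X in _ + X]big1 ?addr0// => y yc.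
  by apply: supp; rewrite xc eq_sym.
 rewrite exchange_big/=; apply: eq_bigr => y /eqP yc; rewrite [RHS](bigID (fun x => q x == c))/= [X in _ = _ + X]big1 ?addr0// => x xc.
 by apply: supp; rewrite yc.
lra.
Qed.

Variables (q : nat -> X -> C) (cost : X -> X -> R) (D0 : X -> R) (D : nat -> C -> R) (a b : X -> R) (K : nat).
Hypotheses (nested : forall k x y, q k x = q k y -> q k.+1 x = q k.+1 y) (cost0 : forall x y, q 0%N x = q 0%N y -> cost x y <= D0 x) (costS : forall k x y, (k < K)%N -> q k.+1 x = q k.+1 y -> cost x y <= D k (q k x) + D k (q k y)) (D00 : forall x, 0 <= D0 x) (DS0 : forall k c, 0 <= D k c) (a0 : forall x, 0 <= a x) (b0 : forall x, 0 <= b x) (ab : \sum_x a x = \sum_x b x) (top : forall x y, q K x = q K y).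
Let bound k := \sum_x a x * D0 x + \sum_(j < k) 2 * \sum_c `|cellsum (q j) a c - cellsum (q j) b c| * D j c.

(** Inside a cell both sides lose the same mass and one of them is exhausted, so what remains of the
    other is the difference of the cell masses. *)
Lemma cell_residual k M c : partial_plan (q k) a b M ->
 cellsum (q k) (fun x => a x - \sum_y M x y) c <= `|cellsum (q k) a c - cellsum (q k) b c| /\
 cellsum (q k) (fun y => b y - \sum_x M x y) c <= `|cellsum (q k) a c - cellsum (q k) b c|.
move=> pM; have E := cell_balance c pM; have F := plan_full pM c.
have nn : 0 <= `|cellsum (q k) a c - cellsum (q k) b c| by [].
have n1 := ler_norm (cellsum (q k) a c - cellsum (q k) b c).
have n2 := ler_norm (- (cellsum (q k) a c - cellsum (q k) b c)); rewrite normrN in n2.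
lra.
Qed.

(** At level k + 1 only the mass left unmatched at level k is moved; [cell_residual] bounds it on
    both sides, whence the factor 2 in [bound]. *)
Lemma greedy_plan k : (k <= K)%N -> exists2 M, partial_plan (q k) a b M & \sum_x \sum_y M x y * cost x y <= bound k.
elim: k => [_|k IH kK].
 have [m pm] := greedy_step (q 0%N) a0 b0; exists m => //; rewrite /bound big_ord0 addr0; apply: ler_sum => x _.
 via (\sum_y m x y * D0 x); last by rewrite -mulr_suml; apply: ler_wpM2r (plan_row pm x).
 apply: ler_sum => y _; have [e|ne] := eqVneq (q 0%N x) (q 0%N y).
  by apply: ler_wpM2l; [exact: plan_ge0 pm x y|exact: cost0].
 by rewrite (plan_cell pm ne) !mul0r.
have [M pM HM] := IH (ltnW kK).
pose al x := a x - \sum_y M x y; pose be y := b y - \sum_x M x y.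
have al0 x : 0 <= al x by rewrite subr_ge0 (plan_row pM).
have be0 y : 0 <= be y by rewrite subr_ge0 (plan_col pM).
have [m pm] := greedy_step (q k.+1) al0 be0.
have rE x : a x - \sum_y (M x y + m x y) = al x - \sum_y m x y by rewrite big_split/= opprD addrA.
have cE y : b y - \sum_x (M x y + m x y) = be y - \sum_x m x y by rewrite big_split/= opprD addrA.
exists (fun x y => M x y + m x y).
 split.
 - by move=> x y; rewrite addr_ge0 ?(plan_ge0 pM) ?(plan_ge0 pm).
 - by move=> x; rewrite -subr_ge0 rE subr_ge0 (plan_row pm).
 - by move=> y; rewrite -subr_ge0 cE subr_ge0 (plan_col pm).
 - move=> x y ne; rewrite (plan_cell pm ne) addr0; apply: (plan_cell pM).
  by apply: contra ne => /eqP e; apply/eqP; exact: nested.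
 - move=> c; have [h|h] := plan_full pm c; [left|right]; apply: etrans h; apply: eq_bigr => x _; [exact: rE|exact: cE].
rewrite /bound big_ord_recr/= addrA; under eq_bigr do under eq_bigr do rewrite mulrDl.
under eq_bigr do rewrite big_split/=; rewrite big_split/=; apply: (lerD HM).
have S1 : \sum_x \sum_y m x y * cost x y <= \sum_x al x * D k (q k x) + \sum_y be y * D k (q k y).
 via (\sum_x \sum_y (m x y * D k (q k x) + m x y * D k (q k y))).
  apply: ler_sum => x _; apply: ler_sum => y _; have [e|ne] := eqVneq (q k.+1 x) (q k.+1 y).
   by rewrite -mulrDr; apply: ler_wpM2l; [exact: plan_ge0 pm x y|exact: costS].
  by rewrite (plan_cell pm ne) !mul0r addr0.
 under eq_bigr do rewrite big_split/=; rewrite big_split/=; apply: lerD.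
  by apply: ler_sum => x _; rewrite -mulr_suml; apply: ler_wpM2r (plan_row pm x).
 rewrite exchange_big/=; apply: ler_sum => y _; rewrite -mulr_suml; apply: ler_wpM2r (plan_col pm y); exact: DS0.
apply: (le_trans S1); rewrite !sum_cells mulrDl mul1r; apply: lerD; apply: ler_sum => c _; apply: ler_wpM2r => //; have [H1 H2] := cell_residual c pM; [exact: H1|exact: H2].
Qed.

(** At the top level there is one cell, in which one residual vanishes; the total masses being
    equal, so does the other. *)
Lemma greedy_transport : exists2 M, [/\ forall x y, 0 <= M x y, forall x, \sum_y M x y = a x & forall y, \sum_x M x y = b y] &
 \sum_x \sum_y M x y * cost x y <= bound K.
have [M pM HM] := greedy_plan (leqnn K); exists M => //.
have al0 x : 0 <= a x - \sum_y M x y by rewrite subr_ge0 (plan_row pM).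
have be0 y : 0 <= b y - \sum_x M x y by rewrite subr_ge0 (plan_col pM).
have E : \sum_x (a x - \sum_y M x y) = \sum_y (b y - \sum_x M x y) by rewrite !sumrB ab exchange_big.
have Z : \sum_x (a x - \sum_y M x y) = 0.
 have [x0 _|X0] := pickP (@predT X); last by apply: big1 => x; have := X0 x.
 have cE g : cellsum (q K) g (q K x0) = \sum_x g x by apply: eq_bigl => x; rewrite (top x x0) eqxx.
 by have := plan_full pM (q K x0); rewrite !cE -E; case.
split; first exact: plan_ge0 pM.
 by move=> x; apply/eqP; rewrite eq_sym -subr_eq0; apply/eqP; move/psumr_eq0P: Z => /(_ (fun x _ => al0 x)) ->.
by move=> y; apply/eqP; rewrite eq_sym -subr_eq0; apply/eqP; rewrite E in Z; move/psumr_eq0P: Z => /(_ (fun x _ => be0 x)) ->.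
Qed.

End Greedy.

(** A linearised Cauchy-Schwarz inequality; [t] is chosen separately in each cell. *)
Lemma norm_le_amgm (R : realType) (x t : R) : 0 < t -> `|x| <= t / 2 * x ^+ 2 + (2 * t)^-1.
move=> t0; have : 0 <= (t * `|x| - 1) ^+ 2 by exact: sqr_ge0.
rewrite -(real_normK (num_real x)); move: `|x| => y H.
have -> : t / 2 * y ^+ 2 + (2 * t)^-1 = (t ^+ 2 * y ^+ 2 + 1) / (2 * t) by field; rewrite gt_eqF.
by rewrite ler_pdivlMr ?mulr_gt0//; move: H; lra.
Qed.

(** * Deviation of an empirical frequency *)

Section Deviation.
Context (R : realType) (N : nat) (P : probability (vec3 R) R) (F : set (vec3 R)).
Hypotheses (N0 : (0 < N)%N) (mF : measurable F).
Notation E := (N.-tuple (vec3 R)).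
Let p := fine (P F).
Let g x : R := \1_F x - p.
Definition freq (w : E) : R := N%:R^-1 * \sum_j \1_F (tnth w j).

Let bg : bmeas g. Proof. by apply: bmeasB; [exact: bmeas_indic|exact: bmeas_cst]. Qed.
Let p0 : 0 <= p. Proof. by rewrite fine_ge0. Qed.
Let g0 : \int[P]_x g x = 0.
by rewrite /g (bfunB (bfun_prob P) (bmeas_indic R mF) (bmeas_cst _ p)) prob_cst prob_indic// subrr.
Qed.

Let g2 : \int[P]_x (g x * g x) <= p.
have -> : (fun x => g x * g x) = fun x => (1 - 2 * p) * \1_F x + p ^+ 2.
 by apply/funext => x; rewrite /g indicE; case: (x \in F); rewrite ?mulr1n ?mulr0n; ring.
rewrite (bfunD (bfun_prob P) (bmeasZ _ (bmeas_indic R mF)) (bmeas_cst _ _)) prob_cst (bfunZ (bfun_prob P) _ (bmeas_indic R mF)) prob_indic//.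
by rewrite -/p; have := sqr_ge0 p; lra.
Qed.

Lemma bmeas_freq : bmeas freq.
by apply: bmeasZ; apply: bmeas_sum => j _; apply: (bmeas_tnth j); routine. Qed.

Lemma prodf_pair i j : prodf (fun=> P) (fun w : E => g (tnth w i) * g (tnth w j)) = if i == j then \int[P]_x (g x * g x) else 0.
have bb := bmeasM (bmeas_tnth i bg) (bmeas_tnth j bg).
case: eqP => [->|/eqP ij].
 by rewrite (prodf_tnth (fun=> P) j (h := fun x => g x * g x))//; routine.
rewrite (_ : (fun=> P) = subst (fun=> P) i P); last by apply/funext => k; rewrite /subst; case: ifP.
rewrite prodf_section// -[RHS](mul0r 1) -[1 in RHS]/(1 : R).
transitivity (\int[P]_x 0 : R); last by rewrite prob_cst mul0r.
apply: eq_Rintegral => x _; rewrite /section_at.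
have -> : (fun w : E => g (tnth (upd w i x) i) * g (tnth (upd w i x) j)) = fun w => g x * g (tnth w j).
 by apply/funext => w; rewrite !tnth_upd eqxx eq_sym (negPf ij).
by rewrite (bfunZ (prodf_bfun _) _ (bmeas_tnth j bg)) prodf_tnth// g0 mulr0.
Qed.

(** The centred indicators of two different particles are uncorrelated, so the variance of the
    frequency is at most p / N. *)
Lemma deviation t : 0 < t -> prodf (fun=> P) (fun w => `|freq w - p|) <= t / 2 * (N%:R^-1 * p) + (2 * t)^-1.
move=> t0; have nn : N%:R != 0 :> R by rewrite pnatr_eq0 -lt0n.
have fE w : freq w - p = N%:R^-1 * \sum_j g (tnth w j).
 by rewrite /freq sumrB sumr_const card_ord -[p *+ N]mulr_natl mulrBr mulKf.
have b1 : bmeas (fun w : E => freq w - p) by apply: bmeasB; [exact: bmeas_freq|exact: bmeas_cst].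
have b2 : bmeas (fun w : E => (freq w - p) ^+ 2) by have := bmeasM b1 b1; under eq_fun do rewrite -expr2.
have ba : bmeas (fun w : E => `|freq w - p|).
 have [m [B HB]] := b1; split; first exact: mcomp. by exists B => w; rewrite normr_id.
via (prodf (fun=> P) (fun w => t / 2 * (freq w - p) ^+ 2 + (2 * t)^-1)).
 apply: (bfun_le (prodf_bfun _) ba) => [|w]; last exact: norm_le_amgm. routine.
rewrite (bfunD (prodf_bfun _) (bmeasZ _ b2) (bmeas_cst _ _)) prodf_cst (bfunZ (prodf_bfun _) _ b2) lerD2r.
apply: ler_wpM2l; first by lra.
have -> : (fun w : E => (freq w - p) ^+ 2) = fun w => N%:R^-1 ^+ 2 * \sum_i \sum_j g (tnth w i) * g (tnth w j).
 by apply/funext => w; rewrite fE exprMn expr2 [(\sum_j _) ^+ 2]expr2 mulr_suml; congr (_ * _); apply: eq_bigr => i _; rewrite mulr_sumr.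
have bij i j := bmeasM (bmeas_tnth i bg) (bmeas_tnth j bg).
rewrite (bfunZ (prodf_bfun _)); last routine.
rewrite (bfun_sum (prodf_bfun _)); last by move=> i _; routine.
have -> : \sum_(i < N) prodf (fun=> P) (fun w : E => \sum_j g (tnth w i) * g (tnth w j)) = N%:R * \int[P]_x (g x * g x).
 transitivity (\sum_(i < N) \int[P]_x (g x * g x)); last by rewrite sumr_const card_ord mulr_natl.
 apply: eq_bigr => i _; rewrite (bfun_sum (prodf_bfun _))// (bigD1 i)//= prodf_pair eqxx big1 ?addr0// => j ji.
 by rewrite prodf_pair eq_sym (negPf ji).
by rewrite expr2 -mulrA mulKf//; apply: ler_wpM2l => //; routine.
Qed.

End Deviation.

(** * From a plan between labels to an allocation *)

Section LabelAllocation.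
Context (R : realType) (N : nat) (P : probability (vec3 R) R) (X : finType) (lab : vec3 R -> X).
Hypotheses (N0 : (0 < N)%N) (mlab : forall l, measurable (lab @^-1` [set l])).
Implicit Types (h : X -> R).

Lemma lab_sum h y : h (lab y) = \sum_l h l * \1_(lab @^-1` [set l]) y.
rewrite (bigD1 (lab y))//= indicE mem_set// mulr1 big1 ?addr0// => l ll.
by rewrite indicE memNset ?mulr0// => /= e; rewrite e eqxx in ll.
Qed.

Definition lmass l : R := fine (P (lab @^-1` [set l])).

Lemma bmeas_lab h : bmeas (fun y => h (lab y)).
under eq_fun do rewrite lab_sum; routine.
Qed.

Lemma lab_integral h : \int[P]_y h (lab y) = \sum_l h l * lmass l.
under eq_Rintegral do rewrite lab_sum.
rewrite (bfun_sum (bfun_prob P)) => [|l _]; last routine.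
by apply: eq_bigr => l _; rewrite (bfunZ (bfun_prob P) _ (bmeas_indic R (mlab l))) prob_indic.
Qed.

Lemma lmass_ge0 l : 0 <= lmass l. Proof. by rewrite fine_ge0. Qed.

Variable w : N.-tuple (vec3 R).
Definition lfreq l : R := N%:R^-1 * \sum_j (lab (tnth w j) == l)%:R.

Lemma lfreq_sum h : \sum_j N%:R^-1 * h (lab (tnth w j)) = \sum_l lfreq l * h l.
under [RHS]eq_bigr do rewrite -mulrA mulr_suml mulr_sumr.
rewrite exchange_big/=; apply: eq_bigr => j _; rewrite (bigD1 (lab (tnth w j)))//= eqxx mul1r big1 ?addr0// => l ll.
by rewrite eq_sym (negPf ll) mul0r mulr0.
Qed.

Lemma lfreq_ge0 l : 0 <= lfreq l.
routine. Qed.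

Lemma lfreq_mass : \sum_l lfreq l = \sum_l lmass l.
have nn : N%:R != 0 :> R by rewrite pnatr_eq0 -lt0n.
transitivity (\sum_l lfreq l * 1); first by apply: eq_bigr => l _; rewrite mulr1.
rewrite -(lfreq_sum (fun=> 1)) sumr_const card_ord mulr1 -[X in X = _]mulr_natl mulfV//.
by have := lab_integral (fun=> 1); rewrite prob_cst => ->; apply: eq_bigr => l _; rewrite mul1r.
Qed.

Variables (M c : X -> X -> R) (tau : vec3 R -> R).
Hypotheses (M0 : forall x y, 0 <= M x y) (Mrow : forall x, \sum_y M x y = lfreq x) (Mcol : forall y, \sum_x M x y = lmass y) (ik : P.-integrable setT (EFin \o @kv R)) (it : integ P tau) (Hc : forall j y, norm3 (tnth w j - y) ^+ 2 <= c (lab (tnth w j)) (lab y) + (tau (tnth w j) + tau y)).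
(** The density of the plan [M] with respect to its two marginals, divided by N. On labels of mass 0
    the uniform value keeps the sum over [j] equal to 1 everywhere. *)
Let Wl x l : R := if lmass l == 0 then N%:R^-1 else N%:R^-1 * (M x l / (lfreq x * lmass l)).
Let W (j : 'I_N) y := Wl (lab (tnth w j)) (lab y).
Let M_row0 x l : lfreq x = 0 -> M x l = 0.
by move=> e; have := Mrow x; rewrite e => /psumr_eq0P -> // y _. Qed.

Let M_col0 x l : lmass l = 0 -> M x l = 0.
by move=> e; have := Mcol l; rewrite e => /psumr_eq0P -> // y _. Qed.

Let Wmass x l : Wl x l * lmass l = N%:R^-1 * (M x l / lfreq x).
rewrite /Wl; case: eqVneq => [e|ne]; first by rewrite e mulr0 (M_col0 x e) mul0r mulr0.
by rewrite invfM -!mulrA mulVf ?mulr1.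
Qed.

Let Mdiv x l : lfreq x * (M x l / lfreq x) = M x l.
by have [e|ne] := eqVneq (lfreq x) 0; [rewrite e mul0r (M_row0 l e)|rewrite mulrCA mulfV ?mulr1]. Qed.

Lemma label_allocation : exists2 V, allocation P V &
 \int[P]_y spread2 V w y <= \sum_x \sum_l M x l * c x l + (N%:R^-1 * \sum_j tau (tnth w j) + \int[P]_y tau y).
have nn : N%:R != 0 :> R by rewrite pnatr_eq0 -lt0n.
have bW j : bmeas (W j) by exact: bmeas_lab.
have W0 j y : 0 <= W j y.
 rewrite /W /Wl; case: ifP => _; first by [].
 by apply: mulr_ge0; rewrite ?invr_ge0//; apply: mulr_ge0 => //; rewrite invr_ge0; apply: mulr_ge0; rewrite ?lfreq_ge0 ?lmass_ge0.
have W1 y : \sum_j W j y = 1.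
 rewrite /W /Wl; case: eqVneq => [e|ne]; first by rewrite sumr_const card_ord -[X in X = _]mulr_natl mulfV.
 rewrite (lfreq_sum (fun x => M x (lab y) / (lfreq x * lmass (lab y)))).
 under eq_bigr do rewrite invfM [M _ _ * _]mulrA mulrA Mdiv. by rewrite -mulr_suml Mcol mulfV.
have aW : allocation P W.
 split=> // j; first by case: (bW j). rewrite lab_integral; under eq_bigr do rewrite Wmass.
 rewrite -mulr_sumr -mulr_suml Mrow mulfV ?mulr1//. have : 0 < lfreq (lab (tnth w j)).
  rewrite /lfreq mulr_gt0 ?invr_gt0 ?ltr0n// (bigD1 j)//= eqxx; apply: (@lt_le_trans _ _ 1) => //.
  by rewrite lerDl sumr_ge0.
 lra.
exists W => //.
have b1 : bmeas (fun y => \sum_j W j y * c (lab (tnth w j)) (lab y)).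
 by apply: bmeas_sum => j _; apply: (bmeasM (bW j)); exact: bmeas_lab.
have b2 : bmeas (fun y => \sum_j W j y * tau (tnth w j)).
 routine.
have ib := bmeas_integrable P (bmeasD b1 b2).
have is_ : integ P (fun y => \sum_j W j y * c (lab (tnth w j)) (lab y) + \sum_j W j y * tau (tnth w j) + tau y).
 by apply: eq_integrable (integrableD measurableT ib it).
via (\int[P]_y (\sum_j W j y * c (lab (tnth w j)) (lab y) + \sum_j W j y * tau (tnth w j) + tau y)).
 apply: le_Rintegral => //; first exact: spread2_integrable.
 move=> y _; rewrite -[tau y]mul1r -(W1 y) mulr_suml -!big_split/=; apply: ler_sum => j _.
 by rewrite -!mulrDr -addrA; apply: ler_wpM2l.
rewrite (RintegralD _ ib it)// (bfunD (bfun_prob P) b1 b2) -addrA; apply: lerD; last rewrite lerD2r.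
 rewrite (bfun_sum (bfun_prob P)) => [|j _]; last by apply: (bmeasM (bW j)); exact: bmeas_lab. apply: eq_ler.
 transitivity (\sum_(j < N) N%:R^-1 * (fun x => \sum_l M x l / lfreq x * c x l) (lab (tnth w j))).
  apply: eq_bigr => j _; rewrite (lab_integral (fun l => Wl (lab (tnth w j)) l * c (lab (tnth w j)) l)) mulr_sumr.
  by apply: eq_bigr => l _; rewrite mulrAC Wmass -[LHS]mulrA.
 rewrite (lfreq_sum (fun x => \sum_l M x l / lfreq x * c x l)); apply: eq_bigr => x _; rewrite mulr_sumr; apply: eq_bigr => l _.
 by rewrite mulrA Mdiv.
rewrite (bfun_sum (bfun_prob P)) => [|j _]; last routine.
rewrite mulr_sumr; apply: eq_ler; apply: eq_bigr => j _.
have [_ _ _ WN] := aW; under eq_Rintegral do rewrite mulrC.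
by rewrite (bfunZ (bfun_prob P) _ (bW j)) WN mulrC.
Qed.

End LabelAllocation.

Lemma mtruncn d (T : measurableType d) (R : realType) (g : T -> R) (p : pred nat) :
 mfun g -> measurable [set x | p (Num.truncn (g x))].
move=> mg; have le n : measurable [set x | (Num.truncn (g x) <= n)%N].
 have -> : [set x | (Num.truncn (g x) <= n)%N] = setT `&` g @^-1` `]-oo, n.+1%:R[.
  by apply/seteqP; split => x /=; rewrite truncn_le_nat in_itv/=; [split|case].
 exact: mg.
have eq n : measurable [set x | Num.truncn (g x) = n].
 case: n => [|n].
  have -> : [set x | Num.truncn (g x) = 0%N] = [set x | (Num.truncn (g x) <= 0)%N].
   by apply/seteqP; split => x /=; [move=> ->|rewrite leqn0 => /eqP].
  by [].
 have -> : [set x | Num.truncn (g x) = n.+1] = [set x | (Num.truncn (g x) <= n.+1)%N] `\` [set x | (Num.truncn (g x) <= n)%N].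
  apply/seteqP; split => x /=; first by move=> ->; rewrite leqnn ltnn.
  by move=> [h /negP]; rewrite -ltnNge => h'; apply/eqP; rewrite eqn_leq h.
 by apply: measurableD.
have -> : [set x | p (Num.truncn (g x))] = \bigcup_(n in p) [set x | Num.truncn (g x) = n].
 by apply/seteqP; split => x /=; [move=> h; exists (Num.truncn (g x))|by move=> [n pn /= e]; rewrite e].
by apply: bigcup_measurable.
Qed.

Lemma divn_close (K i j : nat) : (0 < K)%N -> (i %/ K = j %/ K)%N -> (i.+1 <= K + j)%N.
move=> K0 e; rewrite (divn_eq i K) (divn_eq j K) e -addnS (addnC K) -addnA leq_add2l.
exact: leq_trans (ltn_pmod i K0) (leq_addl _ _).
Qed.

Lemma geometric_le (R : realType) (r : R) n : 0 <= r -> r < 1 -> \sum_(i < n) r ^+ i <= (1 - r)^-1.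
move=> r0 r1; have h : 0 < 1 - r by lra.
rewrite -[leRHS]mul1r ler_pdivlMr// mulrC.
have -> : (1 - r) * \sum_(i < n) r ^+ i = - ((r - 1) * \sum_(i < n) r ^+ i) by ring.
by rewrite -subrX1 opprB gerBl exprn_ge0.
Qed.

(** * Dyadic shells, slots and the hierarchical cost *)

Section Shells.
Context (R : realType) (m : nat).
Hypothesis m0 : (0 < m)%N.
Implicit Types (v w y : vec3 R) (n k : nat).
Notation Pm := (2 ^ m).+1.
Definition label : finType := ('I_m.+1 * ('I_Pm * 'I_Pm * 'I_Pm))%type.
Implicit Types (x : label).

(* Shell n > 0 lies between the spheres of radii 2^(n-1) and 2^n; the last one is unbounded. *)
Definition shell_of n : nat := minn m (if n == 0%N then 0%N else (trunc_log 2 n).+1).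
Definition shell v : nat := shell_of (Num.truncn (norm3 v)).
Definition slot n (a : R) : nat := Num.truncn (2 ^+ m * ((a / 2 ^+ n + 1) / 2)).
(** In the last, unbounded shell a slot may exceed 2^m, and [inord] then returns the index 0. This
    is harmless: distances to points of that shell are paid by [tailf]. *)
Definition lab v : label := (inord (shell v), (inord (slot (shell v) v.1.1), inord (slot (shell v) v.1.2), inord (slot (shell v) v.2))).

Lemma shell_le v : (shell v <= m)%N. Proof. exact: geq_minl. Qed.

Lemma lab1 v : (lab v).1 = shell v :> nat.
by rewrite /lab /= inordK// ltnS shell_le. Qed.

Lemma shell_lt v : (shell v < m)%N -> norm3 v < 2 ^+ shell v.
rewrite /shell /shell_of; case: eqVneq => [e _|ne].
 by rewrite minn0 expr0; have := truncnS_gt (norm3 v); rewrite e.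
rewrite gtn_min ltnn/= => h; rewrite (minn_idPr (ltnW h)).
apply: (lt_le_trans (truncnS_gt _)); rewrite -natrX ler_nat.
have nt : (0 < Num.truncn (norm3 v))%N by rewrite lt0n.
by have /andP[] := trunc_log_bounds (isT : (1 < 2)%N) nt.
Qed.

Lemma shell_gt v : (0 < shell v)%N -> 2 ^+ (shell v).-1 <= norm3 v.
rewrite /shell /shell_of; case: eqVneq => [e|ne]; first by [].
move=> _; have nt : (0 < Num.truncn (norm3 v))%N by rewrite lt0n.
via (2 ^+ trunc_log 2 (Num.truncn (norm3 v))).
 by apply: ler_weXn2l; rewrite ?ler1n//; rewrite -[leqRHS]/(_.+1.-1) -!subn1 leq_sub2r// geq_minr.
rewrite -natrX; apply: (@le_trans _ _ (Num.truncn (norm3 v))%:R); last by rewrite truncn_le norm3_ge0.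
by rewrite ler_nat; have /andP[] := trunc_log_bounds (isT : (1 < 2)%N) nt.
Qed.

Lemma measurable_lab x : measurable (lab @^-1` [set x]).
case: x => n [[i j] l]; have -> : lab @^-1` [set (n, (i, j, l))] =
  [set v | (inord (shell_of (Num.truncn (norm3 v))) : 'I_m.+1) == n] `&`
  [set v | (inord (slot n v.1.1) : 'I_Pm) == i] `&` [set v | (inord (slot n v.1.2) : 'I_Pm) == j] `&`
  [set v | (inord (slot n v.2) : 'I_Pm) == l].
 apply/seteqP; split => v /=.
  rewrite /lab => -[en ei ej el]; have sn : shell v = n :> nat by rewrite -en inordK// ltnS shell_le.
  by rewrite -en eqxx inordK ?ltnS ?shell_le// -ei -ej -el !eqxx.
 move=> [[[/eqP en /eqP ei] /eqP ej] /eqP el]; have sn : shell v = n :> nat by rewrite -en inordK// ltnS shell_le.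
 by rewrite /lab -[inord (shell v)]/(inord (shell_of (Num.truncn (norm3 v)))) en sn ei ej el.
have [c1 c2 c3] := mvec3_coord (@measurable_id _ (vec3 R) setT).
have ms (c : vec3 R -> R) (u : 'I_Pm) : mfun c -> measurable [set v | (inord (slot n (c v)) : 'I_Pm) == u].
 move=> mc; apply: (mtruncn (fun k => (inord k : 'I_Pm) == u)).
 by apply: mfunM => //; apply: mfunM => //; apply: mfunD => //; exact: mfunM.
apply: measurableI; last exact: ms.
apply: measurableI; last exact: ms.
apply: measurableI; last exact: ms.
apply: (mtruncn (fun k => (inord (shell_of k) : 'I_m.+1) == n)); routine.
Qed.

(** Slots are merged by groups of 2^k inside each shell. From level m + 1 on there is one single
    cell, in which the masses left over by different shells are matched. *)
Definition coarse k x : label := if (k <= m)%N then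
 (x.1, (inord (x.2.1.1 %/ 2 ^ k), inord (x.2.1.2 %/ 2 ^ k), inord (x.2.2 %/ 2 ^ k))) else (ord0, (ord0, ord0, ord0)).

Lemma inord_div (i : 'I_Pm) k : (inord (i %/ 2 ^ k) : 'I_Pm) = (i %/ 2 ^ k)%N :> nat.
by rewrite inordK//; apply: leq_ltn_trans (leq_div _ _) (ltn_ord i). Qed.

Lemma coarse1 k x : (k <= m)%N -> (coarse k x).1 = x.1. Proof. by rewrite /coarse => ->. Qed.

Lemma coarse_eq k x x' : (k <= m)%N -> coarse k x = coarse k x' ->
 [/\ x.1 = x'.1, x.2.1.1 %/ 2 ^ k = x'.2.1.1 %/ 2 ^ k, x.2.1.2 %/ 2 ^ k = x'.2.1.2 %/ 2 ^ k & x.2.2 %/ 2 ^ k = x'.2.2 %/ 2 ^ k]%N.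
rewrite /coarse => -> [e1 e2 e3 e4]; split=> //.
- by rewrite -(inord_div x.2.1.1) e2 inord_div.
- by rewrite -(inord_div x.2.1.2) e3 inord_div.
- by rewrite -(inord_div x.2.2) e4 inord_div.
Qed.

Lemma coarse_nested k x x' : coarse k x = coarse k x' -> coarse k.+1 x = coarse k.+1 x'.
have [km|km] := leqP k.+1 m; last by rewrite /coarse [(k.+1 <= m)%N]leqNgt km.
move=> /(coarse_eq (ltnW km)) [e1 e2 e3 e4]; rewrite /coarse km expnSr !divnMA e1 e2 e3 e4.
by [].
Qed.

Lemma coarse_top x x' : coarse m.+1 x = coarse m.+1 x'. Proof. by rewrite /coarse ltnn. Qed.

(** In shell n a cell of level k has sides 2 * 2^n 2^k / 2^m, hence squared diameter 12 * 4^n 4^k /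
    4^m. The constant 48 = 4 * 12 pays for level k + 1, whose transport moves the mass unmatched at
    level k. *)
Definition weight k x : R := 48 * 4 ^+ x.1 * 4 ^+ k / 4 ^+ m.

Lemma weight_ge0 k x : 0 <= weight k x.
routine. Qed.

Lemma weight_mono k k' x : (k <= k')%N -> weight k x <= weight k' x.
by move=> kk; rewrite /weight ler_wpM2r ?invr_ge0 ?exprn_ge0// ler_wpM2l ?mulr_ge0 ?exprn_ge0// ler_weXn2l// ler1n.
Qed.

Definition level_cost k x x' : R := if k is k'.+1 then weight k' x + weight k' x' else weight 0 x.

Lemma level_cost_mono k k' x x' : (k <= k')%N -> level_cost k x x' <= level_cost k' x x'.
case: k k' => [|k] [|k']//= kk; last by rewrite lerD// weight_mono.
by upto (weight_mono x (leq0n k')); rewrite lerDl weight_ge0.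
Qed.

Fact coarse_meet x x' : exists k, coarse k x == coarse k x'.
by exists m.+1; apply/eqP; exact: coarse_top. Qed.

(** The cost of the first level at which the labels merge: up to the tail, it dominates the squared
    distance. *)
Definition label_cost x x' : R := level_cost (ex_minn (coarse_meet x x')) x x'.

Lemma label_cost_le k x x' : coarse k x = coarse k x' -> label_cost x x' <= level_cost k x x'.
by move=> /eqP e; rewrite /label_cost; case: ex_minnP => k' _ /(_ _ e); exact: level_cost_mono. Qed.

Lemma slot_close n k (a b : R) : (k <= m)%N -> `|a| < 2 ^+ n -> `|b| < 2 ^+ n ->
 (((inord (slot n a) : 'I_Pm) %/ 2 ^ k)%N = ((inord (slot n b) : 'I_Pm) %/ 2 ^ k)%N) -> (a - b) ^+ 2 <= 4 * 4 ^+ n * 4 ^+ k / 4 ^+ m.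
move=> km an bn; have p n' : 0 < 2 ^+ n' :> R by [].
pose u (a : R) := 2 ^+ m * ((a / 2 ^+ n + 1) / 2).
have H (c : R) : `|c| < 2 ^+ n -> let i := slot n c in [/\ (i < Pm)%N, i%:R <= u c & u c < i.+1%:R].
 rewrite ltr_norml => /andP[c0 c1] i. have x0 : -1 < c / 2 ^+ n by rewrite ltr_pdivlMr// mulN1r.
 have x1 : c / 2 ^+ n < 1 by rewrite ltr_pdivrMr// mul1r.
 have u0 : 0 <= u c by rewrite mulr_ge0 ?(ltW (p m))// divr_ge0//; lra.
 split; [|by rewrite truncn_le|exact: truncnS_gt].
 rewrite ltnS truncn_le_nat; apply: (@lt_trans _ _ (2 ^+ m)); last by rewrite -natrX ltr_nat.
 by rewrite -[ltRHS]mulr1 ltr_pM2l//; lra.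
have [ia la ha] := H a an; have [ib lb hb] := H b bn; rewrite !inordK//.
set i := slot n a; set j := slot n b => e.
have K0 : (0 < 2 ^ k)%N by rewrite expn_gt0.
have D : `|u a - u b| <= 2 ^+ k.
 rewrite ler_norml; apply/andP; split.
  rewrite lerNl opprB lerBlDr; upto (ltW hb); via (2 ^+ k + i%:R); last by rewrite lerD2l.
  by rewrite -natrX -natrD ler_nat; exact: (divn_close K0 (esym e)).
 rewrite lerBlDr; upto (ltW ha); via (2 ^+ k + j%:R); last by lra.
 by rewrite -natrX -natrD ler_nat; exact: (divn_close K0 e).
have ab : a - b = 2 * 2 ^+ n / 2 ^+ m * (u a - u b).
 by rewrite /u; field; rewrite !gt_eqF.
have -> : 4 * 4 ^+ n * 4 ^+ k / 4 ^+ m = (2 * 2 ^+ n / 2 ^+ m) ^+ 2 * (2 ^+ k) ^+ 2 :> R.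
 have four n' : 4 ^+ n' = (2 ^+ n') ^+ 2 :> R by rewrite -exprM mulnC exprM; congr (_ ^+ n'); rewrite -natrX.
 by rewrite !four; field; rewrite gt_eqF.
rewrite ab exprMn; apply: ler_wpM2l; first routine.
by rewrite -[X in X <= _]real_normK ?num_real//; apply: lerXn2r => //; routine.
Qed.

(** If one point is in the last shell, 2 |w|^2 + 2 |y|^2 is paid by the points of norm at least
    2^(m-1), the larger norm covering the smaller one; whence the factor 4. *)
Definition tailf v : R := if 2 ^+ m.-1 <= norm3 v then 4 * norm3 v ^+ 2 else 0.

Lemma tailf_ge0 v : 0 <= tailf v.
by rewrite /tailf; case: ifP => // _; routine. Qed.

Lemma pow4_le (a : R) n : 0 <= a -> a < 2 ^+ n -> a ^+ 2 <= 4 ^+ n.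
move=> a0 h; have -> : 4 ^+ n = (2 ^+ n) ^+ 2 :> R by rewrite -exprM mulnC exprM; congr (_ ^+ n); rewrite -natrX.
nra.
Qed.

Lemma label_cost_ge w y : norm3 (w - y) ^+ 2 <= label_cost (lab w) (lab y) + (tailf w + tailf y).
have c0 x x' : 0 <= label_cost x x'.
 by rewrite /label_cost; case: (ex_minn _) => [|k] /=; routine.
have far v : (m <= shell v)%N -> 2 ^+ m.-1 <= norm3 v.
 move=> h; have e : shell v = m by apply/eqP; rewrite eqn_leq shell_le. by have := @shell_gt v; rewrite e; apply.
have near v : (shell v < m)%N -> norm3 v < 2 ^+ m.-1.
 move=> h; apply: (lt_le_trans (shell_lt h)); apply: ler_weXn2l; rewrite ?ler1n//. by rewrite -ltnS prednK.
have s2 := norm3_sub2 w y; have tw := tailf_ge0 w; have ty := tailf_ge0 y.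
have big v v' : (m <= shell v)%N -> norm3 v' < 2 ^+ m.-1 \/ (m <= shell v')%N -> 2 * norm3 v ^+ 2 + 2 * norm3 v' ^+ 2 <= tailf v + tailf v'.
 move=> /far fv; rewrite {1}/tailf fv; case=> [h|/far fv']; last by rewrite /tailf fv'; have := sqr_ge0 (norm3 v); have := sqr_ge0 (norm3 v'); lra.
 have : norm3 v' ^+ 2 <= norm3 v ^+ 2 by apply: lerXn2r; rewrite ?nnegrE ?norm3_ge0// (le_trans (ltW h)).
 by have := tailf_ge0 v'; lra.
have [hw|hw] := ltnP (shell w) m; last first.
 apply: (le_trans s2); upto (big w y hw _); last by rewrite lerDr.
 by have [/near|] := ltnP (shell y) m; [left|right].
have [hy|hy] := ltnP (shell y) m; last first.
 by apply: (le_trans s2); rewrite addrC (addrC (tailf w)); upto (big y w hy _); [left; exact: near|rewrite lerDr].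
via (label_cost (lab w) (lab y)); last by rewrite lerDl addr_ge0.
rewrite /label_cost; case: ex_minnP => k /eqP e kmin.
have km1 : (k <= m.+1)%N by apply: kmin; apply/eqP; exact: coarse_top.
have [km|km] := leqP k m; last first.
 have -> : k = m.+1 by apply/eqP; rewrite eqn_leq km1.
 rewrite /= /weight !lab1 !mulfK ?expf_neq0//; apply: (le_trans s2).
 have := pow4_le (norm3_ge0 w) (shell_lt hw); have := pow4_le (norm3_ge0 y) (shell_lt hy).
 have := exprn_ge0 (shell w) (ler0n R 4); have := exprn_ge0 (shell y) (ler0n R 4).
 by move: (4 ^+ shell w : R) (4 ^+ shell y : R) => A B; lra.
have [e1 e2 e3 e4] := coarse_eq km e.
have sE : shell y = shell w by rewrite -!lab1 e1.
have b v (c : R) : (shell v < m)%N -> `|c| <= norm3 v -> `|c| < 2 ^+ shell v by move=> h l; exact: le_lt_trans l (shell_lt h).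
have [w1 w2 w3] := norm3_coord w; have [y1 y2 y3] := norm3_coord y.
move: e2 e3 e4; rewrite /lab /= sE => e2 e3 e4.
have by_ (c : R) : `|c| <= norm3 y -> `|c| < 2 ^+ shell w by rewrite -sE; exact: b.
have d1 := slot_close km (b _ _ hw w1) (by_ _ y1) e2.
have d2 := slot_close km (b _ _ hw w2) (by_ _ y2) e3.
have d3 := slot_close km (b _ _ hw w3) (by_ _ y3) e4.
have N3 : norm3 (w - y) ^+ 2 = (w.1.1 - y.1.1) ^+ 2 + (w.1.2 - y.1.2) ^+ 2 + (w.2 - y.2) ^+ 2.
 by rewrite norm3_sqr /dot3 /=; ring.
have three (a b' c Y : R) : a <= Y -> b' <= Y -> c <= Y -> a + b' + c <= 3 * Y by lra.
have tot : norm3 (w - y) ^+ 2 <= 3 * (4 * 4 ^+ shell w * 4 ^+ k / 4 ^+ m) by rewrite N3; exact: three d1 d2 d3.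
apply: (le_trans tot); case: {tot e kmin km1 km e2 e3 e4 d1 d2 d3} k => [|k] /=; rewrite /weight !lab1 ?sE.
 have : 0 <= 4 ^+ shell w / 4 ^+ m :> R by routine. by rewrite expr0 !mulr1; lra.
rewrite exprS; have : 0 <= 4 ^+ shell w * 4 ^+ k / 4 ^+ m :> R by routine.
by lra.
Qed.

End Shells.

Lemma Rintegral_min_le d (T : measurableType d) (R : realType) (P : probability T R) (g : T -> R) (c : R) :
 integ P g -> (forall x, 0 <= g x) -> (forall B, 0 <= B -> \int[P]_x Num.min (g x) B <= c) ->
 \int[P]_x g x <= c.
move=> ig g0 H; have mg : mfun g by apply/mEFinP; exact: measurable_int ig.
have C : \int[P]_x Num.min (g x) n%:R @[n --> \oo] --> \int[P]_x g x.
 apply: (prob_dominated_cvg (F := fun n x => Num.min (g x) n%:R) (h := g)) => // [n|n x|x].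
 - routine.
 - by rewrite ger0_norm ?min_ge0// ge_min lexx.
 - by apply: cvg_near_cst; near=> n; rewrite min_l//; near: n; exact: nbhs_infty_ger.
rewrite -(cvg_lim _ C)//; apply: limr_le; first by apply/cvg_ex; eexists; exact: C.
by apply: nearW => n; exact: H.
Unshelve. all: by end_near. Qed.

(** * The cost of the allotment *)

Section Rate.
Context (R : realType) (N m : nat) (P : probability (vec3 R) R) (M6 : R).
Hypotheses (N0 : (0 < N)%N) (m0 : (0 < m)%N) (M60 : 0 <= M6) (HM6 : forall Q, 0 <= Q -> \int[P]_v min6 Q v <= M6) (ik : P.-integrable setT (EFin \o @kv R)).
Notation E := (N.-tuple (vec3 R)).
Implicit Types (w : E) (v : vec3 R) (x c : label m).
Let lb : vec3 R -> label m := lab m.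
Let mlb l : measurable (lb @^-1` [set l]) := measurable_lab l.
Let A k w c := cellsum (coarse k) (lfreq lb w) c.
Let B k c := cellsum (coarse k) (lmass P lb) c.
Let sN : R := Num.sqrt N%:R.
Let sN0 : 0 < sN. Proof. by rewrite sqrtr_gt0 ltr0n. Qed.
Let sN2 : sN ^+ 2 = N%:R. Proof. by rewrite sqr_sqrtr. Qed.
Let S32 : R := 32 * (1 + M6).

(** In shell n > 0 one has |v| >= 2^(n-1), and 32^n <= 32 (2^(n-1))^6. *)
Lemma shell_moment : \int[P]_v 32 ^+ (lb v).1 <= S32.
have Q0 : 0 <= 2 ^+ m :> R by [].
have b6 := min6_bmeas Q0; have bp := bfun_prob P.
via (\int[P]_v (1 + 32 * min6 (2 ^+ m) v)); last first.
 rewrite (bfunD bp (bmeas_cst _ _) (bmeasZ _ b6)) prob_cst (bfunZ bp _ b6) /S32. by have := HM6 Q0; lra.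
apply: (bfun_le bp); first exact: (bmeas_lab mlb (fun x => 32 ^+ x.1)).
 routine.
move=> v; rewrite lab1; have m6 := min6_ge0 Q0 v.
have [->|s0] := posnP (shell m v); first by lra.
via (32 * min6 (2 ^+ m) v); last by lra.
rewrite -(prednK s0) exprS; apply: ler_wpM2l => //; have h := shell_gt s0.
have e0 : 0 <= 2 ^+ (shell m v).-1 :> R by [].
via ((2 ^+ (shell m v).-1) ^+ 6).
 by rewrite -exprM mulnC exprM; apply: lerXn2r; rewrite ?nnegrE// -natrX ler_nat.
apply: lerXn2r; rewrite ?nnegrE ?min_ge0 ?norm3_ge0// le_min h/=.
by apply: ler_weXn2l; rewrite ?ler1n//; apply: leq_trans (leq_pred _) (shell_le _ _).
Qed.

Let F k c : set (vec3 R) := [set v | coarse k (lb v) == c].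

Lemma mcell k c : measurable (F k c).
have -> : F k c = \bigcup_(x in [set x | coarse k x == c]) (lb @^-1` [set x]).
 by apply/seteqP; split => v /=; [move=> h; exists (lb v)|move=> [x /= h e]; rewrite /F /= e].
apply: fin_bigcup_measurable; first exact: finite_finset.
by [].
Qed.

Lemma cell_freq k w c : A k w c = freq (F k c) w.
rewrite /A /cellsum /lfreq /freq -mulr_sumr exchange_big/=; congr (_ * _); apply: eq_bigr => j _.
rewrite indicE /F; have [h|h] := eqVneq (coarse k (lb (tnth w j))) c.
 rewrite mem_set//=; last by apply/eqP. rewrite (bigD1 (lb (tnth w j)))//=; last by apply/eqP.
 by rewrite eqxx big1 ?addr0// => l /andP[_ /negPf]; rewrite eq_sym => ->.
rewrite memNset/=; last by apply/negP.
by rewrite big1// => l /eqP lc; case: eqP => // e; rewrite e lc eqxx in h.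
Qed.

Lemma cell_mass k c : B k c = fine (P (F k c)).
rewrite -(prob_indic P (mcell k c)) /B /cellsum.
transitivity (\int[P]_v (fun x => (coarse k x == c)%:R) (lb v)).
 rewrite (lab_integral P mlb (fun x => (coarse k x == c)%:R)) big_mkcond/=; apply: eq_bigr => x _.
 by case: ifP => _; rewrite ?mul1r ?mul0r.
apply: eq_Rintegral => v _; rewrite indicE; case: (boolP (coarse k (lb v) == c)) => h; first by rewrite mem_set.
by rewrite memNset//; apply/negP.
Qed.

(** Only these cells are reached by [coarse k]. Their number per shell, of order 8^(m - k), is what
    makes the sum over the levels converge. *)
Definition valid_cell k c : bool := [&& (c.2.1.1 <= 2 ^ (m - k))%N, (c.2.1.2 <= 2 ^ (m - k))%N & (c.2.2 <= 2 ^ (m - k))%N].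

Lemma coarse_valid k x : (k <= m)%N -> valid_cell k (coarse k x).
move=> km; have h (i : 'I_(2 ^ m).+1) : ((inord (i %/ 2 ^ k) : 'I_(2 ^ m).+1) <= 2 ^ (m - k))%N.
 rewrite inord_div -(@mulnK (2 ^ (m - k)) (2 ^ k)) ?expn_gt0//; apply: leq_div2r.
 by rewrite -expnD subnK// -ltnS ltn_ord.
by rewrite /valid_cell /coarse km /= !h.
Qed.

Lemma bmeas_dev k c : bmeas (fun w : E => `|A k w c - B k c|).
have bd : bmeas (fun w : E => A k w c - B k c).
 apply: bmeasB; last routine. by under eq_fun do rewrite cell_freq; exact: bmeas_freq (mcell k c).
have [md [C HC]] := bd; split; first exact: mcomp.
by exists C => w; rewrite normr_id.
Qed.

Lemma cell_deviation k c t : (k <= m)%N -> 0 < t ->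
 prodf (fun=> P) (fun w : E => `|A k w c - B k c|) <= t / 2 * (N%:R^-1 * B k c) + (valid_cell k c)%:R * (2 * t)^-1.
move=> km t0; have [v|nv] := boolP (valid_cell k c).
 rewrite mul1r cell_mass; under [fun w : E => _]eq_fun do rewrite cell_freq.
 exact: deviation (mcell k c) t t0.
have Z (g : label m -> R) : cellsum (coarse k) g c = 0.
 by apply: big1 => x /eqP e; rewrite -e coarse_valid in nv.
have -> : (fun w : E => `|A k w c - B k c|) = fun=> 0 by apply/funext => w; rewrite /A /B !Z subrr normr0.
by rewrite prodf_cst /B Z !mulr0 mul0r addr0.
Qed.

Lemma count_le (L : nat) : \sum_(i < (2 ^ m).+1) (i <= L)%:R <= L.+1%:R :> R.
rewrite -natr_sum ler_nat.
have [h|h] := leqP (2 ^ m).+1 L.+1.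
 apply: (@leq_trans (\sum_(i < (2 ^ m).+1) 1)); first by apply: leq_sum => i _; exact: leq_b1.
 by rewrite sum1_card card_ord.
rewrite -big_mkcond/= sum1_card; apply: leq_trans (_ : (#|'I_L.+1| <= _)%N); last by rewrite card_ord.
have -> : #|[pred i : 'I_(2 ^ m).+1 | (i <= L)%N]| = #|[set widen_ord (ltnW h) i | i : 'I_L.+1]|.
 apply: eq_card => i; rewrite !inE; apply/idP/imsetP => [il|[i' _ ->]]; last by rewrite /= -ltnS ltn_ord.
 by exists (Ordinal (il : (i < L.+1)%N)) => //; exact: val_inj.
exact: leq_imset_card.
Qed.

Lemma valid_sum k (g : nat -> R) : (k <= m)%N -> (forall n, 0 <= g n) ->
 \sum_c (valid_cell k c)%:R * g c.1 <= 8 * 8 ^+ (m - k) * \sum_(n < m.+1) g n.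
move=> km g0; set L := (2 ^ (m - k))%N.
have -> : \sum_c (valid_cell k c)%:R * g c.1 =
 \sum_(n < m.+1) g n * ((\sum_(i < (2 ^ m).+1) (i <= L)%:R) * (\sum_(i < (2 ^ m).+1) (i <= L)%:R) * (\sum_(i < (2 ^ m).+1) (i <= L)%:R)).
 rewrite -(pair_bigA _ (fun (n : 'I_m.+1) u => (valid_cell k (n, u))%:R * g n))/=; apply: eq_bigr => n _.
 rewrite -mulr_suml mulrC; congr (_ * _). rewrite -(pair_bigA _ (fun u l => (valid_cell k (n, (u, l)))%:R))/=.
 rewrite -(pair_bigA _ (fun i j => \sum_l (valid_cell k (n, ((i, j), l)))%:R))/=.
 rewrite -mulrA mulr_suml; apply: eq_bigr => i _; rewrite mulr_suml mulr_sumr; apply: eq_bigr => j _.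
 rewrite !mulr_sumr; apply: eq_bigr => l _; rewrite /valid_cell /= -/L.
 by case: (i <= L)%N; case: (j <= L)%N; case: (l <= L)%N; rewrite ?mulr1 ?mulr0.
set s := \sum_(i < _) _; have s0 : 0 <= s by routine.
have sL : s <= 2 * 2 ^+ (m - k).
 upto (count_le L); rewrite -natrX -natrM ler_nat mul2n -addnn -addn1 leq_add2l. by rewrite /L expn_gt0.
rewrite -mulr_suml mulrC; apply: ler_wpM2r; first routine.
have -> : 8 * 8 ^+ (m - k) = (2 * 2 ^+ (m - k)) * (2 * 2 ^+ (m - k)) * (2 * 2 ^+ (m - k)) :> R.
 have -> : 8 = 2 * 2 * 2 :> R by lra. by rewrite !exprMn; ring.
by apply: ler_pM => //; [routine|apply: ler_pM].
Qed.

Lemma level_deviation k : (k <= m)%N -> \sum_c prodf (fun=> P) (fun w : E => `|A k w c - B k c|) * weight R k c <=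
 sN^-1 * (24 * S32 * (3 / 4) ^+ (m - k) + 384 * (2 / 3) ^+ (m - k)).
move=> km; set j := (m - k)%N.
have p (a : R) n : 0 < a -> 0 < a ^+ n by move=> ?; rewrite exprn_gt0.
have kj : 4 ^+ k / 4 ^+ m = (4 ^+ j)^-1 :> R.
 by rewrite -(subnK km) -/j exprD invfM mulrCA mulfV ?mulr1// expf_neq0.
(* This choice makes both sums geometric. In shell n, [t] times [weight] is of order 32^n (3/4)^j,
   summed in n by the sixth moment; [weight] over [t] is of order 2^-n 12^-j, and with about 8^j
   cells this gives (2/3)^j. *)
pose t c : R := sN * 8 ^+ c.1 * 3 ^+ j.
have t0 c : 0 < t c by rewrite /t !mulr_gt0.
via (\sum_c (B k c * (24 * (3 / 4) ^+ j / sN * 32 ^+ c.1) + (valid_cell k c)%:R * (24 / sN * (12 ^+ j)^-1 * (2 ^-1) ^+ c.1))).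
 apply: ler_sum => c _; upto (ler_wpM2r (weight_ge0 _ _ _) (cell_deviation c km (t0 c))). apply: eq_ler.
 have -> : weight R k c = 48 * 4 ^+ c.1 * (4 ^+ j)^-1 by rewrite /weight -mulrA kj.
 rewrite /t -sN2 expr_div_n (_ : 32 = 8 * 4 :> R); last by lra. rewrite (_ : 12 = 3 * 4 :> R); last by lra.
 rewrite (_ : 2^-1 = 4 / 8 :> R); last by field. rewrite expr_div_n !exprMn.
 have := sN0; have := p 8 c.1; have := p 3 j; have := p 4 j; have := p 4 c.1.
 move: (8 ^+ c.1 : R) (3 ^+ j : R) (4 ^+ j : R) (4 ^+ c.1 : R) (sN) (B k c) ((valid_cell k c)%:R : R) => a b d e s u vv He Hd Hb Ha Hs.
 by field; rewrite !gt_eqF ?Hd ?Hb ?Ha.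
rewrite big_split/= mulrDr; apply: lerD.
 rewrite -(sum_cells (coarse k) (lmass P lb) (fun c => 24 * (3 / 4) ^+ j / sN * 32 ^+ c.1)).
 have -> : \sum_x lmass P lb x * (24 * (3 / 4) ^+ j / sN * 32 ^+ (coarse k x).1) = 24 * (3 / 4) ^+ j / sN * \int[P]_v 32 ^+ (lb v).1.
  rewrite (lab_integral P mlb (fun x => 32 ^+ x.1)) mulr_sumr; apply: eq_bigr => x _.
  by rewrite coarse1// mulrCA [lmass _ _ _ * _]mulrC.
 have c0 : 0 <= 24 * (3 / 4) ^+ j / sN by routine. upto (ler_wpM2l c0 shell_moment); apply: eq_ler. lra.
have g0 n : 0 <= 24 / sN * (12 ^+ j)^-1 * (2 ^-1) ^+ n by rewrite !mulr_ge0 ?invr_ge0// ltW.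
upto (valid_sum km g0); rewrite -mulr_sumr.
have G := @geometric_le R (2^-1) m.+1 _ _.
have {}G : \sum_(i < m.+1) (2^-1) ^+ i <= 2 :> R.
 by upto (G _ _); rewrite // ?invf_lt1// ?ltr1n//; apply: eq_ler; field.
have c0 : 0 <= 8 * 8 ^+ j * (24 / sN * (12 ^+ j)^-1) :> R.
 routine.
rewrite -/j mulrA; upto (ler_wpM2l c0 G); apply: eq_ler.
rewrite (_ : 2 / 3 = 8 / 12 :> R); last by field.
rewrite expr_div_n; move: (8 ^+ j : R) ((12 ^+ j)^-1 : R) (sN^-1) => u s r; ring.
Qed.

Lemma rev_geometric (r : R) : 0 <= r -> r < 1 -> \sum_(k < m.+1) r ^+ (m - k) <= (1 - r)^-1.
move=> r0 r1; rewrite (reindex_inj rev_ord_inj)/=; apply: le_trans (geometric_le m.+1 r0 r1).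
by apply: eq_ler; apply: eq_bigr => k _; rewrite subSS subKn// -ltnS.
Qed.

Lemma mtailf : mfun (@tailf R m).
have mn : mfun (@norm3 R) by exact: mnorm3.
apply: measurable_fun_ifT; last routine.
 by apply: measurable_fun_ler => //; routine.
by apply: mfunM => //; routine.
Qed.

(** Above r = 2^(m-1) one has |v|^2 <= |v|^6 / r^4 with r^4 = 16^(m-1), and the factor 4 of [tailf]
    gives 64 / 16^m. *)
Lemma tail_moment C : 0 <= C -> \int[P]_v Num.min (tailf m v) C <= 64 / 16 ^+ m * M6.
move=> C0; set r : R := 2 ^+ m.-1; have r0 : 0 < r by rewrite exprn_gt0.
(* Q exceeds r and its square exceeds C, so the bound survives where [min6] is capped. *)
pose Q := r + C + 1; have Q0 : 0 <= Q by routine.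
have c0 : 0 <= 64 / 16 ^+ m :> R by [].
apply: le_trans (ler_wpM2l c0 (HM6 Q0)); rewrite -(bfunZ (bfun_prob P) _ (min6_bmeas Q0)).
have mt := mtailf.
apply: (bfun_le (bfun_prob P)); [by apply: bmeas_min => // v; exact: tailf_ge0|by apply: bmeasZ; exact: min6_bmeas|move=> v].
rewrite /tailf -/r; case: ifP => rv; last by rewrite min_l// mulr_ge0// min6_ge0.
have e : 64 / 16 ^+ m = 4 / r ^+ 4 :> R.
 have -> : r ^+ 4 = 16 ^+ m.-1 by rewrite /r -exprM mulnC exprM; congr (_ ^+ _); rewrite -natrX.
 by rewrite -{1}(prednK m0) exprS; field; rewrite expf_neq0.
rewrite e mulrAC ler_pdivlMr ?exprn_gt0//.
have r4 z : r <= z -> z ^+ 2 * r ^+ 4 <= z ^+ 6.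
 move=> rz; have -> : z ^+ 6 = z ^+ 2 * z ^+ 4 by lra. apply: ler_wpM2l; first exact: sqr_ge0.
 by apply: lerXn2r; rewrite ?nnegrE// (le_trans (ltW r0)).
rewrite /min6; case/orP: (le_total (norm3 v) Q) => h.
 rewrite (min_l h); via (4 * norm3 v ^+ 2 * r ^+ 4).
  by apply: ler_wpM2r; [routine|rewrite ge_min lexx].
 by rewrite -mulrA; apply: ler_wpM2l => //; exact: r4.
rewrite (min_r h); via (C * r ^+ 4).
 by apply: ler_wpM2r; [routine|rewrite ge_min lexx orbT].
have rQ : r <= Q by rewrite /Q -addrA lerDl addr_ge0.
via (Q ^+ 2 * r ^+ 4).
 apply: ler_wpM2r; first routine. by rewrite /Q; move: r0 C0; move: (r) => z; nra.
by upto (r4 _ rQ); have := exprn_ge0 6 Q0; lra.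
Qed.

Definition rate_bound w : R := \sum_x lfreq lb w x * weight R 0 x
 + \sum_(k < m.+1) 2 * \sum_c `|A k w c - B k c| * weight R k c
 + (N%:R^-1 * \sum_j tailf m (tnth w j) + 64 / 16 ^+ m * M6).

Lemma tailf_integrable : P.-integrable setT (EFin \o @tailf R m).
have ick : integ P (fun v : vec3 R => 4 * kv v) by apply: eq_integrable (integrableZl measurableT 4 ik).
apply: (le_integrable measurableT _ _ ick); first by apply/mEFinP; exact: mtailf.
move=> v _ /=; rewrite lee_fin ger0_norm ?tailf_ge0// ger0_norm ?mulr_ge0 ?kv_ge0//.
by rewrite /tailf /kv; have := sqr_ge0 (norm3 v); case: ifP => _; lra.
Qed.

Lemma rate_allocation w : exists2 W, allocation P W & \int[P]_y spread2 W w y <= rate_bound w.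
have cS k x y : (k < m.+1)%N -> coarse k.+1 x = coarse k.+1 y -> label_cost R x y <= weight R k (coarse k x) + weight R k (coarse k y).
 by move=> km e; upto (label_cost_le R e); rewrite /weight !coarse1.
have [M [M0' Mr Mc] HM] := @greedy_transport R (label m) (label m) (@coarse m) (@label_cost R m) (weight R 0) (@weight R m)
 (lfreq lb w) (lmass P lb) m.+1 (@coarse_nested m) (fun x y e => label_cost_le R e) cS (weight_ge0 R 0)
 (@weight_ge0 R m) (lfreq_ge0 lb w) (lmass_ge0 P lb) (lfreq_mass P N0 mlb w) (@coarse_top m).
have [W aW HW] := label_allocation N0 mlb M0' Mr Mc ik tailf_integrable (fun j y => label_cost_ge m0 (tnth w j) y).
exists W => //; apply: (le_trans HW); rewrite /rate_bound; apply: lerD => //; rewrite lerD2l.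
exact: Rintegral_min_le tailf_integrable (tailf_ge0 m) tail_moment.
Qed.

Lemma rate_upper : upper_le (prodf (fun=> P)) rate_bound
 (48 * S32 / 4 ^+ m + 2 * (sN^-1 * (96 * S32 + 1152)) + (64 / 16 ^+ m * M6 + 64 / 16 ^+ m * M6)).
have bF := prodf_bfun (fun _ : 'I_N => P); have F1 := prodf1 (fun _ : 'I_N => P).
have c0 : 0 <= 64 / 16 ^+ m * M6 by rewrite mulr_ge0// divr_ge0.
have nn : N%:R != 0 :> R by rewrite pnatr_eq0 -lt0n.
apply: (upper_leD bF); first apply: (upper_leD bF).
- have -> : (fun w : E => \sum_x lfreq lb w x * weight R 0 x) = fun w => \sum_j N%:R^-1 * weight R 0 (lb (tnth w j)).
  by apply/funext => w; rewrite (lfreq_sum lb w (weight R 0)).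
 have bw := bmeas_lab mlb (weight R 0). have bb j := bmeasZ N%:R^-1 (bmeas_tnth j bw).
 apply: (upper_le_bmeas bF); first routine.
  by move=> w; routine.
 rewrite (bfun_sum bF) => [|j _]//. via (\sum_(j < N) N%:R^-1 * (48 * S32 / 4 ^+ m)); last first.
  by rewrite sumr_const card_ord -[leLHS]mulr_natl mulVKf.
 apply: ler_sum => j _; rewrite (bfunZ bF _ (bmeas_tnth j bw)) (prodf_tnth (fun=> P) j bw).
 apply: ler_wpM2l; first by []. have c1 : 0 <= 48 / 4 ^+ m :> R by [].
 rewrite mulrAC; apply: le_trans (ler_wpM2l c1 shell_moment). have b32 := bmeas_lab mlb (fun x => 32 ^+ x.1 : R).
 rewrite -(bfunZ (bfun_prob P) _ b32); apply: (bfun_le (bfun_prob P) bw (bmeasZ _ b32)) => v.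
 rewrite /weight expr0 mulr1 mulrAC; apply: ler_wpM2l => //; apply: lerXn2r; rewrite ?nnegrE//. lra.
- have bd k c := bmeasM (bmeas_dev k c) (bmeas_cst _ (weight R k c)).
 have bk k : bmeas (fun w : E => \sum_c `|A k w c - B k c| * weight R k c) by routine.
 apply: (upper_le_bmeas bF); first routine.
  move=> w; apply: sumr_ge0 => k _; apply: mulr_ge0 => //; apply: sumr_ge0 => c _. routine.
 rewrite (bfun_sum bF) => [|k _]; last routine.
 via (\sum_(k < m.+1) 2 * (sN^-1 * (24 * S32 * (3 / 4) ^+ (m - k) + 384 * (2 / 3) ^+ (m - k)))).
  apply: ler_sum => k _; rewrite (bfunZ bF _ (bk k)); apply: ler_wpM2l => //. have km : (k <= m)%N by rewrite -ltnS.
  apply: le_trans (level_deviation km); rewrite (bfun_sum bF) => [|c _]; last exact: bd.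
  apply: ler_sum => c _; under [fun w : E => _ * _]eq_fun do rewrite mulrC.
  by rewrite (bfunZ bF _ (bmeas_dev k c)) mulrC.
 rewrite -mulr_sumr -mulr_sumr big_split/= -!mulr_sumr; apply: ler_wpM2l => //. apply: ler_wpM2l; first routine.
 have S0 : 0 <= 24 * S32 by routine. have r1 : 0 <= 3 / 4 :> R by []. have r2 : 0 <= 2 / 3 :> R by [].
 have r3 : 3 / 4 < 1 :> R by lra. have r4 : 2 / 3 < 1 :> R by lra. have q1 := ler_wpM2l S0 (rev_geometric r1 r3).
 have q2 := ler_wpM2l (ler0n R 384) (rev_geometric r2 r4).
 upto (lerD q1 q2); have -> : (1 - 3 / 4)^-1 = 4 :> R by field. have -> : (1 - 2 / 3)^-1 = 3 :> R by field.
 by move: (S32) => z; lra.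
apply: (upper_leD bF); last exact: upper_le_cst.
have -> : 64 / 16 ^+ m * M6 = N%:R^-1 * (N%:R * (64 / 16 ^+ m * M6)) by rewrite mulKf.
apply: (upper_leZ bF); first by [].
apply: (upper_le_sum bF F1) => j; apply: prodf_upper; [|exact: tailf_ge0|exact: tail_moment].
exact: mtailf.
Qed.

End Rate.

Section NonmeasurableIntegral.
Local Open Scope ereal_scope.
Import HBNNSimple.

(* The integral of a nonnegative function is a supremum over the simple functions below it, hence monotone
  without any measurability. *)
Lemma le_integral_nonneg d (T : measurableType d) (R : realType) (mu : {measure set T -> \bar R}) (D : set T) (f g : T -> \bar R) :
 (forall x, D x -> 0 <= f x) -> (forall x, D x -> f x <= g x) -> \int[mu]_(x in D) f x <= \int[mu]_(x in D) g x.
move=> f0 fg; rewrite !ge0_integralE// => [|x Dx]; last exact: le_trans (f0 x Dx) (fg x Dx).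
apply: le_ereal_sup => _ [h /= H <-]; exists h => //= x; upto (H x).
by rewrite /patch; case: ifP => // /set_mem; exact: fg.
Qed.

End NonmeasurableIntegral.

(** * Mass of small cubes under an L^p density *)

Section BallMass.
Context (R : realType) (f : probability (vec3 R) R) (p : R).
Hypothesis p1 : 1 < p.
Implicit Types (x y : vec3 R) (r : R).
Definition cube3 x r : set (vec3 R) :=
 (`[x.1.1 - r, x.1.1 + r]%classic `*` `[x.1.2 - r, x.1.2 + r]%classic) `*` `[x.2 - r, x.2 + r]%classic.

Lemma mcube3 x r : measurable (cube3 x r).
by apply: measurableX; [apply: measurableX|]; routine. Qed.

Lemma leb3_cube x r : 0 <= r -> leb3 R (cube3 x r) = (8 * r ^+ 3)%:E.
move=> r0; have L (a : R) : leb (`[a - r, a + r]%classic : set R) = (2 * r)%:E.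
 rewrite lebesgue_itvcc; congr EFin; rewrite max_r; first by ring. lra.
have mi (a : R) : measurable (`[a - r, a + r]%classic : set (measurableTypeR R)) by [].
pose A (a : R) : set (measurableTypeR R) := `[a - r, a + r]%classic.
have mA := measurableX (mi x.1.1) (mi x.1.2).
have E1 : leb3 R (cube3 x r) = (leb2 R (A x.1.1 `*` A x.1.2)%classic * leb (A x.2))%E by exact: product_measure1E.
have E2 : leb2 R (A x.1.1 `*` A x.1.2)%classic = (leb (A x.1.1) * leb (A x.1.2))%E.
 exact: product_measure1E (mi _) (mi _).
rewrite E1 E2 /A.
by rewrite !L -!EFinM; congr EFin; ring.
Qed.

(** Hoelder's inequality between a density and the indicator of the cube, followed by the infimum
    over the densities. *)
Lemma ball_mass x r : 0 < r -> (f (cube3 x r) <= density_Lnorm p f * ((8 * r ^+ 3) `^ (1 - p^-1))%:E)%E.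
move=> r0; have p0 : 0 < p by exact: lt_trans p1.
have q1 : 0 < 1 - p^-1 by rewrite subr_gt0 invf_lt1.
pose q := (1 - p^-1)^-1; have q0 : 0 < q by rewrite invr_gt0.
set V := 8 * r ^+ 3; have V0 : 0 < V by rewrite mulr_gt0// exprn_gt0.
have mQ := mcube3 x r.
have key g : density_of f g -> (f (cube3 x r) <= 'N[leb3 R]_(p%:E)[EFin \o g] * (V `^ (1 - p^-1))%:E)%E.
 move=> [mg g0 fE]; have m1 : mfun (\1_(cube3 x r) : vec3 R -> R) by [].
 have := @hoelder _ _ R (leb3 R) g (\1_(cube3 x r)) p q mg m1 p0 q0. rewrite invrK subrKC => /(_ erefl) H.
 have -> : f (cube3 x r) = 'N[leb3 R]_1[EFin \o (g \* \1_(cube3 x r))%R]%E.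
  rewrite fE// Lnorm1 [LHS]integral_mkcond; apply: eq_integral => v _ /=; rewrite /patch indicE.
  by case: (v \in cube3 x r); rewrite ?mulr1 ?mulr0// ger0_norm.
 apply: (le_trans H); apply: lee_wpmul2l; first exact: Lnorm_ge0.
 have EI : (\int[leb3 R]_v (`|\1_(cube3 x r) v| `^ q)%:E = V%:E)%E.
  rewrite -(leb3_cube x (ltW r0)) -(setIT (cube3 x r)) -integral_indic// setIT; apply: eq_integral => v _ /=.
  by rewrite indicE; case: (v \in cube3 x r) => /=; rewrite ?normr1 ?powR1// normr0 powR0// gt_eqF.
 have -> : 'N[leb3 R]_(q%:E)[EFin \o \1_(cube3 x r)]%E = (V%:E `^ q^-1)%E by rewrite unlock -EI.
 by rewrite poweR_EFin invrK.
have Vp : 0 < V `^ (1 - p^-1) by rewrite powR_gt0.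
rewrite -lee_pdivrMr//; apply: le_ereal_inf_tmp => _ [g dg <-].
by rewrite lee_pdivrMr//; exact: key.
Qed.

End BallMass.

Lemma powR_half (R : realType) (n : nat) (a : R) : (2 ^+ n)^-1 `^ a = (2 `^ (- a)) ^+ n.
have -> : 2 ^- n = 2 `^ (- n%:R) :> R by rewrite powRN powR_mulrn.
rewrite -powRrM -[RHS]powR_mulrn// -powRrM.
by congr (_ `^ _); rewrite !mulNr [n%:R * _]mulrC.
Qed.

Lemma itv_center (R : realType) (a b r : R) : - r <= a - b <= r -> a - r <= b <= a + r.
by move=> /andP[? ?]; apply/andP; split; lra. Qed.

(** * Integrals of the singular weight *)

Section SingularMass.
Context (R : realType) (gamma p : R).
Hypotheses (Hg : -1 < gamma < 0) (Hp : 3 / (3 + gamma) < p).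
Implicit Types (x y : vec3 R) (eps s : R).
Let h (n : nat) : R := (2 ^+ n)^-1.
Let h0 n : 0 < h n. Proof. by rewrite invr_gt0 exprn_gt0. Qed.

(** Each halving of the cutoff distance can increase the weight only where [s] is below the previous
    cutoff. *)
Lemma dyadic_bound n s : Num.max s (h n) `^ gamma <= 1 + \sum_(k < n) h k.+1 `^ gamma * (s <= h k)%R%:R.
elim: n => [|n IH].
 have m1 : 1 <= Num.max s 1 by rewrite le_max lexx orbT.
 by rewrite big_ord0 addr0 /h expr0 invr1; have := powg_anti Hg ltr01 m1; rewrite powR1.
rewrite big_ord_recr/= addrA; have [sh|sh] := leP s (h n).
 rewrite mulr1 -[leLHS]add0r; apply: lerD.
  routine.
 by apply: (powg_anti Hg) => //; rewrite le_max lexx orbT.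
rewrite mulr0 addr0; apply: le_trans IH; apply: (powg_anti Hg); first by rewrite lt_max h0 orbT.
by rewrite (max_l (ltW sh)) le_max lexx.
Qed.

Lemma p_gt1 : 1 < p.
apply: lt_trans Hp; case/andP: Hg => g1 g2; rewrite ltr_pdivlMr; lra.
Qed.

(** Sum of the geometric series of the dyadic cubes; its ratio is below 1 because p > 3/(3 +
    gamma). *)
Definition sing_cst : R := 2 `^ (- gamma) * 8 `^ (1 - p^-1) / (1 - 2 `^ (- gamma - 3 * (1 - p^-1))).

Let ratio : 2 `^ (- gamma - 3 * (1 - p^-1)) < 1 :> R.
have p0 : 0 < p by exact: lt_trans p_gt1.
rewrite /powR pnatr_eq0/= expR_lt1 pmulr_llt0 ?ln_gt0 ?ltr1n//.
move: Hp; case/andP: Hg => g1 g2; rewrite ltr_pdivrMr; last by lra.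
move=> H; have : (3 + gamma) * p * p^-1 > 3 * p^-1 by rewrite ltr_pM2r ?invr_gt0// mulrC.
by rewrite mulfK ?gt_eqF//; lra.
Qed.

Lemma sing_cst_gt0 : 0 < sing_cst.
by rewrite /sing_cst divr_gt0// subr_gt0. Qed.

Lemma singular_mass (f : probability (vec3 R) R) x eps (L : R) : 0 < eps -> (density_Lnorm p f <= L%:E)%E ->
 \int[f]_y lsing gamma eps (norm3 (x - y)) <= 1 + sing_cst * L.
move=> e0 HL; have [n hn] : exists n, h n <= eps.
 exists (Num.truncn eps^-1); rewrite /h -[leRHS]invrK lef_pV2 ?posrE ?invr_gt0//.
 upto (ltW (truncnS_gt _)); rewrite -natrX ler_nat; exact: ltn_expl.
have bl : bmeas (fun y => lsing gamma eps (norm3 (x - y))).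
 by apply: (bmeas_lsing Hg) => //; apply: mnorm3; exact: mvec3B.
pose Q k := cube3 x (h k); have mQ k : measurable (Q k) by exact: mcube3.
have bQ k : bmeas (fun y => h k.+1 `^ gamma * \1_(Q k) y) by routine.
have L0 : 0 <= L by rewrite -lee_fin; apply: le_trans HL; apply: le_ereal_inf_tmp => _ [g _ <-]; exact: Lnorm_ge0.
via (\int[f]_y (1 + \sum_(k < n) h k.+1 `^ gamma * \1_(Q k) y)).
 apply: (bfun_le (bfun_prob f) bl) => [|y]; first routine.
 rewrite /lsing; via (Num.max (norm3 (x - y)) (h n) `^ gamma).
  by apply: (powg_anti Hg); rewrite ?lt_max ?h0 ?orbT// ge_max !le_max lexx hn orbT.
 upto (dyadic_bound n _); rewrite lerD2l; apply: ler_sum => k _; apply: ler_wpM2l; first routine.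
 case: (boolP (norm3 (x - y) <= h k)) => [xy|_]; last by []. rewrite indicE mem_set//= /Q /cube3 /= !in_itv/=.
 have [n1 n2 n3] := norm3_coord (x - y).
 move: (le_trans n1 xy) (le_trans n2 xy) (le_trans n3 xy); rewrite !ler_norml /=.
 by move=> /itv_center c1 /itv_center c2 /itv_center c3.
rewrite (bfunD (bfun_prob f) (bmeas_cst _ 1)); last routine.
rewrite prob_cst lerD2l (bfun_sum (bfun_prob f))//.
set u := 2 `^ (- gamma - 3 * (1 - p^-1)).
have term k : \int[f]_y (h k.+1 `^ gamma * \1_(Q k) y) <= 2 `^ (- gamma) * 8 `^ (1 - p^-1) * L * u ^+ k.
 rewrite (bfunZ (bfun_prob f) _ (bmeas_indic R (mQ k))) prob_indic//.
 have -> : h k.+1 `^ gamma = 2 `^ (- gamma) * 2 `^ (- gamma) ^+ k.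
  by rewrite -exprS /h powR_half.
 have B : fine (f (Q k)) <= L * (8 `^ (1 - p^-1) * (2 `^ (- (3 * (1 - p^-1)))) ^+ k).
  rewrite -lee_fin fineK ?fin_num_measure//; upto (ball_mass f p_gt1 x (h0 k)).
  have -> : (8 * h k ^+ 3) `^ (1 - p^-1) = 8 `^ (1 - p^-1) * (2 `^ (- (3 * (1 - p^-1)))) ^+ k.
   rewrite powRM ?exprn_ge0 ?ltW//; congr (_ * _). rewrite /h exprVn -exprM powR_half mulnC exprM; congr (_ ^+ _).
   by rewrite -powR_mulrn// -powRrM; congr (_ `^ _); rewrite mulNr mulrC.
  by rewrite [X in (_ <= X)%E]EFinM; apply: lee_wpmul2r => //; routine.
 have -> : u = 2 `^ (- gamma) * 2 `^ (- (3 * (1 - p^-1))) by rewrite /u powRD//; apply/implyP; rewrite pnatr_eq0.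
 rewrite exprMn; have c0 : 0 <= 2 `^ (- gamma) * 2 `^ (- gamma) ^+ k :> R by []. nra.
via (\sum_(k < n) 2 `^ (- gamma) * 8 `^ (1 - p^-1) * L * u ^+ k).
 by apply: ler_sum => k _; exact: term.
rewrite -mulr_sumr.
have c0 : 0 <= 2 `^ (- gamma) * 8 `^ (1 - p^-1) * L by routine.
upto (ler_wpM2l c0 (geometric_le n (powR_ge0 _ _) ratio)).
by rewrite /sing_cst -/u; apply: eq_ler; move: (_^-1) => z; ring.
Qed.

End SingularMass.

(** * Supremum over the centres, and its time integral *)

Section SingularSup.
Context (R : realType) (I : vec3 R -> vec3 R) (gamma p eps : R) (beta : R -> R) (f : R -> probability (vec3 R) R).
Hypotheses (Hw : weak_solution gamma beta I f) (Hg : -1 < gamma < 0) (Hp : 3 / (3 + gamma) < p) (e0 : 0 < eps).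
Implicit Types (x y : vec3 R) (r : R).
Let grid (n : nat) : vec3 R := if unpickle n is Some k then
 let: (a, b, c) := k : int * int * int in vec3_mk (a%:~R * (eps / 3)) (b%:~R * (eps / 3)) (c%:~R * (eps / 3)) else 0.

Let g n r := \int[ft f r]_y lsing gamma eps (norm3 (grid n - y)).

(* A countable supremum, hence measurable in time, which controls the supremum over the whole space. *)
Definition sing_sup r : R := 2 * sup (range (fun n => g n r)).

Let bl x : bmeas (fun y => lsing gamma eps (norm3 (x - y))).
by apply: (bmeas_lsing Hg) => //; apply: mnorm3; exact: mvec3B. Qed.

Let g_bound n r : 0 <= g n r <= eps `^ gamma.
apply/andP; split; first by apply: (bfun_ge0 (bfun_prob _) (bl _)) => y; rewrite ltW ?lsing_gt0.
rewrite -(prob_cst (ft f r) (eps `^ gamma)); apply: (bfun_le (bfun_prob _) (bl _) (bmeas_cst _ _)) => y; exact: lsing_le.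
Qed.

Let g_ub r : has_ubound (range (fun n => g n r)).
by exists (eps `^ gamma) => _ [n _ <-]; have /andP[] := g_bound n r. Qed.

Lemma sing_sup_ge0 r : 0 <= sing_sup r.
rewrite mulr_ge0//; via (g 0 r); first by have /andP[] := g_bound 0 r.
by apply: ub_le_sup => //; exists 0%N.
Qed.

Lemma grid_close x : exists n, norm3 (grid n - x) <= eps.
have d0 : 0 < eps / 3 by rewrite divr_gt0.
pose k (a : R) := Num.floor (a / (eps / 3)).
have H (a : R) : `|(k a)%:~R * (eps / 3) - a| <= eps / 3.
 have := floor_le_tmp (a / (eps / 3)); have := floorD1_gt (a / (eps / 3)); rewrite intrD.
 rewrite -/(k a) ltr_pdivrMr// ler_pdivlMr// mulrDl mul1r => h1 h2. by rewrite ler_norml; apply/andP; split; lra.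
exists (pickle ((k x.1.1, k x.1.2), k x.2)); upto (norm3_le_sum _); rewrite /grid pickleK /=.
by have := H x.1.1; have := H x.1.2; have := H x.2; rewrite /=; lra.
Qed.

(** Moving the centre by at most [eps] to a point of the grid changes the cut-off weight by at most
    a factor 2. *)
Lemma sing_supP r x : \int[ft f r]_y lsing gamma eps (norm3 (x - y)) <= sing_sup r.
have [n hn] := grid_close x.
via (2 * g n r); last by apply: ler_wpM2l => //; apply: ub_le_sup => //; exists n.
rewrite -(bfunZ (bfun_prob _) _ (bl _)); apply: (bfun_le (bfun_prob _) (bl _) (bmeasZ _ (bl _))) => y.
have E : norm3 (grid n - y) <= Num.max (norm3 (x - y)) eps + eps.
 have -> : grid n - y = (x - y) + (grid n - x) by apply: vec3_eq; rewrite /=; ring.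
 by upto (norm3D _ _); apply: lerD => //; rewrite le_max lexx.
have := @lsing_half _ gamma Hg eps (Num.max (norm3 (x - y)) eps) (norm3 (grid n - y)) e0.
rewrite /lsing -maxA maxxx; apply; apply: (le_trans E); rewrite mulrDl mul1r lerD2l le_max lexx orbT.
by [].
Qed.

Lemma bmeas_sing_sup : bmeas sing_sup.
have mg n : mfun (g n).
 have [] // := bmeas_sol Hw (r := fun r => r) (psi := fun z : R * vec3 R => lsing gamma eps (norm3 (grid n - z.2))) (@measurable_id _ R setT) _.
 by apply: (bmeas_lsing Hg) => //; apply: mnorm3; apply: mvec3B => //; routine.
apply: (bmeas_bound (a := 0) (b := 2 * eps `^ gamma)).
 apply: mfunM => //; have := @measurable_fun_sups _ _ R setT g 0%N (fun t _ => g_ub t) mg.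
 by apply: eq_measurable_fun => t _; rewrite /sups/=; congr (sup _); apply/seteqP; split => z [n _ <-]; exists n.
move=> r; rewrite sing_sup_ge0/=; apply: ler_wpM2l => //; apply: ge_sup; first by exists (g 0 r); exists 0%N.
by move=> _ [n _ <-]; have /andP[] := g_bound n r.
Qed.

Lemma sing_sup_Lnorm r (L : R) : (density_Lnorm p (ft f r) <= L%:E)%E -> sing_sup r <= 2 * (1 + sing_cst gamma p * L).
move=> HL; apply: ler_wpM2l => //; apply: ge_sup; first by exists (g 0 r); exists 0%N.
by move=> _ [n _ <-]; exact: singular_mass.
Qed.

Lemma sing_sup_integral T (A : R) : 0 <= T -> (\int[leb]_(t in `[0%R, T]) density_Lnorm p (f t) <= A%:E)%E ->
 iint 0 T sing_sup <= 2 * T + 2 * sing_cst gamma p * A.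
move=> T0 HA; have bs := bmeas_sing_sup; set c := 2 * sing_cst gamma p.
have c0 : 0 < c by rewrite mulr_gt0// sing_cst_gt0.
(* [h] is bounded, measurable and below the L^p norm at each time, so its integral is compared with
   that of the norm by [le_integral_nonneg]. *)
pose h r := c^-1 * Num.max (sing_sup r - 2) 0.
have bm : bmeas (fun r => Num.max (sing_sup r - 2) 0).
 have [ms [M HM]] := bs; apply: (bmeas_bound (a := 0) (b := `|M|)); first by apply: measurable_maxr => //; exact: mfunB.
 move=> r; rewrite le_max lexx orbT ge_max/=; apply/andP; split => //.
 by have := le_trans (ler_norm _) (HM r); have := ler_norm M; lra.
have bh : bmeas h by routine.
have h0 r : 0 <= h r by apply: mulr_ge0; [rewrite invr_ge0 ltW|rewrite le_max lexx orbT].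
via (iint 0 T (fun r => 2 + c * h r)).
 apply: (bfun_le (iint_bfun 0 T) bs); first routine.
 by move=> r; rewrite /h mulrA mulfV ?gt_eqF// mul1r -lerBlDl le_max lexx.
rewrite (bfunD (iint_bfun 0 T) (bmeas_cst _ _) (bmeasZ _ bh)) (bfunZ (iint_bfun 0 T) _ bh) iint_cst// subr0 [T * 2]mulrC lerD2l.
apply: ler_wpM2l; first exact: ltW.
have I0 : (0 <= \int[leb]_(r in `[0%R, T]) (h r)%:E)%E by apply: integral_ge0 => r _; rewrite lee_fin.
have H : (\int[leb]_(r in `[0%R, T]) (h r)%:E <= A%:E)%E.
 apply: le_trans HA; apply: le_integral_nonneg => r /=; rewrite in_itv/= => /andP[r0 _]; first by rewrite lee_fin.
 have fr : ft f r = f r by rewrite /ft max_l.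
 have := @sing_sup_Lnorm r; rewrite fr; case E : (density_Lnorm p (f r)) => [L||] H.
 - rewrite lee_fin /h mulrC ler_pdivrMr//; have := H L (lexx _).
  have L0 : 0 <= L by rewrite -lee_fin -E; apply: le_ereal_inf_tmp => _ [g' _ <-]; exact: Lnorm_ge0.
  move=> H'; rewrite ge_max; apply/andP; split; last by nra.
  by move: H'; rewrite /c; move: (sing_sup r) (sing_cst gamma p) => u v; lra.
 - by rewrite leey.
 - have : (0 <= density_Lnorm p (f r))%E by apply: le_ereal_inf_tmp => _ [g' _ <-]; exact: Lnorm_ge0. by rewrite E.
by rewrite /iint /Rintegral -lee_fin fineK// ge0_fin_numE// (le_lt_trans H)// ltry.
Qed.

End SingularSup.

(** * Scalar inequalities of the Gronwall argument *)

Section ScalarBounds.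
Context (R : realType).

Lemma crowd_algebra (n p C c d s e b k z : R) : 0 < n -> 0 <= p -> 0 <= C -> 0 <= c -> 0 <= b ->
 p * (C * c + 4 * n * (C + 1) * (2 * n^-1 * d + 2 * s) + n * e + k * z) <=
 p * ((C + 1) * (c + 8 * d + 8 * n * s) + n * e + n * b + k * z).
move=> n0 p0 C0 c00 b0; apply: ler_wpM2l => //; have nb := mulr_ge0 (ltW n0) b0.
have -> : 4 * n * (C + 1) * (2 * n^-1 * d + 2 * s) = (C + 1) * (8 * d + 8 * n * s) by field; rewrite gt_eqF.
lra.
Qed.

Lemma bad_algebra (n p C c d s e b k z : R) : 0 < n -> 0 <= p -> 0 <= C -> 0 <= c -> 0 <= d -> 0 <= s -> 0 <= e -> 1 <= b ->
 p * (1 * c + n * (2 * n^-1 * d + 2 * s) + n * 1 + k * z) <=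
 p * ((C + 1) * (c + 8 * d + 8 * n * s) + n * e + n * b + k * z).
move=> n0 p0 C0 c00 d0 s0 e0 b1; apply: ler_wpM2l => //.
have -> : n * (2 * n^-1 * d + 2 * s) = 2 * d + 2 * n * s by field; rewrite gt_eqF.
have h1 := mulr_ge0 C0 c00; have h2 := mulr_ge0 C0 d0; have h3 := mulr_ge0 (ltW n0) s0; have h4 := mulr_ge0 C0 h3.
nra.
Qed.

(** Beyond the truncation, d^2 > M gives d^2 <= d^6 / M^2, and d is at most twice the larger of x
    and y. *)
Lemma sixth_power (M x y d : R) : 0 < M -> 0 <= x -> 0 <= y -> 0 <= d -> d <= x + y ->
 d ^+ 2 <= Num.min (d ^+ 2) M + 64 / M ^+ 2 * (x ^+ 6 + y ^+ 6).
move=> M0 x0 y0 d0 dxy; have x6 := exprn_ge0 6 x0; have y6 := exprn_ge0 6 y0.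
have c0 : 0 <= 64 / M ^+ 2 * (x ^+ 6 + y ^+ 6) by nra.
case/orP: (le_total (d ^+ 2) M) => h; first by rewrite (min_l h) lerDl.
via (64 / M ^+ 2 * (x ^+ 6 + y ^+ 6)); last by rewrite lerDr le_min sqr_ge0 ltW.
rewrite mulrAC ler_pdivlMr ?exprn_gt0//; via (d ^+ 2 * (d ^+ 2) ^+ 2).
 by apply: ler_wpM2l; [routine|apply: lerXn2r; rewrite ?nnegrE ?sqr_ge0// ltW].
have -> : d ^+ 2 * (d ^+ 2) ^+ 2 = d ^+ 6 by ring.
have m0 : 0 <= Num.max x y by rewrite le_max x0.
via ((2 * Num.max x y) ^+ 6).
 apply: lerXn2r; rewrite ?nnegrE ?mulr_ge0//; apply: (le_trans dxy).
 by rewrite mulrDl mul1r lerD// le_max lexx ?orbT.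
rewrite exprMn; have -> : 2 ^+ 6 = 64 :> R by lra.
apply: ler_wpM2l => //; case/orP: (le_total x y) => h'; [rewrite (max_r h') lerDr|rewrite (max_l h') lerDl]; by [].
Qed.

Lemma sqr_le_6 (x : R) : x ^+ 2 <= 1 + x ^+ 6.
have -> : x ^+ 6 = (x ^+ 2) ^+ 3 by ring.
by have := sqr_ge0 x; move: (x ^+ 2) => u u0; have [h|h] := leP u 1; [have := exprn_ge0 3 u0; lra|rewrite exprS; nra].
Qed.

Lemma step_algebra (tau T P G p q pc C c d d' n s rb e b kap S en m a a' : R) : 0 <= tau -> tau * T = 1 -> 0 <= pc ->
 0 <= C -> 0 <= n -> 0 <= kap -> P + G <= T * (c - p - q) + pc * (C * (c + 8 * d + 8 * n * s) + n * e + n * b + kap * (S + 2 * n * en)) ->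
 d <= c + m * (a + a') -> s <= rb -> S <= 3 * n + 2 * a' -> d' = 8 * m ->
 p + tau * P + (q + tau * G) <= (1 + tau * (9 * pc * C)) * c + (tau * pc * (C * d' * a) +
  tau * pc * (C * d' * a' + C * (8 * n) * rb + n * b + 2 * kap * a' + (n * e + kap * (3 * n + 2 * n * en)))).
move=> t0 tT p0 C0 n0 k0 pt hd hs hS ->.
have : C * (c + 8 * d + 8 * n * s) + n * e + n * b + kap * (S + 2 * n * en) <= C * (c + 8 * (c + m * (a + a')) + 8 * n * rb) + n * e + n * b +
  kap * (3 * n + 2 * a' + 2 * n * en).
 apply: lerD; [rewrite !lerD2r|]; apply: ler_wpM2l => //; last by lra. nra.
move=> /(ler_wpM2l p0) h; have {h} := ler_wpM2l t0 (le_trans pt (lerD (lexx _) h)).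
rewrite [leRHS]mulrDr [X in _ <= X + _]mulrA tT mul1r; set X := tau * (pc * _).
have -> : X = tau * (9 * pc * C) * c + (tau * pc * (C * (8 * m) * a) + tau * pc * (C * (8 * m) * a' + C * (8 * n) * rb +
 n * b + 2 * kap * a' + (n * e + kap * (3 * n + 2 * n * en)))) by rewrite /X; ring.
rewrite mulrDr mulrDl mul1r; lra.
Qed.

Lemma gather_algebra (tau pc C m EK n M6 rho e E kap en : R) : 0 <= tau -> 0 <= pc -> 1 <= C -> 0 <= m -> 0 <= EK -> 0 <= n ->
 0 <= M6 -> 0 <= rho -> 0 <= e -> 0 <= E -> 0 <= kap -> 0 <= en ->
 tau * pc * (C * m * (EK * (n * M6))) + tau * pc * (C * m * (n * M6) + C * (8 * n) * rho + n * (n * E) + 2 * kap * (n * M6) +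
  (n * e + kap * (3 * n + 2 * n * en))) <=
 tau * (9 * pc * C * (n * (m * (M6 * (EK + 1)) + (rho + e + n * E + kap * (3 + 2 * M6 + 2 * en))))).
move=> t0 p0 C1 m0 EK0 n0 M0 r0 e0 E0 k0 en0; rewrite -mulrDr -mulrA; apply: ler_wpM2l => //.
rewrite (mulrC 9) -!(mulrA pc); apply: ler_wpM2l => //; have C0 : 0 <= C by lra.
pose x1 := n * (m * (M6 * (EK + 1))); pose x2 := n * rho; pose x3 := n * (n * E) + n * e + kap * n * (3 + 2 * M6 + 2 * en).
have x10 : 0 <= x1 by routine.
have x20 : 0 <= x2 by routine.
have x30 : 0 <= x3 by rewrite !addr_ge0 ?mulr_ge0 ?addr_ge0 ?mulr_ge0.
have -> : C * m * (EK * (n * M6)) + (C * m * (n * M6) + C * (8 * n) * rho + n * (n * E) + 2 * kap * (n * M6) +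
  (n * e + kap * (3 * n + 2 * n * en))) = C * x1 + 8 * (C * x2) + x3 by rewrite /x1 /x2 /x3; ring.
have -> : 9 * C * (n * (m * (M6 * (EK + 1)) + (rho + e + n * E + kap * (3 + 2 * M6 + 2 * en)))) =
 9 * (C * x1) + 9 * (C * x2) + 9 * (C * x3) by rewrite /x1 /x2 /x3; ring.
nra.
Qed.

Lemma abstract_nonneg (x : R) : 0 <= x -> exists2 m, 0 <= m & x = m.
by exists x. Qed.

Lemma close_algebra (h c1 c2 dF F q r g U D Us Ds l t k : R) : 0 < h -> 0 < t -> 0 <= g ->
 `|dF - h * F| <= c1 * h ^+ 2 -> `|q - r| <= c2 * h -> F + r <= (U - D) / t + g * (U + k) -> U <= Us + l * h -> Ds - l * h <= D ->
 (dF - c1 * h ^+ 2) / h + q <= (Us - Ds + 2 * l * h) / t + c2 * h + g * (Us + k + l * h).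
move=> h0 t0 g0; rewrite !ler_norml => /andP[_ h1] /andP[_ h2] h3 h4 h5.
have h6 : (dF - c1 * h ^+ 2) / h <= F by rewrite ler_pdivrMr// [F * h]mulrC lerBlDr -lerBlDl.
have h7 : (U - D) / t <= (Us - Ds + 2 * l * h) / t by rewrite ler_pM2r ?invr_gt0//; lra.
nra.
Qed.

Lemma collect_algebra (h tau dF c1 q dG e Us Ds l c2 A k X : R) : 0 < tau -> 0 < h -> h <= tau -> 0 <= l -> 0 <= c1 -> 0 <= c2 -> 0 <= A -> 0 <= X ->
 Ds <= Us -> h * ((dF - c1 * h ^+ 2) / h) + q <= h * ((Us - Ds + 2 * l * h) / tau + c2 * h) + A * (Us + k + l * h) ->
 `|dG - q| <= e * h -> Ds + dF + dG <= Us + A * (Us + k + (l + 2 * l / tau + c1 + c2 + X) * h) + (l + 2 * l / tau + c1 + c2 + X) * h ^+ 2 + e * h.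
move=> t0 h0 ht l0 c10 c20 A0 X0 DU; rewrite mulrCA divff ?gt_eqF// mulr1 ler_norml => H /andP[_ H2].
have y0 : 0 <= 2 * l / tau by routine.
have h1 : h / tau * (Us - Ds) <= Us - Ds by apply: ler_piMl; rewrite ?subr_ge0// ler_pdivrMr// mul1r.
have E1 : h * ((Us - Ds + 2 * l * h) / tau + c2 * h) = h / tau * (Us - Ds) + 2 * l / tau * h ^+ 2 + c2 * h ^+ 2 by ring.
have h2 : A * (Us + k + l * h) <= A * (Us + k + (l + 2 * l / tau + c1 + c2 + X) * h).
 apply: ler_wpM2l => //; rewrite lerD2l; apply: ler_wpM2r; [exact: ltW|lra].
nra.
Qed.

Lemma long_step (tau h B Ut Us A k C c e : R) : 0 < tau -> tau < h -> 0 <= B -> Ut <= B -> 0 <= Us -> 0 <= A -> 0 <= k -> 0 <= c -> 0 <= e ->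
 C = c + B / tau ^+ 2 -> Ut <= Us + A * (Us + k + C * h) + C * h ^+ 2 + e * h.
move=> t0 th B0 UB U0 A0 k0 c00 ee ->; have h0 : 0 < h := lt_trans t0 th.
have b0 : 0 <= B / tau ^+ 2 by routine.
have h1 : B <= B / tau ^+ 2 * h ^+ 2.
 by rewrite mulrAC ler_pdivlMr ?exprn_gt0//; apply: ler_wpM2l => //; apply: lerXn2r; rewrite ?nnegrE ltW.
have h2 : 0 <= A * (Us + k + (c + B / tau ^+ 2) * h) by routine.
nra.
Qed.

Lemma divide_algebra (tau A U p P q G k : R) : 0 < tau ->
 p + tau * P + (q + tau * G) <= (1 + tau * A) * U + tau * (A * k) -> P + G <= (U - (p + q)) / tau + A * (U + k).
move=> t0 h; rewrite -(ler_pM2l t0) [leRHS]mulrDr mulrCA divff ?gt_eqF// mulr1; lra.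
Qed.

End ScalarBounds.

Lemma iint_le (R : realType) (a b : R) (g h : R -> R) : bmeas g -> bmeas h ->
 (forall x, a <= x <= b -> g x <= h x) -> iint a b g <= iint a b h.
move=> bg bh H; apply: (le_Rintegral _ (itv_integrable a b bg) (itv_integrable a b bh)); first routine.
by [].
Qed.

Lemma upper_le_ge0 d (T : measurableType d) (R : realType) (F : (T -> R) -> R) (h : T -> R) (c : R) :
 bfun F -> upper_le F h c -> 0 <= c.
move=> bF [_ h0 /(_ _ (lexx 0))]; have -> : (fun x => Num.min (h x) 0) = fun=> 0 by apply/funext => x; rewrite min_r.
by rewrite (bfun_cst bF) mul0r.
Qed.

(** * Gronwall inequality for the dual value *)

Section DualFlow.
Context (R : realType) (I : vec3 R -> vec3 R) (gamma nu c0 c1 : R) (beta : R -> R) (f : R -> probability (vec3 R) R).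
Hypotheses (HI : frame_choice I) (Hk : kernel_bounds nu c0 c1 beta) (Hg : -1 < gamma < 0) (Hgn : 0 < gamma + nu) (Hw : weak_solution gamma beta I f).
Context (N : nat) (K : R) d (Omega : measurableType d) (P : probability Omega R) (V : R -> {RV P >-> N.-tuple (vec3 R)}).
Hypotheses (N0 : (0 < N)%N) (K1 : 1 <= K) (HV : particle_process gamma beta K P V).
Variables (T M6 eps rho : R).
Hypotheses (T0 : 0 <= T) (M60 : 0 <= M6) (HM6 : forall t Q, 0 <= t <= T -> 0 <= Q -> \int[ft f t]_v min6 Q v <= M6) (e0 : 0 < eps) (eN : eps `^ gamma <= N%:R).
Notation E := (N.-tuple (vec3 R)).
Hypothesis Hrho : forall t, 0 <= t <= T -> exists2 rb : E -> R, upper_le (gflow f t) rb rho &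
 forall w, exists2 W, allocation (ft f t) W & \int[ft f t]_y spread2 W w y <= rb w.
Hypothesis init : forall psi : E -> R, bmeas psi -> pflow V 0 psi = gflow f 0 psi.
Implicit Types (v w : E) (phi psi : E -> R) (s t r M Lam : R).
Let K0 : 0 < K. Proof. exact: lt_le_trans K1. Qed.
Let nn : 0 < N%:R :> R. Proof. by rewrite ltr0n. Qed.
Let sg := sing_sup gamma eps f.
Let sg0 r : 0 <= sg r. Proof. exact: (sing_sup_ge0 f Hg e0). Qed.
Let pc := 2 * pi * pair_cst nu c0 c1.
Let pc0 : 0 <= pc. Proof. by rewrite /pc mulr_ge0 ?(pair_cst_ge0 Hk)// mulr_ge0 ?pi_ge0. Qed.
Let lam := chernoff_rate gamma eps.
Let kap := K `^ (1 - 2 / nu).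
Let PG := @particle_generator R gamma beta N K.
Let d2 v w := \sum_j norm3 (tnth v j - tnth w j) ^+ 2.
Let s6 w := \sum_j norm3 (tnth w j) ^+ 6.

(** If a particle is crowded, [point_bound] is used with cutoff 1: all weights are at most 1 and the
    loss of order N is paid by [badf], which is then at least 1. Otherwise [closest_sum] gives S = 4
    N (sg r + 1), of the same order as N times the mean weight. *)
Lemma point_all M Lam r v w phi psi W : 0 <= M -> K <= Lam -> bmeas phi -> bmeas psi ->
 (forall v w, phi v + psi w <= costN M v w) -> allocation (ft f r) W ->
 PG phi v + genf I gamma beta f Lam r psi w <= 2 * pi * N%:R * Lam * (costN M v w - phi v - psi w) +
 pc * ((sg r + 1) * (costN M v w + 8 * d2 v w + 8 * N%:R * \int[ft f r]_y spread2 W w y) + N%:R * eps `^ (2 + gamma) +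
  N%:R * badf gamma lam eps (sg r) w + kap * (\sum_i (1 + 2 * norm3 (tnth w i) ^+ 2) + 2 * N%:R * energy f)).
move=> M0 KL bp bs Hc aW; have cN := costN_ge0 v w M0.
have lam0 : 0 <= lam by routine.
have [/existsP[k hk]|/existsPn good] := boolP [exists k, 0 < crowd gamma eps (sg r) w k].
 have l1 x : lsing gamma 1 x <= 1 by have := lsing_le Hg x ltr01; rewrite powR1.
 have S1 y : \sum_i lsing gamma 1 (norm3 (tnth w i - y)) <= N%:R.
  by via (\sum_(i < N) 1); [exact: ler_sum|rewrite sumr_const card_ord].
 have C1 x : \int[ft f r]_y lsing gamma 1 (norm3 (x - y)) <= 1.
  rewrite -[leRHS](prob_cst (ft f r)); apply: (bfun_le (bfun_prob _)) => //; [|routine].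
  by apply: (bmeas_lsing Hg) => //; apply: mnorm3; exact: mvec3B.
 have pb := point_bound HI Hk Hg Hgn Hw v M0 K1 KL ltr01 bp bs Hc aW S1 C1. apply: (le_trans pb).
 rewrite powR1 lerD2l; apply: bad_algebra => //.
 - routine.
 - by apply: Rintegral_ge0 => y _; exact: (spread2_ge0 _ _ aW).
 - exact: powR_ge0.
 rewrite /badf (bigD1 k)//= -[leLHS]addr0; apply: lerD; last routine. by rewrite -expR0 ler_expR mulr_ge0// ltW.
have S1 y : \sum_i lsing gamma eps (norm3 (tnth w i - y)) <= 4 * N%:R * (sg r + 1).
 have -> : 4 * N%:R * (sg r + 1) = 2 * (N%:R * (2 * sg r + 1) + N%:R) by ring.
 apply: (closest_sum Hg N0) => // k; rewrite (bigD1 k)//= addrC; apply: lerD.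
  by have := good k; rewrite -leNgt /crowd subr_le0.
 by apply: le_trans eN; exact: lsing_le.
have pb := point_bound HI Hk Hg Hgn Hw v M0 K1 KL e0 bp bs Hc aW S1 (sing_supP f Hg e0 r).
apply: (le_trans pb).
by rewrite lerD2l; apply: crowd_algebra => //; routine.
Qed.

Let EK := expR (4 * pi * K * 6 ^+ 6 * T).

(** If some |w_j| exceeds 1 + B, its capped sixth power alone exceeds B; otherwise the cap is
    inactive. *)
Lemma min_s6 w B : 0 <= B -> Num.min (s6 w) B <= summ6 (1 + B) w.
move=> B0; have Q0 : 0 <= 1 + B by lra.
have [/existsP[j hj]|/existsPn h] := boolP [exists j, 1 + B < norm3 (tnth w j)].
 apply: (@le_trans _ _ B); first by rewrite ge_min lexx orbT. via (min6 (1 + B) (tnth w j)).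
  rewrite /min6 (min_r (ltW hj)) -[leLHS]mulr1; via ((1 + B) * (1 + B) ^+ 5); last by []. nra.
 by rewrite /summ6 (bigD1 j)//= lerDl; apply: sumr_ge0 => i _; exact: min6_ge0.
rewrite ge_min; apply/orP; left; apply: ler_sum => j _.
by rewrite /min6 min_l// leNgt h.
Qed.

Lemma ms6 : mfun s6.
apply: measurable_sum => j; apply: mfunX; routine.
Qed.

Lemma sqr_s6 w : \sum_i (1 + 2 * norm3 (tnth w i) ^+ 2) <= 3 * N%:R + 2 * s6 w.
have -> : 3 * N%:R = \sum_(i < N) 3 :> R by rewrite sumr_const card_ord -[RHS]mulr_natr.
rewrite /s6 mulr_sumr -big_split/=; apply: ler_sum => i _; have := sqr_le_6 (norm3 (tnth w i)); lra.
Qed.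

Lemma s6_upper (F : (E -> R) -> R) c : bfun F -> (forall Q, 0 <= Q -> F (summ6 Q) <= c) -> upper_le F s6 c.
move=> bF H; have s0 w : 0 <= s6 w by apply: sumr_ge0 => j _; rewrite exprn_ge0 ?norm3_ge0.
split => [||B B0]; [exact: ms6|exact: s0|].
have Q0 : 0 <= 1 + B by lra.
apply: le_trans (H _ Q0); apply: (bfun_le bF) => [||w]; [exact: bmeas_min ms6 s0 B0| |exact: min_s6].
by apply: bmeas_sum => i _; apply: bmeas_tnth; exact: min6_bmeas.
Qed.

Lemma gflow_s6 r Q : 0 <= r <= T -> 0 <= Q -> gflow f r (@summ6 R N Q) <= N%:R * M6.
move=> rT Q0; rewrite (bfun_sum (@gflow_bfun R f N r)) => [|i _]; last by apply: bmeas_tnth; exact: min6_bmeas.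
via (\sum_(i < N) M6); last by rewrite sumr_const card_ord mulr_natl.
by apply: ler_sum => i _; rewrite /gflow (prodf_tnth (fun=> ft f r) i (min6_bmeas Q0)); exact: HM6.
Qed.

Lemma pflow_s6 r Q : 0 <= r <= T -> 0 <= Q -> pflow V r (summ6 Q) <= EK * (N%:R * M6).
move=> /andP[r0 rT] Q0; upto (pflow_moment HI Hk N0 K0 HV Q0 r0).
rewrite init; last by apply: bmeas_sum => i _; apply: bmeas_tnth; exact: min6_bmeas.
have z : 0 <= (0 : R) <= T by lra.
apply: ler_pM; rewrite ?expR_ge0 ?gflow_s6//.
 apply: (bfun_ge0 (@gflow_bfun R f N 0)); first by apply: bmeas_sum => i _; apply: bmeas_tnth; exact: min6_bmeas.
 by move=> w; exact: summ6_ge0.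
by rewrite ler_expR; apply: ler_wpM2l => //; apply: mulr_ge0; rewrite ?exprn_ge0//; apply: mulr_ge0 (ltW K0); rewrite mulr_ge0 ?pi_ge0.
Qed.

Definition chaos_err : R := rho + eps `^ (2 + gamma) + N%:R * expR (- (lam * N%:R)) + kap * (3 + 2 * M6 + 2 * energy f).
(** 512 = 8 * 64: [sixth_power] gives 64 / M^2 and [point_all] multiplies the squared distances by
    8. *)
Definition cut_cst M : R := N%:R * (512 / M ^+ 2 * (M6 * (EK + 1)) + chaos_err).

Lemma crowded_upper r : upper_le (gflow f r) (badf gamma lam eps (sg r) : E -> R) (N%:R * expR (- (lam * N%:R))).
have lam0 : 0 <= lam by routine.
apply: (upper_le_bmeas (@gflow_bfun R f N r)); last first.
 exact: (chernoff N Hg e0 (sg0 r) (sing_supP f Hg e0 r)).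
- by move=> w; routine.
by apply: bmeas_sum => i _; exact: bmeas_badf_term.
Qed.

Section Level.
Variable M : R.
Hypothesis M0 : 0 < M.
Let k := cut_cst M.
Let pairing r := [set x : R | exists phi psi, admissible M phi psi /\ x = pflow V r phi + gflow f r psi].
Definition dual_value r : R := sup (pairing r).

Let adm0 r : pairing r 0.
exists (fun=> 0), (fun=> 0); split; first exact: admissible0 (ltW M0).
by rewrite /gflow prodf_cst (bfun_cst (pflow_bfun V r)) mul0r addr0.
Qed.

Let adm_ub r : has_ubound (pairing r).
exists (N%:R * M + N%:R * M) => _ [phi [psi [ad ->]]]; have [bp bs] := admissible_bmeas ad; have [_ _ pB sB _] := ad.
apply: lerD; apply: le_trans (ler_norm _) _.
 by have := bfun_norm_le (pflow_bfun V r) bp pB; rewrite pflow1 mulr1.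
by have := bfun_norm_le (@gflow_bfun R f N r) bs sB; rewrite (gflow1 f N) mulr1.
Qed.

Lemma dual_ge r phi psi : admissible M phi psi -> pflow V r phi + gflow f r psi <= dual_value r.
by move=> ad; apply: ub_le_sup => //; exists phi, psi. Qed.

Lemma dual_le r c : (forall phi psi, admissible M phi psi -> pflow V r phi + gflow f r psi <= c) -> dual_value r <= c.
by move=> H; apply: ge_sup; [exists 0|move=> _ [phi [psi [ad ->]]]; exact: H]. Qed.

Lemma dual_ge0 r : 0 <= dual_value r. Proof. exact: ub_le_sup. Qed.

Lemma dual_bound r : dual_value r <= 2 * (N%:R * M).
apply: dual_le => phi psi ad; have [bp bs] := admissible_bmeas ad; have [_ _ pB sB _] := ad.
rewrite mulrDl mul1r; apply: lerD; apply: le_trans (ler_norm _) _.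
 by have := bfun_norm_le (pflow_bfun V r) bp pB; rewrite pflow1 mulr1.
by have := bfun_norm_le (@gflow_bfun R f N r) bs sB; rewrite (gflow1 f N) mulr1.
Qed.

Section Rate.
Variable Lam : R.
Hypothesis KL : K <= Lam.
Let L0 : 0 < Lam. Proof. exact: lt_le_trans KL. Qed.
(** Inverse of the coefficient of the gap [costN M v w - phi v - psi w] in [point_all]. *)
Let tau := (2 * pi * N%:R * Lam)^-1.
Let tau0 : 0 < tau. Proof. by rewrite invr_gt0 !mulr_gt0 ?pi_gt0. Qed.

(** Multiplied by [tau], the gap term of [point_all] becomes cost - phi - psi and cancels phi + psi.
    So phi + tau PG phi and psi + tau genf psi lie together below (1 + O(tau)) cost plus remainders
    in v and in w, and [dual_step_upper] applies. *)
Lemma generators_le r phi psi : 0 <= r <= T -> admissible M phi psi ->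
 pflow V r (PG phi) + gflow f r (genf I gamma beta f Lam r psi) <=
 (dual_value r - (pflow V r phi + gflow f r psi)) / tau + 9 * pc * (sg r + 1) * (dual_value r + k).
move=> rT ad; have [bp bs] := admissible_bmeas ad; have [_ _ _ _ Hc] := ad.
have bL : bmeas (PG phi) := bmeas_generator gamma HI Hk K0 bp.
have bA := bmeas_genf gamma f HI Hk Lam r bs.
have [rb Urb Hrb] := Hrho rT; have bF := pflow_bfun V r; have bG := @gflow_bfun R f N r.
have F1 := pflow1 V r; have G1 := gflow1 f N r.
set C := sg r + 1; have C1 : 1 <= C by rewrite lerDr sg0.
have C00 : 0 <= C by apply: le_trans C1.
have [m m0 Em] := abstract_nonneg (divr_ge0 (ler0n R 512) (sqr_ge0 M)).
pose cst := N%:R * eps `^ (2 + gamma) + kap * (3 * N%:R + 2 * N%:R * energy f).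
have kap0 : 0 <= kap by exact: powR_ge0.
have en0 := energy_ge0 f.
have cst0 : 0 <= cst by rewrite /cst addr_ge0 ?mulr_ge0 ?addr_ge0 ?mulr_ge0 ?powR_ge0.
have tT : tau * (2 * pi * N%:R * Lam) = 1 by rewrite mulVf// gt_eqF// !mulr_gt0 ?pi_gt0.
have rho0 := upper_le_ge0 bG Urb.
pose b1 v := tau * pc * (C * m * s6 v).
pose b2 w := tau * pc * (C * m * s6 w + C * (8 * N%:R) * rb w + N%:R * badf gamma lam eps (sg r) w + 2 * kap * s6 w + cst).
have tp : 0 <= tau * pc by rewrite mulr_ge0// ltW.
have Cm : 0 <= C * m by exact: mulr_ge0.
have U6 : upper_le (gflow f r) s6 (N%:R * M6) by apply: s6_upper => // Q Q0; exact: gflow_s6.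
have Ub := crowded_upper r.
have H1 : upper_le (pflow V r) b1 (tau * pc * (C * m * (EK * (N%:R * M6)))).
 by apply: upper_leZ => //; apply: upper_leZ => //; apply: s6_upper => // Q Q0; exact: pflow_s6.
have H2 : upper_le (gflow f r) b2 (tau * pc * (C * m * (N%:R * M6) + C * (8 * N%:R) * rho + N%:R * (N%:R * expR (- (lam * N%:R))) + 2 * kap * (N%:R * M6) + cst)).
 apply: upper_leZ => //; apply: upper_leD => //; last exact: upper_le_cst.
 apply: upper_leD => //; last by apply: upper_leZ => //; rewrite mulr_ge0.
 apply: upper_leD => //; last exact: upper_leZ. by apply: upper_leD => //; apply: upper_leZ => //; rewrite mulr_ge0.
have bp1 := bmeasD bp (bmeasZ tau bL); have bs1 := bmeasD bs (bmeasZ tau bA).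
have A0 : 0 < 1 + tau * (9 * pc * C).
 apply: (ltr_wpDr _ ltr01); routine.
have := @dual_step_upper R N _ _ M _ (dual_value r) _ _ _ _ b1 b2 (ltW M0) A0 bF bG F1 G1 (dual_ge r) bp1 bs1 H1 H2 _.
rewrite (bfunD bF bp (bmeasZ _ bL)) (bfunZ bF _ bL) (bfunD bG bs (bmeasZ _ bA)) (bfunZ bG _ bA).
move=> HD; have {HD} HD : pflow V r phi + tau * pflow V r (PG phi) + (gflow f r psi + tau * gflow f r (genf I gamma beta f Lam r psi)) <=
  (1 + tau * (9 * pc * C)) * dual_value r + tau * (9 * pc * C * k).
 apply: le_trans (HD _) _.
  move=> v w; have [W aW HW] := Hrb w. have pt := point_all v w (ltW M0) KL bp bs Hc aW.
  have d6 : d2 v w <= costN M v w + 64 / M ^+ 2 * (s6 v + s6 w).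
   rewrite /d2 /costN /s6 -big_split/= mulr_sumr -big_split/=; apply: ler_sum => j _.
   apply: sixth_power; rewrite ?norm3_ge0//. by have := norm3D (tnth v j) (- tnth w j); rewrite norm3N.
  have w6 := sqr_s6 w. have sM : m = 8 * (64 / M ^+ 2) by rewrite -Em mulrA -natrM.
  by apply: (step_algebra (ltW tau0) tT pc0 C00 (ltW nn) kap0 pt d6 HW w6 sM).
 rewrite lerD2l /cst /k /cut_cst Em; apply: gather_algebra; routine.
exact: (divide_algebra tau0 HD).
Qed.

Let L := 2 * Num.sqrt M.
Let Lp : 0 <= L. Proof. by rewrite mulr_ge0 ?sqrtr_ge0. Qed.
Let J := jump_rate N K.
Let J0 : 0 <= J. Proof. exact: rate_ge0. Qed.
Let sc := sol_cst nu c1 f.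
Let sc0 : 0 <= sc. Proof. exact: (sol_cst_ge0 f Hk). Qed.
Let ell := J * (N%:R * M) + N%:R * (sc * L).
Let ell0 : 0 <= ell. Proof.
by apply: addr_ge0; [apply: mulr_ge0 => //; apply: mulr_ge0 (ltW M0)|apply: mulr_ge0 => //; exact: mulr_ge0].
Qed.

Lemma pairing_lip s t phi psi : 0 <= s -> s <= t -> admissible M phi psi ->
 `|(pflow V t phi + gflow f t psi) - (pflow V s phi + gflow f s psi)| <= ell * (t - s).
move=> s0 st ad; have [lp ls pB _ _] := ad; have [_ bs] := admissible_bmeas ad.
have h1 := pflow_lip HI Hk N0 K0 HV Lp lp pB s0 st.
have h2 := gflow_lip HI Hk Hg Hgn Hw Lp bs ls s0 st.
have -> : (pflow V t phi + gflow f t psi) - (pflow V s phi + gflow f s psi) =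
 (pflow V t phi - pflow V s phi) + (gflow f t psi - gflow f s psi) by ring.
upto (ler_normD _ _); upto (lerD h1 h2).
by rewrite /ell; apply: eq_ler; rewrite -/J -/sc; ring.
Qed.

Lemma dual_lip s t : 0 <= s -> s <= t -> dual_value t <= dual_value s + ell * (t - s).
move=> s0 st; apply: dual_le => phi psi ad; have := pairing_lip s0 st ad; rewrite ler_norml => /andP[_ h].
by have := dual_ge s ad; lra.
Qed.

Let rate r := 9 * pc * (sg r + 1).
Let acc t := iint 0 t rate.
Let c1' := 4 * J ^+ 2 * (N%:R * M).
Let c2' := N%:R * (N%:R * (sc * (4 * pi * Lam * L))).
Let err := N%:R * (2 * (1 + energy f) * cut_err nu c1 L Lam).
Let CC := ell + 2 * ell / tau + c1' + c2' + 2 * (N%:R * M) / tau ^+ 2.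
Let c10 : 0 <= c1'.
by apply: mulr_ge0; [rewrite mulr_ge0 ?sqr_ge0|apply: mulr_ge0 (ltW M0)]. Qed.

Let c20 : 0 <= c2'.
apply: mulr_ge0 => //; apply: mulr_ge0 => //; apply: mulr_ge0 => //; apply: mulr_ge0 Lp.
by apply: mulr_ge0 (ltW L0); rewrite mulr_ge0 ?pi_ge0.
Qed.

Let err0 : 0 <= err.
apply: mulr_ge0 => //; apply: mulr_ge0; first by rewrite mulr_ge0 ?addr_ge0 ?energy_ge0.
by apply: mulr_ge0 (powR_ge0 _ _); apply: mulr_ge0 Lp; exact: rate_cst_ge0 Hk.
Qed.

Let X0 : 0 <= 2 * (N%:R * M) / tau ^+ 2.
by apply: divr_ge0 (sqr_ge0 _); apply: mulr_ge0 => //; apply: mulr_ge0 (ltW M0). Qed.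

Let CC0 : 0 <= ell + 2 * ell / tau + c1' + c2'.
by apply: addr_ge0 c20; apply: addr_ge0 c10; apply: addr_ge0 => //; apply: divr_ge0 (ltW tau0); exact: mulr_ge0.
Qed.

Let k0 : 0 <= k.
rewrite /k /cut_cst; have [m m0 ->] := abstract_nonneg (divr_ge0 (ler0n R 512) (sqr_ge0 M)).
apply: mulr_ge0 (ltW nn) _; apply: addr_ge0; first by apply: mulr_ge0 m0 _; apply: mulr_ge0 M60 _; exact: addr_ge0 (expR_ge0 _) ler01.
have [|rb Urb _] := Hrho (t := 0); first by rewrite lexx.
apply: addr_ge0; first by rewrite !addr_ge0 ?powR_ge0 ?mulr_ge0 ?expR_ge0 ?(upper_le_ge0 (@gflow_bfun R f N 0) Urb).
by apply: mulr_ge0 (powR_ge0 _ _) _; rewrite !addr_ge0 ?mulr_ge0 ?energy_ge0.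
Qed.

Lemma rate_ge0' r : 0 <= rate r.
routine. Qed.

Lemma bmeas_rate : bmeas rate.
by apply: bmeasZ; apply: bmeasD; [exact: bmeas_sing_sup Hw Hg e0|routine]. Qed.

Lemma acc_sub s t : 0 <= s -> s <= t -> acc t - acc s = iint s t rate.
by move=> s0 st; rewrite /acc (iint_add s0 st (itv_integrable 0 t bmeas_rate)) addrC addKr.
Qed.

(** An admissible pair is followed from s to t. Its value at s may fall short of U(s), and
    [generators_le] charges this deficit divided by tau; over a step of length at most tau the
    charge does not exceed the deficit. *)
Lemma dual_step_le s t : 0 <= s -> s <= t -> t <= T ->
 dual_value t <= dual_value s + (acc t - acc s) * (dual_value s + k + CC * (t - s)) + CC * (t - s) ^+ 2 + err * (t - s).
move=> s0 st tT; have [e|ne] := eqVneq s t.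
 by rewrite e !subrr mul0r expr0n/= !mulr0 !addr0.
have h0 : 0 < t - s by lra.
have A0 : 0 <= acc t - acc s.
 by rewrite (acc_sub s0 st); apply: (bfun_ge0 (iint_bfun s t) bmeas_rate) => r; routine.
(* Steps longer than tau are trivial: the last summand of [CC] makes CC (t - s)^2 exceed the bound 2
   N M on the dual value. *)
have [ht|ht] := boolP (t - s <= tau); last first.
 apply: (long_step tau0 _ _ (dual_bound t) (dual_ge0 s) A0 k0 CC0 err0 (erefl _)); first by rewrite ltNge. routine.
apply: dual_le => phi psi ad; have [lp ls pB _ _] := ad; have [bp bs] := admissible_bmeas ad.
have [q bq [q1 q2]] := gflow_step HI Hk Hg Hgn Hw Lp bs ls L0 s0 st.
set Us := dual_value s; set Ds := pflow V s phi + gflow f s psi; set X := pflow V t phi - pflow V s phi.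
have ptw r : s <= r <= t -> (X - c1' * (t - s) ^+ 2) / (t - s) + q r <=
  (Us - Ds + 2 * ell * (t - s)) / tau + c2' * (t - s) + (Us + k + ell * (t - s)) * rate r.
 move=> rst; have /andP[sr rt] := rst; have rT : 0 <= r <= T by rewrite (le_trans s0 sr) (le_trans rt tT).
 have lr : ell * (r - s) <= ell * (t - s) by apply: ler_wpM2l => //; rewrite lerD2r.
 have p1 := pflow_step HI Hk N0 K0 HV Lp lp pB s0 sr rt.
 have p2 : `|q r - gflow f r (genf I gamma beta f Lam r psi)| <= c2' * (t - s).
  by upto (q2 _ rst); rewrite /c2'; apply: eq_ler; rewrite -/sc; ring.
 have p3 := le_trans (dual_lip s0 sr) (lerD (lexx _) lr).
 have p4 := le_trans (pairing_lip s0 sr ad) lr; rewrite ler_norml in p4; have /andP[p4' _] := p4.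
 rewrite [(Us + k + _) * _]mulrC. have p5 : Ds - ell * (t - s) <= pflow V r phi + gflow f r psi by rewrite /Ds; lra.
 exact: (close_algebra h0 tau0 (rate_ge0' r) p1 p2 (generators_le rT ad) p3 p5).
have := iint_le (bmeasD (bmeas_cst _ _) bq) (bmeasD (bmeas_cst _ _) (bmeasZ _ bmeas_rate)) ptw.
rewrite (bfunD (iint_bfun s t) (bmeas_cst _ _) bq) (bfunD (iint_bfun s t) (bmeas_cst _ _) (bmeasZ _ bmeas_rate)).
rewrite (bfunZ (iint_bfun s t) _ bmeas_rate) !iint_cst// -acc_sub// [(Us + k + _) * _]mulrC => H.
have e1 : `|gflow f t psi - gflow f s psi - iint s t q| <= err * (t - s) by rewrite /err -mulrA.
have := collect_algebra tau0 h0 ht ell0 c10 c20 A0 X0 (dual_ge s ad) H e1.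
by apply: le_trans; rewrite /Ds /X; lra.
Qed.

Lemma dual_gronwall : dual_value T <= expR (acc T) * (k + err * T).
(* Both systems start from the same product law, and the cost vanishes on the diagonal. *)
have D0 : dual_value 0 <= 0.
 apply: dual_le => phi psi ad; have [bp bs] := admissible_bmeas ad; have [_ _ _ _ H] := ad.
 rewrite (init bp) -(bfunD (@gflow_bfun R f N 0) bp bs); have e0' := bfun_cst (@gflow_bfun R f N 0) 0.
 rewrite mul0r in e0'; rewrite -[leRHS]e0'.
 apply: (bfun_le (@gflow_bfun R f N 0) (bmeasD bp bs) (bmeas_cst _ _)) => v; apply: le_trans (H v v) _.
 by rewrite (costNxx _ (ltW M0)).
have am s t : 0 <= s -> s <= t -> t <= T -> acc s <= acc t.
 move=> s0 st _; rewrite -subr_ge0 (acc_sub s0 st); apply: (bfun_ge0 (iint_bfun s t) bmeas_rate) => r; routine.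
have a0 : acc 0 = 0 by have := acc_sub (lexx 0) (lexx 0); rewrite subrr.
have u0 s : 0 <= s <= T -> 0 <= dual_value s + k by move=> _; rewrite addr_ge0 ?dual_ge0.
have := discrete_gronwall T0 k0 (addr_ge0 CC0 X0) err0 am u0 dual_step_le.
rewrite a0 subr0 => H; via (dual_value T + k); first by rewrite lerDl.
apply: (le_trans H); apply: ler_wpM2l; [routine|lra].
Qed.

End Rate.

(** [Lam] tends to infinity: it enters the bound of [dual_gronwall] only through [cut_err], which
    tends to 0. *)
Lemma dual_final : dual_value T <= expR (9 * pc * iint 0 T (fun r => sg r + 1)) * k.
have -> : 9 * pc * iint 0 T (fun r => sg r + 1) = iint 0 T (fun r => 9 * pc * (sg r + 1)).
 by rewrite -(bfunZ (iint_bfun 0 T)) //; apply: bmeasD; [exact: bmeas_sing_sup Hw Hg e0|routine].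
set e := expR _; pose L := 2 * Num.sqrt M; pose b := N%:R * (2 * (1 + energy f)) : R.
have H : (fun n => e * (k + b * cut_err nu c1 L n.+1%:R * T)) @ \oo --> (e * (k + b * 0 * T) : R).
 apply: cvgM; [exact: cvg_cst|apply: cvgD; [exact: cvg_cst|apply: cvgM; [|exact: cvg_cst]]].
 by apply: cvgM; [exact: cvg_cst|exact: (cut_err_cvg Hk L)].
rewrite mulr0 mul0r addr0 in H; rewrite -(cvg_lim _ H)//; apply: limr_ge; first by apply/cvg_ex; eexists; exact: H.
near=> n; have Kn : K <= n.+1%:R.
 by apply: (@le_trans _ _ n%:R); [near: n; exact: nbhs_infty_ger|rewrite ler_nat].
by rewrite /b -(mulrA N%:R); exact: dual_gronwall Kn.
Unshelve. all: by end_near. Qed.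

End Level.
End DualFlow.

(** * Probability measures built from bounded functionals *)

Lemma bfun_fsum d (T : measurableType d) (R : realType) (n : nat) (J : 'I_n -> (T -> R) -> R) :
 (forall i, bfun (J i)) -> bfun (fun f => \sum_i J i f).
move=> bJ; split.
- by move=> f g bf bg; rewrite -big_split; apply: eq_bigr => i _; exact: bfunD.
- by move=> a f bf; rewrite mulr_sumr; apply: eq_bigr => i _; exact: bfunZ.
- by move=> f bf f0; apply: sumr_ge0 => i _; exact: bfun_ge0.
- move=> F f M mF FM Ff; by apply: cvg_big => [|i _]; [exact: add_continuous|exact: (bfun_cvg (bJ i) mF FM Ff)].
Qed.

Section BfunMeasure.
Context d (T : measurableType d) (R : realType) (I : (T -> R) -> R).

(* The truncation only matters on nonmeasurable sets. *)
Definition bfun_mass (bI : bfun I) (I1 : I (fun=> 1) = 1) (A : set T) : \bar R := (Num.max 0 (I (\1_A)))%:E.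

Hypotheses (bI : bfun I) (I1 : I (fun=> 1) = 1).
Local Notation mu := (bfun_mass bI I1).

Let ind_ge0 A : measurable A -> 0 <= I (\1_A).
by move=> mA; apply: (bfun_ge0 bI); [exact: bmeas_indic|move=> x; rewrite indicE]. Qed.

Lemma bfun_massE A : measurable A -> mu A = (I (\1_A))%:E.
by move=> mA; rewrite /bfun_mass max_r// ind_ge0. Qed.

Let mu0 : mu set0 = 0%E.
by rewrite bfun_massE// indic0 -[X in I X]/(fun=> 0) (bfun_cst bI) mul0r. Qed.

Let mu_ge0 A : (0 <= mu A)%E.
by rewrite lee_fin le_max lexx. Qed.

Let mu_add : semi_sigma_additive mu.
move=> F mF tF mU; have [H B] := indic_bigcup_cvg R mF tF.
have m n : mfun (fun x => \sum_(i < n) \1_(F i) x : R).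
 by apply: measurable_sum => i; exact: measurable_indic.
rewrite (bfun_massE mU); have -> : (fun n => \sum_(0 <= i < n) mu (F i)) = EFin \o (fun n => I (fun x => \sum_(i < n) \1_(F i) x)).
 apply/funext => n; rewrite /= (bfun_sum bI) => [|i _]; last exact: bmeas_indic.
 by rewrite big_mkord -sumEFin; apply: eq_bigr => i _; exact: bfun_massE.
by apply/fine_cvgP; split; [exact: nearW|exact: (bfun_cvg bI m B H)].
Qed.

HB.instance Definition _ := isMeasure.Build d T R mu mu0 mu_ge0 mu_add.

Let muT : mu setT = 1%E.
by rewrite bfun_massE// indicT I1. Qed.

HB.instance Definition _ := Measure_isProbability.Build d T R mu muT.

Definition bfun_measure : probability T R := mu.

End BfunMeasure.

Lemma bfun_measure_integral d (T : measurableType d) (R : realType) (I : (T -> R) -> R) (bI : bfun I) (I1 : I (fun=> 1) = 1) (g : T -> R) :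
 bmeas g -> \int[bfun_measure bI I1]_x g x = I g.
move=> bg; apply: (bfun_eq_indic (bfun_prob _) bI) => // A mA; rewrite prob_indic//.
by have -> : bfun_measure bI I1 A = (I (\1_A))%:E by exact: bfun_massE.
Qed.

Section Simple.
Import HBNNSimple.

(** The integral of a nonnegative function, measurable or not, is the supremum over the simple
    functions below it. It serves for [W2sq], an infimum over uncountably many couplings. *)
Lemma integral_le_bounded d (T : measurableType d) (R : realType) (mu : {measure set T -> \bar R}) (g : T -> \bar R) (c : \bar R) :
 (forall x, (0 <= g x)%E) ->
 (forall h : T -> R, bmeas h -> (forall x, 0 <= h x) -> (forall x, ((h x)%:E <= g x)%E) -> (\int[mu]_x (h x)%:E <= c)%E) ->
 (\int[mu]_x g x <= c)%E.
move=> g0 H; rewrite ge0_integralE//; apply: ge_ereal_sup => _ [h /= hg <-].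
rewrite -integralT_nnsfun; apply: H => //; last by move=> x; have := hg x; rewrite patchT// inE.
split; first routine.
have [M [_ HM]] := simple_bounded h; exists (M + 1) => x; apply: HM => //; rewrite ltrDl//.
Qed.

End Simple.

(** * From allocations to the Wasserstein distance *)

Section Transport.
Context (R : realType) (N : nat) (P : probability (vec3 R) R).
Hypotheses (N0 : (0 < N)%N) (ik : P.-integrable setT (EFin \o @kv R)).
Notation E := (N.-tuple (vec3 R)).
Implicit Types (v w : E).

(** The coupling attaches v_j to the piece of P allotted to w_j; then |v_j - y|^2 <= 2 |v_j - w_j|^2
    + 2 |w_j - y|^2. *)
Lemma W2sq_allocation v w W : allocation P W -> (W2sq (empirical_measure v) P <=
  (2 / N%:R * \sum_j norm3 (tnth v j - tnth w j) ^+ 2 + 2 * \int[P]_y spread2 W w y)%:E)%E.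
move=> aW; have [mW W0 W1 WN] := aW.
have bW j : bmeas (W j).
 apply: (bmeas_bound (a := 0) (b := 1)) => // y; rewrite W0/= -(W1 y) (bigD1 j)//= lerDl. routine.
pose I psi := \sum_j \int[P]_y (W j y * psi (tnth v j, y)).
have bI : bfun I.
 apply: bfun_fsum => j; have mS : mfun (fun y : vec3 R => (tnth v j, y)) by exact: measurable_pair1.
 exact: (bfun_comp (bfun_weight (bfun_prob P) (bW j) (W0 j)) mS).
have I1 : I (fun=> 1) = 1.
 rewrite /I (eq_bigr (fun=> N%:R^-1)) => [|j _]; last by rewrite -(WN j); apply: eq_Rintegral => y _; rewrite mulr1.
 by rewrite sumr_const card_ord -[LHS]mulr_natr mulVf// pnatr_eq0 -lt0n.
via (\int[bfun_measure bI I1]_z (norm3 (z.1 - z.2) ^+ 2)%:E)%E.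
 apply: ereal_inf_lbound; exists (bfun_measure bI I1) => // A mA; split.
 - have mA' : measurable (A `*` [set: vec3 R]) by exact: measurableX.
  have -> : bfun_measure bI I1 (A `*` setT) = (I (\1_(A `*` setT)))%:E by exact: bfun_massE.
  rewrite /empirical_measure sumEFin -EFinM mulr_sumr; congr EFin; apply: eq_bigr => j _.
  rewrite -(WN j) mulrC -(bfunZ (bfun_prob P) _ (bW j)); apply: eq_Rintegral => y _.
  by rewrite mulrC !indicE; congr (_%:R * _); rewrite in_setX in_setT andbT.
 - have mA' : measurable ([set: vec3 R] `*` A) by exact: measurableX.
  have -> : bfun_measure bI I1 (setT `*` A) = (I (\1_(setT `*` A)))%:E by exact: bfun_massE.
  have -> : I (\1_(setT `*` A)) = \int[P]_y \1_A y.
   rewrite /I -(bfun_sum (bfun_prob P)) => [|k _]; last first.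
    by apply: (bmeasM (bW k)); apply: bmeas_comp (bmeas_indic R mA') _; routine.
   apply: eq_Rintegral => y _; rewrite -[RHS]mul1r -(W1 y) mulr_suml; apply: eq_bigr => k _.
   by rewrite !indicE in_setX in_setT.
  by rewrite prob_indic// fineK// fin_num_measure.
apply: integral_le_bounded => [z|h bh h0 hle]; first routine.
rewrite (bmeas_integralE _ bh) lee_fin (bfun_measure_integral bI I1 bh) /I.
have bWh k : bmeas (fun y => W k y * h (tnth v k, y)) by apply: (bmeasM (bW k)); apply: bmeas_comp bh _; routine.
rewrite -(bfun_sum (bfun_prob P)) => [|k _]; last exact: bWh.
have isp := spread2_integrable w aW ik.
pose b y := \sum_j (2 * norm3 (tnth v j - tnth w j) ^+ 2) * W j y.
have bb : bmeas b by apply: bmeas_sum => k _; exact: bmeasZ.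
have := Rintegral_le_quad (a := 2) (c := 0) (bmeas_sum (fun k _ => bWh k)) bb isp isp.
rewrite mul0r addr0 => /(_ xpredT) H; upto (H _) => {H} [y|].
 rewrite mul0r addr0 /b /spread2 mulr_sumr -big_split/=; apply: ler_sum => k _.
 have := hle (tnth v k, y); rewrite lee_fin /= => hk.
 have -> : 2 * norm3 (tnth v k - tnth w k) ^+ 2 * W k y + 2 * (W k y * norm3 (tnth w k - y) ^+ 2) =
  W k y * (2 * norm3 (tnth v k - tnth w k) ^+ 2 + 2 * norm3 (tnth w k - y) ^+ 2) by ring.
 apply: ler_wpM2l => //; apply: (le_trans hk).
 by have := norm3_sub2 (tnth v k - tnth w k) (y - tnth w k); rewrite opprB addrA subrK -[norm3 (y - _)]norm3N opprB.
rewrite lerD2r /b (bfun_sum (bfun_prob P)) => [|k _]; last routine.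
rewrite mulr_sumr; apply: ler_sum => k _; rewrite (bfunZ (bfun_prob P) _ (bW k)) WN.
by apply: eq_ler; ring.
Qed.

End Transport.

(** * Removing the truncation *)

Section Limit.
Context (R : realType) (N : nat) (P : probability (vec3 R) R) d (Omega : measurableType d) (Q : probability Omega R)
 (X : Omega -> N.-tuple (vec3 R)).
Hypotheses (N0 : (0 < N)%N) (ik : P.-integrable setT (EFin \o @kv R)) (mX : mfun X).
Notation E := (N.-tuple (vec3 R)).
Notation F psi := (\int[Q]_x psi (X x)).
Notation G psi := (prodf (fun=> P) psi).

(** By [W2sq_allocation] the squared distance is below the infimum over w of (2/N) |v - w|^2 + 2
    rb(w). Up to the factor 2/N this is the c-transform of -N rb, so the dual bound applies to it
    directly, without choosing a w for each configuration. The truncation error c / M^2 vanishes as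
    M grows. *)
Lemma W2sq_dual (rb : E -> R) (rho c e : R) : 0 <= c -> upper_le (prodf (fun=> P)) rb rho ->
 (forall w, exists2 W, allocation P W & \int[P]_y spread2 W w y <= rb w) ->
 (forall n : nat, forall phi psi : E -> R, admissible n.+1%:R phi psi -> F phi + G psi <= N%:R * (c / n.+1%:R ^+ 2 + e)) ->
 (\int[Q]_x W2sq (empirical_measure (X x)) P <= (2 * (e + rho))%:E)%E.
move=> c00 Urb Hrb HU; have [mrb rb0 _] := Urb; have nn : 0 < N%:R :> R by rewrite ltr0n.
have bF := (bfun_comp (bfun_prob Q) mX).
have F1 : F (fun=> 1) = 1 by rewrite prob_cst.
have bG : bfun (fun psi : E -> R => G psi) by exact: prodf_bfun.
have G1 : G (fun _ : E => 1) = 1 by exact: prodf_cst.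
apply: integral_le_bounded => [x|h bh h0 hle].
 by apply: le_ereal_inf_tmp => _ [r _ <-]; apply: integral_ge0 => z _; routine.
have [_ [B HB]] := bh; rewrite (bmeas_integralE Q bh) lee_fin.
pose psi n w := - (N%:R * Num.min (rb w) n.+1%:R).
pose phi n := ctrans n.+1%:R (psi n).
have n1 n : 0 <= n.+1%:R :> R by [].
have psi0 n w : psi n w <= 0 by rewrite oppr_le0 mulr_ge0// le_min rb0/=.
have bpsi n : bmeas (psi n) by apply/bmeasN/bmeasZ; exact: bmeas_min.
have phi_ge0 n v : 0 <= phi n v.
 by apply: ctrans_ge => w; rewrite subr_ge0; apply: le_trans (psi0 n w) _; exact: costN_ge0.
have phi_le n v w : phi n v + psi n w <= costN n.+1%:R v w.
 by rewrite -lerBrDr (costNC _ v); exact: (ctrans_le (n1 n) (psi0 n)).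
have bphi n : bmeas (phi n).
 split; first by apply: lipN_measurable; exact: ctrans_lip (psi0 n).
 exists (N%:R * n.+1%:R - psi n [tuple 0 | i < N]) => v; rewrite ger0_norm//.
 by rewrite lerBrDr; upto (phi_le n v _); exact: costN_le.
have Fphi n : F (phi n) <= N%:R * (c / n.+1%:R ^+ 2 + (e + rho)).
 have z v w : phi n v + psi n w <= 1 * costN n.+1%:R v w + (0 + 0) by rewrite mul1r !addr0.
 have := dual_step (n1 n) ltr01 bF bG F1 G1 (HU n) (bphi n) (bpsi n) (bmeas_cst _ 0) (bmeas_cst _ 0) z.
 rewrite (bfun_cst bF) (bfun_cst bG) !mul0r !addr0 mul1r => H. have : G (psi n) >= - (N%:R * rho).
  have [_ _ /(_ _ (n1 n)) H'] := Urb; have bm := bmeas_min mrb rb0 (n1 n).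
  rewrite /psi (bfunN bG (bmeasZ _ bm)) (bfunZ bG _ bm). by rewrite lerN2 ler_wpM2l// ltW.
 move=> H'; rewrite addrA [leRHS]mulrDr; via (N%:R * (c / n.+1%:R ^+ 2 + e) - G (psi n)).
  by rewrite lerBrDr.
 by rewrite lerD2l lerNl.
(* For a bounded [h] the truncations cause no loss: as soon as one of them is active, the right side
   already exceeds the bound on [h]. *)
have hphi n x : N%:R * B <= n.+1%:R -> h x <= 2 / N%:R * phi n (X x).
 move=> nB; have hB : N%:R / 2 * h x <= n.+1%:R.
  apply: le_trans nB; via (N%:R * h x).
   by apply: ler_wpM2r => //; rewrite ler_pdivrMr// ler_peMr ?ler1n// ltW.
  by apply: ler_wpM2l; [exact: ltW|apply: le_trans (ler_norm _) (HB x)].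
 suff H : N%:R / 2 * h x <= phi n (X x).
  have -> : h x = 2 / N%:R * (N%:R / 2 * h x) by field; rewrite gt_eqF. by apply: ler_wpM2l => //; routine.
 apply: ctrans_ge => w; rewrite opprK; apply: (le_trans _ (y := _ + _)); last exact: lexx.
 have p0 : 0 <= N%:R * Num.min (rb w) n.+1%:R by rewrite mulr_ge0// le_min rb0/=.
 have [/existsP[j hj]|/existsPn hj] := boolP [exists j, n.+1%:R < dist3 (tnth w j) (tnth (X x) j) ^+ 2].
  apply: (le_trans hB); rewrite -[leLHS]addr0; apply: lerD => //.
  rewrite /costN (bigD1 j)//= {1}/costM (min_r (ltW hj)) lerDl; apply: sumr_ge0 => i _; exact: costM_ge0.
 have -> : costN n.+1%:R w (X x) = \sum_j norm3 (tnth (X x) j - tnth w j) ^+ 2.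
  by apply: eq_bigr => j _; rewrite /costM min_l 1?leNgt// /dist3 -norm3N opprB.
 have [hr|hr] := boolP (n.+1%:R < rb w).
  apply: (le_trans hB); rewrite (min_r (ltW hr)) -[leLHS]add0r; apply: lerD; first routine.
  by rewrite ler_peMl// ler1n.
 rewrite -leNgt in hr; rewrite (min_l hr); have [W aW HW] := Hrb w.
 have := le_trans (hle x) (W2sq_allocation N0 ik (X x) w aW); rewrite lee_fin => H.
 have hN : 0 <= N%:R / 2 :> R by []. upto (ler_wpM2l hN H);
 have -> (x1 y1 : R) : N%:R / 2 * (2 / N%:R * x1 + 2 * y1) = x1 + N%:R * y1 by field; rewrite gt_eqF.
 by rewrite lerD2l ler_pM2l.
pose k := Num.bound `|N%:R * B|.
apply: (@le_invn _ _ _ (2 * c)) => [|m]; first routine.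
pose n := (m + k)%N; have nB : N%:R * B <= n.+1%:R.
 upto (ler_norm _); upto (ltW (archi_boundP (normr_ge0 _))). by rewrite ler_nat leqW// leq_addl.
via (2 / N%:R * F (phi n)).
 rewrite -(bfunZ (bfun_prob Q) _ (bmeas_comp (bphi n) mX)); apply: (bfun_le (bfun_prob Q) bh) => [|x]; last exact: hphi.
 exact: (bmeasZ _ (bmeas_comp (bphi n) mX)).
have t0 : 0 <= 2 / N%:R :> R by [].
upto (ler_wpM2l t0 (Fphi n)); rewrite mulrA divfK ?gt_eqF// mulrDr addrC lerD2l -mulrA.
apply: ler_wpM2l => //; apply: ler_wpM2l => //; rewrite lef_pV2 ?posrE//.
apply: (@le_trans _ _ n.+1%:R); first by rewrite ler_nat ltnS leq_addr.
by rewrite expr2 ler_peMr// ler1n.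
Qed.

End Limit.

Lemma level_algebra (R : realType) (E E' k M x ch : R) : E' <= E -> 0 <= k -> 0 <= M -> 0 <= x -> 0 <= ch ->
 E' * (k / M * x + ch) <= E * (k * x) / M + E * ch.
move=> EE k0 M0 x0 c0; have -> : E * (k * x) / M + E * ch = E * (k / M * x + ch) by ring.
by apply: ler_wpM2r => //; routine.
Qed.

(** * The estimate at a fixed time *)

Section FixedTime.
Context (R : realType) (I : vec3 R -> vec3 R) (gamma nu c0 c1 : R) (beta : R -> R) (f : R -> probability (vec3 R) R).
Hypotheses (HI : frame_choice I) (Hk : kernel_bounds nu c0 c1 beta) (Hg : -1 < gamma < 0) (Hgn : 0 < gamma + nu) (Hw : weak_solution gamma beta I f).
Context (N : nat) (K : R) d (Omega : measurableType d) (P : probability Omega R) (V : R -> {RV P >-> N.-tuple (vec3 R)}).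
Hypotheses (N0 : (0 < N)%N) (K1 : 1 <= K) (HV : particle_process gamma beta K P V) (H0 : iid P (f 0) (fun i w => tnth (V 0 w) i)).
Variables (T M6 : R).
Hypotheses (T0 : 0 <= T) (M60 : 0 <= M6) (HM6 : forall t Q, 0 <= t <= T -> 0 <= Q -> \int[ft f t]_v min6 Q v <= M6).
(** The constants of [rate_upper], once 4^-N and 16^-N are bounded by N^(-1/2). *)
Definition rate_cst6 (M : R) : R := 48 * (32 * (1 + M)) + 2 * (96 * (32 * (1 + M)) + 1152) + 128 * M.

Lemma inv_pow_le_sqrt (b : R) : 4 <= b -> 1 / b ^+ N <= (Num.sqrt N%:R)^-1 :> R.
move=> b4; have n0 : 0 < N%:R :> R by rewrite ltr0n.
have b0 : 0 < b by lra.
rewrite div1r lef_pV2 ?posrE ?exprn_gt0 ?sqrtr_gt0//.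
apply: (@le_trans _ _ N%:R).
 rewrite -[leLHS]mulr1 -{2}(sqr_sqrtr (ltW n0)) expr2 ler_pM2l ?sqrtr_gt0//.
 by rewrite -[leLHS]sqrtr1 ler_wsqrtr// ler1n.
via (4 ^+ N); last by apply: lerXn2r; rewrite ?nnegrE// ltW.
by rewrite -natrX ler_nat ltnW// ltn_expl.
Qed.

(** The number of dyadic scales is taken equal to N: the series over the scales converge, so it
    affects only the terms 4^-N and 16^-N. *)
Lemma rate_upper6 t : 0 <= t <= T -> exists2 rb : N.-tuple (vec3 R) -> R, upper_le (gflow f t) rb (rate_cst6 M6 / Num.sqrt N%:R) &
 forall w, exists2 W, allocation (ft f t) W & \int[ft f t]_y spread2 W w y <= rb w.
move=> tT; exists (rate_bound N (ft f t) M6); last first.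
 by apply: rate_allocation => // [Q|]; [exact: HM6|exact: (sol_energy Hw t).1].
apply: (upper_leW _ (rate_upper N0 N0 M60 (fun Q => HM6 tT))).
have := inv_pow_le_sqrt (b := 4) (lexx _); have := inv_pow_le_sqrt (b := 16); rewrite ler_nat => /(_ isT).
have : 0 <= (Num.sqrt N%:R)^-1 :> R by [].
rewrite /rate_cst6 !div1r; move: (Num.sqrt _)^-1 (16 ^+ N)^-1 (4 ^+ N)^-1 => s a b s0 a0 b0.
have h1 := ler_wpM2l M60 a0; have h2 := ler_wpM2l M60 b0; lra.
Qed.

(** The dual estimate is run on [0, t] with the moment bound, the transport rate and the exponent of
    [0, T], which makes the result uniform in t. *)
Lemma chaos_at t eps a : 0 <= t <= T -> 0 < eps -> eps `^ gamma <= N%:R ->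
 9 * (2 * pi * pair_cst nu c0 c1) * iint 0 T (fun r => sing_sup gamma eps f r + 1) <= a ->
 (\int[P]_w W2sq (empirical_measure (V t w)) (f t) <=
  (2 * (expR a * chaos_err gamma nu f N K M6 eps (rate_cst6 M6 / Num.sqrt N%:R) + rate_cst6 M6 / Num.sqrt N%:R))%:E)%E.
move=> /andP[t0 tT] e0 eN ha; have ft0 s : 0 <= s -> ft f s = f s by move=> s0; rewrite /ft max_l.
have sub s : 0 <= s <= t -> 0 <= s <= T by lra.
have init psi : bmeas psi -> pflow V 0 psi = gflow f 0 psi.
 move=> bp; rewrite /gflow ft0//; exact: (prodf_iid (measurable_funPT (V 0)) H0 bp).
have tT' : 0 <= t <= T by lra.
have [rb Urb Hrb] := rate_upper6 tT'.
rewrite -(ft0 t t0); set rho := rate_cst6 M6 / _; set E := expR a.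
set c := E * (512 * (M6 * (expR (4 * pi * K * 6 ^+ 6 * t) + 1))).
have X0 : 0 <= M6 * (expR (4 * pi * K * 6 ^+ 6 * t) + 1) by routine.
have ch0 : 0 <= chaos_err gamma nu f N K M6 eps rho.
 have rho0 : 0 <= rho := upper_le_ge0 (@gflow_bfun R f N t) Urb. apply: addr_ge0; first routine.
 by apply: mulr_ge0 (powR_ge0 _ _) _; rewrite !addr_ge0 ?mulr_ge0 ?energy_ge0.
apply: (@W2sq_dual _ _ _ _ _ _ (V t) N0 (sol_energy Hw t).1 _ rb rho c).
- exact: measurable_funPT.
- apply: mulr_ge0 (expR_ge0 _) _; exact: mulr_ge0 (ler0n R 512) X0.
- exact: Urb.
- exact: Hrb.
move=> n phi psi ad; upto (dual_ge f V t ad).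
have HM t' Q : 0 <= t' <= t -> 0 <= Q -> \int[ft f t']_v min6 Q v <= M6 by move=> /sub; exact: HM6.
have HR t' : 0 <= t' <= t -> exists2 rb : N.-tuple (vec3 R) -> R, upper_le (gflow f t') rb rho &
 forall w, exists2 W, allocation (ft f t') W & \int[ft f t']_y spread2 W w y <= rb w by move=> /sub; exact: rate_upper6.
have := dual_final HI Hk Hg Hgn Hw N0 K1 HV t0 M60 HM e0 eN HR init (ltr0Sn R n).
have bs : bmeas (fun r => sing_sup gamma eps f r + 1) by apply: bmeasD; [exact: bmeas_sing_sup Hw Hg e0|exact: bmeas_cst].
have mono : iint 0 t (fun r => sing_sup gamma eps f r + 1) <= iint 0 T (fun r => sing_sup gamma eps f r + 1).
 rewrite (iint_add t0 tT (itv_integrable 0 T bs)) lerDl; apply: (bfun_ge0 (iint_bfun t T) bs) => r.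
 by rewrite addr_ge0// (sing_sup_ge0 f Hg e0).
have pc0 : 0 <= 9 * (2 * pi * pair_cst nu c0 c1) by apply: mulr_ge0 => //; apply: mulr_ge0 (pair_cst_ge0 Hk); rewrite mulr_ge0 ?pi_ge0.
have aE : expR (9 * (2 * pi * pair_cst nu c0 c1) * iint 0 t (fun r => sing_sup gamma eps f r + 1)) <= E.
 by rewrite ler_expR; apply: le_trans ha; exact: ler_wpM2l.
move=> H; apply: (le_trans H); rewrite /cut_cst mulrCA; apply: ler_wpM2l => //.
exact: (level_algebra aE (ler0n R 512) (sqr_ge0 _) X0 ch0).
Qed.

End FixedTime.

(** * The choice of the cutoff distance *)

Section Cutoff.
Context (R : realType) (gamma : R) (N : nat).
Hypotheses (Hg : -1 < gamma < 0) (N0 : (0 < N)%N).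
(** The typical distance between N particles. *)
Let eps : R := N%:R `^ (- 3^-1).
Let n0 : 0 < N%:R :> R. Proof. by rewrite ltr0n. Qed.
Let n1 : 1 <= N%:R :> R. Proof. by rewrite ler1n. Qed.

Lemma cutoff_gt0 : 0 < eps. Proof. exact: powR_gt0. Qed.

Lemma cutoff_powR (x : R) : eps `^ x = N%:R `^ (- (x / 3)).
by rewrite -powRrM mulNr mulrC. Qed.

Lemma cutoff_le : eps `^ gamma <= N%:R.
rewrite cutoff_powR -[leRHS](powRr1 (ltW n0)); apply: ler_powR => //; have /andP[] := Hg; lra.
Qed.

(** The exponent obtained is (2 + gamma)/3, which is at least (2 + 2 gamma)/3 since gamma < 0, and 1
    - 6/q is below 1. *)
Lemma cutoff_error (q : R) : 6 < q -> eps `^ (2 + gamma) <= N%:R `^ (- ((1 - 6 / q) * (2 + 2 * gamma) / 3)).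
move=> q6; rewrite cutoff_powR; apply: ler_powR => //; rewrite lerN2; have /andP[g1 g0] := Hg.
have q0 : 0 < q by lra.
have h : 0 <= 6 / q by routine.
nra.
Qed.

(** The exponent is N^(1 + gamma/3) / 2, and exp(-x) <= 27 / x^3 gives 27 * 8 = 216 times
    N^(-2-gamma), where -2 - gamma <= -1/2. *)
Lemma cutoff_crowd : N%:R * expR (- (chernoff_rate gamma eps * N%:R)) <= 216 * N%:R `^ (- (1 / 2)).
have /andP[g1 g0] := Hg; have E : chernoff_rate gamma eps * N%:R = 2^-1 * N%:R `^ (1 + gamma / 3).
 rewrite /chernoff_rate cutoff_powR invfM -powRN opprK -mulrA; congr (_ * _).
 by rewrite -[X in _ * X = _](powRr1 (ltW n0)) mulrC -powRD// (gt_eqF n0) implybT.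
have p0 : 0 < N%:R `^ (1 + gamma / 3) :> R by exact: powR_gt0.
rewrite E; via (N%:R * (27 / (2^-1 * N%:R `^ (1 + gamma / 3)) ^+ 3)).
 by apply: ler_wpM2l; [exact: ltW|apply: expRN_le_cube; rewrite mulr_gt0].
have -> : (2^-1 * N%:R `^ (1 + gamma / 3)) ^+ 3 = 8^-1 * N%:R `^ (3 + gamma) :> R.
 have -> : N%:R `^ (3 + gamma) = (N%:R `^ (1 + gamma / 3)) ^+ 3 :> R by rewrite -powR_mulrn// -powRrM; congr (_ `^ _); field.
 lra.
have -> : N%:R * (27 / (8^-1 * N%:R `^ (3 + gamma))) = 216 * (N%:R / N%:R `^ (3 + gamma)) :> R.
 lra.
apply: ler_wpM2l => //; rewrite -[X in X / _](powRr1 (ltW n0)) -powRN -powRD; last by rewrite (gt_eqF n0) implybT.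
by apply: ler_powR => //; lra.
Qed.

Lemma sqrt_powR : (Num.sqrt N%:R)^-1 = N%:R `^ (- (1 / 2)) :> R.
by rewrite powRN div1r powR12_sqrt// ltW. Qed.

End Cutoff.

(** * Conclusion *)

Lemma total_algebra (R : realType) (E c6 s a b k m x y : R) : 0 <= E -> 0 <= c6 -> 0 <= s -> 0 <= k -> 0 <= m -> 0 <= y -> a <= y -> b <= 216 * s ->
 2 * (E * (c6 * s + a + b + k * m) + c6 * s) <= 2 * (E * (c6 + 217 + m) + c6) * (y + k + s).
move=> E0 c0 s0 k0 m0 y0 ay bs.
have h : c6 * s + a + b + k * m <= (c6 + 217 + m) * (y + k + s).
 nra.
nra.
Qed.

Theorem theorem1p4 (R : realType) (gamma nu : R) (beta : R -> R)
    (I : vec3 R -> vec3 R) (q p : R)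
    (f0 : probability (vec3 R) R) (f : R -> probability (vec3 R) R) :
  -1 < gamma < 0 -> 0 < nu < 1 -> 0 < gamma + nu ->
  angular_kernel nu beta ->
  frame_choice I ->
  6 < q -> gamma ^+ 2 / (gamma + nu) < q ->
  (moment q f0 < +oo)%E -> finite_entropy f0 ->
  3 / (3 + gamma) < p < p0 gamma nu q ->
  (forall A, measurable A -> f 0 A = f0 A) ->
  weak_solution gamma beta I f ->
  uniqueness_class p f ->
  forall T : R, 0 < T ->
  exists C : R,
  forall (N : nat) (K : R), (1 <= N)%N -> 1 <= K ->
  forall (d : measure_display) (Omega : measurableType d)
    (P : probability Omega R) (V : R -> {RV P >-> N.-tuple (vec3 R)}),
  particle_process gamma beta K P V ->
  iid P f0 (fun i w => tnth (V 0 w) i) ->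
  (ereal_sup [set \int[P]_w W2sq (empirical_measure (V t w)) (f t)
             | t in `[0%R, T]%classic]
   <= (C * (N%:R `^ (- ((1 - 6 / q) * (2 + 2 * gamma) / 3))
            + K `^ (1 - 2 / nu)
            + N%:R `^ (- (1 / 2))))%:E)%E.
Proof.
move=> Hg Hnu Hgn Hb HI q6 _ mq _ /andP[p1 _] f00 Hw [_ Hu] T T0; have [c0 [c1 Hk]] := angular_kernel_bounds Hnu Hb.
have mq0 : (moment q (f 0%R) < +oo)%E.
  by rewrite /moment (eq_measure_integral f0)// => A mA _; exact: f00.
have [M6 M60 HM] := sol_moment HI Hk Hg Hgn Hw (ltW T0) q6 mq0.
have HM6 t Q : 0 <= t <= T -> 0 <= Q -> \int[ft f t]_v min6 Q v <= M6.
  move=> tT Q0; apply: le_trans (HM t Q tT Q0).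
  apply: (le_Rintegral measurableT (bmeas_integrable _ (min6_bmeas Q0)) (tmom3_integrable Hw Q0 t)) => v _.
  exact: tmom_ge6 Q0 (norm3_ge0 v).
have D0 t : (0 <= density_Lnorm p (f t))%E by apply: le_ereal_inf_tmp => _ [g _ <-]; exact: Lnorm_ge0.
(* The time integral of the L^p norm is finite by the uniqueness class; it fixes the Gronwall
   exponent [a] independently of N and K. *)
pose A := fine (\int[leb]_(t in `[0%R, T]) density_Lnorm p (f t))%E.
have HA : (\int[leb]_(t in `[0%R, T]) density_Lnorm p (f t) <= A%:E)%E.
  by rewrite fineK// ge0_fin_numE ?Hu//; exact: integral_ge0.
pose a := 9 * (2 * pi * pair_cst nu c0 c1) * (3 * T + 2 * sing_cst gamma p * A).
(* 217 is 1 for the cutoff error plus 216 for the crowding error; 3 + 2 M6 + 2 energy multiplies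
   K^(1-2/nu), and the last [rate_cst6] is the final transport in [W2sq_dual]. *)
exists (2 * (expR a * (rate_cst6 M6 + 217 + (3 + 2 * M6 + 2 * energy f)) + rate_cst6 M6)).
move=> N K N0 K1 d Omega P V HV Hi; apply: ge_ereal_sup => _ [t tT <-].
have {}tT : 0 <= t <= T by move: tT; rewrite /= in_itv.
have Hi0 : iid P (f 0) (fun i w => tnth (V 0 w) i) by case: Hi => H1 H2; split=> // i B mB; rewrite H1// f00.
have e0 := cutoff_gt0 R N0; have eN := cutoff_le Hg N0.
have ha : 9 * (2 * pi * pair_cst nu c0 c1) * iint 0 T (fun r => sing_sup gamma (N%:R `^ (- 3^-1)) f r + 1) <= a.
  apply: ler_wpM2l; first by apply: mulr_ge0 => //; apply: mulr_ge0 (pair_cst_ge0 Hk); rewrite mulr_ge0 ?pi_ge0.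
  rewrite (bfunD (iint_bfun 0 T) (bmeas_sing_sup Hw Hg e0) (bmeas_cst _ _)) (iint_cst _ (ltW T0)) subr0 mulr1.
  upto (lerD (sing_sup_integral Hw Hg p1 e0 (ltW T0) HA) (lexx T)).
  by apply: eq_ler; ring.
upto (chaos_at HI Hk Hg Hgn Hw N0 K1 HV Hi0 M60 HM6 tT e0 eN ha).
rewrite lee_fin /chaos_err sqrt_powR//; apply: total_algebra; rewrite ?expR_ge0 ?powR_ge0//.
- by rewrite /rate_cst6; lra.
- by rewrite !addr_ge0 ?mulr_ge0 ?energy_ge0.
- exact: cutoff_error.
- exact: cutoff_crowd.
Qed.
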